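(* Fix a real number $\vartheta$ with $0<\vartheta<1$. Then there is a constant $C=C(\vartheta)>0$ such that for all real $x\ge 27$, \[ \left| S_{\vartheta}(x) - x^{\vartheta} F\big((1-\vartheta)\log x\big)\frac{\alpha_{\vartheta}(x)}{\vartheta}\right| \le C\, x^{\vartheta} F\big((1-\vartheta)\log x\big)\frac{\alpha_{\vartheta}(x)}{\vartheta}\sqrt{\frac{\log\log x}{\log x}} . \] Moreover, as $x\to\infty$, \[ S_{\vartheta}(x)=(1+o(1))\, x^{\vartheta} F\big((1-\vartheta)\log x\big)\frac{1}{\vartheta}\Big(\frac{2}{1-\vartheta}\Big)^{1/2}\big((\log x)\log\log x\big)^{-1/2}. \]
   Context: For a natural number $m$, let $k(m)$ denote the largest square-free divisor of $m$ (the product of the distinct primes dividing $m$). For $\vartheta>0$ and real $x\ge1$, let $S_\vartheta(x)$ be the number of natural numbers $m\le x$ with $k(m)\le m^{\vartheta}$. Let $\psi(m)=\prod_{p\mid m}(p+1)$ (product over primes), and define $F:[0,\infty)\to[0,\infty)$ by \[F(v)=\frac{6}{\pi^2}\sum_{m\ge1}\frac{1}{\psi(m)}\min\Big(1,\frac{e^v}{m}\Big).\] For $0<\vartheta<1$ and $x\ge 2$, $\alpha_\vartheta(x)$ denotes the unique real number $\alpha>0$ satisfying \[\sum_{p}\frac{p^{\alpha}\log p}{(p^{\alpha}-1)\big(1+(p+1)(p^{\alpha}-1)\big)}=(1-\vartheta)\log x,\] the sum being over all primes $p$. *)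

(* Defs.v *)
From Stdlib Require Import Reals ClassicalEpsilon.
From Coquelicot Require Import Coquelicot.
From mathcomp Require Import ssreflect ssrbool ssrnat eqtype seq bigop prime.

Set Implicit Arguments.
Unset Strict Implicit.

Definition rad (m : nat) : nat := (\prod_(p <- primes m) p)%N.

Definition psi (m : nat) : nat := (\prod_(p <- primes m) p.+1)%N.

Open Scope R_scope.

Definition S_count (theta x : R) : nat :=
  (\sum_(1 <= m < (Z.to_nat (Int_part x)).+1)
     (if Rle_dec (INR (rad m)) (Rpower (INR m) theta) then 1 else 0))%N.

Definition S_theta (theta x : R) : R := INR (S_count theta x).

(* F(v) = 6/pi^2 * sum_{m >= 1} 1/psi(m) * min(1, e^v / m); index n stands for m = n+1. *)
Definition F (v : R) : R :=
  6 / PI ^ 2 *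
  Series (fun n : nat => / INR (psi n.+1) * Rmin 1 (exp v / INR n.+1)).

Definition G (a : R) : R :=
  Series (fun n : nat =>
    if prime n then
      let p := INR n in
      Rpower p a * ln p /
        ((Rpower p a - 1) * (1 + (p + 1) * (Rpower p a - 1)))
    else 0).

(* alpha_theta(x): the (unique) alpha > 0 with G alpha = (1 - theta) log x,
   selected by definite description (Hilbert epsilon). *)
Definition alpha (theta x : R) : R :=
  epsilon (inhabits 0) (fun a => 0 < a /\ G a = (1 - theta) * ln x).

(* Main.v *)
Require Import Defs.
From Stdlib Require Import Reals Lra ZArith ClassicalEpsilon.
From Coquelicot Require Import Coquelicot.
From HB Require Import structures.
From mathcomp Require Import all_boot.
From mathcomp Require Import zify.

Set Implicit Arguments.
Unset Strict Implicit.
Open Scope R_scope.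

(** Put v = (1 - theta) ln x, beta = theta / (1 - theta), let G a = v and L = - ln a.
    Writing n = k j with k = rad n turns S_theta(x) into a sum over j <= x of the number of
    k <= Y_j with k = rad (k j), where Y_j = min (x / j, j ^ beta).  A sieve evaluates the inner
    count as (6 / pi^2) Y_j / psi(j) with an error that is summed by Rankin's trick at the exponent a
    and is smaller than the main term by a power of a.

    Let P(m) = 1 / (psi(m) m^a H(a)), a probability on the positive integers, and X = ln m - v, which
    is centred because G a = v.  Up to the common factor (6 / pi^2) e^(a v) H(a), F(v) is the expectation
    of f(X) with f(u) = e^(a u) min (1, e^-u), and the main term of S_theta(x) is x^theta times the
    expectation of r(X) with r(u) = e^(a u) min (e^(beta u), e^-u).  At scales up to 1 / a the law of X
    is flat: after smoothing by the Fejer kernel its density at u differs from the density at 0 by a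
    relative error O(a L).  Hence the ratio of the two expectations is that of the integrals of r and f,
    namely a / theta, up to a factor 1 + O(a L), and a L is of order sqrt (ln ln x / ln x) because
    G a ~ 1 / (a^2 L).  The smoothing rests on bounds for the characteristic function of X, an
    explicit Euler product.  On the range a/10 <= t <= a^-10 it is at most a^14: otherwise, if t is not
    too small, t ln p would be close to a multiple of 2 pi for all but few primes p, hence also t ln n
    and t ln (n + h) for most integers n free of the exceptional primes, contradicting the size of
    ln (1 + h / n). *)

#[local] Arguments INR : simpl never.
#[local] Arguments pow : simpl never.

HB.instance Definition _ := Monoid.isComLaw.Build R 0 Rplus
  (fun a b c => esym (Rplus_assoc a b c)) Rplus_comm Rplus_0_l.
HB.instance Definition _ := Monoid.isComLaw.Build R 1 Rmult
  (fun a b c => esym (Rmult_assoc a b c)) Rmult_comm Rmult_1_l.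
HB.instance Definition _ := Monoid.isMulLaw.Build R 0 Rmult Rmult_0_l Rmult_0_r.
HB.instance Definition _ := Monoid.isAddLaw.Build R Rmult Rplus
  Rmult_plus_distr_r Rmult_plus_distr_l.
HB.instance Definition _ := Monoid.isComLaw.Build C (RtoC 1) Cmult
  Cmult_assoc Cmult_comm Cmult_1_l.

Notation "'\rsum_' ( m <= i < n | P ) F" := (\big[Rplus/0]_(m <= i < n | P%B) F)
  (at level 36, F at level 36, i, m, n at level 50).
Notation "'\rsum_' ( m <= i < n ) F" := (\big[Rplus/0]_(m <= i < n) F)
  (at level 36, F at level 36, i, m, n at level 50).
Notation "'\rsum_' ( i <- r | P ) F" := (\big[Rplus/0]_(i <- r | P%B) F)
  (at level 36, F at level 36, i, r at level 50).
Notation "'\rsum_' ( i <- r ) F" := (\big[Rplus/0]_(i <- r) F)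
  (at level 36, F at level 36, i, r at level 50).
Notation "'\rprod_' ( m <= i < n ) F" := (\big[Rmult/1]_(m <= i < n) F)
  (at level 36, F at level 36, i, m, n at level 50).
Notation "'\rprod_' ( i <- r ) F" := (\big[Rmult/1]_(i <- r) F)
  (at level 36, F at level 36, i, r at level 50).
Notation "'\cprod_' ( m <= i < n ) F" := (\big[Cmult/RtoC 1]_(m <= i < n) F)
  (at level 36, F at level 36, i, m, n at level 50).

Section FiniteSums.
Variables (I : eqType).
Implicit Types (r : seq I) (P : pred I) (F E : I -> R).

Lemma rsum_ge0 r P F : (forall i, i \in r -> P i -> 0 <= F i) ->
  0 <= \rsum_(i <- r | P i) F i.
Proof.
move=> F_ge0; rewrite big_seq_cond.
apply: (big_ind (fun x => 0 <= x)); [lra | move=> x y; lra | by move=> i /andP [? ?]; apply: F_ge0].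
Qed.

Lemma rsum_le r P F E : (forall i, i \in r -> P i -> F i <= E i) ->
  \rsum_(i <- r | P i) F i <= \rsum_(i <- r | P i) E i.
Proof.
move=> F_le_E; rewrite big_seq_cond [X in _ <= X]big_seq_cond.
apply: (big_ind2 (fun x y => x <= y)); [lra | move=> x y z t; lra |].
by move=> i /andP [? ?]; apply: F_le_E.
Qed.

Lemma Rabs_rsum_le r P F :
  Rabs (\rsum_(i <- r | P i) F i) <= \rsum_(i <- r | P i) Rabs (F i).
Proof.
apply: (big_ind2 (fun x y => Rabs x <= y)); first by rewrite Rabs_R0; lra.
  move=> x y z t x_le z_le; apply: Rle_trans (Rabs_triang _ _) _; lra.
by move=> *; lra.
Qed.

Lemma rsumB r P F E : \rsum_(i <- r | P i) F i - \rsum_(i <- r | P i) E i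
  = \rsum_(i <- r | P i) (F i - E i).
Proof.
rewrite /Rminus big_split /=; congr (_ + _).
by apply: (big_morph Ropp) => [x y|]; [exact: Ropp_plus_distr | exact: Ropp_0].
Qed.

Lemma rsum_const r (c : R) : \rsum_(i <- r) c = INR (size r) * c.
Proof.
elim: r => [|a r IH]; first by rewrite big_nil /= Rmult_0_l.
by rewrite big_cons IH -[size (a :: r)]/((size r).+1) S_INR; ring.
Qed.

Lemma rprod_ge0 r F : (forall i, i \in r -> 0 <= F i) -> 0 <= \rprod_(i <- r) F i.
Proof.
move=> F_ge0; rewrite big_seq.
by apply: (big_ind (fun x => 0 <= x)); [lra | move=> x y; nra | ].
Qed.

Lemma rprod_gt0 r F : (forall i, i \in r -> 0 < F i) -> 0 < \rprod_(i <- r) F i.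
Proof.
move=> F_gt0; rewrite big_seq.
by apply: (big_ind (fun x => 0 < x)); [lra | move=> x y; nra | ].
Qed.

Lemma rprod_le r F E : (forall i, i \in r -> 0 <= F i <= E i) ->
  \rprod_(i <- r) F i <= \rprod_(i <- r) E i.
Proof.
move=> F_bounds.
suff : 0 <= \rprod_(i <- r) F i <= \rprod_(i <- r) E i by lra.
rewrite big_seq [X in _ <= _ <= X]big_seq.
by apply: (big_ind2 (fun x y => 0 <= x <= y)); [lra | move=> x y z t; nra | ].
Qed.

Lemma rprod_exp r F : \rprod_(i <- r) exp (F i) = exp (\rsum_(i <- r) F i).
Proof. by apply/esym/(big_morph exp) => [x y|]; [rewrite exp_plus | rewrite exp_0]. Qed.

Lemma rprod_le_exp r F E : (forall i, i \in r -> 0 <= F i <= exp (E i)) ->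
  \rprod_(i <- r) F i <= exp (\rsum_(i <- r) E i).
Proof. by move=> F_le_exp; rewrite -rprod_exp; apply: rprod_le. Qed.

Lemma rprod_one_sub_bounds r F : (forall i, i \in r -> 0 <= F i <= 1) ->
  1 - \rsum_(i <- r) F i <= \rprod_(i <- r) (1 - F i) <= 1.
Proof.
elim: r => [|i r IH] F01; first by rewrite !big_nil; lra.
have Fi : 0 <= F i <= 1 by apply: F01; rewrite mem_head.
have Fr j : j \in r -> 0 <= F j <= 1 by move=> jr; apply: F01; rewrite inE jr orbT.
by rewrite !big_cons; have := IH Fr; nra.
Qed.

Lemma rprod_inv r F : (forall i, 0 < F i) -> \rprod_(i <- r) / F i = / \rprod_(i <- r) F i.
Proof.
move=> F_gt0; elim: r => [|i r IH]; first by rewrite !big_nil Rinv_1.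
by rewrite !big_cons IH Rinv_mult.
Qed.

Lemma rprod_const r (c : R) : \rprod_(i <- r) c = c ^ size r.
Proof. by elim: r => [|i r IH]; rewrite ?big_nil // big_cons IH. Qed.

End FiniteSums.

Lemma rsum_nat_le (m n : nat) (F E : nat -> R) :
  (forall i, (m <= i < n)%N -> F i <= E i) ->
  \rsum_(m <= i < n) F i <= \rsum_(m <= i < n) E i.
Proof. by move=> F_le_E; apply: rsum_le => i; rewrite mem_index_iota => i_range _; apply: F_le_E. Qed.

Lemma rsum_nat_ge0 (m n : nat) (F : nat -> R) :
  (forall i, (m <= i < n)%N -> 0 <= F i) -> 0 <= \rsum_(m <= i < n) F i.
Proof. by move=> F_ge0; apply: rsum_ge0 => i; rewrite mem_index_iota => i_range _; apply: F_ge0. Qed.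

Lemma rsum_widen_le (m n : nat) (F : nat -> R) (a b : nat) :
  (forall i, 0 <= F i) -> (m <= a)%N -> (b <= n)%N ->
  \rsum_(a <= i < b) F i <= \rsum_(m <= i < n) F i.
Proof.
move=> F_ge0 m_le_a b_le_n.
case: (leqP a b) => [a_le_b|b_lt_a]; last by rewrite big_geq; [apply: rsum_nat_ge0 | lia].
rewrite (@big_cat_nat _ _ _ a m n) //=; last by lia.
rewrite (@big_cat_nat _ _ _ b a n) //=.
have := @rsum_nat_ge0 m a F (fun i _ => F_ge0 i).
have := @rsum_nat_ge0 b n F (fun i _ => F_ge0 i).
lra.
Qed.

Lemma rsum_telescope (m n : nat) (f : nat -> R) : (m <= n)%N ->
  \rsum_(m <= i < n) (f i.+1 - f i) = f n - f m.
Proof.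
elim: n => [|n IH] m_le; first by (have -> : m = 0%N by lia); rewrite big_geq //; ring.
case: (ltngtP m n.+1) => m_cases; [|lia|by rewrite m_cases big_geq //; ring].
by rewrite big_nat_recr /= ?IH; [ring | lia | lia].
Qed.

Lemma rsum_multiples (k N : nat) (F : nat -> R) : (0 < k)%N ->
  \rsum_(0 <= m < k * N) (if (k %| m)%N then F m else 0) = \rsum_(0 <= m < N) F (k * m)%N.
Proof.
move=> k_gt0; elim: N => [|N IH]; first by rewrite muln0 !big_geq.
rewrite mulnS (@big_cat_nat _ _ _ (k * N)) //=; last by lia.
rewrite IH [RHS]big_nat_recr //=; congr (_ + _).
rewrite big_ltn; last by lia.
rewrite dvdn_mulr // big1_seq ?Rplus_0_r // => i.
rewrite mem_index_iota => i_range; case: ifP => // /dvdnP [j i_eq]; exfalso.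
by move: i_range; rewrite i_eq [(j * k)%N]mulnC -mulnS !ltn_pmul2l //=; lia.
Qed.

Lemma rsum_multiples_upto (k M : nat) (F : nat -> R) : (0 < k)%N ->
  \rsum_(1 <= l < M.+1) (if (k %| l)%N then F l else 0) = \rsum_(1 <= l < (M %/ k).+1) F (k * l)%N.
Proof.
move=> k_gt0.
have M_lt : (M.+1 <= k * (M %/ k).+1)%N by rewrite mulnC ltn_ceil.
have := rsum_multiples (M %/ k).+1 F k_gt0.
rewrite (@big_cat_nat _ _ _ M.+1 0 _) //= [X in _ + X]big1_seq; last first.
  move=> i; rewrite mem_index_iota => /andP [_ /andP [M_lt_i i_lt]].
  case: ifP => // /dvdnP [j i_eq]; move: M_lt_i i_lt; rewrite i_eq mulnC ltn_pmul2l // => M_lt_i i_lt.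
  have : (M < k * (M %/ k))%N by apply: leq_trans M_lt_i _; rewrite leq_mul2l; apply/orP; right; lia.
  by have := leq_divM M k; rewrite mulnC; lia.
rewrite Rplus_0_r big_ltn // [in RHS]big_ltn // dvdn0 muln0.
lra.
Qed.

(** * Series *)

Lemma sum_n_rsum (a : nat -> R) n : sum_n a n = \rsum_(0 <= i < n.+1) a i.
Proof.
elim: n => [|n IH]; first by rewrite sum_O big_nat1.
by rewrite sum_Sn IH [RHS]big_nat_recr.
Qed.

Lemma is_series_rsum (a : nat -> R) (l : R) :
  is_series a l <-> is_lim_seq (fun N => \rsum_(0 <= i < N) a i) l.
Proof.
rewrite (is_lim_seq_incr_1 (fun N => \rsum_(0 <= i < N) a i)).
split=> lim_a.
  by apply: (is_lim_seq_ext (sum_n a)) => // n; apply: sum_n_rsum.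
by apply: (is_lim_seq_ext (fun n => \rsum_(0 <= i < n.+1) a i)) lim_a => n; rewrite sum_n_rsum.
Qed.

Lemma is_lim_seq_rsum (a : nat -> R) : ex_series a ->
  is_lim_seq (fun N => \rsum_(0 <= i < N) a i) (Series a).
Proof. by move=> sum_a; apply/is_series_rsum/Series_correct. Qed.

Lemma is_lim_seq_ub (u : nat -> R) (l B : R) :
  (exists N, forall n, (N <= n)%N -> u n <= B) -> is_lim_seq u l -> l <= B.
Proof.
move=> [N u_le] lim_u.
apply: (@is_lim_seq_le_loc u (fun _ => B) l B) lim_u (is_lim_seq_const B).
by exists N => n N_le_n; apply: u_le; lia.
Qed.

Lemma is_lim_seq_lb (u : nat -> R) (l B : R) :
  (exists N, forall n, (N <= n)%N -> B <= u n) -> is_lim_seq u l -> B <= l.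
Proof.
move=> [N u_ge] lim_u.
apply: (@is_lim_seq_le_loc (fun _ => B) u B l) (is_lim_seq_const B) lim_u.
by exists N => n N_le_n; apply: u_ge; lia.
Qed.

Lemma is_lim_seq_squeeze0 (u v : nat -> R) :
  (exists N, forall n, (N <= n)%N -> 0 <= u n <= v n) -> is_lim_seq v 0 -> is_lim_seq u 0.
Proof.
move=> [N u_le_v]; apply: is_lim_seq_le_le_loc (is_lim_seq_const 0).
by exists N => n N_le_n; apply: u_le_v; lia.
Qed.

Lemma is_lim_seq_mult_subseq (u : nat -> R) (l : R) (k : nat) : (0 < k)%N ->
  is_lim_seq u l -> is_lim_seq (fun N => u (k * N)%N) l.
Proof.
move=> k_gt0; apply: is_lim_seq_subseq.
by apply: eventually_subseq => n; apply/ltP; rewrite ltn_pmul2l.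
Qed.

Lemma ex_series_nneg_bounded (a : nat -> R) (B : R) : (forall n, 0 <= a n) ->
  (forall N, \rsum_(0 <= i < N) a i <= B) -> ex_series a /\ Series a <= B.
Proof.
move=> a_ge0 partial_le.
have : ex_finite_lim_seq (fun N => \rsum_(0 <= i < N) a i).
  apply: (ex_finite_lim_seq_incr _ B) => // n.
  by rewrite big_nat_recr //=; have := a_ge0 n; lra.
case=> l lim_a; have series_a : is_series a l by apply/is_series_rsum.
split; first by exists l.
rewrite (is_series_unique _ _ series_a); apply: is_lim_seq_ub lim_a.
by exists 0%N.
Qed.

Lemma rsum_le_Series (a : nat -> R) N : (forall n, 0 <= a n) -> ex_series a ->
  \rsum_(0 <= i < N) a i <= Series a.
Proof.
move=> a_ge0 sum_a; apply: is_lim_seq_lb (is_lim_seq_rsum sum_a).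
by exists N => n N_le_n; apply: rsum_widen_le.
Qed.

Lemma Series_ge0 (a : nat -> R) : (forall n, 0 <= a n) -> ex_series a -> 0 <= Series a.
Proof. by move=> a_ge0 sum_a; have := rsum_le_Series 0 a_ge0 sum_a; rewrite big_geq. Qed.

Lemma series_dominated (a b : nat -> R) : (forall n, Rabs (a n) <= b n) -> ex_series b ->
  ex_series a /\ Rabs (Series a) <= Series b.
Proof.
move=> a_le_b sum_b.
have sum_abs_a : ex_series (fun n => Rabs (a n)).
  by apply: (ex_series_le (fun n => Rabs (a n)) b) => // n; rewrite /norm /= /abs /= Rabs_Rabsolu.
split; first exact: ex_series_Rabs.
apply: Rle_trans (Series_Rabs _ sum_abs_a) _; apply: Series_le => // n; split=> //; exact: Rabs_pos.
Qed.

Lemma Series_sub_rsum_le (a b : nat -> R) N : (forall n, Rabs (a n) <= b n) -> ex_series b ->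
  Rabs (Series a - \rsum_(0 <= i < N) a i) <= Series b - \rsum_(0 <= i < N) b i.
Proof.
move=> a_le_b sum_b; have [sum_a _] := series_dominated a_le_b sum_b.
have tail_lim u : ex_series u -> is_lim_seq
    (fun n => \rsum_(0 <= i < n) u i - \rsum_(0 <= i < N) u i) (Series u - \rsum_(0 <= i < N) u i).
  by move=> sum_u; apply: is_lim_seq_minus'; [exact: is_lim_seq_rsum | exact: is_lim_seq_const].
have tailE u n : (N <= n)%N ->
    \rsum_(0 <= i < n) u i - \rsum_(0 <= i < N) u i = \rsum_(N <= i < n) u i.
  by move=> N_le_n; rewrite (@big_cat_nat _ _ _ N 0 n) //=; lra.
have le_lim : Rbar_le (Rabs (Series a - \rsum_(0 <= i < N) a i)) (Series b - \rsum_(0 <= i < N) b i).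
  apply: is_lim_seq_le_loc (is_lim_seq_abs _ _ (tail_lim a sum_a)) (tail_lim b sum_b).
  exists N => n N_le_n; rewrite !tailE; [|lia|lia].
  by apply: Rle_trans (Rabs_rsum_le _ _ _) _; apply: rsum_nat_le.
exact: le_lim.
Qed.

Lemma Series_tail_lt (b : nat -> R) eps : ex_series b -> 0 < eps ->
  exists N, forall n, (N <= n)%N -> Series b - \rsum_(0 <= i < n) b i < eps.
Proof.
move=> sum_b eps_gt0.
have /is_lim_seq_spec /(_ (mkposreal _ eps_gt0)) [N near] := is_lim_seq_rsum sum_b.
by exists N => n N_le_n; have := near n ltac:(lia); move/Rabs_def2 => /=; lra.
Qed.

Lemma Series_multiples (k : nat) (F : nat -> R) : (0 < k)%N ->
  ex_series (fun n => Rabs (F n)) ->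
  ex_series (fun m => if (k %| m)%N then F m else 0) /\
  Series (fun m => if (k %| m)%N then F m else 0) = Series (fun m => F (k * m)%N).
Proof.
move=> k_gt0 sum_F.
have sum_mult : ex_series (fun m => if (k %| m)%N then F m else 0).
  apply: (proj1 (series_dominated _ sum_F)) => n.
  by case: ifP => _; [lra | rewrite Rabs_R0; exact: Rabs_pos].
split=> //.
have := is_lim_seq_mult_subseq k_gt0 (is_lim_seq_rsum sum_mult).
move/(is_lim_seq_ext _ _ _ (fun N => rsum_multiples N F k_gt0)).
by move/is_series_rsum/is_series_unique.
Qed.

(** * Natural numbers as reals *)

Lemma INR_gt0 n : (0 < n)%N -> 0 < INR n.
Proof. by move=> n_gt0; apply: lt_0_INR; lia. Qed.

Lemma leq_INR (m n : nat) : (m <= n)%N -> INR m <= INR n.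
Proof. by move=> m_le_n; apply: le_INR; lia. Qed.

Lemma ltn_INR (m n : nat) : (m < n)%N -> INR m < INR n.
Proof. by move=> m_lt_n; apply: lt_INR; lia. Qed.

Lemma INR_ge1 n : (0 < n)%N -> 1 <= INR n.
Proof. by move=> n_gt0; apply: (@leq_INR 1). Qed.

Lemma INR_ge2 n : (1 < n)%N -> 2 <= INR n.
Proof. by move=> n_gt1; have -> : 2 = INR 2 by []; apply: leq_INR. Qed.

Lemma leq_of_INR (m n : nat) : INR m <= INR n -> (m <= n)%N.
Proof. by move/INR_le; lia. Qed.

Lemma ltn_of_INR (m n : nat) : INR m < INR n -> (m < n)%N.
Proof. by move/INR_lt; lia. Qed.

Lemma INR_addn (m n : nat) : INR (m + n)%N = INR m + INR n.
Proof. exact: plus_INR. Qed.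

Lemma INR_muln (m n : nat) : INR (m * n)%N = INR m * INR n.
Proof. exact: mult_INR. Qed.

Lemma Rmax_le_inv (x y z : R) : Rmax x y <= z -> x <= z /\ y <= z.
Proof. by move=> max_le; have := Rmax_l x y; have := Rmax_r x y; lra. Qed.

Lemma Rle_div_intro a b c : 0 < c -> a * c <= b -> a <= b / c.
Proof. by move=> c_gt0; apply Rle_div_r. Qed.

Lemma Rdiv_le_intro a b c : 0 < c -> a <= b * c -> a / c <= b.
Proof. by move=> c_gt0; apply Rle_div_l. Qed.

Lemma INR_expn (a n : nat) : INR (a ^ n)%N = INR a ^ n.
Proof. by elim: n => [|n IH] //; rewrite expnS INR_muln IH. Qed.

Lemma INR_2 : INR 2 = 2.
Proof. by rewrite INR_IZR_INZ. Qed.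

Lemma INR_prod (s : seq nat) (f : nat -> nat) :
  INR (\prod_(p <- s) f p)%N = \rprod_(p <- s) INR (f p).
Proof. by apply: (big_morph INR) => //; exact: mult_INR. Qed.

Lemma INR_divn_le (n d : nat) : (0 < d)%N -> INR (n %/ d) <= INR n / INR d.
Proof.
move=> d_gt0; apply: Rle_div_intro; first exact: INR_gt0.
by rewrite -INR_muln; apply: leq_INR; apply: leq_divM.
Qed.

Lemma INR_divn_ge (n d : nat) : (0 < d)%N -> INR n / INR d - 1 <= INR (n %/ d).
Proof.
move=> d_gt0.
have : INR n <= INR ((n %/ d).+1 * d)%N by apply: leq_INR; apply: ltnW; apply: ltn_ceil.
rewrite INR_muln S_INR => n_le.
suff : INR n / INR d <= INR (n %/ d) + 1 by lra.
by apply: Rdiv_le_intro => //; exact: INR_gt0.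
Qed.

Definition floorn (x : R) : nat := Z.to_nat (Int_part x).

Lemma floorn_bounds x : 0 <= x -> INR (floorn x) <= x < INR (floorn x) + 1.
Proof.
move=> x_ge0; have [le_x gt_x] := base_Int_part x; rewrite /floorn.
have Int_part_ge0 : (0 <= Int_part x)%Z.
  have : IZR (-1) < IZR (Int_part x) by lra.
  by move/lt_IZR; lia.
rewrite INR_IZR_INZ Z2Nat.id //; lra.
Qed.

Lemma leq_floorn n x : 0 <= x -> INR n <= x -> (n <= floorn x)%N.
Proof.
move=> x_ge0 n_le_x; have [_ x_lt] := floorn_bounds x_ge0.
have : INR n < INR (floorn x).+1 by rewrite S_INR; lra.
by move/ltn_of_INR; lia.
Qed.

Lemma floorn_INR n : floorn (INR n) = n.
Proof.
have [le_n n_lt] := floorn_bounds (pos_INR n).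
have := leq_of_INR le_n; have := leq_floorn (pos_INR n) (Rle_refl (INR n)); lia.
Qed.

Lemma floorn_div Z d : 0 <= Z -> (0 < d)%N -> floorn (Z / INR d) = (floorn Z %/ d)%N.
Proof.
move=> Z_ge0 d_gt0; have d_pos := INR_gt0 d_gt0.
have Zd_ge0 : 0 <= Z / INR d by apply: Rdiv_le_0_compat.
have [floorZ_le _] := floorn_bounds Z_ge0; have [floorZd_le _] := floorn_bounds Zd_ge0.
apply/eqP; rewrite eqn_leq; apply/andP; split.
  rewrite leq_divRL //; apply: leq_floorn => //; rewrite INR_muln.
  by apply Rle_div_r.
apply: leq_floorn => //; apply: Rle_div_intro => //; apply: Rle_trans floorZ_le.
by rewrite -INR_muln; apply: leq_INR; exact: leq_divM.
Qed.

Lemma floorn_min a b : 0 <= a -> 0 <= b -> floorn (Rmin a b) = minn (floorn a) (floorn b).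
Proof.
move=> a_ge0 b_ge0.
have [floora_le _] := floorn_bounds a_ge0; have [floorb_le _] := floorn_bounds b_ge0.
case: (Rle_lt_dec a b) => [a_le_b|b_lt_a].
  rewrite Rmin_left //; apply/esym/minn_idPl; apply: leq_floorn => //; lra.
rewrite Rmin_right; last lra.
by apply/esym/minn_idPr; apply: leq_floorn => //; lra.
Qed.

(** * Elementary inequalities *)

Lemma ln_le_sub1 x : 0 < x -> ln x <= x - 1.
Proof. by move=> x_gt0; have := exp_ineq1_le (ln x); rewrite exp_ln //; lra. Qed.

Lemma ln_ge_one_sub_inv x : 0 < x -> 1 - / x <= ln x.
Proof.
move=> x_gt0; have := ln_le_sub1 (Rinv_0_lt_compat _ x_gt0); rewrite ln_Rinv //; lra.
Qed.

Lemma ln_ge0 x : 1 <= x -> 0 <= ln x.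
Proof. by move=> x_ge1; rewrite -ln_1; apply: ln_le; lra. Qed.

Lemma ln_gt0 x : 1 < x -> 0 < ln x.
Proof. by move=> x_gt1; rewrite -ln_1; apply: ln_increasing; lra. Qed.

Lemma ln_INR_ge0 n : 0 <= ln (INR n).
Proof.
case: n => [|n]; last by apply: ln_ge0; apply: INR_ge1.
by rewrite INR_0 /ln; case: (Rlt_dec 0 0) => [lt00|_]; [exfalso; lra | lra].
Qed.

Lemma ln2_bounds : 1/2 < ln 2 < 1.
Proof.
split; first by have := ln_lt_2; lra.
have : ln 2 < ln (exp 1) by apply: ln_increasing; [lra | have := exp_ineq1 1; lra].
by rewrite ln_exp.
Qed.

Lemma ln_ge_half x : 2 <= x -> 1 / 2 < ln x.
Proof. by move=> x_ge2; have := ln_le 2 x ltac:(lra) x_ge2; have := ln2_bounds; lra. Qed.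

Lemma ln_sqrt x : 0 < x -> ln x = 2 * ln (sqrt x).
Proof.
move=> x_gt0; have sqrtx_gt0 := sqrt_lt_R0 _ x_gt0.
by rewrite -{1}(sqrt_sqrt x) ?ln_mult; lra.
Qed.

Lemma ln_le_2sqrt x : 0 < x -> ln x <= 2 * sqrt x.
Proof.
by move=> x_gt0; rewrite ln_sqrt //; have := ln_le_sub1 (sqrt_lt_R0 _ x_gt0); lra.
Qed.

Lemma ln_le_4sqrt_sqrt x : 0 < x -> ln x <= 4 * sqrt (sqrt x).
Proof.
by move=> x_gt0; rewrite ln_sqrt //; have := ln_le_2sqrt (sqrt_lt_R0 _ x_gt0); lra.
Qed.

Lemma ln_floorn_bounds Y : 2 <= Y ->
  ln Y - 1 <= ln (INR (floorn Y)) <= ln Y /\ (1 < floorn Y)%N.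
Proof.
move=> Y_ge2; have [floorY_le floorY_gt] := @floorn_bounds Y ltac:(lra).
have floorY_gt1 : (2 <= floorn Y)%N by apply: leq_floorn; rewrite ?INR_2; lra.
split=> //; split; last by apply: ln_le; lra.
have : ln (Y / 2) <= ln (INR (floorn Y)) by apply: ln_le; lra.
rewrite ln_div; [|lra|lra]; have := ln2_bounds; lra.
Qed.

Lemma ln_succ_sub_bounds n : (0 < n)%N -> 0 <= ln (INR n.+1) - ln (INR n) <= / INR n.
Proof.
move=> n_gt0; have n_pos := INR_gt0 n_gt0; have Sn_pos := INR_gt0 (ltn0Sn n).
split; first by have := ln_le _ _ n_pos (leq_INR (leqnSn n)); lra.
rewrite -ln_div //; apply: Rle_trans (ln_le_sub1 _) _; first exact: Rdiv_lt_0_compat.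
by rewrite S_INR; right; field; lra.
Qed.

Lemma harmonic_le w : \rsum_(1 <= n < w.+1) / INR n <= 1 + ln (INR w).
Proof.
case: w => [|w]; first by rewrite big_geq //; have := ln_INR_ge0 0; lra.
elim: w => [|w IH]; first by rewrite big_nat1 INR_1 ln_1 Rinv_1; lra.
rewrite big_nat_recr //=.
have w_pos : 0 < INR w.+1 by exact: INR_gt0.
have Sw_pos : 0 < INR w.+2 by exact: INR_gt0.
have := @ln_ge_one_sub_inv (INR w.+2 / INR w.+1) ltac:(apply: Rdiv_lt_0_compat; lra).
rewrite ln_div //.
have -> : 1 - / (INR w.+2 / INR w.+1) = / INR w.+2.
  by rewrite (S_INR w.+1) in Sw_pos *; field; lra.
lra.
Qed.

Lemma exp_gt1 x : 0 < x -> 1 < exp x.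
Proof. by move=> x_gt0; have := exp_ineq1_le x; lra. Qed.

Lemma exp_le x y : x <= y -> exp x <= exp y.
Proof. by move=> [xy|->]; [left; exact: exp_increasing | lra]. Qed.

Lemma exp_le1 x : x <= 0 -> exp x <= 1.
Proof. by move=> x_le0; rewrite -exp_0; exact: exp_le. Qed.

Lemma exp_mul_opp x : exp x * exp (- x) = 1.
Proof. by rewrite -exp_plus Rplus_opp_r exp_0. Qed.

Lemma exp_halves x : exp (x / 2) * exp (x / 2) = exp x.
Proof. by rewrite -exp_plus; congr exp; field. Qed.

Lemma exp_pow m x : exp x ^ m = exp (INR m * x).
Proof.
elim: m => [|m IH]; first by rewrite INR_0 Rmult_0_l exp_0.
by rewrite S_INR -tech_pow_Rmult IH -exp_plus; congr exp; ring.
Qed.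

Lemma exp2_le_exp (m : nat) x : INR m <= x -> 2 ^ m <= exp x.
Proof.
move=> m_le_x; apply: Rle_trans (exp_le m_le_x).
rewrite -[INR m]Rmult_1_r -exp_pow.
apply: pow_incr; have := exp_ineq1_le 1; lra.
Qed.

Lemma pow_le_exp (n : nat) (c y : R) : (0 < n)%N -> 0 < c <= 1 -> 0 <= y ->
  (1 + y) ^ n <= (INR n / c) ^ n * exp (c * y).
Proof.
move=> n_gt0 [c_gt0 c_le1] y_ge0; have n_ge1 := INR_ge1 n_gt0.
have -> : exp (c * y) = exp (c * y / INR n) ^ n by rewrite exp_pow; congr exp; field; lra.
rewrite -Rpow_mult_distr; apply: pow_incr; split; first lra.
have exp_ge := exp_ineq1_le (c * y / INR n).
have ratio_ge1 : 1 <= INR n / c by apply: Rle_div_intro; lra.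
apply: (@Rle_trans _ (INR n / c * (1 + c * y / INR n))); last by apply: Rmult_le_compat_l; lra.
have -> : INR n / c * (1 + c * y / INR n) = INR n / c + y by field; lra.
lra.
Qed.

Lemma pow_mul_exp_le (n : nat) (c y : R) : (0 < n)%N -> 0 < c <= 1 -> 0 <= y ->
  (1 + y) ^ n * exp (- (c * y)) <= (INR n / c) ^ n.
Proof.
move=> n_gt0 c_bounds y_ge0.
have := Rmult_le_compat_r _ _ _ (Rlt_le _ _ (exp_pos (- (c * y)))) (pow_le_exp n_gt0 c_bounds y_ge0).
by rewrite Rmult_assoc exp_mul_opp Rmult_1_r.
Qed.

Lemma exp_ge_pow (n : nat) x : (0 < n)%N -> 0 <= x -> (x / INR n) ^ n <= exp x.
Proof.
move=> n_gt0 x_ge0; have n_pos := INR_gt0 n_gt0.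
have -> : exp x = exp (x / INR n) ^ n by rewrite exp_pow; congr exp; field; lra.
apply: pow_incr; split; first by apply: Rdiv_le_0_compat.
by have := exp_ineq1_le (x / INR n); lra.
Qed.

Lemma exp_dominates (C e : R) (k : nat) : 0 < e ->
  exists L0, 0 < L0 /\ forall L, L0 <= L -> C * L ^ k <= exp (e * L).
Proof.
move=> e_gt0; have k_pos := INR_gt0 (ltn0Sn k).
set f := (e / INR k.+1) ^ k.+1.
have f_gt0 : 0 < f by apply: pow_lt; apply: Rdiv_lt_0_compat.
have ratio_ge0 := Rdiv_le_0_compat _ _ (Rabs_pos C) f_gt0.
exists (Rabs C / f + 1); split; first lra.
move=> L L_ge.
apply: Rle_trans (@exp_ge_pow k.+1 (e * L) isT _); last by apply: Rmult_le_pos; lra.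
have -> : (e * L / INR k.+1) ^ k.+1 = f * L * L ^ k.
  have -> : e * L / INR k.+1 = e / INR k.+1 * L by field; lra.
  by rewrite Rpow_mult_distr -/f -(tech_pow_Rmult L k); ring.
apply: Rmult_le_compat_r; first by apply: pow_le; lra.
apply: Rle_trans (Rle_abs C) _.
have -> : Rabs C = f * (Rabs C / f) by field; lra.
by apply: Rmult_le_compat_l; lra.
Qed.

Lemma is_derive_ge0_le (f df : R -> R) (a b : R) : a <= b ->
  (forall x, a <= x <= b -> is_derive f x (df x)) ->
  (forall x, a <= x <= b -> 0 <= df x) -> f a <= f b.
Proof.
move=> ab f_df df_ge0.
have := MVT_gen f a b df; rewrite Rmin_left // Rmax_right //.
case=> [x x_ab | x x_ab | c [c_ab f_mvt]]; first by apply: f_df; lra.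
  apply continuity_pt_filterlim; apply: ex_derive_continuous.
  by eexists; exact: f_df.
by have := df_ge0 c c_ab; nra.
Qed.

Lemma expm1_ge_mul_exp_half x : 0 <= x -> x * exp (x / 2) <= exp x - 1.
Proof.
move=> x_ge0.
have sinh_ge y : 0 <= y -> 2 * y <= exp y - exp (- y).
  move=> y_ge0.
  have := @is_derive_ge0_le (fun z => exp z - exp (- z) - 2 * z)
    (fun z => exp z + exp (- z) - 2) 0 y y_ge0.
  rewrite Ropp_0 exp_0 => mono; suff : 1 - 1 - 2 * 0 <= exp y - exp (- y) - 2 * y by lra.
  apply: mono => z _; first by auto_derive => //; ring.
  by have := exp_ineq1_le z; have := exp_ineq1_le (- z); lra.
have := sinh_ge (x / 2) ltac:(lra); rewrite -(exp_halves x).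
have := exp_mul_opp (x / 2); have := exp_pos (x / 2); nra.
Qed.

Lemma expm1_le_double x : 0 <= x <= 1 / 2 -> exp x - 1 <= 2 * x.
Proof.
move=> x_bounds; have := exp_mul_opp x.
have := exp_ineq1_le (- x); have := exp_pos x; nra.
Qed.

Lemma inv_one_sub_exp_le x : 0 < x -> / (1 - exp (- x)) <= 1 + / x.
Proof.
move=> x_gt0; have exp_opp := exp_mul_opp x.
have exp_ge := exp_ineq1_le x.
have -> : 1 + / x = / (x / (1 + x)) by field; lra.
apply: Rinv_le_contravar; first by apply: Rdiv_lt_0_compat; lra.
apply: Rdiv_le_intro; [lra | nra].
Qed.

Lemma exp_opp_lipschitz x y : 0 <= x -> 0 <= y -> Rabs (exp (- x) - exp (- y)) <= Rabs (x - y).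
Proof.
have ordered u w : 0 <= u -> u <= w -> 0 <= exp (- u) - exp (- w) <= w - u.
  move=> u_ge0 uw.
  have -> : exp (- w) = exp (- u) * exp (- (w - u)) by rewrite -exp_plus; congr exp; ring.
  have exp_u_gt0 := exp_pos (- u); have exp_u_le1 : exp (- u) <= 1 by apply: exp_le1; lra.
  have exp_ge := exp_ineq1_le (- (w - u)).
  have exp_wu_le1 : exp (- (w - u)) <= 1 by apply: exp_le1; lra.
  nra.
move=> x_ge0 y_ge0; case: (Rle_lt_dec x y) => xy.
  have diff := ordered x y x_ge0 xy.
  by rewrite Rabs_pos_eq; [rewrite Rabs_left1; lra | lra].
have diff := ordered y x y_ge0 (Rlt_le _ _ xy).
by rewrite Rabs_left1; [rewrite Rabs_pos_eq; lra | lra].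
Qed.

Lemma sin_le x : 0 <= x -> sin x <= x.
Proof. by move=> [x_gt0|<-]; [left; exact: sin_lt_x | rewrite sin_0; lra]. Qed.

Lemma Rabs_sin_le x : Rabs (sin x) <= Rabs x.
Proof.
have nneg y : 0 <= y -> Rabs (sin y) <= y.
  move=> y_ge0; apply: Rabs_le; split; last exact: sin_le.
  case: (Rle_lt_dec y PI) => yPI; first by have := sin_ge_0 y y_ge0 yPI; lra.
  by have := SIN_bound y; have := PI2_1; lra.
case: (Rle_lt_dec 0 x) => x_sign; first by rewrite (Rabs_pos_eq x) //; exact: nneg.
rewrite (Rabs_left x) // -(Rabs_Ropp (sin x)) -sin_neg; apply: nneg; lra.
Qed.

Lemma Rabs_sin_add x y : Rabs (sin (x + y)) <= Rabs (sin x) + Rabs (sin y).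
Proof.
rewrite sin_plus; apply: Rle_trans (Rabs_triang _ _) _; rewrite !Rabs_mult.
have cosx_le1 : Rabs (cos x) <= 1 by apply: Rabs_le; exact: COS_bound.
have cosy_le1 : Rabs (cos y) <= 1 by apply: Rabs_le; exact: COS_bound.
have := Rabs_pos (sin x); have := Rabs_pos (sin y); nra.
Qed.

Lemma one_sub_cosE x : 1 - cos x = 2 * (sin (x / 2) * sin (x / 2)).
Proof.
have -> : cos x = cos (2 * (x / 2)) by congr cos; field.
by rewrite cos_2a_sin; ring.
Qed.

Lemma one_sub_cos_bounds x : 0 <= 1 - cos x <= x * x / 2.
Proof.
split; first by have := COS_bound x; lra.
rewrite one_sub_cosE; have sin_half_le := Rabs_sin_le (x / 2).
have := Rsqr_le_abs_1 _ _ sin_half_le; rewrite /Rsqr; lra.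
Qed.

Lemma sin_ge_cubic x : 0 <= x -> x - x ^ 3 / 6 <= sin x.
Proof.
move=> x_ge0.
have := @is_derive_ge0_le (fun y => sin y - y + y * y * y / 6) (fun y => cos y - 1 + y * y / 2) 0 x x_ge0.
rewrite sin_0 => mono.
suff : 0 - 0 + 0 * 0 * 0 / 6 <= sin x - x + x * x * x / 6 by rewrite /pow; lra.
apply: mono => y _; last by have := one_sub_cos_bounds y; lra.
by auto_derive => //; field.
Qed.

Lemma x_cos_le_sin x : 0 <= x <= PI / 2 -> x * cos x <= sin x.
Proof.
move=> [x_ge0 x_le].
have := @is_derive_ge0_le (fun y => sin y - y * cos y) (fun y => y * sin y) 0 x x_ge0.
rewrite sin_0 Rmult_0_l => mono; suff : 0 - 0 <= sin x - x * cos x by lra.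
apply: mono => y y_bounds; first by auto_derive => //; ring.
by apply: Rmult_le_pos; [|apply: sin_ge_0; have := PI_RGT_0]; lra.
Qed.

Lemma one_sub_cos_ge x : 0 <= x <= 1 -> x * x / 4 <= 1 - cos x.
Proof.
move=> x_bounds; rewrite one_sub_cosE.
have := @sin_ge_cubic (x / 2) ltac:(lra); set z := x / 2 => sin_z_ge.
have -> : x * x / 4 = z * z by rewrite /z; field.
have z_bounds : 0 <= z <= 1 / 2 by rewrite /z; lra.
have : 3 / 4 * z <= sin z by apply: Rle_trans sin_z_ge; rewrite /pow; nra.
nra.
Qed.

Lemma Rabs_cos_sub x y : Rabs (cos x - cos y) <= Rabs (x - y).
Proof.
have -> : cos x - cos y = - 2 * (sin ((x + y) / 2) * sin ((x - y) / 2)).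
  have -> : cos x = cos ((x + y) / 2 + (x - y) / 2) by congr cos; field.
  have -> : cos y = cos ((x + y) / 2 - (x - y) / 2) by congr cos; field.
  by rewrite cos_plus cos_minus; ring.
rewrite !Rabs_mult; have -> : Rabs (- 2) = 2 by rewrite Rabs_left; lra.
have sin_diff_le := Rabs_sin_le ((x - y) / 2).
have sin_sum_le1 : Rabs (sin ((x + y) / 2)) <= 1 by apply: Rabs_le; exact: SIN_bound.
have halfE : Rabs ((x - y) / 2) = Rabs (x - y) / 2.
  by rewrite /Rdiv Rabs_mult (Rabs_pos_eq (/ 2)); lra.
have := Rabs_pos (sin ((x - y) / 2)); have := Rabs_pos (sin ((x + y) / 2)); nra.
Qed.

Lemma Rabs_sin_sub x y : Rabs (sin x - sin y) <= Rabs (x - y).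
Proof.
have := Rabs_cos_sub (PI / 2 - x) (PI / 2 - y); rewrite !cos_shift.
have -> : PI / 2 - x - (PI / 2 - y) = - (x - y) by ring.
by rewrite Rabs_Ropp.
Qed.

Lemma six_PI2_bounds : 1 / 3 <= 6 / PI ^ 2 <= 1.
Proof.
have PI_gt0 := PI_RGT_0; have PI2_gt0 : 0 < PI ^ 2 by apply: pow_lt.
split.
  have : PI ^ 2 <= 4 ^ 2 by apply: pow_incr; have := PI_4; lra.
  by move=> PI2_le; apply: Rle_div_intro => //; lra.
have : 3 ^ 2 <= PI ^ 2 by apply: pow_incr; have := PI2_3_2; lra.
by move=> PI2_ge; apply: Rdiv_le_intro => //; lra.
Qed.

(** * Continuity and integration *)

Lemma continuous_rsum (f : nat -> R -> R) (x : R) N : (forall n, continuous (f n) x) ->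
  continuous (fun y => \rsum_(0 <= n < N) f n y) x.
Proof.
move=> f_cont; elim: N => [|N IH].
  apply: (continuous_ext (fun _ => 0)) => [y|]; first by rewrite big_geq.
  exact: continuous_const.
apply: (continuous_ext (fun y => \rsum_(0 <= n < N) f n y + f N y)).
  by move=> y; rewrite big_nat_recr.
exact: (continuous_plus (fun y => \rsum_(0 <= n < N) f n y)).
Qed.

Lemma continuous_Series (f : nat -> R -> R) (M : nat -> R) (x : R) :
  (forall n, continuous (f n) x) ->
  locally x (fun y => forall n, Rabs (f n y) <= M n) -> ex_series M ->
  continuous (fun y => Series (fun n => f n y)) x.
Proof.
move=> f_cont [d f_le_M] sum_M; apply/filterlim_locally => eps.
have eps4_gt0 : 0 < eps / 4 by have := cond_pos eps; lra.
have [N tail_lt] := Series_tail_lt sum_M eps4_gt0.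
have near y : ball x d y -> Rabs (Series (fun n => f n y) - \rsum_(0 <= n < N) f n y) <= eps / 4.
  move=> xy; apply: Rle_trans (Series_sub_rsum_le N (f_le_M y xy) sum_M) _.
  by apply: Rlt_le; exact: tail_lt.
have /filterlim_locally /(_ (mkposreal _ eps4_gt0)) partial := @continuous_rsum f x N f_cont.
have in_ball : locally x (fun y => ball x d y) by exists d.
generalize (filter_and _ _ partial in_ball); apply: filter_imp => y [partial_y xy].
move: (near x (ball_center x d)) (near y xy) partial_y.
rewrite /ball /= /AbsRing_ball /= /abs /minus /plus /opp /=.
move=> /Rabs_le_between near_x /Rabs_le_between near_y /Rabs_def2 partial_y.
apply: Rabs_def1; lra.
Qed.

Lemma lipschitz_continuous (f : R -> R) (K : R) :
  (forall x y, Rabs (f x - f y) <= K * Rabs (x - y)) -> forall x, continuous f x.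
Proof.
move=> f_lip x; apply/filterlim_locally => eps.
have K_ge0 : 0 <= Rabs K by exact: Rabs_pos.
have d_gt0 : 0 < eps / (Rabs K + 1) by apply: Rdiv_lt_0_compat; [exact: cond_pos | lra].
exists (mkposreal _ d_gt0) => y.
rewrite /ball /= /AbsRing_ball /= /abs /minus /plus /opp /= => xy.
rewrite -/(Rminus _ _) in xy *.
apply: Rle_lt_trans (f_lip y x) _.
apply: (@Rle_lt_trans _ (Rabs K * Rabs (y - x))).
  by apply: Rmult_le_compat_r; [exact: Rabs_pos | exact: Rle_abs].
apply: (@Rle_lt_trans _ (Rabs K * (eps / (Rabs K + 1)))); first by apply: Rmult_le_compat_l; lra.
have -> : Rabs K * (eps / (Rabs K + 1)) = eps - eps / (Rabs K + 1) by field; lra.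
lra.
Qed.

Lemma ex_RInt_cont (f : R -> R) a b : (forall x, continuous f x) -> ex_RInt f a b.
Proof. by move=> f_cont; apply: ex_RInt_continuous => x _. Qed.

Lemma is_RInt_rsum (g : nat -> R -> R) (a b : R) N : (forall m, ex_RInt (g m) a b) ->
  is_RInt (fun x => \rsum_(0 <= m < N) g m x) a b (\rsum_(0 <= m < N) RInt (g m) a b).
Proof.
move=> g_int; elim: N => [|N IH].
  apply: (is_RInt_ext (fun _ => 0)); first by move=> x _; rewrite big_geq.
  by rewrite big_geq //; have := is_RInt_const a b 0; rewrite /scal /= /mult /= Rmult_0_r.
rewrite big_nat_recr //=.
apply: (is_RInt_ext (fun x => plus (\rsum_(0 <= m < N) g m x) (g N x))).
  by move=> x _; rewrite big_nat_recr.
by apply: is_RInt_plus => //; exact: RInt_correct.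
Qed.

Lemma is_RInt_Series (g : nat -> R -> R) (M : nat -> R) (a b : R) :
  (forall m, ex_RInt (g m) a b) -> (forall m x, Rabs (g m x) <= M m) -> ex_series M ->
  is_RInt (fun x => Series (fun m => g m x)) a b (Series (fun m => RInt (g m) a b)).
Proof.
move=> g_int g_le_M sum_M.
pose f N x := \rsum_(0 <= m < N) g m x.
have f_unif : filterlim f eventually
    (locally (fun x => Series (fun m => g m x) : R_CompleteNormedModule)).
  apply/filterlim_locally => eps.
  have [N tail_lt] := Series_tail_lt sum_M (cond_pos eps).
  exists N => n N_le_n x.
  rewrite /ball /= /AbsRing_ball /= /abs /minus /plus /opp /= -/(Rminus _ _) Rabs_minus_sym.
  apply: Rle_lt_trans (Series_sub_rsum_le n (g_le_M^~ x) sum_M) _.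
  by apply: tail_lt; lia.
have [If [lim_If int_If]] :=
  filterlim_RInt f a b eventually _ _ _ (fun N => @is_RInt_rsum g a b N g_int) f_unif.
have -> // : Series (fun m => RInt (g m) a b) = If.
by apply: is_series_unique; apply/is_series_rsum; exact: lim_If.
Qed.

(** * Complex series and limits *)

Definition CSeries (a : nat -> C) : C :=
  (Series (fun n => fst (a n)), Series (fun n => snd (a n))).

Definition Csummable (a : nat -> C) := ex_series (fun n => Cmod (a n)).

Lemma Rabs_fst_Cmod (z : C) : Rabs (fst z) <= Cmod z.
Proof. by apply: Rle_trans (Rmax_Cmod z); apply: Rmax_l. Qed.

Lemma Rabs_snd_Cmod (z : C) : Rabs (snd z) <= Cmod z.
Proof. by apply: Rle_trans (Rmax_Cmod z); apply: Rmax_r. Qed.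

Lemma Csummable_fst a : Csummable a -> ex_series (fun n => fst (a n)).
Proof. by move=> sum_a; apply: (proj1 (series_dominated _ sum_a)) => n; exact: Rabs_fst_Cmod. Qed.

Lemma Csummable_snd a : Csummable a -> ex_series (fun n => snd (a n)).
Proof. by move=> sum_a; apply: (proj1 (series_dominated _ sum_a)) => n; exact: Rabs_snd_Cmod. Qed.

Lemma Csummable_le (a b : nat -> C) : (forall n, Cmod (a n) <= Cmod (b n)) ->
  Csummable b -> Csummable a.
Proof.
move=> a_le_b sum_b; apply: (proj1 (series_dominated _ sum_b)) => n.
by rewrite Rabs_pos_eq; [|exact: Cmod_ge_0].
Qed.

Lemma CSeries_ext (a b : nat -> C) : (forall n, a n = b n) -> CSeries a = CSeries b.
Proof. by move=> ab; rewrite /CSeries; congr (_, _); apply: Series_ext => n; rewrite ab. Qed.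

Lemma CSeries_plus (a b : nat -> C) : Csummable a -> Csummable b ->
  CSeries (fun n => (a n + b n)%C) = (CSeries a + CSeries b)%C.
Proof.
move=> sum_a sum_b; rewrite /CSeries /Cplus /=; congr (_, _); apply: Series_plus;
  by [apply: Csummable_fst | apply: Csummable_snd].
Qed.

Lemma CSeries_scal (c : C) (a : nat -> C) : Csummable a ->
  CSeries (fun n => (c * a n)%C) = (c * CSeries a)%C.
Proof.
move=> sum_a; have sum_re := Csummable_fst sum_a; have sum_im := Csummable_snd sum_a.
rewrite /CSeries /Cmult /=; congr (_, _).
  rewrite (Series_ext _ (fun n => c.1 * (a n).1 + - c.2 * (a n).2)); last by move=> n; ring.
  rewrite Series_plus; [|exact: ex_series_scal|exact: ex_series_scal].
  by rewrite !Series_scal_l; ring.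
rewrite Series_plus; [|exact: ex_series_scal|exact: ex_series_scal].
by rewrite !Series_scal_l; ring.
Qed.

Lemma Csummable_scal (c : C) a : Csummable a -> Csummable (fun n => (c * a n)%C).
Proof.
move=> sum_a; apply: (ex_series_ext (fun n => Cmod c * Cmod (a n))).
  by move=> n; rewrite Cmod_mult.
exact: ex_series_scal.
Qed.

Lemma Csummable_plus a b : Csummable a -> Csummable b ->
  Csummable (fun n => (a n + b n)%C).
Proof.
move=> sum_a sum_b; apply: (proj1 (series_dominated _ (ex_series_plus _ _ sum_a sum_b))) => n.
rewrite Rabs_pos_eq; [exact: Cmod_triangle|exact: Cmod_ge_0].
Qed.

Lemma CSeries_multiples (k : nat) (a : nat -> C) : (0 < k)%N -> Csummable a ->
  CSeries (fun m => if (k %| m)%N then a m else RtoC 0) = CSeries (fun m => a (k * m)%N).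
Proof.
move=> k_gt0 sum_a.
have sum_re : ex_series (fun n => Rabs (fst (a n))).
  by apply: (proj1 (series_dominated _ sum_a)) => n; rewrite Rabs_Rabsolu; exact: Rabs_fst_Cmod.
have sum_im : ex_series (fun n => Rabs (snd (a n))).
  by apply: (proj1 (series_dominated _ sum_a)) => n; rewrite Rabs_Rabsolu; exact: Rabs_snd_Cmod.
have [_ reE] := Series_multiples k_gt0 sum_re; have [_ imE] := Series_multiples k_gt0 sum_im.
rewrite /CSeries; congr (_, _); [rewrite -reE|rewrite -imE];
  by apply: Series_ext => n; case: ifP.
Qed.

Lemma Cmod_le_Rabs_add (z : C) : Cmod z <= Rabs (fst z) + Rabs (snd z).
Proof.
have re_ge0 := Rabs_pos (fst z); have im_ge0 := Rabs_pos (snd z).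
rewrite /Cmod -(sqrt_Rsqr (Rabs (fst z) + Rabs (snd z))); last lra.
apply: sqrt_le_1_alt; rewrite -(pow2_abs (fst z)) -(pow2_abs (snd z)) /Rsqr /pow; nra.
Qed.

Lemma Cmod_CSeries_sub_le (a : nat -> C) (b : nat -> R) N : (forall n, Cmod (a n) <= b n) ->
  ex_series b ->
  Cmod (CSeries a - (\rsum_(0 <= i < N) fst (a i), \rsum_(0 <= i < N) snd (a i)))%C
    <= 2 * (Series b - \rsum_(0 <= i < N) b i).
Proof.
move=> a_le_b sum_b; apply: Rle_trans (Cmod_le_Rabs_add _) _.
have re_le n : Rabs (fst (a n)) <= b n by apply: Rle_trans (Rabs_fst_Cmod _) _.
have im_le n : Rabs (snd (a n)) <= b n by apply: Rle_trans (Rabs_snd_Cmod _) _.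
have := Series_sub_rsum_le N re_le sum_b; have := Series_sub_rsum_le N im_le sum_b.
by rewrite /CSeries /Rminus /=; lra.
Qed.

Definition Clim (z : nat -> C) (l : C) := is_lim_seq (fun k => Cmod (z k - l)%C) 0.

Lemma Clim_ext z z' l : (forall k, z k = z' k) -> Clim z l -> Clim z' l.
Proof. by move=> zz'; apply: is_lim_seq_ext => k; rewrite zz'. Qed.

Lemma Clim_mult z z' l l' : Clim z l -> Clim z' l' ->
  Clim (fun k => (z k * z' k)%C) (l * l')%C.
Proof.
move=> lim_z lim_z'.
pose bound k := Cmod (z k - l)%C * Cmod (z' k - l')%C
  + (Cmod (z k - l)%C * Cmod l' + Cmod l * Cmod (z' k - l')%C).
apply: (@is_lim_seq_squeeze0 _ bound).
  exists 0%N => k _; split; first exact: Cmod_ge_0.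
  have -> : (z k * z' k - l * l' =
      (z k - l) * (z' k - l') + ((z k - l) * l' + l * (z' k - l')))%C by ring.
  apply: Rle_trans (Cmod_triangle _ _) _; rewrite /bound Cmod_mult.
  by have := Cmod_triangle ((z k - l) * l')%C (l * (z' k - l'))%C; rewrite !Cmod_mult; lra.
have -> : 0 = 0 * 0 + (0 * Cmod l' + Cmod l * 0) by ring.
by do 2?apply: is_lim_seq_plus'; apply: is_lim_seq_mult' => //; exact: is_lim_seq_const.
Qed.

Lemma Clim_RtoC (u : nat -> R) (l : R) : is_lim_seq u l -> Clim (fun k => RtoC (u k)) (RtoC l).
Proof.
move=> lim_u; apply: (is_lim_seq_ext (fun k => Rabs (u k - l))).
  by move=> k; rewrite -RtoC_minus Cmod_R.
apply: (is_lim_seq_abs_0 (fun k => u k - l)).1.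
have -> : 0 = l - l by ring.
by apply: is_lim_seq_minus' => //; exact: is_lim_seq_const.
Qed.

Lemma is_lim_seq_of_dist (u : nat -> R) (l : R) (d : nat -> R) :
  (forall k, Rabs (u k - l) <= d k) -> is_lim_seq d 0 -> is_lim_seq u l.
Proof.
move=> u_near lim_d.
have lim_diff : is_lim_seq (fun k => u k - l) 0.
  apply: (is_lim_seq_abs_0 _).2; apply: is_lim_seq_squeeze0 lim_d.
  by exists 0%N => k _; split; [exact: Rabs_pos |].
have := is_lim_seq_plus' _ _ _ _ lim_diff (is_lim_seq_const l); rewrite Rplus_0_l.
by apply: is_lim_seq_ext => k; ring.
Qed.

Lemma Clim_fst z l : Clim z l -> is_lim_seq (fun k => fst (z k)) (fst l).
Proof. by apply: is_lim_seq_of_dist => k; exact: (Rabs_fst_Cmod (z k - l)%C). Qed.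

Lemma Clim_snd z l : Clim z l -> is_lim_seq (fun k => snd (z k)) (snd l).
Proof. by apply: is_lim_seq_of_dist => k; exact: (Rabs_snd_Cmod (z k - l)%C). Qed.

Lemma Clim_Cmod_le z l B : Clim z l -> (exists K, forall k, (K <= k)%N -> Cmod (z k) <= B) ->
  Cmod l <= B.
Proof.
move=> lim_z [K z_le]; suff : Cmod l - B <= 0 by lra.
apply: is_lim_seq_lb lim_z; exists K => k /z_le zk_le.
have := Cmod_triangle (z k) (- (z k - l))%C; rewrite Cmod_opp.
have -> : (z k + - (z k - l) = l)%C by ring.
lra.
Qed.

Lemma Cmod_cprod (z : nat -> C) m n :
  Cmod (\cprod_(m <= i < n) z i) = \rprod_(m <= i < n) Cmod (z i).
Proof. by apply: (big_morph Cmod) => [x y|]; [exact: Cmod_mult | exact: Cmod_1]. Qed.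

Lemma RtoC_rprod (f : nat -> R) m n :
  RtoC (\rprod_(m <= i < n) f i) = \cprod_(m <= i < n) RtoC (f i).
Proof. by apply: (big_morph RtoC) => // x y; exact: RtoC_mult. Qed.

Definition cis (x : R) : C := (cos x, sin x).

Lemma Cmod_cis x : Cmod (cis x) = 1.
Proof.
rewrite /Cmod /cis [fst _]/= [snd _]/=.
have -> : cos x ^ 2 + sin x ^ 2 = 1 by have := sin2_cos2 x; rewrite /Rsqr /pow; lra.
exact: sqrt_1.
Qed.

Lemma cisD x y : cis (x + y) = (cis x * cis y)%C.
Proof. by rewrite /cis /Cmult /= cos_plus sin_plus; congr (_, _); ring. Qed.

Lemma cis0 : cis 0 = RtoC 1.
Proof. by rewrite /cis cos_0 sin_0. Qed.

Lemma Clim_cis (u : nat -> R) (l : R) : is_lim_seq u l -> Clim (fun k => cis (u k)) (cis l).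
Proof.
move=> /Clim_RtoC lim_u.
apply: (@is_lim_seq_squeeze0 _ (fun k => 2 * Cmod (RtoC (u k) - RtoC l))).
  exists 0%N => k _; split; first exact: Cmod_ge_0.
  apply: Rle_trans (Cmod_le_Rabs_add _) _; rewrite -RtoC_minus Cmod_R /=.
  by have := Rabs_cos_sub (u k) l; have := Rabs_sin_sub (u k) l; rewrite /Rminus; lra.
have -> : 0 = 2 * 0 by ring.
by apply: is_lim_seq_mult' => //; exact: is_lim_seq_const.
Qed.

(** * Euler products *)

Definition prime_weight (b : nat -> R) (m : nat) : R := \rprod_(p <- primes m) b p.

Definition rough (k m : nat) : bool := all (fun p => (k <= p)%N) (primes m).

Lemma prime_weight1 b : prime_weight b 1 = 1.
Proof. by rewrite /prime_weight big_nil. Qed.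

Lemma prime_weight_primeM b p m : prime p -> (0 < m)%N ->
  prime_weight b (p * m)%N = if (p %| m)%N then prime_weight b m else b p * prime_weight b m.
Proof.
move=> p_prime m_gt0; have p_gt0 := prime_gt0 p_prime; rewrite /prime_weight.
case: ifP => p_dvd.
  suff -> : primes (p * m)%N = primes m by [].
  apply/eq_primes => q; rewrite primesM // primes_prime // inE.
  by case: eqP => [->|//]; rewrite mem_primes p_prime m_gt0 p_dvd.
have -> : b p * \rprod_(q <- primes m) b q = \rprod_(q <- p :: primes m) b q by rewrite big_cons.
apply: perm_big; apply: uniq_perm; rewrite ?primes_uniq //= ?primes_uniq ?andbT.
  by rewrite mem_primes p_prime m_gt0 p_dvd.
by move=> q; rewrite primesM // primes_prime // !inE.
Qed.

Lemma prime_weight_ge0 b m : (forall p, 0 <= b p) -> 0 <= prime_weight b m.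
Proof. by move=> b_ge0; apply: rprod_ge0. Qed.

Lemma rough0 m : rough 0 m.
Proof. exact/allP. Qed.

Lemma roughS k m : (0 < m)%N ->
  rough k.+1 m = rough k m && ~~ (prime k && (k %| m)%N).
Proof.
move=> m_gt0; apply/idP/idP.
  move/allP=> lt_k; apply/andP; split; first by apply/allP => p /lt_k; lia.
  apply/negP => /andP [k_prime k_dvd].
  by have := lt_k k; rewrite mem_primes k_prime m_gt0 k_dvd => /(_ isT); rewrite ltnn.
case/andP=> /allP le_k k_ndvd; apply/allP => p p_dvd; have := le_k p p_dvd.
rewrite leq_eqVlt => /orP [/eqP kp|//].
by move: p_dvd k_ndvd; rewrite mem_primes kp => /and3P [-> _ ->].
Qed.

Lemma rough_primeM k m : prime k -> (0 < m)%N -> rough k (k * m) = rough k m.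
Proof.
move=> k_prime m_gt0; have k_gt0 := prime_gt0 k_prime; apply/allP/allP => le_k p p_dvd.
  by apply: le_k; rewrite primesM // p_dvd orbT.
move: p_dvd; rewrite primesM // => /orP [|]; last exact: le_k.
by rewrite primes_prime // inE => /eqP ->.
Qed.

Lemma rough_lt_eq1 k m : (0 < m)%N -> (m < k)%N -> rough k m -> m = 1%N.
Proof.
move=> m_gt0 m_lt_k /allP le_k; case: (ltngtP m 1) => // m_gt1; first by lia.
have : pdiv m \in primes m by rewrite mem_primes pdiv_prime // m_gt0 pdiv_dvd.
by move/le_k; have := pdiv_leq m_gt0; lia.
Qed.

Section EulerUpperBound.
Variables (b e : nat -> R).
Hypothesis b_ge0 : forall p, 0 <= b p.
Hypothesis e_ge0 : forall m, 0 <= e m.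
Hypothesis e1 : e 1%N = 1.
Hypothesis eM : forall p m, prime p -> (0 < m)%N -> e (p * m)%N = e p * e m.
Hypothesis e_lt1 : forall p, prime p -> e p < 1.

(* The local factor [1 + b p (e p + e p ^ 2 + ...)]. *)
Definition euler_factor (n : nat) : R :=
  if prime n then 1 + b n * (e n / (1 - e n)) else 1.

Let rough_term k m := if (0 < m)%N && rough k m then prime_weight b m * e m else 0.

Lemma rough_term_ge0 k m : 0 <= rough_term k m.
Proof.
rewrite /rough_term; case: ifP => _; [|lra].
by apply: Rmult_le_pos; [apply: prime_weight_ge0|].
Qed.

Lemma euler_factor_ge1 n : 1 <= euler_factor n.
Proof.
rewrite /euler_factor; case: ifP => n_prime; [|lra].
suff : 0 <= b n * (e n / (1 - e n)) by lra.
apply: Rmult_le_pos => //; apply: Rdiv_le_0_compat => //; have := e_lt1 n_prime; lra.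
Qed.

(* The multiples of [k] contribute [D <= e k * (D + b k * T)], [T] being the sum over the
   integers prime to [k]. *)
Lemma rsum_rough_term_le N k :
  \rsum_(0 <= m < N) rough_term k m <= euler_factor k * \rsum_(0 <= m < N) rough_term k.+1 m.
Proof.
rewrite /euler_factor; case: ifP => k_prime; last first.
  rewrite Rmult_1_l; apply: rsum_nat_le => m _; rewrite /rough_term.
  by case m_gt0: (0 < m)%N => //=; [rewrite roughS // k_prime /= andbT; lra | lra].
have k_gt0 := prime_gt0 k_prime.
set T := \rsum_(0 <= m < N) rough_term k.+1 m.
set D := \rsum_(0 <= m < N) (if (k %| m)%N then rough_term k m else 0).
have -> : \rsum_(0 <= m < N) rough_term k m = T + D.
  rewrite /T /D -big_split; apply: eq_bigr => m _ /=; rewrite /rough_term.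
  case m_gt0: (0 < m)%N => /=; last by case: ifP => _; rewrite Rplus_0_l.
  rewrite roughS // k_prime /=; case: (rough k m); case: (k %| m)%N => /=; lra.
have D_le : D <= e k * (D + b k * T).
  have -> : e k * (D + b k * T) = \rsum_(0 <= m < N) rough_term k (k * m)%N.
    rewrite /D /T big_distrr -big_split big_distrr; apply: eq_bigr => m _ /=; rewrite /rough_term.
    rewrite muln_gt0 k_gt0 /=; case m_gt0: (0 < m)%N => /=; last by case: ifP; lra.
    rewrite roughS // rough_primeM // k_prime /= prime_weight_primeM // eM //.
    by case: (rough k m); case: (k %| m)%N => /=; lra.
  rewrite -rsum_multiples //; apply: rsum_widen_le => //; last by nia.
  by move=> i; case: ifP => _; [apply: rough_term_ge0|lra].
have ek_lt1 := e_lt1 k_prime.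
suff : D <= b k * (e k / (1 - e k)) * T by lra.
have -> : b k * (e k / (1 - e k)) * T = b k * e k * T / (1 - e k) by field; lra.
by apply: Rle_div_intro; [lra | nra].
Qed.

Lemma rsum_le_euler_prod N :
  \rsum_(1 <= m < N) (prime_weight b m * e m) <= \rprod_(0 <= n < N) euler_factor n.
Proof.
have prod_ge0 k : 0 <= \rprod_(0 <= n < k) euler_factor n.
  by apply: rprod_ge0 => i _; have := euler_factor_ge1 i; lra.
case: N => [|[|N]]; [by rewrite [X in X <= _]big_geq //; exact: prod_ge0 .. |].
have sieved k : \rsum_(0 <= m < N.+2) rough_term 0 m <=
    (\rprod_(0 <= n < k) euler_factor n) * \rsum_(0 <= m < N.+2) rough_term k m.
  elim: k => [|k IH]; first by rewrite [X in X * _]big_geq //; lra.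
  apply: Rle_trans IH _; rewrite [X in _ <= X * _]big_nat_recr //= Rmult_assoc.
  by apply: Rmult_le_compat_l; last exact: rsum_rough_term_le.
have all_rough : \rsum_(0 <= m < N.+2) rough_term 0 m =
    \rsum_(1 <= m < N.+2) (prime_weight b m * e m).
  rewrite big_ltn // /rough_term /= Rplus_0_l; apply: eq_big_seq => m.
  by rewrite mem_index_iota => /andP [-> _]; rewrite rough0.
have only_one : \rsum_(0 <= m < N.+2) rough_term N.+2 m = 1.
  rewrite big_ltn // big_ltn // [rough_term _ 0]/rough_term [rough_term _ 1]/rough_term /=.
  rewrite prime_weight1 e1 big1_seq; first by lra.
  move=> m; rewrite mem_index_iota => /andP [_ /andP [m_gt1 m_lt]]; rewrite /rough_term.
  by case: ifP => // /andP [m_gt0 m_rough]; have := rough_lt_eq1 m_gt0 m_lt m_rough; lia.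
by have := sieved N.+2; rewrite all_rough only_one Rmult_1_r.
Qed.

End EulerUpperBound.

Section ComplexEulerProduct.
Variables (b : nat -> R) (e : nat -> C).
Hypothesis e1 : e 1%N = RtoC 1.
Hypothesis eM : forall p m, prime p -> (0 < m)%N -> e (p * m)%N = (e p * e m)%C.
Hypothesis e_lt1 : forall p, prime p -> Cmod (e p) < 1.

Definition Ceuler_factor (n : nat) : C :=
  if prime n then (1 + RtoC (b n) * (e n / (1 - e n)))%C else RtoC 1.

Definition rough_Cterm k m : C :=
  if (0 < m)%N && rough k m then (RtoC (prime_weight b m) * e m)%C else RtoC 0.

Hypothesis summable : Csummable (rough_Cterm 0).

Lemma Cmod_rough_Cterm_le k m : Cmod (rough_Cterm k m) <= Cmod (rough_Cterm 0 m).
Proof.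
rewrite /rough_Cterm rough0 andbT; case m_gt0: (0 < m)%N => /=; last by lra.
by case: ifP => _; [lra | rewrite Cmod_0; exact: Cmod_ge_0].
Qed.

Lemma rough_Cterm_summable k : Csummable (rough_Cterm k).
Proof. by apply: Csummable_le summable => n; apply: Cmod_rough_Cterm_le. Qed.

Lemma one_sub_neq0 k : prime k -> (1 - e k)%C <> RtoC 0.
Proof.
move=> k_prime sub0; have ek1 : e k = RtoC 1 by rewrite -[e k]Cplus_0_r -sub0; ring.
by have := e_lt1 k_prime; rewrite ek1 Cmod_1; lra.
Qed.

Lemma CSeries_rough_step k :
  CSeries (rough_Cterm k) = (Ceuler_factor k * CSeries (rough_Cterm k.+1))%C.
Proof.
rewrite /Ceuler_factor; case: ifP => k_prime; last first.
  rewrite Cmult_1_l; apply: CSeries_ext => m; rewrite /rough_Cterm.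
  by case m_gt0: (0 < m)%N => //=; rewrite roughS // k_prime /= andbT.
have k_gt0 := prime_gt0 k_prime.
set T := CSeries (rough_Cterm k.+1).
set d := fun m => if (k %| m)%N then rough_Cterm k m else RtoC 0.
have sum_d : Csummable d.
  apply: Csummable_le (rough_Cterm_summable k) => n; rewrite /d; case: ifP => _; first by lra.
  by rewrite Cmod_0; exact: Cmod_ge_0.
set D := CSeries d.
have -> : CSeries (rough_Cterm k) = (T + D)%C.
  rewrite /T /D -CSeries_plus //; last exact: rough_Cterm_summable.
  apply: CSeries_ext => m; rewrite /d /rough_Cterm.
  case m_gt0: (0 < m)%N => /=; last by case: ifP => _; rewrite Cplus_0_l.
  by rewrite roughS // k_prime /=; case: (rough k m); case: (k %| m)%N => /=; ring.
have D_eq : D = (e k * (D + RtoC (b k) * T))%C.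
  rewrite {1}/D CSeries_multiples //; last exact: rough_Cterm_summable.
  have sum_bT := Csummable_scal (RtoC (b k)) (rough_Cterm_summable k.+1).
  rewrite /T -(CSeries_scal (RtoC (b k)) (rough_Cterm_summable k.+1)) /D.
  rewrite -(CSeries_plus sum_d sum_bT) -CSeries_scal; last exact: Csummable_plus.
  apply: CSeries_ext => m; rewrite /d /rough_Cterm muln_gt0 k_gt0 /=.
  case m_gt0: (0 < m)%N => /=; last by case: ifP => _; ring.
  rewrite roughS // rough_primeM // k_prime /= prime_weight_primeM // eM //.
  by case: (rough k m); case: (k %| m)%N => /=; rewrite ?RtoC_mult; ring.
have ek_neq1 := one_sub_neq0 k_prime.
have D_mul : (D * (1 - e k) = RtoC (b k) * e k * T)%C.
  by rewrite Cmult_comm [in LHS]/Cminus Cmult_plus_distr_r {1}D_eq; ring.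
have -> : D = (D * (1 - e k) / (1 - e k))%C by field.
by rewrite D_mul; field.
Qed.

Lemma CSeries_rough_prod k :
  CSeries (rough_Cterm 0) = ((\cprod_(0 <= n < k) Ceuler_factor n) * CSeries (rough_Cterm k))%C.
Proof.
elim: k => [|k IH]; first by rewrite big_geq // Cmult_1_l.
by rewrite big_nat_recr //= IH CSeries_rough_step; ring.
Qed.

Lemma CSeries_rough_lim : Clim (fun k => CSeries (rough_Cterm k)) (RtoC 1).
Proof.
pose M n := Cmod (rough_Cterm 0 n).
pose tail k := Series M - \rsum_(0 <= i < k) M i.
apply: (@is_lim_seq_squeeze0 _ (fun k => 2 * tail k)).
  exists 2%N => -[|[|k]] // _; split; first exact: Cmod_ge_0.
  have partial1 (pr : C -> R) : pr (RtoC 0) = 0 ->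
      \rsum_(0 <= i < k.+2) pr (rough_Cterm k.+2 i) = pr (RtoC 1).
    move=> pr0; rewrite big_ltn // big_ltn // big1_seq => [|m]; last first.
      rewrite mem_index_iota => /andP [_ /andP [m_gt1 m_lt]]; rewrite /rough_Cterm.
      by case: ifP => // /andP [m_gt0 /(rough_lt_eq1 m_gt0 m_lt)]; lia.
    rewrite {1 2}/rough_Cterm /= pr0 prime_weight1 e1 Cmult_1_l; lra.
  have := Cmod_CSeries_sub_le k.+2 (Cmod_rough_Cterm_le k.+2) summable.
  by rewrite (partial1 fst) // (partial1 snd).
have -> : 0 = 2 * (Series M - Series M) by ring.
apply: is_lim_seq_mult'; first exact: is_lim_seq_const.
by apply: is_lim_seq_minus'; [exact: is_lim_seq_const | exact: is_lim_seq_rsum].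
Qed.

Lemma Ceuler_product :
  Clim (fun k => \cprod_(0 <= n < k) Ceuler_factor n) (CSeries (rough_Cterm 0)).
Proof.
set S0 := CSeries (rough_Cterm 0); pose s k := CSeries (rough_Cterm k).
apply: (@is_lim_seq_squeeze0 _ (fun k => 2 * Cmod S0 * Cmod (s k - 1)%C)); last first.
  have -> : 0 = 2 * Cmod S0 * 0 by ring.
  by apply: is_lim_seq_mult' CSeries_rough_lim; exact: is_lim_seq_const.
have half_gt0 : 0 < 1 / 2 by lra.
have /is_lim_seq_spec /(_ (mkposreal _ half_gt0)) [K near] := CSeries_rough_lim.
exists K => k K_le_k; split; first exact: Cmod_ge_0.
set P := \cprod_(0 <= n < k) _; have S0E : S0 = (P * s k)%C by apply: CSeries_rough_prod.
have s_near : Cmod (s k - 1)%C < 1 / 2.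
  by have := near k ltac:(lia); rewrite /= Rminus_0_r Rabs_pos_eq //; exact: Cmod_ge_0.
have s_ge : 1 / 2 <= Cmod (s k).
  have := Cmod_triangle (s k) (- (s k - 1))%C; rewrite Cmod_opp.
  have -> : (s k + - (s k - 1) = RtoC 1)%C by ring.
  rewrite Cmod_1; lra.
have -> : (P - S0 = P * - (s k - 1))%C by rewrite S0E; ring.
rewrite Cmod_mult Cmod_opp; apply: Rmult_le_compat_r; first exact: Cmod_ge_0.
by rewrite S0E Cmod_mult; have := Cmod_ge_0 P; nra.
Qed.

End ComplexEulerProduct.

Section RealEulerProduct.
Variables (b e : nat -> R).
Hypothesis e_ge0 : forall m, 0 <= e m.
Hypothesis e1 : e 1%N = 1.
Hypothesis eM : forall p m, prime p -> (0 < m)%N -> e (p * m)%N = e p * e m.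
Hypothesis e_lt1 : forall p, prime p -> e p < 1.
Let term m := if (0 < m)%N then prime_weight b m * e m else 0.
Hypothesis summable : ex_series (fun m => Rabs (term m)).

Lemma euler_product : is_lim_seq (fun k => \rprod_(0 <= n < k) euler_factor b e n) (Series term).
Proof.
pose ec m := RtoC (e m).
have termE m : rough_Cterm b ec 0 m = RtoC (term m).
  by rewrite /rough_Cterm rough0 andbT /term /ec; case: ifP => _ //; rewrite RtoC_mult.
have sum_ec : Csummable (rough_Cterm b ec 0).
  by apply: ex_series_ext summable => m; rewrite termE Cmod_R.
have lim_prod : Clim (fun k => \cprod_(0 <= n < k) Ceuler_factor b ec n) (CSeries (rough_Cterm b ec 0)).
  apply: Ceuler_product sum_ec => [|p m p_prime m_gt0|p p_prime]; first by rewrite /ec e1.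
    by rewrite /ec eM // RtoC_mult.
  by rewrite /ec Cmod_R Rabs_pos_eq //; exact: e_lt1.
have -> : Series term = fst (CSeries (rough_Cterm b ec 0)).
  by rewrite /CSeries /=; apply: Series_ext => m; rewrite termE.
apply: is_lim_seq_ext (Clim_fst lim_prod) => k.
suff -> : \cprod_(0 <= n < k) Ceuler_factor b ec n = RtoC (\rprod_(0 <= n < k) euler_factor b e n) by [].
rewrite RtoC_rprod; apply: eq_bigr => n _.
rewrite /Ceuler_factor /euler_factor /ec; case: ifP => // n_prime; have en_lt1 := e_lt1 n_prime.
by rewrite RtoC_plus RtoC_mult RtoC_div ?RtoC_minus //; lra.
Qed.

End RealEulerProduct.

(** * Chebyshev and Mertens estimates *)

Lemma INR_prime_ge2 p : prime p -> 2 <= INR p.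
Proof. by move=> /prime_gt1; exact: INR_ge2. Qed.

Lemma ln_prime_gt0 p : prime p -> 0 < ln (INR p).
Proof. by move=> /INR_prime_ge2 p_ge2; apply: ln_gt0; lra. Qed.

Lemma subadditive_le_logn (f : nat -> R) m N : f 1%N <= 0 ->
  (forall p k, prime p -> (0 < k)%N -> f (p * k)%N <= f p + f k) -> (0 < m)%N -> (m < N)%N ->
  f m <= \rsum_(0 <= p < N | prime p) (INR (logn p m) * f p).
Proof.
move=> f1 f_sub; elim/ltn_ind: m => m IH m_gt0 m_lt_N.
case: (ltngtP m 1) => m_cases; [lia| |]; last first.
  by rewrite m_cases big1 // => p _; rewrite logn1 INR_0 Rmult_0_l.
set q := pdiv m; have q_prime : prime q by apply: pdiv_prime.
have q_gt1 := prime_gt1 q_prime; have q_le_m : (q <= m)%N by apply: pdiv_leq.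
have mE : (m = q * (m %/ q))%N by rewrite mulnC divnK // pdiv_dvd.
set k := (m %/ q)%N in mE; have k_lt_m : (k < m)%N by apply: ltn_Pdiv.
have k_gt0 : (0 < k)%N by rewrite lt0n; apply/eqP => k0; move: mE m_gt0; rewrite k0 muln0; lia.
rewrite [in X in X <= _]mE; apply: Rle_trans (f_sub _ _ q_prime k_gt0) _.
apply: Rle_trans (Rplus_le_compat_l _ _ _ (IH k k_lt_m k_gt0 ltac:(lia))) _.
have -> : f q = \rsum_(0 <= p < N | prime p) (INR (p == q) * f p).
  rewrite big_mkcond (bigD1_seq q) /= ?iota_uniq //; last by rewrite mem_index_iota; lia.
  rewrite q_prime eqxx big1; first by rewrite Rmult_1_l Rplus_0_r.
  by move=> p /negbTE ->; case: ifP => _ //; rewrite (_ : INR false = 0) // Rmult_0_l.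
rewrite -big_split; right; apply: eq_bigr => p p_prime /=.
by rewrite [in RHS]mE lognM ?(prime_gt0 q_prime) // (@logn_prime p q) // INR_addn Rmult_plus_distr_r.
Qed.

Lemma ln_INR_logn m N : (0 < m)%N -> (m < N)%N ->
  ln (INR m) = \rsum_(0 <= p < N | prime p) (INR (logn p m) * ln (INR p)).
Proof.
move=> m_gt0 m_lt_N.
have lnM p k : prime p -> (0 < k)%N -> ln (INR (p * k)) = ln (INR p) + ln (INR k).
  move=> p_prime k_gt0; rewrite INR_muln ln_mult //; first exact: INR_gt0 (prime_gt0 p_prime).
  exact: INR_gt0.
apply: Rle_antisym.
  apply: (@subadditive_le_logn (fun n => ln (INR n))) => //; first by rewrite INR_1 ln_1; lra.
  by move=> p k p_prime k_gt0; rewrite lnM //; lra.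
suff : - ln (INR m) <= - \rsum_(0 <= p < N | prime p) (INR (logn p m) * ln (INR p)) by lra.
rewrite (big_morph Ropp Ropp_plus_distr Ropp_0).
under eq_bigr => p _ do rewrite Ropp_mult_distr_r.
apply: (@subadditive_le_logn (fun n => - ln (INR n))) => //; first by rewrite INR_1 ln_1; lra.
by move=> p k p_prime k_gt0; rewrite lnM //; lra.
Qed.

Definition chebyshev_theta n := \rsum_(0 <= p < n.+1 | prime p) ln (INR p).

Lemma bin_le_exp2 n m : ('C(n, m) <= 2 ^ n)%N.
Proof.
elim: n m => [|n IH] [|m] //; first by rewrite bin0 expn_gt0.
by rewrite binS expnS mul2n -addnn leq_add.
Qed.

Lemma prime_ndvd_fact p n : prime p -> (n < p)%N -> ~~ (p %| n`!)%N.
Proof.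
move=> p_prime; elim: n => [|n IH] n_lt_p; first by rewrite dvdn1; have := prime_gt1 p_prime; lia.
by rewrite factS Euclid_dvdM // negb_or gtnNdvd //=; apply: IH; lia.
Qed.

Lemma prime_dvd_central_bin p n : prime p -> (n < p <= 2 * n)%N -> (p %| 'C(2 * n, n))%N.
Proof.
move=> p_prime /andP [n_lt_p p_le].
have p_dvd : (p %| (2 * n)`!)%N by apply: dvdn_fact; have := prime_gt0 p_prime; lia.
have p_ndvd : ~~ (p %| n`!)%N by apply: prime_ndvd_fact.
move: p_dvd; rewrite -(bin_fact (m := n) (n := 2 * n)); last by lia.
rewrite Euclid_dvdM // Euclid_dvdM //.
by rewrite (_ : 2 * n - n = n)%N ?(negbTE p_ndvd) ?orbF //; lia.
Qed.

Lemma chebyshev_theta_double n : (0 < n)%N ->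
  chebyshev_theta (2 * n) <= chebyshev_theta n + INR (2 * n) * ln 2.
Proof.
move=> n_gt0; set B := 'C(2 * n, n).
have B_gt0 : (0 < B)%N by rewrite bin_gt0; lia.
have lnB_le : ln (INR B) <= INR (2 * n) * ln 2.
  rewrite -ln_pow; last lra.
  apply: ln_le; first exact: INR_gt0.
  by have := leq_INR (bin_le_exp2 (2 * n) n); rewrite INR_expn INR_2.
apply: Rle_trans (Rplus_le_compat_l _ _ _ lnB_le).
set N := (maxn B.+1 (2 * n).+1).
pose lnB_term p := if prime p then INR (logn p B) * ln (INR p) else 0.
have lnB_term_ge0 p : 0 <= lnB_term p.
  rewrite /lnB_term; case: ifP => _; last lra.
  by apply: Rmult_le_pos; [exact: pos_INR | exact: ln_INR_ge0].
have -> : ln (INR B) = \rsum_(0 <= p < N) lnB_term p.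
  by rewrite (@ln_INR_logn B N) // ?big_mkcond // /N; lia.
have widen := @rsum_widen_le 0 N lnB_term n.+1 (2 * n).+1 lnB_term_ge0 isT ltac:(rewrite /N; lia).
apply: Rle_trans (Rplus_le_compat_l _ _ _ widen).
rewrite /chebyshev_theta !(big_mkcond (fun p => prime p)) /=.
rewrite (@big_cat_nat _ _ _ n.+1 0 (2 * n).+1) //=; last by lia.
apply: Rplus_le_compat_l; apply: rsum_nat_le => p p_range; rewrite /lnB_term.
case: ifP => p_prime; [|lra].
have : (1 <= logn p B)%N by rewrite logn_gt0 mem_primes p_prime B_gt0 prime_dvd_central_bin.
by move/leq_INR; rewrite INR_1; have := ln_prime_gt0 p_prime; nra.
Qed.

Lemma chebyshev_theta_le n : chebyshev_theta n <= 4 * INR n.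
Proof.
have [_ ln2_lt1] := ln2_bounds.
elim/ltn_ind: n => n IH.
case: n IH => [|[|n]] IH.
- by rewrite /chebyshev_theta big_mkcond big_nat1 INR_0 /=; lra.
- by rewrite /chebyshev_theta big_mkcond big_ltn // big_nat1 INR_1 /=; lra.
set m := uphalf n.+2; have m_gt0 : (0 < m)%N by [].
have widen : chebyshev_theta n.+2 <= chebyshev_theta (2 * m).
  rewrite /chebyshev_theta !(big_mkcond (fun p => prime p)) /=.
  apply: rsum_widen_le => //; last by rewrite /m; lia.
  by move=> i; case: ifP => _; [exact: ln_INR_ge0 | lra].
have := chebyshev_theta_double m_gt0; have := IH m ltac:(rewrite /m; lia).
have : INR (6 * m) <= INR (4 * n.+2) by apply: leq_INR; rewrite /m; lia.
rewrite !INR_muln INR_2 [INR 6]INR_IZR_INZ [INR 4]INR_IZR_INZ /=.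
have := pos_INR m; nra.
Qed.

Definition mertens_sum n := \rsum_(0 <= p < n.+1 | prime p) (ln (INR p) / INR p).

Lemma ln_factS n : ln (INR (n.+1)`!) = ln (INR n.+1) + ln (INR n`!).
Proof.
by rewrite factS INR_muln ln_mult //; [exact: INR_gt0 | apply: INR_gt0; exact: fact_gt0].
Qed.

Lemma ln_fact_le n : (0 < n)%N -> ln (INR n`!) <= INR n * ln (INR n).
Proof.
elim: n => [//|[|n] IH] _; first by rewrite INR_1 ln_1; lra.
have ln_mono : ln (INR n.+1) <= ln (INR n.+2).
  by apply: ln_le; [exact: INR_gt0 | apply: leq_INR].
by rewrite ln_factS [X in _ <= X * _]S_INR; have := IH isT; have := pos_INR n.+1; nra.
Qed.

Lemma ln_fact_ge n : (0 < n)%N -> INR n * ln (INR n) - INR n <= ln (INR n`!).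
Proof.
elim: n => [//|[|n] IH] _; first by rewrite INR_1 ln_1; lra.
have [_ dln_le] := @ln_succ_sub_bounds n.+1 isT; have n_pos := INR_gt0 (ltn0Sn n).
have dln_mul_le1 : INR n.+1 * (ln (INR n.+2) - ln (INR n.+1)) <= 1.
  apply: Rle_trans (Rmult_le_compat_l _ _ _ (Rlt_le _ _ n_pos) dln_le) _.
  by rewrite Rinv_r; lra.
by rewrite ln_factS [X in X * _ - _](S_INR n.+1) [X in _ - X](S_INR n.+1); have := IH isT; nra.
Qed.

Lemma ln_fact_primes n : ln (INR n`!) =
  \rsum_(0 <= p < n.+1 | prime p) (INR (logn p n`!) * ln (INR p)).
Proof.
have fact_pos := fact_gt0 n.
rewrite (@ln_INR_logn n`! (maxn n`! n).+1) //; last by lia.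
rewrite big_mkcond [RHS]big_mkcond (@big_cat_nat _ _ _ n.+1 0) //=; last by lia.
rewrite [X in _ + X]big1_seq ?Rplus_0_r // => p.
rewrite mem_index_iota => /andP [_ /andP [n_lt_p _]].
case: ifP => // p_prime; have p_ndvd := prime_ndvd_fact p_prime n_lt_p.
by rewrite lognE (negbTE p_ndvd) !andbF INR_0 Rmult_0_l.
Qed.

Lemma logn_fact_le p n : prime p -> INR (logn p n`!) <= INR n / (INR p - 1).
Proof.
move=> p_prime; have p_ge2 := INR_prime_ge2 p_prime; rewrite logn_fact //.
have partial m : INR (\sum_(1 <= k < m.+1) n %/ p ^ k)%N <= INR n / (INR p - 1) * (1 - / INR p ^ m).
  elim: m => [|m IH]; first by rewrite big_geq // INR_0 pow_O; right; field; lra.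
  rewrite big_nat_recr //= INR_addn.
  have pm_gt0 : 0 < INR p ^ m by apply: pow_lt; lra.
  have := @INR_divn_le n (p ^ m.+1) ltac:(by rewrite expn_gt0 prime_gt0).
  rewrite INR_expn -tech_pow_Rmult => quot_le.
  apply: Rle_trans (Rplus_le_compat _ _ _ _ IH quot_le) _.
  by right; field; lra.
apply: Rle_trans (partial n) _.
rewrite -[X in _ <= X]Rmult_1_r; apply: Rmult_le_compat_l.
  by apply: Rdiv_le_0_compat; [exact: pos_INR | lra].
suff : 0 < / INR p ^ n by lra.
by apply: Rinv_0_lt_compat; apply: pow_lt; lra.
Qed.

Lemma logn_fact_ge p n : prime p -> (0 < n)%N -> INR n / INR p - 1 <= INR (logn p n`!).
Proof.
move=> p_prime n_gt0; apply: Rle_trans (INR_divn_ge n (prime_gt0 p_prime)) _.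
apply: leq_INR; rewrite logn_fact // big_ltn // expn1; exact: leq_addr.
Qed.

Lemma mertens_upper n : (0 < n)%N -> mertens_sum n <= ln (INR n) + 4.
Proof.
move=> n_gt0; have n_pos := INR_gt0 n_gt0.
have : INR n * mertens_sum n - chebyshev_theta n <= INR n * ln (INR n).
  apply: Rle_trans (ln_fact_le n_gt0); rewrite ln_fact_primes /mertens_sum /chebyshev_theta.
  rewrite big_distrr rsumB; apply: rsum_le => p _ p_prime /=.
  by have := logn_fact_ge p_prime n_gt0; have := ln_prime_gt0 p_prime; rewrite /Rdiv; nra.
have := chebyshev_theta_le n; nra.
Qed.

Lemma inv_pow32_le_telescope x : 2 <= x -> / (x * sqrt x) <= 2 / sqrt (x - 1) - 2 / sqrt x.
Proof.
move=> x_ge2.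
have s_gt0 : 0 < sqrt (x - 1) by apply: sqrt_lt_R0; lra.
have t_gt0 : 0 < sqrt x by apply: sqrt_lt_R0; lra.
have ssE := sqrt_sqrt (x - 1) ltac:(lra); have ttE := sqrt_sqrt x ltac:(lra).
have st : sqrt (x - 1) <= sqrt x by apply: sqrt_le_1_alt; lra.
rewrite -{1}ttE; set s := sqrt (x - 1) in s_gt0 ssE st *; set t := sqrt x in t_gt0 ttE st *.
have -> : 2 / s - 2 / t = 2 * ((t - s) * (t + s)) / (s * t * (t + s)) by field; lra.
have -> : (t - s) * (t + s) = 1 by lra.
rewrite Rmult_1_r -[/ _]Rmult_1_l.
have den_gt0 : 0 < s * t * (t + s) by apply: Rmult_lt_0_compat; nra.
have den_le : s * t * (t + s) <= t * t * (2 * t) by apply: Rmult_le_compat; nra.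
apply: Rle_div_intro => //; rewrite Rmult_comm Rmult_1_l; apply: Rdiv_le_intro => //; lra.
Qed.

Lemma rsum_inv_pow32_le N : \rsum_(2 <= n < N) / (INR n * sqrt (INR n)) <= 2.
Proof.
case: (leqP N 2) => N_cases; first by rewrite big_geq //; lra.
pose F n := - (2 / sqrt (INR n - 1)).
apply: (@Rle_trans _ (\rsum_(2 <= n < N) (F n.+1 - F n))).
  apply: rsum_nat_le => n /andP [n_gt1 _].
  have := inv_pow32_le_telescope (INR_ge2 n_gt1).
  rewrite /F S_INR; have -> : INR n + 1 - 1 = INR n by ring.
  lra.
rewrite rsum_telescope; last lia.
have -> : F 2%N = - 2 by rewrite /F INR_2 (_ : 2 - 1 = 1) ?sqrt_1; [field | ring].
suff : 0 < 2 / sqrt (INR N - 1) by rewrite /F; lra.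
apply: Rdiv_lt_0_compat; first lra.
by apply: sqrt_lt_R0; have := ltn_INR N_cases; rewrite INR_2; lra.
Qed.

Lemma rsum_ln_over_sq_le N : \rsum_(2 <= k < N) (ln (INR k) / (INR k * (INR k - 1))) <= 8.
Proof.
apply: (@Rle_trans _ (4 * \rsum_(2 <= k < N) / (INR k * sqrt (INR k)))); last first.
  by have := rsum_inv_pow32_le N; lra.
rewrite big_distrr; apply: rsum_nat_le => k /andP [k_gt1 _] /=.
have k_ge2 := INR_ge2 k_gt1; have lnk_le := @ln_le_2sqrt (INR k) ltac:(lra).
have s_gt0 : 0 < sqrt (INR k) by apply: sqrt_lt_R0; lra.
have ssE := sqrt_sqrt (INR k) ltac:(lra).
apply: Rdiv_le_intro; first by nra.
have -> : 4 * / (INR k * sqrt (INR k)) * (INR k * (INR k - 1)) = 4 * (INR k - 1) / sqrt (INR k).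
  by field; lra.
apply: Rle_trans lnk_le _; apply: Rle_div_intro => //; rewrite Rmult_assoc ssE; lra.
Qed.

Lemma mertens_lower n : (0 < n)%N -> ln (INR n) - 9 <= mertens_sum n.
Proof.
move=> n_gt0; have n_pos := INR_gt0 n_gt0.
pose excess k := ln (INR k) / (INR k * (INR k - 1)).
suff : INR n * ln (INR n) - INR n <= INR n * (mertens_sum n + 8) by nra.
apply: Rle_trans (ln_fact_ge n_gt0) _; rewrite ln_fact_primes.
apply: (@Rle_trans _ (INR n * (mertens_sum n + \rsum_(0 <= k < n.+1 | prime k) excess k))).
  rewrite /mertens_sum -big_split big_distrr; apply: rsum_le => p _ p_prime /=.
  have lnp_gt0 := ln_prime_gt0 p_prime; have p_ge2 := INR_prime_ge2 p_prime.
  apply: Rle_trans (Rmult_le_compat_r _ _ _ (Rlt_le _ _ lnp_gt0) (logn_fact_le n p_prime)) _.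
  by right; rewrite /excess; field; lra.
apply: Rmult_le_compat_l; first lra.
apply: Rplus_le_compat_l; apply: Rle_trans (rsum_ln_over_sq_le n.+1); rewrite big_mkcond.
case: n n_gt0 {n_pos} => [//|n] _; rewrite big_ltn // big_ltn //= !Rplus_0_l.
apply: rsum_nat_le => k /andP [k_gt1 _]; case: ifP => _; first by rewrite /excess; lra.
have k_ge2 := INR_ge2 k_gt1; apply: Rdiv_le_0_compat; first exact: ln_INR_ge0.
nra.
Qed.

(** * Sums over primes of 1 / (p ln p) *)

Lemma abel_summation_error (E f : nat -> R) (B : R) (m w : nat) : (m <= w)%N ->
  (forall n, (m <= n)%N -> Rabs (E n) <= B) ->
  (forall n, (m <= n)%N -> 0 <= f n.+1 <= f n) ->
  f w <= f m /\
  Rabs (\rsum_(m <= i < w) ((E i.+1 - E i) * f i.+1) - E w * f w + E m * f m) <= B * (f m - f w).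
Proof.
move=> mw E_le f_anti.
have base : f m <= f m /\
    Rabs (\rsum_(m <= i < m) ((E i.+1 - E i) * f i.+1) - E m * f m + E m * f m) <= B * (f m - f m).
  by rewrite big_geq //; split; [lra|]; rewrite (_ : _ + _ = 0) ?Rabs_R0; nra.
elim: w mw => [|w IH] mw; first by have m0 : m = 0%N by [lia]; rewrite m0 in base *.
case: (ltngtP m w.+1) => m_cases; [|lia|by rewrite -m_cases].
have [fw_le err_le] := IH ltac:(lia); have [fSw_ge0 fSw_le] := f_anti w ltac:(lia).
split; first lra.
rewrite big_nat_recr //=; set S := \rsum_(m <= i < w) _ in err_le *.
have -> : S + (E w.+1 - E w) * f w.+1 - E w.+1 * f w.+1 + E m * f m
   = (S - E w * f w + E m * f m) + E w * (f w - f w.+1) by ring.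
apply: Rle_trans (Rabs_triang _ _) _; rewrite Rabs_mult (Rabs_pos_eq (f w - _)); last lra.
have := E_le w ltac:(lia); nra.
Qed.

Lemma abel_summation_bound (E f : nat -> R) (B : R) (m w : nat) : (m <= w)%N -> 0 <= f w ->
  (forall n, (m <= n)%N -> Rabs (E n) <= B) ->
  (forall n, (m <= n)%N -> 0 <= f n.+1 <= f n) ->
  Rabs (\rsum_(m <= i < w) ((E i.+1 - E i) * f i.+1)) <= 2 * B * f m.
Proof.
move=> mw fw_ge0 E_le f_anti; have [fw_le err_le] := abel_summation_error mw E_le f_anti.
have Ef_le n : (m <= n)%N -> 0 <= f n -> Rabs (E n * f n) <= B * f n.
  move=> mn fn_ge0; rewrite Rabs_mult (Rabs_pos_eq (f n)) //.
  by apply: Rmult_le_compat_r => //; apply: E_le.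
have Efw := Ef_le w mw fw_ge0; have Efm := Ef_le m (leqnn m) ltac:(lra).
set S := \rsum_(m <= i < w) _ in err_le *.
move: err_le Efw Efm => /Rabs_le_between err_le /Rabs_le_between Efw /Rabs_le_between Efm.
apply: Rabs_le; lra.
Qed.

Lemma rsum_inv_sq_le y w : (1 < y)%N -> \rsum_(y <= i < w) (/ INR i * / INR i) <= 1.
Proof.
move=> y_gt1; case: (leqP w y) => w_cases; first by rewrite big_geq //; lra.
pose F i := - / (INR i - 1).
apply: (@Rle_trans _ (\rsum_(y <= i < w) (F i.+1 - F i))).
  apply: rsum_nat_le => i /andP [y_le_i _]; have : 2 <= INR i by apply: INR_ge2; lia.
  rewrite /F S_INR; set x := INR i => x_ge2.
  have -> : - / (x + 1 - 1) - - / (x - 1) = / x * / (x - 1) by field; lra.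
  apply: Rmult_le_compat_l; first by left; apply: Rinv_0_lt_compat; lra.
  by apply: Rinv_le_contravar; lra.
rewrite rsum_telescope; last by lia.
have y_ge2 : 2 <= INR y by apply: INR_ge2.
have w_ge2 : 2 <= INR w by apply: INR_ge2; lia.
have : 0 < / (INR w - 1) by apply: Rinv_0_lt_compat; lra.
have : / (INR y - 1) <= / 1 by apply: Rinv_le_contravar; lra.
rewrite /F Rinv_1; lra.
Qed.

Definition inv_sq_ln (n : nat) := / ln (INR n) ^ 2.

Lemma ln_INR_ge_half n : (1 < n)%N -> 1 / 2 < ln (INR n).
Proof. by move=> n_gt1; apply: ln_ge_half; exact: INR_ge2. Qed.

Lemma inv_sq_ln_anti m n : (1 < m)%N -> (m <= n)%N -> 0 <= inv_sq_ln n <= inv_sq_ln m.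
Proof.
move=> m_gt1 mn; have lnm_gt := ln_INR_ge_half m_gt1; have lnn_gt := @ln_INR_ge_half n ltac:(lia).
rewrite /inv_sq_ln; split; first by left; apply: Rinv_0_lt_compat; apply: pow_lt; lra.
apply: Rinv_le_contravar; first by apply: pow_lt; lra.
apply: pow_incr; split; first lra.
by apply: ln_le; [apply: INR_gt0; lia | exact: leq_INR].
Qed.

Lemma rsum_dln_inv_sq_ln y w : (1 < y)%N -> (y <= w)%N ->
  Rabs (\rsum_(y <= i < w) ((ln (INR i.+1) - ln (INR i)) * inv_sq_ln i.+1)
        - (/ ln (INR y) - / ln (INR w))) <= 2 * inv_sq_ln y.
Proof.
move=> y_gt1 yw.
pose dln i := ln (INR i.+1) - ln (INR i).
pose r i := dln i * dln i * (/ ln (INR i) * inv_sq_ln i.+1).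
have r_bounds i : (y <= i < w)%N -> 0 <= r i <= 2 * inv_sq_ln y * (/ INR i * / INR i).
  move=> /andP [y_le_i _]; have lni_gt := @ln_INR_ge_half i ltac:(lia).
  have [dln_ge0 dln_le] := @ln_succ_sub_bounds i ltac:(lia).
  have [f_ge0 f_le] := @inv_sq_ln_anti y i.+1 y_gt1 ltac:(lia).
  have invln_gt0 : 0 < / ln (INR i) by apply: Rinv_0_lt_compat; lra.
  have invln_le2 : / ln (INR i) <= 2.
    by rewrite -[2]Rinv_inv; apply: Rinv_le_contravar; lra.
  rewrite /r; split; first by apply: Rmult_le_pos; [exact: Rle_0_sqr | apply: Rmult_le_pos; lra].
  rewrite (Rmult_comm (2 * _)); apply: Rmult_le_compat; [exact: Rle_0_sqr | | |].
  - by apply: Rmult_le_pos; lra.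
  - exact: Rmult_le_compat.
  - by apply: Rmult_le_compat; lra.
have -> : \rsum_(y <= i < w) (dln i * inv_sq_ln i.+1) - (/ ln (INR y) - / ln (INR w)) =
    - \rsum_(y <= i < w) r i.
  have -> : / ln (INR y) - / ln (INR w) = - / ln (INR w) - - / ln (INR y) by ring.
  rewrite -(rsum_telescope (fun k => - / ln (INR k)) yw) rsumB.
  rewrite (big_morph Ropp Ropp_plus_distr Ropp_0); apply: eq_big_seq => i.
  rewrite mem_index_iota => /andP [y_le_i _]; rewrite /r /inv_sq_ln /dln.
  have lni_gt := @ln_INR_ge_half i ltac:(lia); have lnSi_gt := @ln_INR_ge_half i.+1 ltac:(lia).
  by field; lra.
rewrite Rabs_Ropp Rabs_pos_eq; last by apply: rsum_nat_ge0 => i /r_bounds; lra.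
apply: (@Rle_trans _ (2 * inv_sq_ln y * \rsum_(y <= i < w) (/ INR i * / INR i))).
  by rewrite big_distrr; apply: rsum_nat_le => i /r_bounds [].
have := rsum_inv_sq_le w y_gt1; have := inv_sq_ln_anti y_gt1 (leqnn y); nra.
Qed.

Definition inv_plogp (n : nat) := if prime n then / (INR n * ln (INR n)) else 0.

Lemma inv_plogp_ge0 n : 0 <= inv_plogp n.
Proof.
rewrite /inv_plogp; case: ifP => n_prime; last lra.
have := INR_prime_ge2 n_prime; have := ln_prime_gt0 n_prime => lnn_gt0 n_ge2.
by left; apply: Rinv_0_lt_compat; nra.
Qed.

(* Partial summation with [1 / (p ln p) = (ln p / p) * inv_sq_ln p]. *)
Lemma rsum_inv_plogp_approx y w : (1 < y)%N -> (y <= w)%N ->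
  Rabs (\rsum_(y.+1 <= n < w.+1) inv_plogp n - (/ ln (INR y) - / ln (INR w)))
    <= 20 / ln (INR y) ^ 2.
Proof.
move=> y_gt1 yw.
pose E n := mertens_sum n - ln (INR n).
have E_le n : (y <= n)%N -> Rabs (E n) <= 9.
  move=> y_le_n; apply: Rabs_le; rewrite /E.
  by have := @mertens_upper n ltac:(lia); have := @mertens_lower n ltac:(lia); lra.
have f_anti n : (y <= n)%N -> 0 <= inv_sq_ln n.+1 <= inv_sq_ln n.
  by move=> y_le_n; apply: inv_sq_ln_anti; lia.
have [fw_ge0 _] := inv_sq_ln_anti y_gt1 yw.
have := abel_summation_bound yw fw_ge0 E_le f_anti; have := rsum_dln_inv_sq_ln y_gt1 yw.
have -> : \rsum_(y.+1 <= n < w.+1) inv_plogp n =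
    \rsum_(y <= i < w) ((E i.+1 - E i) * inv_sq_ln i.+1) +
    \rsum_(y <= i < w) ((ln (INR i.+1) - ln (INR i)) * inv_sq_ln i.+1).
  rewrite big_add1 /= -big_split; apply: eq_big_seq => i.
  rewrite mem_index_iota => /andP [y_le_i _] /=.
  have lnSi_gt := @ln_INR_ge_half i.+1 ltac:(lia); have Si_gt0 : 0 < INR i.+1 by apply: INR_gt0.
  have -> : E i.+1 - E i =
      (if prime i.+1 then ln (INR i.+1) / INR i.+1 else 0) - (ln (INR i.+1) - ln (INR i)).
    rewrite /E /mertens_sum (big_mkcond (fun p => prime p)) [in X in _ - (X - _)]big_mkcond /=.
    by rewrite [X in X - _ - _]big_nat_recr //=; ring.
  by rewrite /inv_plogp /inv_sq_ln; case: ifP => _; field; lra.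
rewrite -[20 / _]/(20 * inv_sq_ln y) => /Rabs_le_between smooth /Rabs_le_between error.
apply: Rabs_le; lra.
Qed.

Lemma rsum_inv_plogp_tail_le y w : (1 < y)%N ->
  \rsum_(y.+1 <= n < w) inv_plogp n <= 41 / ln (INR y).
Proof.
move=> y_gt1; have lny_gt := ln_INR_ge_half y_gt1.
case: (leqP w y.+1) => w_cases.
  by rewrite big_geq //; apply: Rdiv_le_0_compat; lra.
case: w w_cases => [//|w] w_cases.
have := @rsum_inv_plogp_approx y w y_gt1 ltac:(lia).
move/Rabs_le_between => [_ sum_le].
have : 0 < / ln (INR w).
  by apply: Rinv_0_lt_compat; have := @ln_INR_ge_half w ltac:(lia); lra.
have : 20 / ln (INR y) ^ 2 <= 40 / ln (INR y).
  have -> : 40 / ln (INR y) = 20 * (2 * ln (INR y)) / ln (INR y) ^ 2 by field; lra.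
  apply: Rmult_le_compat_r; last lra.
  by left; apply: Rinv_0_lt_compat; apply: pow_lt; lra.
rewrite /Rdiv; lra.
Qed.

Lemma rsum_inv_plogp_le N : \rsum_(0 <= n < N) inv_plogp n <= 83.
Proof.
apply: (@Rle_trans _ (\rsum_(0 <= n < N + 3) inv_plogp n)).
  by apply: rsum_widen_le => //; [exact: inv_plogp_ge0 | lia].
do 3?[rewrite big_ltn; last by lia].
rewrite {1 2 3}/inv_plogp /= INR_2.
have := @rsum_inv_plogp_tail_le 2 (N + 3) isT; rewrite INR_2 => tail_le.
have [ln2_gt ln2_lt] := ln2_bounds.
have tail_const : 41 / ln 2 <= 82 by apply: Rdiv_le_intro; lra.
have two_term : / (2 * ln 2) <= 1 by rewrite -Rinv_1; apply: Rinv_le_contravar; lra.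
lra.
Qed.

Lemma ex_series_inv_plogp : ex_series inv_plogp.
Proof. exact: (proj1 (ex_series_nneg_bounded inv_plogp_ge0 rsum_inv_plogp_le)). Qed.

(* The second term covers [p <= sqrt x], the first one [p > sqrt x]. *)
Lemma one_le_chebyshev_weight x p : 2 <= x -> 2 <= p ->
  1 <= 2 / ln x * ln p + 2 * sqrt x * (ln p / p).
Proof.
move=> x_ge2 p_ge2; have lnx_gt := ln_ge_half x_ge2; have lnp_gt := ln_ge_half p_ge2.
have s_gt0 : 0 < sqrt x by apply: sqrt_lt_R0; lra.
have large_ge0 : 0 < 2 / ln x * ln p.
  by apply: Rmult_lt_0_compat; [apply: Rdiv_lt_0_compat|]; lra.
have small_ge0 : 0 < 2 * sqrt x * (ln p / p).
  by apply: Rmult_lt_0_compat; [|apply: Rdiv_lt_0_compat]; lra.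
case: (Rle_lt_dec p (sqrt x)) => p_cases.
  suff : 1 <= 2 * sqrt x * (ln p / p) by lra.
  have -> : 2 * sqrt x * (ln p / p) = (sqrt x / p) * (2 * ln p) by field; lra.
  have : 1 <= sqrt x / p by apply: Rle_div_intro; lra.
  nra.
suff : 1 <= 2 / ln x * ln p by lra.
have : ln (sqrt x) <= ln p by apply: ln_le; lra.
have -> : 2 / ln x * ln p = (2 * ln p) / ln x by field; lra.
have := @ln_sqrt x ltac:(lra).
by move=> lnxE lnp_ge; apply: Rle_div_intro; lra.
Qed.

Lemma prime_count_le n : (1 < n)%N ->
  \rsum_(0 <= p < n.+1 | prime p) 1 <= 300 * (INR n / ln (INR n)).
Proof.
move=> n_gt1; have x_ge2 := INR_ge2 n_gt1; have lnx_gt := ln_ge_half x_ge2.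
have theta_le := chebyshev_theta_le n; have mertens_le := @mertens_upper n ltac:(lia).
have count_le : \rsum_(0 <= p < n.+1 | prime p) 1 <=
    2 / ln (INR n) * chebyshev_theta n + 2 * sqrt (INR n) * mertens_sum n.
  rewrite /chebyshev_theta /mertens_sum !big_distrr -big_split.
  apply: rsum_le => p _ p_prime /=.
  exact: one_le_chebyshev_weight x_ge2 (INR_prime_ge2 p_prime).
move: (INR n) x_ge2 lnx_gt theta_le mertens_le count_le => x x_ge2 lnx_gt theta_le mertens_le count_le.
have s_gt0 : 0 < sqrt x by apply: sqrt_lt_R0; lra.
have ssE := sqrt_sqrt x ltac:(lra).
have large_le : 2 / ln x * chebyshev_theta n <= 8 * (x / ln x).
  have -> : 8 * (x / ln x) = 2 / ln x * (4 * x) by field; lra.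
  by apply: Rmult_le_compat_l => //; apply: Rdiv_le_0_compat; lra.
have small_le : 2 * sqrt x * mertens_sum n <= 288 * (x / ln x).
  apply: (@Rle_trans _ (2 * sqrt x * (9 * ln x))); first by apply: Rmult_le_compat_l; lra.
  have -> : 288 * (x / ln x) = 288 * x / ln x by field; lra.
  apply: Rle_div_intro; first lra.
  have lnx_le := @ln_le_4sqrt_sqrt x ltac:(lra).
  have ln_sq_le : ln x * ln x <= 16 * sqrt x.
    by have := sqrt_sqrt (sqrt x) ltac:(lra); nra.
  have := Rmult_le_compat_l (18 * sqrt x) _ _ ltac:(lra) ln_sq_le.
  have -> : 18 * sqrt x * (16 * sqrt x) = 288 * (sqrt x * sqrt x) by ring.
  rewrite ssE; lra.
have : 0 < x / ln x by apply: Rdiv_lt_0_compat; lra.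
lra.
Qed.

(** * The saddle point equation *)

(* Under the law [P(m) ~ 1 / (psi m * m ^ a)] the exponents of the primes in [m] are independent:
   [p] divides [m] with probability [div_prob a p], and then its exponent is geometric
   of ratio [geom_ratio a p] and mean [geom_mean a p].  So [log_mean a p] is the mean of
   [(logn p m) * ln p]. *)
Definition div_prob (a : R) (n : nat) := / (1 + (INR n + 1) * (Rpower (INR n) a - 1)).
Definition geom_ratio (a : R) (n : nat) := Rpower (INR n) (- a).
Definition geom_mean (a : R) (n : nat) := / (1 - geom_ratio a n).
Definition log_mean (a : R) (n : nat) := div_prob a n * geom_mean a n * ln (INR n).

Lemma saddle_denominator_ge p y : 0 < p -> 0 < y ->
  p * (exp y * (y * y)) <= (exp y - 1) * (1 + (p + 1) * (exp y - 1)).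
Proof.
move=> p_gt0 y_gt0; have expm1_ge := expm1_ge_mul_exp_half (Rlt_le _ _ y_gt0).
have half_gt0 := exp_pos (y / 2).
have sq_le : (y * exp (y / 2)) * (y * exp (y / 2)) <= (exp y - 1) * (exp y - 1).
  by apply: Rmult_le_compat => //; nra.
have -> : exp y * (y * y) = (y * exp (y / 2)) * (y * exp (y / 2)).
  by rewrite -(exp_halves y); ring.
have : p * ((y * exp (y / 2)) * (y * exp (y / 2))) <= p * ((exp y - 1) * (exp y - 1)).
  by apply: Rmult_le_compat_l; lra.
nra.
Qed.

Lemma saddle_denominator_le A p y : 0 < A -> A <= p -> A <= p * y -> 0 < y ->
  (exp y - 1) * (1 + (p + 1) * (exp y - 1)) <=
    p * ((1 + / A) * (1 + / A)) * ((y * exp y) * (y * exp y)).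
Proof.
move=> A_gt0 A_le_p A_le_py y_gt0.
have exp_ge := exp_ineq1_le y.
have expm1_le : exp y - 1 <= y * exp y.
  by have := exp_ineq1_le (- y); have := exp_mul_opp y; nra.
have invA_gt0 : 0 < / A by apply: Rinv_0_lt_compat.
have invA_mul z : A <= z -> 1 <= z * / A.
  by move=> A_le_z; apply: Rle_div_intro; lra.
set c := 1 + / A; set w := p * (exp y - 1).
have w_ge : 1 <= w * / A by apply: invA_mul; rewrite /w; nra.
have second_factor : 1 + (p + 1) * (exp y - 1) <= w * (c * c).
  have p_add1_le : p + 1 <= p * c by have := invA_mul p A_le_p; rewrite /c; nra.
  have : (p + 1) * (exp y - 1) <= p * c * (exp y - 1) by apply: Rmult_le_compat_r; lra.
  have -> : p * c * (exp y - 1) = w * c by rewrite /w; ring.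
  have -> : w * (c * c) = w * c + w * / A * c by rewrite /c; ring.
  have : 1 <= w * / A * c by rewrite /c; nra.
  lra.
apply: (@Rle_trans _ ((exp y - 1) * (w * (c * c)))); first by apply: Rmult_le_compat_l; lra.
have -> : (exp y - 1) * (w * (c * c)) = p * (c * c) * ((exp y - 1) * (exp y - 1)) by rewrite /w; ring.
apply: Rmult_le_compat_l; first by rewrite /c; nra.
by apply: Rmult_le_compat; lra.
Qed.

Section PerPrime.
Variables (a : R) (n : nat).
Hypothesis a_gt0 : 0 < a.
Hypothesis n_prime : prime n.

Lemma a_ln_prime_gt0 : 0 < a * ln (INR n).
Proof. by apply: Rmult_lt_0_compat => //; exact: ln_prime_gt0. Qed.

Lemma geom_ratio_exp : geom_ratio a n = exp (- (a * ln (INR n))).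
Proof. by rewrite /geom_ratio /Rpower; congr exp; ring. Qed.

Lemma geom_ratio_inv : geom_ratio a n = / Rpower (INR n) a.
Proof. exact: Rpower_Ropp. Qed.

Lemma geom_ratio_bounds : 0 < geom_ratio a n < 1.
Proof.
rewrite geom_ratio_exp; split; first exact: exp_pos.
rewrite -exp_0; apply: exp_increasing; have := a_ln_prime_gt0; lra.
Qed.

Lemma geom_ratio_ge : 1 - a * ln (INR n) <= geom_ratio a n.
Proof. by rewrite geom_ratio_exp; have := exp_ineq1_le (- (a * ln (INR n))); lra. Qed.

Lemma geom_mean_ge1 : 1 <= geom_mean a n.
Proof.
have := geom_ratio_bounds => ratio_bounds; rewrite /geom_mean -{1}Rinv_1.
by apply: Rinv_le_contravar; lra.
Qed.

Lemma geom_mean_ln_le : geom_mean a n * ln (INR n) <= ln (INR n) + / a.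
Proof.
have lnp_gt0 := ln_prime_gt0 n_prime; rewrite /geom_mean geom_ratio_exp.
have inv_le := inv_one_sub_exp_le a_ln_prime_gt0.
apply: Rle_trans (Rmult_le_compat_r _ _ _ (Rlt_le _ _ lnp_gt0) inv_le) _.
by right; field; lra.
Qed.

Lemma Rpower_prime_sub1_gt0 : 0 < Rpower (INR n) a - 1.
Proof. by have := exp_gt1 a_ln_prime_gt0; rewrite /Rpower; lra. Qed.

Lemma div_prob_bounds : 0 < div_prob a n < 1.
Proof.
have pow_gt1 := Rpower_prime_sub1_gt0; have p_ge2 := INR_prime_ge2 n_prime.
have prod_gt0 : 0 < (INR n + 1) * (Rpower (INR n) a - 1) by apply: Rmult_lt_0_compat; lra.
rewrite /div_prob; split; first by apply: Rinv_0_lt_compat; lra.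
by rewrite -Rinv_1; apply: Rinv_lt_contravar; lra.
Qed.

(* [x exp (x / 2) <= exp x - 1] with [x = a ln p]. *)
Lemma div_prob_le_exp :
  div_prob a n <= / (a * (INR n * ln (INR n))) * exp (- (a * ln (INR n) / 2)).
Proof.
have p_ge2 := INR_prime_ge2 n_prime.
have a_lnp_gt0 := a_ln_prime_gt0; have expm1_ge := expm1_ge_mul_exp_half (Rlt_le _ _ a_lnp_gt0).
have half_gt0 := exp_pos (a * ln (INR n) / 2).
rewrite /div_prob exp_Ropp -Rinv_mult; apply: Rinv_le_contravar.
  by apply: Rmult_lt_0_compat => //; nra.
have : INR n * (a * ln (INR n) * exp (a * ln (INR n) / 2)) <= INR n * (exp (a * ln (INR n)) - 1).
  by apply: Rmult_le_compat_l; lra.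
by rewrite /Rpower; have := exp_gt1 a_lnp_gt0; nra.
Qed.

Lemma div_prob_le : div_prob a n <= / (a * (INR n * ln (INR n))).
Proof.
have p_ge2 := INR_prime_ge2 n_prime.
have a_lnp_gt0 := a_ln_prime_gt0.
have : exp (- (a * ln (INR n) / 2)) <= 1 by apply: exp_le1; lra.
have : 0 < / (a * (INR n * ln (INR n))) by apply: Rinv_0_lt_compat; nra.
have := div_prob_le_exp; nra.
Qed.

Lemma log_meanE : log_mean a n = Rpower (INR n) a * ln (INR n) /
   ((Rpower (INR n) a - 1) * (1 + (INR n + 1) * (Rpower (INR n) a - 1))).
Proof.
have pow_gt1 := Rpower_prime_sub1_gt0; have p_ge2 := INR_prime_ge2 n_prime.
rewrite /log_mean /div_prob /geom_mean geom_ratio_inv.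
set u := Rpower (INR n) a in pow_gt1 *.
have : 0 < (INR n + 1) * (u - 1) by nra.
by move=> prod_gt0; field; lra.
Qed.

Lemma log_mean_gt0 : 0 < log_mean a n.
Proof.
have [q_gt0 _] := div_prob_bounds; have mean_ge1 := geom_mean_ge1.
by apply: Rmult_lt_0_compat; [apply: Rmult_lt_0_compat; lra | exact: ln_prime_gt0].
Qed.

Lemma log_mean_le_small : log_mean a n <= ln (INR n) + / a.
Proof.
have [q_gt0 q_lt1] := div_prob_bounds; have mean_ge1 := geom_mean_ge1.
have lnp_gt0 := ln_prime_gt0 n_prime; have := geom_mean_ln_le; rewrite /log_mean Rmult_assoc.
have : 0 < geom_mean a n * ln (INR n) by nra.
nra.
Qed.

Lemma log_mean_le : log_mean a n <= / (a * a) * / (INR n * ln (INR n)).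
Proof.
have p_ge2 := INR_prime_ge2 n_prime; have lnp_gt0 := ln_prime_gt0 n_prime.
have y_gt0 := a_ln_prime_gt0; have den_ge := @saddle_denominator_ge (INR n) _ ltac:(lra) y_gt0.
have -> : / (a * a) * / (INR n * ln (INR n)) =
    ln (INR n) / (INR n * ((a * ln (INR n)) * (a * ln (INR n)))) by field; lra.
rewrite log_meanE /Rpower; set y := a * ln (INR n) in y_gt0 den_ge *.
have exp_y_gt1 := exp_gt1 y_gt0.
set D := _ * (1 + _) in den_ge *.
have D_gt0 : 0 < D by apply: Rmult_lt_0_compat; nra.
apply: Rdiv_le_intro => //.
have -> : ln (INR n) / (INR n * (y * y)) * D = ln (INR n) * D / (INR n * (y * y)) by field; lra.
apply: Rle_div_intro => //; nra.
Qed.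

Lemma log_mean_ge (A : R) : 0 < A -> A <= INR n * (a * ln (INR n)) -> A <= INR n ->
  exp (- (a * ln (INR n))) / ((1 + / A) * (1 + / A)) * (/ (a * a) * / (INR n * ln (INR n)))
    <= log_mean a n.
Proof.
move=> A_gt0 A_le_py A_le_p.
have lnp_gt0 := ln_prime_gt0 n_prime.
have y_gt0 := a_ln_prime_gt0; have den_le := saddle_denominator_le A_gt0 A_le_p A_le_py y_gt0.
have -> : / (a * a) * / (INR n * ln (INR n)) =
    ln (INR n) / (INR n * ((a * ln (INR n)) * (a * ln (INR n)))) by field; lra.
rewrite log_meanE /Rpower; set y := a * ln (INR n) in y_gt0 den_le *.
have exp_y_gt1 := exp_gt1 y_gt0; have invA_gt0 : 0 < / A by apply: Rinv_0_lt_compat.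
set c := 1 + / A in den_le *; have c_gt1 : 1 < c by rewrite /c; lra.
have -> : exp (- y) / (c * c) * (ln (INR n) / (INR n * (y * y))) =
    exp y * ln (INR n) / (INR n * (c * c) * ((y * exp y) * (y * exp y))).
  by rewrite exp_Ropp; field; lra.
apply: Rmult_le_compat_l; first by apply: Rmult_le_pos; lra.
by apply: Rinv_le_contravar den_le; apply: Rmult_lt_0_compat; nra.
Qed.

End PerPrime.

Definition G_term (a : R) (n : nat) := if prime n then log_mean a n else 0.

Lemma G_Series a : 0 < a -> G a = Series (G_term a).
Proof.
move=> a_gt0; apply: Series_ext => n; rewrite /G_term; case: ifP => n_prime //.
by rewrite log_meanE.
Qed.

Lemma G_term_ge0 a n : 0 < a -> 0 <= G_term a n.
Proof.
by move=> a_gt0; rewrite /G_term; case: ifP => n_prime; [left; exact: log_mean_gt0 | lra].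
Qed.

Lemma G_term_le a n : 0 < a -> G_term a n <= / (a * a) * inv_plogp n.
Proof.
by move=> a_gt0; rewrite /G_term /inv_plogp; case: ifP => n_prime; [exact: log_mean_le | lra].
Qed.

Lemma ex_series_G_term a : 0 < a -> ex_series (G_term a).
Proof.
move=> a_gt0; have sum_major := ex_series_scal_l (/ (a * a)) inv_plogp ex_series_inv_plogp.
apply: (proj1 (series_dominated _ sum_major)) => n.
by rewrite Rabs_pos_eq; [exact: G_term_le | exact: G_term_ge0].
Qed.

Lemma G_le a : 0 < a -> G a <= 83 / (a * a).
Proof.
move=> a_gt0; rewrite G_Series //.
apply: is_lim_seq_ub (is_lim_seq_rsum (ex_series_G_term a_gt0)); exists 0%N => N _.
apply: (@Rle_trans _ (\rsum_(0 <= i < N) (/ (a * a) * inv_plogp i))).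
  by apply: rsum_nat_le => i _; exact: G_term_le.
rewrite -big_distrr /= /Rdiv Rmult_comm; apply: Rmult_le_compat_r; last exact: rsum_inv_plogp_le.
by left; apply: Rinv_0_lt_compat; nra.
Qed.

Lemma continuous_G_term n a : 0 < a -> continuous (fun y => G_term y n) a.
Proof.
move=> a_gt0; rewrite /G_term; case: (boolP (prime n)) => n_prime; last exact: continuous_const.
have p_ge2 := INR_prime_ge2 n_prime.
have pow_gt1 := Rpower_prime_sub1_gt0 a_gt0 n_prime.
apply: (@ex_derive_continuous _ _ (fun y => log_mean y n)).
rewrite /log_mean /div_prob /geom_mean /geom_ratio /Rpower.
have [r_gt0 r_lt1] := geom_ratio_bounds a_gt0 n_prime; rewrite /geom_ratio /Rpower in r_gt0 r_lt1.
rewrite /Rpower in pow_gt1.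
by auto_derive; repeat split => //; nra.
Qed.

Lemma continuous_G a : 0 < a -> continuous G a.
Proof.
move=> a_gt0; have half_gt0 : 0 < a / 2 by lra.
have near_gt (y : R) : ball a (mkposreal _ half_gt0) y -> a / 2 < y.
  by rewrite /ball /= /AbsRing_ball /= /abs /minus /plus /opp /= => /Rabs_def2; lra.
apply: (continuous_ext_loc G (fun y => Series (G_term y))).
  by exists (mkposreal _ half_gt0) => y /near_gt y_gt; rewrite G_Series //; lra.
apply: (@continuous_Series (fun n y => G_term y n) (fun n => / (a / 2 * (a / 2)) * inv_plogp n)).
- by move=> n; exact: continuous_G_term.
- exists (mkposreal _ half_gt0) => y /near_gt y_gt n; have y_gt0 : 0 < y by lra.
  rewrite Rabs_pos_eq; last exact: G_term_ge0.
  apply: Rle_trans (G_term_le n y_gt0) _; apply: Rmult_le_compat_r; first exact: inv_plogp_ge0.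
  by apply: Rinv_le_contravar; nra.
- exact: ex_series_scal_l ex_series_inv_plogp.
Qed.

(** * Asymptotics of G at 0 *)

Lemma saddle_mul_exp a : 0 < a -> a * exp (- ln a) = 1.
Proof. by move=> a_gt0; rewrite exp_Ropp exp_ln // Rinv_r //; lra. Qed.

Lemma saddle_eq_exp a : 0 < a -> a = exp (- - ln a).
Proof. by move=> a_gt0; rewrite Ropp_involutive exp_ln. Qed.

Lemma inv_saddle_eq_exp a : 0 < a -> / a = exp (- ln a).
Proof. by move=> a_gt0; rewrite exp_Ropp exp_ln. Qed.

Lemma saddle_pow_eq_exp a n : 0 < a -> a ^ n = exp (- (INR n * - ln a)).
Proof. by move=> a_gt0; rewrite {1}(saddle_eq_exp a_gt0) exp_pow; congr exp; ring. Qed.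

Lemma saddle_L3_le1 a : 0 < a -> 100 <= - ln a -> a * (- ln a) ^ 3 <= 1.
Proof.
move=> a_gt0; have := saddle_mul_exp a_gt0; set L := - ln a => a_exp L_ge.
have : L ^ 3 <= exp L.
  apply: Rle_trans (@exp_ge_pow 6 L isT ltac:(lra)); rewrite [INR 6]INR_IZR_INZ /=.
  have -> : (L / 6) ^ 6 = L ^ 3 * (L ^ 3 / 46656) by field.
  rewrite -{1}[L ^ 3]Rmult_1_r; apply: Rmult_le_compat_l; first by apply: pow_le; lra.
  have : 100 ^ 3 <= L ^ 3 by apply: pow_incr; lra.
  lra.
nra.
Qed.

Section GAsymptotics.
Variable a : R.
Hypothesis a_gt0 : 0 < a.
Let L := - ln a.
Hypothesis L_ge100 : 100 <= L.
Let s := sqrt L.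

Lemma sqrt_L_bounds : 10 <= s /\ s * s = L /\ ln L <= 2 * s.
Proof.
have sqrt_sq : s * s = L by apply: sqrt_sqrt; lra.
have s_ge0 : 0 <= s by apply: sqrt_pos.
split; first by nra.
by split=> //; apply: ln_le_2sqrt; lra.
Qed.

Let y_up := floorn (/ (a * L)).

Lemma upper_cut_bounds : INR y_up <= / (a * L) /\
  L - 2 * s - 1 <= ln (INR y_up) /\ L / 2 <= ln (INR y_up) /\ (1 < y_up)%N.
Proof.
have [s_ge10 [sqrt_sq lnL_le]] := sqrt_L_bounds; have aL3_le1 := saddle_L3_le1 a_gt0 L_ge100.
have aL_gt0 : 0 < a * L by nra.
have lnY : ln (/ (a * L)) = L - ln L.
  by rewrite ln_Rinv // ln_mult //; [rewrite /L; ring | lra].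
have Y_ge2 : 2 <= / (a * L).
  by rewrite -[2]Rinv_inv; apply: Rinv_le_contravar => //; rewrite -/L in aL3_le1; nra.
have [[lny_ge _] y_gt1] := ln_floorn_bounds Y_ge2.
have [y_le _] := @floorn_bounds (/ (a * L)) ltac:(lra).
rewrite -/y_up in lny_ge y_gt1 y_le; rewrite lnY in lny_ge.
have cut_ge : L - 2 * s - 1 <= ln (INR y_up) by lra.
have half_le : L / 2 <= L - 2 * s - 1 by rewrite -sqrt_sq; nra.
by split; [exact: y_le | split; [|split; [lra|]]].
Qed.

Lemma G_head_le : \rsum_(0 <= n < y_up.+1) G_term a n <= 4 / (a * L) + 600 / (a * a * (L * L)).
Proof.
have [y_le [_ [lny_ge y_gt1]]] := upper_cut_bounds.
have inva_gt0 : 0 < / a by apply: Rinv_0_lt_compat.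
apply: (@Rle_trans _ (chebyshev_theta y_up + / a * \rsum_(0 <= n < y_up.+1 | prime n) 1)).
  rewrite /chebyshev_theta big_distrr -big_split /G_term -big_mkcond.
  by apply: rsum_le => p _ p_prime /=; have := log_mean_le_small a_gt0 p_prime; lra.
have theta_le : chebyshev_theta y_up <= 4 / (a * L).
  by have := chebyshev_theta_le y_up; rewrite /Rdiv; lra.
have count_le : \rsum_(0 <= n < y_up.+1 | prime n) 1 <= 600 / (a * (L * L)).
  apply: Rle_trans (prime_count_le y_gt1) _.
  have -> : 600 / (a * (L * L)) = 300 * (/ (a * L) * / (L / 2)) by field; lra.
  apply: Rmult_le_compat_l; first lra.
  apply: Rmult_le_compat; [exact: pos_INR | by left; apply: Rinv_0_lt_compat; lra | lra |].
  by apply: Rinv_le_contravar; lra.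
have -> : 600 / (a * a * (L * L)) = / a * (600 / (a * (L * L))) by field; lra.
by apply: Rplus_le_compat => //; apply: Rmult_le_compat_l; lra.
Qed.

Lemma G_tail_le N : (y_up.+1 <= N)%N ->
  \rsum_(y_up.+1 <= n < N) G_term a n <= / (a * a) * (/ (L - 2 * s - 1) + 80 / (L * L)).
Proof.
have [s_ge10 [sqrt_sq _]] := sqrt_L_bounds; have [_ [lny_ge [lny_ge_half y_gt1]]] := upper_cut_bounds.
case: N => [|w] // y_le_w.
apply: (@Rle_trans _ (/ (a * a) * \rsum_(y_up.+1 <= n < w.+1) inv_plogp n)).
  by rewrite big_distrr; apply: rsum_nat_le => i _; exact: G_term_le.
apply: Rmult_le_compat_l; first by left; apply: Rinv_0_lt_compat; nra.
have /Rabs_le_between [_ sum_le] := @rsum_inv_plogp_approx y_up w y_gt1 ltac:(lia).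
have invln_le : / ln (INR y_up) <= / (L - 2 * s - 1) by apply: Rinv_le_contravar; nra.
have invlnw_gt0 : 0 < / ln (INR w).
  by apply: Rinv_0_lt_compat; have := @ln_INR_ge_half w ltac:(lia); lra.
have error_le : 20 / ln (INR y_up) ^ 2 <= 80 / (L * L).
  have -> : 80 / (L * L) = 20 * / ((L / 2) ^ 2) by field; lra.
  apply: Rmult_le_compat_l; first lra.
  apply: Rinv_le_contravar; first by apply: pow_lt; lra.
  by apply: pow_incr; lra.
lra.
Qed.

Lemma G_upper : G a <= (1 + 690 / s) / (a * a * L).
Proof.
have [s_ge10 [sqrt_sq _]] := sqrt_L_bounds.
rewrite G_Series //.
apply: is_lim_seq_ub (is_lim_seq_rsum (ex_series_G_term a_gt0)); exists y_up.+1 => N N_ge.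
rewrite (@big_cat_nat _ _ _ y_up.+1 0 N) //=.
apply: Rle_trans (Rplus_le_compat _ _ _ _ G_head_le (G_tail_le N_ge)) _.
apply: Rle_div_intro; first by nra.
have -> : (4 / (a * L) + 600 / (a * a * (L * L)) + / (a * a) * (/ (L - 2 * s - 1) + 80 / (L * L)))
    * (a * a * L) = 4 * a + 680 / L + (1 + (2 * s + 1) / (L - 2 * s - 1)).
  by field; repeat split; nra.
have ratio_le : (2 * s + 1) / (L - 2 * s - 1) <= 5 / s.
  apply: Rdiv_le_intro; first by nra.
  have -> : 5 / s * (L - 2 * s - 1) = 5 * s - 10 - 5 / s by rewrite -sqrt_sq; field; lra.
  have : 5 / s <= 1 by apply: Rdiv_le_intro; lra.
  lra.
have invL_le : 680 / L <= 680 / s.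
  by apply: Rmult_le_compat_l; [lra | apply: Rinv_le_contravar; nra].
have a_le : 4 * a <= 4 / s.
  apply: Rmult_le_compat_l; first lra.
  rewrite -[a]Rinv_inv (inv_saddle_eq_exp a_gt0); apply: Rinv_le_contravar; first lra.
  by have := exp_ineq1_le L; rewrite -/L; nra.
have : 690 / s = 680 / s + 5 / s + 4 / s + 1 / s by field; lra.
have : 0 < 1 / s by apply: Rdiv_lt_0_compat; lra.
lra.
Qed.

Let y_low := floorn (L / a).
Let w_low := floorn (exp (L * L)).

Lemma lower_cut_bounds : L / a <= INR y_low + 1 /\ L <= ln (INR y_low) <= L + 2 * s /\
  L * L - 1 <= ln (INR w_low) <= L * L /\ (1 < y_low)%N /\ (y_low <= w_low)%N.
Proof.
have [s_ge10 [sqrt_sq lnL_le]] := sqrt_L_bounds; have aL3_le1 := saddle_L3_le1 a_gt0 L_ge100.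
have a_lt1 : a < 1 by have : 1 <= L ^ 3; [by apply: pow_R1_Rle; lra | rewrite -/L in aL3_le1; nra].
have Y_ge2 : 2 <= L / a by apply: Rle_div_intro; nra.
have lnY : ln (L / a) = L + ln L by rewrite ln_div; [rewrite /L; ring | lra | lra].
have [lny_bounds y_gt1] := ln_floorn_bounds Y_ge2.
have [_ y_gt] := @floorn_bounds (L / a) ltac:(lra).
rewrite -/y_low in lny_bounds y_gt1 y_gt; rewrite lnY in lny_bounds.
have lnL_ge1 : 1 <= ln L.
  by rewrite -[1](ln_exp 1); apply: ln_le; [exact: exp_pos | have := exp_le_3; lra].
have W_ge2 : 2 <= exp (L * L) by have := exp_ineq1_le (L * L); nra.
have [lnw_bounds w_gt1] := ln_floorn_bounds W_ge2; rewrite -/w_low ln_exp in lnw_bounds.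
do 4?[split; first lra || by []].
apply: leq_of_INR; apply: Rlt_le.
by apply: ln_lt_inv; [apply: INR_gt0; lia | apply: INR_gt0; lia | nra].
Qed.

Let loss := (1 - / L) * (1 - 2 * / L).

Lemma log_mean_window_ge n : (y_low < n <= w_low)%N -> prime n ->
  loss * (/ (a * a) * / (INR n * ln (INR n))) <= log_mean a n.
Proof.
have aL3_le1 := saddle_L3_le1 a_gt0 L_ge100; rewrite -/L in aL3_le1.
have [Y_le [lny_bounds [lnw_bounds [y_gt1 _]]]] := lower_cut_bounds.
move=> /andP [y_lt_n n_le_w] n_prime.
have p_ge2 := INR_prime_ge2 n_prime.
have L_le_na : L <= INR n * a.
  have : L / a <= INR n by have := leq_INR y_lt_n; rewrite S_INR; lra.
  by move=> Y_le_n; have := Rmult_le_compat_r a _ _ (Rlt_le _ _ a_gt0) Y_le_n;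
     have -> : L / a * a = L by [field; lra].
have lnn_ge : L <= ln (INR n).
  have : ln (INR y_low) <= ln (INR n); last lra.
  by apply: ln_le; [apply: INR_gt0; lia | apply: leq_INR; lia].
have lnn_le : ln (INR n) <= L * L.
  have : ln (INR n) <= ln (INR w_low) by apply: ln_le; [lra | apply: leq_INR].
  lra.
have a_lt1 : a < 1 by have : 1 <= L ^ 3; [by apply: pow_R1_Rle; lra | nra].
have := @log_mean_ge a n a_gt0 n_prime L ltac:(lra) ltac:(nra) ltac:(nra).
apply: Rle_trans; apply: Rmult_le_compat_r.
  by left; apply: Rmult_lt_0_compat; apply: Rinv_0_lt_compat; nra.
have invL_bounds : 0 < / L <= / 100.
  by split; [apply: Rinv_0_lt_compat; lra | apply: Rinv_le_contravar; lra].
have exp_ge : 1 - / L <= exp (- (a * ln (INR n))).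
  have := exp_ineq1_le (- (a * ln (INR n))).
  have : a * ln (INR n) <= a * (L * L) by apply: Rmult_le_compat_l; lra.
  have : a * (L * L) <= / L.
    rewrite -[/ L]Rmult_1_l; apply: Rle_div_intro; first lra.
    by have -> : a * (L * L) * L = a * L ^ 3 by ring.
  lra.
have sq_ge : 1 - 2 * / L <= / ((1 + / L) * (1 + / L)).
  by rewrite -[/ (_ * _)]Rmult_1_l; apply: Rle_div_intro; nra.
by apply: Rmult_le_compat; lra.
Qed.

Lemma inv_plogp_window_ge :
  1 - 2 / s - 22 * / L <= L * \rsum_(y_low.+1 <= n < w_low.+1) inv_plogp n.
Proof.
have [s_ge10 [sqrt_sq _]] := sqrt_L_bounds.
have [_ [lny_bounds [lnw_bounds [y_gt1 yw]]]] := lower_cut_bounds.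
have /Rabs_le_between [sum_ge _] := rsum_inv_plogp_approx y_gt1 yw.
set S := \rsum_(_ <= n < _) _ in sum_ge *.
have invlny_ge : / (L + 2 * s) <= / ln (INR y_low) by apply: Rinv_le_contravar; lra.
have invlnw_le : / ln (INR w_low) <= 2 * / (L * L).
  have -> : 2 * / (L * L) = / (L * L / 2) by field; lra.
  by apply: Rinv_le_contravar; nra.
have error_le : 20 / ln (INR y_low) ^ 2 <= 20 * / (L * L).
  apply: Rmult_le_compat_l; first lra.
  by apply: Rinv_le_contravar; rewrite /pow; nra.
have : L * (/ (L + 2 * s) - 22 * / (L * L)) <= L * S by apply: Rmult_le_compat_l; lra.
have -> : L * (/ (L + 2 * s) - 22 * / (L * L)) = 1 - 2 * s / (L + 2 * s) - 22 * / L by field; nra.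
have : 2 * s / (L + 2 * s) <= 2 / s.
  apply: Rdiv_le_intro; first nra.
  have -> : 2 / s * (L + 2 * s) = 2 * s + 4 by rewrite -sqrt_sq; field; lra.
  lra.
lra.
Qed.

Lemma G_lower : (1 - 27 / s) / (a * a * L) <= G a.
Proof.
have [s_ge10 [sqrt_sq _]] := sqrt_L_bounds.
have invs_bounds : 0 < / s <= / 10.
  by split; [apply: Rinv_0_lt_compat; lra | apply: Rinv_le_contravar; lra].
have invL_le_invs : / L <= / s by apply: Rinv_le_contravar; nra.
have loss_ge : 1 - 3 * / L <= loss by rewrite /loss; nra.
rewrite G_Series //.
apply: is_lim_seq_lb (is_lim_seq_rsum (ex_series_G_term a_gt0)); exists w_low.+1 => N N_ge.
apply: (@Rle_trans _ (\rsum_(y_low.+1 <= n < w_low.+1) G_term a n)); last first.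
  by apply: rsum_widen_le => // i; exact: G_term_ge0.
apply: (@Rle_trans _ (loss * / (a * a) * \rsum_(y_low.+1 <= n < w_low.+1) inv_plogp n)); last first.
  rewrite big_distrr; apply: rsum_nat_le => i /andP [y_lt_i i_le_w] /=.
  rewrite /inv_plogp /G_term; case: ifP => i_prime; last lra.
  by rewrite Rmult_assoc; apply: log_mean_window_ge => //; rewrite y_lt_i.
have := inv_plogp_window_ge; set S := \rsum_(_ <= n < _) _ => LS_ge.
have S_ge0 : 0 <= S by apply: rsum_nat_ge0 => i _; exact: inv_plogp_ge0.
apply: Rdiv_le_intro; first by nra.
have -> : loss * / (a * a) * S * (a * a * L) = loss * (L * S) by field; lra.
case: (Rle_lt_dec (1 - 27 / s) 0) => s_cases.
  by apply: Rle_trans s_cases _; apply: Rmult_le_pos; [lra | apply: Rmult_le_pos; lra].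
have : (1 - 3 * / L) * (1 - 2 / s - 22 * / L) <= loss * (L * S).
  by rewrite /Rdiv in s_cases LS_ge *; apply: Rmult_le_compat; lra.
rewrite /Rdiv; nra.
Qed.

End GAsymptotics.

Lemma sqrt_ge_of_sq_le c x : 0 <= c -> c * c <= x -> c <= sqrt x.
Proof. by move=> c_ge0 cc_le; rewrite -(sqrt_square c) //; exact: sqrt_le_1_alt. Qed.

Lemma G_unbounded v : 0 < v -> exists a, 0 < a /\ v <= G a.
Proof.
move=> v_gt0; pose L := 10000 + 10 * v; have L_gt0 : 0 < L by rewrite /L; lra.
exists (exp (- L)); split; first exact: exp_pos.
have lnE : - ln (exp (- L)) = L by rewrite ln_exp; ring.
have := @G_lower (exp (- L)) (exp_pos _) ltac:(rewrite lnE /L; lra).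
rewrite lnE; apply: Rle_trans.
have sqrtL_ge : 100 <= sqrt L by apply: sqrt_ge_of_sq_le; rewrite /L; lra.
have loss_le : 27 / sqrt L <= 27 / 100.
  by apply: Rmult_le_compat_l; [lra | apply: Rinv_le_contravar; lra].
have e_gt0 := exp_pos (- L).
have e_mul_le : exp (- L) * (1 + L) <= 1.
  by have := exp_mul_opp L; have := exp_ineq1_le L; nra.
apply: Rle_div_intro; first by apply: Rmult_lt_0_compat => //; apply: Rmult_lt_0_compat.
have ev_le : exp (- L) * (10 * v) <= 1.
  by apply: Rle_trans e_mul_le; apply: Rmult_le_compat_l; [lra | rewrite /L; lra].
have -> : v * (exp (- L) * exp (- L) * L) = (exp (- L) * v) * (exp (- L) * L) by ring.
have : 0 <= exp (- L) * v by nra.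
nra.
Qed.

Lemma G_surjective v : 0 < v -> exists a, 0 < a /\ G a = v.
Proof.
move=> v_gt0; have [b [b_gt0 v_le]] := G_unbounded v_gt0.
have [d [d_gt0 le_v]] : exists d, 0 < d /\ G d <= v.
  have ratio_gt0 : 0 < 83 / v by apply: Rdiv_lt_0_compat; lra.
  exists (83 / v + 1); split; first lra.
  apply: Rle_trans (@G_le (83 / v + 1) ltac:(lra)) _; apply: Rdiv_le_intro; first nra.
  have -> : v * ((83 / v + 1) * (83 / v + 1)) = 83 * (83 / v) + 166 + v by field; lra.
  lra.
have [z [_ Gz]] : {x : R | Rmin (ln b) (ln d) <= x <= Rmax (ln b) (ln d) /\ (fun y => G (exp y)) x = v}.
  apply: IVT_gen.
    move=> y; apply continuity_pt_filterlim.
    apply: (continuous_comp exp G); last exact: continuous_G (exp_pos _).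
    by apply: ex_derive_continuous; auto_derive.
  rewrite !exp_ln //.
  by split; [apply: Rle_trans (Rmin_r _ _) le_v | apply: Rle_trans v_le (Rmax_l _ _)].
by exists (exp z); split; [exact: exp_pos |].
Qed.

Lemma G_saddle_asymp a : 0 < a -> 3000 <= - ln a ->
  Rabs (a * a * G a * - ln a - 1) <= 690 / sqrt (- ln a) /\ - ln a <= ln (G a) /\ 0 < G a.
Proof.
move=> a_gt0 L_ge; have L_ge100 : 100 <= - ln a by lra.
have := saddle_L3_le1 a_gt0 L_ge100; have := inv_saddle_eq_exp a_gt0.
have := G_upper a_gt0 L_ge100; have := G_lower a_gt0 L_ge100.
set L := - ln a in L_ge L_ge100 *; set s := sqrt L => lower upper inva aL3_le1.
have s_ge : 54 <= s by apply: sqrt_ge_of_sq_le; lra.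
have aaL_gt0 : 0 < a * a * L by apply: Rmult_lt_0_compat; nra.
have loss_le : 27 / s <= 1 / 2 by apply: Rdiv_le_intro; lra.
have prodE : a * a * G a * L = G a * (a * a * L) by ring.
have scaled_upper : a * a * G a * L <= 1 + 690 / s by rewrite prodE; apply Rle_div_r.
have scaled_lower : 1 - 27 / s <= a * a * G a * L by rewrite prodE; apply Rle_div_l.
split; first by apply: Rabs_le; rewrite /Rdiv in scaled_upper scaled_lower *; lra.
have expL_le : exp L <= G a.
  rewrite -inva; apply: (Rmult_le_reg_r (a * a * L)) => //; rewrite -prodE.
  have -> : / a * (a * a * L) = a * L by field; lra.
  apply: Rle_trans scaled_lower.
  have : a * L <= 1 / 2; last lra.
  have : 2 * L <= L ^ 3 by rewrite /pow; nra.
  nra.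
have expL_gt0 := exp_pos L; split; last lra.
by rewrite -{1}(ln_exp L); apply: ln_le.
Qed.

Lemma L_ge_of_G_ge a M : 0 < a -> 83 * exp (2 * M) <= G a -> M <= - ln a.
Proof.
move=> a_gt0 G_ge; have aa_gt0 : 0 < a * a by nra.
have exp_aa_le1 : exp (2 * M) * (a * a) <= 1.
  have := Rle_trans _ _ _ G_ge (G_le a_gt0) => exp_le_inv.
  have := Rmult_le_compat_r _ _ _ (Rlt_le _ _ aa_gt0) exp_le_inv.
  have -> : 83 / (a * a) * (a * a) = 83 by field; lra.
  lra.
have exp_gt0 := exp_pos (2 * M).
have := ln_le (exp (2 * M) * (a * a)) 1 ltac:(nra) exp_aa_le1.
rewrite ln_mult // ln_exp ln_1 ln_mult //; lra.
Qed.

(** * The characteristic function *)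

Section GeometricMixture.
Variables (q r x : R).
Hypothesis q_bounds : 0 < q < 1.
Hypothesis r_bounds : 0 < r < 1.

(* [geom_mix] is the characteristic function at [x] of the variable that vanishes with probability
   [1 - q] and is otherwise geometric on the positive integers: with [z = exp (i x)] it is
   [1 - q + q (1 - r) z / (1 - r z)], and [geom_den = |1 - r z| ^ 2]. *)
Definition geom_den := (1 - r) * (1 - r) + 2 * r * (1 - cos x).
Definition geom_re := (1 - r) * (cos x - r) / geom_den.
Definition geom_im := (1 - r) * sin x / geom_den.
Definition geom_mix : C := (1 - q + q * geom_re, q * geom_im).

Lemma geom_den_gt0 : 0 < geom_den.
Proof. by rewrite /geom_den; have := one_sub_cos_bounds x; nra. Qed.

Lemma geom_denE : geom_den = 1 - 2 * r * cos x + r * r.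
Proof. by rewrite /geom_den; ring. Qed.

Lemma sin_sqE : sin x * sin x = 1 - cos x * cos x.
Proof. by have := sin2_cos2 x; rewrite /Rsqr; lra. Qed.

Lemma one_sub_rcis_neq0 : (1 - RtoC r * cis x)%C <> RtoC 0.
Proof.
move=> sub0; have : Cmod (RtoC r * cis x)%C = 1.
  have -> : (RtoC r * cis x = RtoC 1)%C by rewrite -[LHS]Cplus_0_r -sub0; ring.
  by rewrite Cmod_1.
by rewrite Cmod_mult Cmod_cis Cmod_R Rabs_pos_eq; lra.
Qed.

Lemma geometric_series_cis : (RtoC r * cis x / (1 - RtoC r * cis x))%C =
  (r * (cos x - r) / geom_den, r * sin x / geom_den).
Proof.
have den_gt0 := geom_den_gt0; have nz := one_sub_rcis_neq0.
set z : C := (r * (cos x - r) / geom_den, r * sin x / geom_den).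
suff mulE : (z * (1 - RtoC r * cis x) = RtoC r * cis x)%C.
  by transitivity (z * (1 - RtoC r * cis x) / (1 - RtoC r * cis x))%C; [rewrite mulE | field].
rewrite /z /Cmult /Cminus /Cplus /Copp /RtoC /cis /=; congr (_, _).
  have -> : r * (cos x - r) / geom_den * (1 + - (r * cos x - 0 * sin x))
      - r * sin x / geom_den * (0 + - (r * sin x + 0 * cos x))
    = r * ((cos x - r) * (1 - r * cos x) + r * (sin x * sin x)) / geom_den by field; lra.
  by rewrite sin_sqE geom_denE; field; rewrite -geom_denE; lra.
have -> : r * (cos x - r) / geom_den * (0 + - (r * sin x + 0 * cos x))
    + r * sin x / geom_den * (1 + - (r * cos x - 0 * sin x))
  = r * sin x * (1 - 2 * r * cos x + r * r) / geom_den by field; lra.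
by rewrite -geom_denE; field; lra.
Qed.

Lemma Cmod2_geom : geom_re * geom_re + geom_im * geom_im = (1 - r) * (1 - r) / geom_den.
Proof.
have den_gt0 := geom_den_gt0; rewrite /geom_re /geom_im.
have -> : (1 - r) * (cos x - r) / geom_den * ((1 - r) * (cos x - r) / geom_den) +
    (1 - r) * sin x / geom_den * ((1 - r) * sin x / geom_den)
  = (1 - r) * (1 - r) * ((cos x - r) * (cos x - r) + sin x * sin x) / geom_den / geom_den by field; lra.
have -> : (cos x - r) * (cos x - r) + sin x * sin x = geom_den by rewrite sin_sqE geom_denE; ring.
by field; lra.
Qed.

Lemma Cmod2_geom_mix :
  Cmod geom_mix ^ 2 = 1 - 2 * q * (1 - cos x) * (1 + r - q) / geom_den.
Proof.
have den_gt0 := geom_den_gt0.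
rewrite Cmod2_alt /geom_mix /Re /Im [fst _]/= [snd _]/=.
have -> : (1 - q + q * geom_re) ^ 2 + (q * geom_im) ^ 2 =
    (1 - q) * (1 - q) + 2 * (1 - q) * q * geom_re
    + q * q * (geom_re * geom_re + geom_im * geom_im) by ring.
rewrite Cmod2_geom /geom_re; apply: (Rmult_eq_reg_r geom_den); last lra.
have -> : ((1 - q) * (1 - q) + 2 * (1 - q) * q * ((1 - r) * (cos x - r) / geom_den)
    + q * q * ((1 - r) * (1 - r) / geom_den)) * geom_den
  = (1 - q) * (1 - q) * geom_den + 2 * (1 - q) * q * ((1 - r) * (cos x - r))
    + q * q * ((1 - r) * (1 - r)) by field; lra.
have -> : (1 - 2 * q * (1 - cos x) * (1 + r - q) / geom_den) * geom_den
  = geom_den - 2 * q * (1 - cos x) * (1 + r - q) by field; lra.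
by rewrite geom_denE; ring.
Qed.

Definition mix_gain := 2 * q * (1 - cos x) * r / geom_den.

Lemma mix_gain_bounds : 0 <= mix_gain <= 1.
Proof.
have den_gt0 := geom_den_gt0; have [cos_ge0 _] := one_sub_cos_bounds x.
rewrite /mix_gain; split.
  by apply: Rdiv_le_0_compat => //; apply: Rmult_le_pos; nra.
apply: Rdiv_le_intro => //; rewrite /geom_den.
have : 0 <= 2 * r * (1 - cos x) by nra.
nra.
Qed.

Lemma Cmod_geom_mix_le : Cmod geom_mix <= exp (- mix_gain / 2).
Proof.
have den_gt0 := geom_den_gt0; have [cos_ge0 _] := one_sub_cos_bounds x.
have sq_le : Cmod geom_mix ^ 2 <= 1 - mix_gain.
  rewrite Cmod2_geom_mix /mix_gain.
  suff : 2 * q * (1 - cos x) * r / geom_den <= 2 * q * (1 - cos x) * (1 + r - q) / geom_den by lra.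
  apply: Rmult_le_compat_r; first by left; apply: Rinv_0_lt_compat.
  by apply: Rmult_le_compat_l; [nra | lra].
have exp_ge := exp_ineq1_le (- mix_gain); rewrite -(exp_halves (- mix_gain)) in exp_ge.
have := exp_pos (- mix_gain / 2); have := Cmod_ge_0 geom_mix; nra.
Qed.

Lemma Cmod_geom_mix_small :
  Cmod geom_mix <= (1 - q) + (1 - r) / sqrt (2 * r * (1 - cos x)) \/ cos x = 1.
Proof.
have den_gt0 := geom_den_gt0; have [cos_ge0 _] := one_sub_cos_bounds x.
case: (Req_dec (cos x) 1) => cos_cases; [by right | left].
have sub_gt0 : 0 < 2 * r * (1 - cos x) by apply: Rmult_lt_0_compat; lra.
have -> : geom_mix = (RtoC (1 - q) + RtoC q * (geom_re, geom_im))%C.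
  by rewrite /geom_mix /Cplus /Cmult /RtoC /=; congr (_, _); ring.
apply: Rle_trans (Cmod_triangle _ _) _.
rewrite Cmod_mult !Cmod_R !Rabs_pos_eq; [|lra|lra]; apply: Rplus_le_compat_l.
apply: (@Rle_trans _ (Cmod (geom_re, geom_im))).
  by have := Cmod_ge_0 (geom_re, geom_im); nra.
have -> : Cmod (geom_re, geom_im) = (1 - r) / sqrt geom_den.
  rewrite /Cmod [fst _]/= [snd _]/= /pow !Rmult_1_r Cmod2_geom.
  by rewrite sqrt_div_alt // sqrt_square; lra.
apply: Rmult_le_compat_l; first lra.
apply: Rinv_le_contravar; first exact: sqrt_lt_R0.
by apply: sqrt_le_1_alt; rewrite /geom_den; nra.
Qed.

Hypothesis x_ge0 : 0 <= x.
Let l := / (1 - r).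
Let X := l * x.
Let theta := q * X.

Definition centered_mix : C := (geom_mix * cis (- (q * (/ (1 - r) * x))))%C.

Lemma Cmod_centered_mix : Cmod centered_mix = Cmod geom_mix.
Proof. by rewrite /centered_mix Cmod_mult Cmod_cis Rmult_1_r. Qed.

Lemma mul_mean : l * (1 - r) = 1.
Proof. by rewrite /l Rinv_l; lra. Qed.

Lemma mean_bounds : 1 <= l /\ 0 <= x <= X.
Proof. by have := mul_mean; rewrite /X => lr1; split; nra. Qed.

Lemma geom_den_mean : geom_den * (l * l) = 1 + 2 * r * (1 - cos x) * (l * l).
Proof.
have -> : geom_den * (l * l) = (l * (1 - r)) * (l * (1 - r)) + 2 * r * (1 - cos x) * (l * l).
  by rewrite /geom_den; ring.
by rewrite mul_mean; ring.
Qed.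

Lemma one_sub_geom_re_bounds : 0 <= 1 - geom_re <= X * X.
Proof.
have den_gt0 := geom_den_gt0; have [cos_ge0 cos_le] := one_sub_cos_bounds x.
have -> : 1 - geom_re = (1 - cos x) * (1 + r) / geom_den.
  rewrite /geom_re; apply: (Rmult_eq_reg_r geom_den); last lra.
  by rewrite /geom_den; field; rewrite -/geom_den; lra.
split; first by apply: Rdiv_le_0_compat => //; nra.
apply: Rdiv_le_intro => //.
have -> : X * X * geom_den = x * x * (geom_den * (l * l)) by rewrite /X; ring.
rewrite geom_den_mean.
have : 0 <= 2 * r * (1 - cos x) * (l * l) by apply: Rmult_le_pos; [nra | exact: Rle_0_sqr].
by have := Rle_0_sqr x; rewrite /Rsqr; nra.
Qed.

Let y := 2 * r * (1 - cos x) * (l * l).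

Lemma geom_imE : geom_im = l * sin x / (1 + y).
Proof.
have den_gt0 := geom_den_gt0; have [l_ge1 _] := mean_bounds.
rewrite /y -geom_den_mean /geom_im.
have -> : 1 - r = / l by rewrite /l Rinv_inv.
by field; lra.
Qed.

Lemma mean_defect_bounds : 0 <= y <= X * X.
Proof.
have [cos_ge0 cos_le] := one_sub_cos_bounds x.
split; first by apply: Rmult_le_pos; [nra | exact: Rle_0_sqr].
have -> : X * X = x * x * (l * l) by rewrite /X; ring.
by apply: Rmult_le_compat_r; [exact: Rle_0_sqr | nra].
Qed.

Lemma Rabs_mean_sin_le : Rabs (l * sin x) <= X.
Proof.
have [l_ge1 _] := mean_bounds; have := Rabs_sin_le x; rewrite (Rabs_pos_eq x) // => sin_le.
by rewrite Rabs_mult (Rabs_pos_eq l) /X; [apply: Rmult_le_compat_l; lra | lra].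
Qed.

Lemma Rabs_geom_im_le : Rabs geom_im <= X.
Proof.
have [y_ge0 _] := mean_defect_bounds; have lsin_le := Rabs_mean_sin_le.
rewrite geom_imE /Rdiv Rabs_mult (Rabs_pos_eq (/ (1 + y))); last first.
  by left; apply: Rinv_0_lt_compat; lra.
apply: Rdiv_le_intro; first lra.
by have := Rabs_pos (l * sin x); nra.
Qed.

Lemma Rabs_geom_im_sub_le : Rabs (geom_im - X) <= 7 / 6 * X ^ 3.
Proof.
have [y_ge0 y_le] := mean_defect_bounds; have [l_ge1 [_ x_le]] := mean_bounds.
have sin_ge := sin_ge_cubic x_ge0; have sin_x_le := sin_le x_ge0.
have -> : geom_im - X = - (l * (x - sin x) + l * sin x * (y / (1 + y))).
  by rewrite geom_imE /X; field; lra.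
rewrite Rabs_Ropp; apply: Rle_trans (Rabs_triang _ _) _.
have cubic_part : Rabs (l * (x - sin x)) <= X ^ 3 / 6.
  rewrite Rabs_pos_eq; last by nra.
  apply: (@Rle_trans _ (l * (x ^ 3 / 6))); first by apply: Rmult_le_compat_l; lra.
  have -> : X ^ 3 / 6 = l * l * l * (x ^ 3 / 6) by rewrite /X; field.
  apply: Rmult_le_compat_r; last by nra.
  by have := pow_le x 3 x_ge0; lra.
have defect_part : Rabs (l * sin x * (y / (1 + y))) <= X ^ 3.
  have ratio_bounds : 0 <= y / (1 + y) <= X * X.
    split; first by apply: Rdiv_le_0_compat; lra.
    by apply: Rdiv_le_intro; nra.
  rewrite Rabs_mult (Rabs_pos_eq (y / _)); last lra.
  have -> : X ^ 3 = X * (X * X) by ring.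
  by apply: Rmult_le_compat; [exact: Rabs_pos | lra | exact: Rabs_mean_sin_le | lra].
lra.
Qed.

Lemma mean_phase_bounds : 0 <= theta <= X /\ theta * theta <= q * (X * X) /\ theta ^ 3 <= q * X ^ 3.
Proof.
have [l_ge1 [_ x_le]] := mean_bounds; have X_ge0 : 0 <= X by lra.
split; first by rewrite /theta; nra.
split; first by rewrite /theta; have := Rle_0_sqr X; rewrite /Rsqr; nra.
have -> : theta ^ 3 = q * q * q * X ^ 3 by rewrite /theta; ring.
by apply: Rmult_le_compat_r; [exact: pow_le | nra].
Qed.

(* The linear terms in [X] cancel because of the centering. *)
Lemma Im_centered_mix_le : Rabs (snd centered_mix) <= 3 * q * X ^ 3.
Proof.
have [l_ge1 [_ x_le]] := mean_bounds; have X_ge0 : 0 <= X by lra.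
have [re_ge re_le] := one_sub_geom_re_bounds.
have im_le := Rabs_geom_im_le; have im_sub_le := Rabs_geom_im_sub_le.
have [[th_ge0 th_le] [th2_le th3_le]] := mean_phase_bounds.
have sin_ge := sin_ge_cubic th_ge0; have sin_th_le := sin_le th_ge0.
have cos_bounds := one_sub_cos_bounds theta.
rewrite /centered_mix -/l -/X -/theta /geom_mix /cis /Cmult /= cos_neg sin_neg.
have -> : (1 - q + q * geom_re) * - sin theta + q * geom_im * cos theta =
  (theta - sin theta)
  + (q * ((geom_im - X) - geom_im * (1 - cos theta)) + q * (1 - geom_re) * sin theta).
  by rewrite /theta; ring.
have sin_part : Rabs (theta - sin theta) <= q * X ^ 3 / 6 by rewrite Rabs_pos_eq; lra.
have im_part : Rabs (q * ((geom_im - X) - geom_im * (1 - cos theta))) <=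
    q * (7 / 6 * X ^ 3 + X ^ 3 / 2).
  rewrite Rabs_mult (Rabs_pos_eq q); last lra.
  apply: Rmult_le_compat_l; first lra.
  apply: Rle_trans (Rabs_triang _ _) _; rewrite Rabs_Ropp; apply: Rplus_le_compat => //.
  rewrite Rabs_mult (Rabs_pos_eq (1 - cos theta)); last lra.
  have -> : X ^ 3 / 2 = X * (X * X / 2) by rewrite /pow; field.
  by apply: Rmult_le_compat => //; [exact: Rabs_pos | lra | nra].
have re_part : Rabs (q * (1 - geom_re) * sin theta) <= q * X ^ 3.
  rewrite Rabs_mult (Rabs_pos_eq (q * _)); last by apply: Rmult_le_pos; lra.
  have -> : q * X ^ 3 = q * (X * X) * X by ring.
  apply: Rmult_le_compat; [by apply: Rmult_le_pos; lra | exact: Rabs_pos | | ].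
    by apply: Rmult_le_compat_l; lra.
  by have := Rabs_sin_le theta; rewrite (Rabs_pos_eq theta) //; lra.
apply: Rle_trans (Rabs_triang _ _) _; apply: Rle_trans (Rplus_le_compat_l _ _ _ (Rabs_triang _ _)) _.
have := pow_le X 3 X_ge0; nra.
Qed.

Lemma Re_centered_mix_ge : 1 - 3 * q * (X * X) <= fst centered_mix.
Proof.
have [l_ge1 [_ x_le]] := mean_bounds.
have [re_ge re_le] := one_sub_geom_re_bounds; have im_le := Rabs_geom_im_le.
have [[th_ge0 th_le] [th2_le _]] := mean_phase_bounds.
have cos_bounds := one_sub_cos_bounds theta.
rewrite /centered_mix -/l -/X -/theta /geom_mix /cis /Cmult /= cos_neg sin_neg.
have -> : (1 - q + q * geom_re) * cos theta - q * geom_im * - sin theta =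
  cos theta - q * (1 - geom_re) * cos theta + q * geom_im * sin theta by ring.
have re_part : q * (1 - geom_re) * cos theta <= q * (X * X).
  have : q * (1 - geom_re) <= q * (X * X) by apply: Rmult_le_compat_l; lra.
  have : 0 <= q * (1 - geom_re) by apply: Rmult_le_pos; lra.
  nra.
have : Rabs (q * geom_im * sin theta) <= q * (X * X).
  rewrite Rmult_assoc Rabs_mult (Rabs_pos_eq q); last lra.
  apply: Rmult_le_compat_l; first lra.
  have := Rabs_sin_le theta; rewrite (Rabs_pos_eq theta) // Rabs_mult => sin_th_le.
  by apply: Rmult_le_compat; [exact: Rabs_pos | exact: Rabs_pos | lra | lra].
move/Rabs_le_between; lra.
Qed.

End GeometricMixture.

Definition psi_weight (p : nat) : R := / (INR p + 1).

Definition psi_term (a : R) (m : nat) : R :=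
  if (0 < m)%N then prime_weight psi_weight m * geom_ratio a m else 0.

Definition psi_series (a : R) : R := Series (psi_term a).

Definition psi_factor (a : R) (n : nat) : R := if prime n then / (1 - div_prob a n) else 1.

Lemma psi_weight_gt0 p : 0 < psi_weight p.
Proof. by apply: Rinv_0_lt_compat; have := pos_INR p; lra. Qed.

Lemma prime_weight_psi m : prime_weight psi_weight m = / INR (psi m).
Proof.
rewrite /psi INR_prod /prime_weight -rprod_inv; last by move=> p; apply: INR_gt0.
by apply: eq_bigr => p _; rewrite /psi_weight S_INR.
Qed.

Lemma Rpower_INR_muln (x : R) (p m : nat) : (0 < p)%N -> (0 < m)%N ->
  Rpower (INR (p * m)) x = Rpower (INR p) x * Rpower (INR m) x.
Proof. by move=> p_gt0 m_gt0; rewrite INR_muln Rpower_mult_distr //; apply: INR_gt0. Qed.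

Lemma Rpower_1_l x : Rpower 1 x = 1.
Proof. by rewrite /Rpower ln_1 Rmult_0_r exp_0. Qed.

Definition centered_ln (a : R) (m : nat) : R := ln (INR m) - G a.

Definition saddle_law (a : R) (m : nat) : R := psi_term a m / psi_series a.

Definition expectation (a : R) (h : R -> R) :=
  Series (fun m => saddle_law a m * h (centered_ln a m)).

Definition charf (a t : R) : C :=
  CSeries (fun m => (RtoC (saddle_law a m) * cis (t * centered_ln a m))%C).

Definition charf_factor (a t : R) (n : nat) : C :=
  if prime n then centered_mix (div_prob a n) (geom_ratio a n) (t * ln (INR n)) else RtoC 1.

Definition gain (a t : R) (n : nat) : R :=
  if prime n then mix_gain (div_prob a n) (geom_ratio a n) (t * ln (INR n)) else 0.

Section SaddleLaw.
Variable a : R.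
Hypothesis a_gt0 : 0 < a.

Lemma psi_term_ge0 m : 0 <= psi_term a m.
Proof.
rewrite /psi_term; case: ifP => _; last lra.
apply: Rmult_le_pos; last by left; exact: exp_pos.
by apply: prime_weight_ge0 => p; have := psi_weight_gt0 p; lra.
Qed.

Lemma geom_ratio1 : geom_ratio a 1 = 1.
Proof. by rewrite /geom_ratio INR_1 Rpower_1_l. Qed.

Lemma geom_ratioM p m : prime p -> (0 < m)%N ->
  geom_ratio a (p * m) = geom_ratio a p * geom_ratio a m.
Proof. by move=> /prime_gt0 p_gt0 m_gt0; exact: Rpower_INR_muln. Qed.

Lemma psi_factor_div_prob n : prime n ->
  1 + psi_weight n * (geom_ratio a n / (1 - geom_ratio a n)) = / (1 - div_prob a n).
Proof.
move=> n_prime; have p_ge2 := INR_prime_ge2 n_prime.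
have pow_gt1 := Rpower_prime_sub1_gt0 a_gt0 n_prime.
rewrite /psi_weight /div_prob geom_ratio_inv; set u := Rpower (INR n) a in pow_gt1 *.
by field; repeat split; nra.
Qed.

Lemma psi_euler_factorE n : euler_factor psi_weight (geom_ratio a) n = psi_factor a n.
Proof. by rewrite /euler_factor /psi_factor; case: ifP => // /psi_factor_div_prob ->. Qed.

Lemma psi_factor_ge1 n : 1 <= psi_factor a n.
Proof.
rewrite /psi_factor; case: ifP => n_prime; last lra.
have [q_gt0 q_lt1] := div_prob_bounds a_gt0 n_prime; rewrite -{1}Rinv_1.
by apply: Rinv_le_contravar; lra.
Qed.

Lemma psi_factor_le n : psi_factor a n <= exp (/ a * inv_plogp n).
Proof.
rewrite /psi_factor /inv_plogp; case: ifP => n_prime; last by rewrite Rmult_0_r exp_0; lra.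
rewrite -psi_factor_div_prob //; apply: Rle_trans (exp_ineq1_le _); apply: Rplus_le_compat_l.
have p_ge2 := INR_prime_ge2 n_prime.
have pow_gt1 := Rpower_prime_sub1_gt0 a_gt0 n_prime.
have a_lnp_gt0 := a_ln_prime_gt0 a_gt0 n_prime.
have pow_ge : a * ln (INR n) <= Rpower (INR n) a - 1.
  by rewrite /Rpower; have := exp_ineq1_le (a * ln (INR n)); lra.
rewrite /psi_weight geom_ratio_inv; set u := Rpower (INR n) a in pow_gt1 pow_ge *.
have -> : / (INR n + 1) * (/ u / (1 - / u)) = / ((INR n + 1) * (u - 1)).
  by field; repeat split; lra.
rewrite -Rinv_mult; apply: Rinv_le_contravar; nra.
Qed.

Lemma rsum_psi_term_le N : \rsum_(0 <= m < N) psi_term a m <= exp (/ a * 83).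
Proof.
case: N => [|N]; first by rewrite big_geq //; left; exact: exp_pos.
rewrite big_ltn // {1}/psi_term Rplus_0_l.
have -> : \rsum_(1 <= m < N.+1) psi_term a m =
    \rsum_(1 <= m < N.+1) (prime_weight psi_weight m * geom_ratio a m).
  by apply: eq_big_seq => m; rewrite mem_index_iota /psi_term => /andP [-> _].
apply: Rle_trans (rsum_le_euler_prod _ _ geom_ratio1 geom_ratioM _ N.+1) _.
- by move=> p; have := psi_weight_gt0 p; lra.
- by move=> m; left; exact: exp_pos.
- by move=> p p_prime; have := geom_ratio_bounds a_gt0 p_prime; lra.
apply: (@Rle_trans _ (exp (\rsum_(0 <= n < N.+1) (/ a * inv_plogp n)))).
  apply: rprod_le_exp => n _; rewrite psi_euler_factorE.
  by split; [have := psi_factor_ge1 n; lra | exact: psi_factor_le].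
apply: exp_le; rewrite -big_distrr /=; apply: Rmult_le_compat_l; last exact: rsum_inv_plogp_le.
by left; exact: Rinv_0_lt_compat.
Qed.

Lemma ex_series_psi_term : ex_series (psi_term a).
Proof. exact: (proj1 (ex_series_nneg_bounded psi_term_ge0 rsum_psi_term_le)). Qed.

Lemma psi_series_ge1 : 1 <= psi_series a.
Proof.
have := rsum_le_Series 2 psi_term_ge0 ex_series_psi_term.
by rewrite big_ltn // big_nat1 {1 2}/psi_term /= prime_weight1 geom_ratio1 /psi_series; lra.
Qed.

Lemma psi_euler_product :
  is_lim_seq (fun k => \rprod_(0 <= n < k) psi_factor a n) (psi_series a).
Proof.
apply: (is_lim_seq_ext (fun k => \rprod_(0 <= n < k) euler_factor psi_weight (geom_ratio a) n)).
  by move=> k; apply: eq_bigr => n _; exact: psi_euler_factorE.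
apply: euler_product geom_ratio1 geom_ratioM _ _.
- by move=> m; left; exact: exp_pos.
- by move=> p p_prime; have := geom_ratio_bounds a_gt0 p_prime; lra.
apply: (ex_series_ext (psi_term a)) ex_series_psi_term => m.
by rewrite Rabs_pos_eq //; exact: psi_term_ge0.
Qed.

Lemma rprod_psi_factor_le N : \rprod_(0 <= n < N) psi_factor a n <= psi_series a.
Proof.
apply: is_lim_seq_lb psi_euler_product.
exists N => n N_le_n; rewrite (@big_cat_nat _ _ _ N 0 n) //=.
have prod_ge1 s : 1 <= \rprod_(i <- s) psi_factor a i.
  elim: s => [|i s IH]; first by rewrite big_nil; lra.
  by rewrite big_cons; have := psi_factor_ge1 i; nra.
by have := prod_ge1 (index_iota 0 N); have := prod_ge1 (index_iota N n); nra.
Qed.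

Definition Cpower (t : R) (m : nat) : C := (RtoC (geom_ratio a m) * cis (t * ln (INR m)))%C.

Lemma CpowerM t p m : prime p -> (0 < m)%N -> Cpower t (p * m) = (Cpower t p * Cpower t m)%C.
Proof.
move=> p_prime m_gt0; have p_gt0 := prime_gt0 p_prime; rewrite /Cpower geom_ratioM // INR_muln.
rewrite ln_mult; [|exact: INR_gt0|exact: INR_gt0].
by rewrite Rmult_plus_distr_l cisD RtoC_mult; ring.
Qed.

Lemma rough_Cterm_psi t m :
  rough_Cterm psi_weight (Cpower t) 0 m = (RtoC (psi_term a m) * cis (t * ln (INR m)))%C.
Proof.
rewrite /rough_Cterm rough0 andbT /psi_term; case: ifP => _; last by ring.
by rewrite /Cpower RtoC_mult; ring.
Qed.

Lemma rough_Cterm_psi_summable t : Csummable (rough_Cterm psi_weight (Cpower t) 0).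
Proof.
apply: (ex_series_ext (psi_term a)) ex_series_psi_term => m.
by rewrite rough_Cterm_psi Cmod_mult Cmod_cis Cmod_R Rabs_pos_eq ?Rmult_1_r //; exact: psi_term_ge0.
Qed.

Lemma psi_Ceuler_product t :
  Clim (fun k => \cprod_(0 <= n < k) Ceuler_factor psi_weight (Cpower t) n)
       (CSeries (rough_Cterm psi_weight (Cpower t) 0)).
Proof.
apply: Ceuler_product (CpowerM t) _ (rough_Cterm_psi_summable t).
  by rewrite /Cpower geom_ratio1 INR_1 ln_1 Rmult_0_r cis0; ring.
move=> p p_prime; rewrite /Cpower Cmod_mult Cmod_cis Cmod_R Rmult_1_r.
by have := geom_ratio_bounds a_gt0 p_prime => r_bounds; rewrite Rabs_pos_eq; lra.
Qed.

Lemma geom_mix_euler t n : prime n ->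
  geom_mix (div_prob a n) (geom_ratio a n) (t * ln (INR n)) =
  (RtoC (/ psi_factor a n) * Ceuler_factor psi_weight (Cpower t) n)%C.
Proof.
move=> n_prime; rewrite /Ceuler_factor /Cpower /psi_factor n_prime Rinv_inv.
have r_bounds := geom_ratio_bounds a_gt0 n_prime; have [q_gt0 q_lt1] := div_prob_bounds a_gt0 n_prime.
have p_ge2 := INR_prime_ge2 n_prime.
have den_gt0 := geom_den_gt0 (t * ln (INR n)) r_bounds.
have mixE : (1 - div_prob a n) * (/ (INR n + 1) * geom_ratio a n) =
    div_prob a n * (1 - geom_ratio a n).
  have := psi_factor_div_prob n_prime; rewrite /psi_weight => factorE.
  have -> : (1 - div_prob a n) * (/ (INR n + 1) * geom_ratio a n) =
      (1 - div_prob a n) * (1 - geom_ratio a n) *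
      (/ (INR n + 1) * (geom_ratio a n / (1 - geom_ratio a n))) by field; lra.
  have -> : / (INR n + 1) * (geom_ratio a n / (1 - geom_ratio a n)) = / (1 - div_prob a n) - 1 by lra.
  by field; lra.
rewrite geometric_series_cis // /geom_mix /geom_re /geom_im.
set q := div_prob a n in mixE q_lt1 *; set r := geom_ratio a n in mixE *.
set x := t * ln (INR n) in den_gt0 *; set D := geom_den r x in den_gt0 *.
rewrite /psi_weight /Cmult /Cplus /RtoC /=; congr (_, _).
  have -> : q * ((1 - r) * (cos x - r) / D) = (q * (1 - r)) * ((cos x - r) / D) by field; lra.
  by rewrite -mixE; field; lra.
have -> : q * ((1 - r) * sin x / D) = (q * (1 - r)) * (sin x / D) by field; lra.
by rewrite -mixE; field; lra.
Qed.

Lemma saddle_law_ge0 m : 0 <= saddle_law a m.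
Proof. by apply: Rdiv_le_0_compat; [exact: psi_term_ge0 | have := psi_series_ge1; lra]. Qed.

Lemma is_series_saddle_law : is_series (saddle_law a) 1.
Proof.
have -> : 1 = / psi_series a * psi_series a by have := psi_series_ge1 => H_ge1; field; lra.
apply: (is_series_ext (fun m => / psi_series a * psi_term a m)) => [m|].
  by rewrite /saddle_law /Rdiv Rmult_comm.
exact: is_series_scal_l (Series_correct _ ex_series_psi_term).
Qed.

Lemma ex_series_saddle_law : ex_series (saddle_law a).
Proof. by exists 1; exact: is_series_saddle_law. Qed.

Lemma ex_series_saddle_law_bounded (h : nat -> R) B : (forall m, Rabs (h m) <= B) ->
  ex_series (fun m => saddle_law a m * h m) /\
  Rabs (Series (fun m => saddle_law a m * h m)) <= B.
Proof.
move=> h_le.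
have sum_B : is_series (fun m => B * saddle_law a m) B.
  by rewrite -{2}[B]Rmult_1_r; exact: is_series_scal_l is_series_saddle_law.
have le_B m : Rabs (saddle_law a m * h m) <= B * saddle_law a m.
  have law_ge0 := saddle_law_ge0 m; rewrite Rabs_mult (Rabs_pos_eq (saddle_law a m)) // Rmult_comm.
  by apply: Rmult_le_compat_r.
have [summable Series_le] := series_dominated le_B (ex_intro _ _ sum_B); split=> //.
by rewrite -(is_series_unique _ _ sum_B).
Qed.

Lemma charf_euler_product t : Clim (fun k => \cprod_(0 <= n < k) charf_factor a t n) (charf a t).
Proof.
have H_ge1 := psi_series_ge1.
have -> : charf a t = (RtoC (/ psi_series a) * cis (- (t * G a))
    * CSeries (rough_Cterm psi_weight (Cpower t) 0))%C.
  rewrite -CSeries_scal; last exact: rough_Cterm_psi_summable.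
  apply: CSeries_ext => m; rewrite rough_Cterm_psi /saddle_law /Rdiv RtoC_mult /centered_ln.
  have -> : t * (ln (INR m) - G a) = - (t * G a) + t * ln (INR m) by ring.
  by rewrite cisD; ring.
have lim_norm : Clim (fun k => RtoC (/ \rprod_(0 <= n < k) psi_factor a n)) (RtoC (/ psi_series a)).
  by apply: Clim_RtoC; have := @is_lim_seq_inv _ _ psi_euler_product; apply; case; lra.
have lim_phase : Clim (fun k => cis (- (t * \rsum_(0 <= n < k) G_term a n))) (cis (- (t * G a))).
  apply: Clim_cis; rewrite G_Series //.
  have lim_G := is_lim_seq_scal_l _ (- t) _ (is_lim_seq_rsum (ex_series_G_term a_gt0)).
  have -> : - (t * Series (G_term a)) = - t * Series (G_term a) by ring.
  by apply: is_lim_seq_ext lim_G => k /=; ring.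
apply: Clim_ext (Clim_mult (Clim_mult lim_norm lim_phase) (psi_Ceuler_product t)) => k.
elim: k => [|k IH].
  by rewrite !big_geq // Rinv_1 Rmult_0_r Ropp_0 cis0; ring.
rewrite ![in RHS]big_nat_recr //= -IH ![in LHS]big_nat_recr //= Rinv_mult.
set A := \rprod_(0 <= n < k) _; set B := \rsum_(0 <= n < k) _; set D := \cprod_(0 <= n < k) _.
have -> : - (t * (B + G_term a k)) = - (t * B) + - (t * G_term a k) by ring.
rewrite cisD RtoC_mult /charf_factor /G_term; case: ifP => k_prime; last first.
  by rewrite /psi_factor /Ceuler_factor k_prime Rinv_1 Rmult_0_r Ropp_0 cis0; ring.
rewrite /centered_mix (geom_mix_euler t k_prime) -/(geom_mean a k).
have -> : - (div_prob a k * (geom_mean a k * (t * ln (INR k)))) = - (t * log_mean a k).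
  by rewrite /log_mean; ring.
ring.
Qed.

Lemma gain_bounds t n : 0 <= gain a t n <= 1.
Proof.
rewrite /gain; case: ifP => n_prime; last lra.
by apply: mix_gain_bounds; [exact: div_prob_bounds | exact: geom_ratio_bounds].
Qed.

Lemma Cmod_charf_factor_le t n : Cmod (charf_factor a t n) <= exp (- gain a t n / 2).
Proof.
rewrite /charf_factor /gain; case: ifP => n_prime.
  rewrite Cmod_centered_mix.
  by apply: Cmod_geom_mix_le; [exact: div_prob_bounds | exact: geom_ratio_bounds].
by rewrite Cmod_1 Ropp_0 /Rdiv Rmult_0_l exp_0; lra.
Qed.

Lemma rsum_opp_half (g : nat -> R) k :
  \rsum_(0 <= n < k) (- g n / 2) = - (\rsum_(0 <= n < k) g n) / 2.
Proof.
have -> : - (\rsum_(0 <= n < k) g n) / 2 = - (1 / 2) * \rsum_(0 <= n < k) g n by field.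
by rewrite big_distrr; apply: eq_bigr => n _ /=; field.
Qed.

Lemma Cmod_cprod_le_exp (z : nat -> C) (g : nat -> R) k :
  (forall n, Cmod (z n) <= exp (- g n / 2)) ->
  Cmod (\cprod_(0 <= n < k) z n) <= exp (- (\rsum_(0 <= n < k) g n) / 2).
Proof.
move=> z_le; rewrite Cmod_cprod -rsum_opp_half.
by apply: rprod_le_exp => n _; split; [exact: Cmod_ge_0 |].
Qed.

Lemma Cmod_charf_le t g :
  (exists K, forall k, (K <= k)%N -> g <= \rsum_(0 <= n < k) gain a t n) ->
  Cmod (charf a t) <= exp (- g / 2).
Proof.
move=> [K g_le]; apply: Clim_Cmod_le (charf_euler_product t) _; exists K => k /g_le g_le_k.
by apply: Rle_trans (Cmod_cprod_le_exp k (Cmod_charf_factor_le t)) _; apply: exp_le; lra.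
Qed.

Lemma Rabs_rprod_Re_le (z : nat -> C) (g : nat -> R) k :
  (forall n, Cmod (z n) <= exp (- g n / 2)) ->
  Rabs (\rprod_(0 <= n < k) fst (z n)) <= exp (- (\rsum_(0 <= n < k) g n) / 2).
Proof.
move=> z_le; rewrite -rsum_opp_half (big_morph Rabs Rabs_mult Rabs_R1).
by apply: rprod_le_exp => n _; split; [exact: Rabs_pos | exact: Rle_trans (Rabs_fst_Cmod _) (z_le n)].
Qed.

Lemma Cmod_cprod_sub_Re_le (z : nat -> C) (g : nat -> R) k :
  (forall n, 0 <= g n <= 1) -> (forall n, Cmod (z n) <= exp (- g n / 2)) ->
  Cmod (\cprod_(0 <= n < k) z n - RtoC (\rprod_(0 <= n < k) fst (z n)))%C <=
  exp (1 / 2) * (\rsum_(0 <= n < k) Rabs (snd (z n))) * exp (- (\rsum_(0 <= n < k) g n) / 2).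
Proof.
move=> g_bounds z_le; elim: k => [|k IH].
  rewrite !big_geq // /Cminus Cplus_opp_r Cmod_0 Rmult_0_r Rmult_0_l; lra.
have re_le := Rabs_rprod_Re_le k z_le.
rewrite !big_nat_recr //=.
set A := \cprod_(0 <= n < k) _ in IH *; set B := \rprod_(0 <= n < k) _ in IH re_le *.
set S := \rsum_(0 <= n < k) _ in IH *; set s := \rsum_(0 <= n < k) _ in IH re_le *.
have -> : (A * z k - RtoC (B * fst (z k)) = (A - RtoC B) * z k + RtoC B * (z k - RtoC (fst (z k))))%C.
  by rewrite RtoC_mult; ring.
apply: Rle_trans (Cmod_triangle _ _) _; rewrite !Cmod_mult Cmod_R.
have -> : Cmod (z k - RtoC (fst (z k)))%C = Rabs (snd (z k)).
  rewrite /Cmod /Cminus /Cplus /Copp /RtoC [fst _]/= [snd _]/=.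
  have -> : (fst (z k) + - fst (z k)) ^ 2 + (snd (z k) + - 0) ^ 2 = Rsqr (snd (z k)).
    by rewrite /Rsqr; ring.
  exact: sqrt_Rsqr_abs.
have -> : - (s + g k) / 2 = - s / 2 + - g k / 2 by field.
rewrite exp_plus; have exp_s := exp_pos (- s / 2).
have exp_ge1 : 1 <= exp (1 / 2) * exp (- g k / 2).
  by rewrite -exp_plus; have := exp_ineq1_le (1 / 2 + - g k / 2); have := g_bounds k; lra.
have first_term : Cmod (A - RtoC B)%C * Cmod (z k) <=
    exp (1 / 2) * S * exp (- s / 2) * exp (- g k / 2).
  by apply: Rmult_le_compat => //; exact: Cmod_ge_0.
have second_term : Rabs B * Rabs (snd (z k)) <=
    exp (- s / 2) * Rabs (snd (z k)) * (exp (1 / 2) * exp (- g k / 2)).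
  apply: (@Rle_trans _ (exp (- s / 2) * Rabs (snd (z k)))).
    by apply: Rmult_le_compat_r => //; exact: Rabs_pos.
  by have := Rmult_le_pos _ _ (Rlt_le _ _ exp_s) (Rabs_pos (snd (z k))); nra.
lra.
Qed.

Lemma charf_re_im_bounds t g I P :
  (exists K, forall k, (K <= k)%N -> g <= \rsum_(0 <= n < k) gain a t n) ->
  (forall k, \rsum_(0 <= n < k) Rabs (snd (charf_factor a t n)) <= I) ->
  (forall k, P <= \rprod_(0 <= n < k) fst (charf_factor a t n)) ->
  Rabs (snd (charf a t)) <= exp (1 / 2) * I * exp (- g / 2) /\
  P - exp (1 / 2) * I * exp (- g / 2) <= fst (charf a t).
Proof.
move=> [K g_le] im_le re_ge; set err := exp (1 / 2) * I * exp (- g / 2).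
have near k : (K <= k)%N -> Cmod (\cprod_(0 <= n < k) charf_factor a t n
    - RtoC (\rprod_(0 <= n < k) fst (charf_factor a t n)))%C <= err.
  move=> /g_le g_le_k.
  apply: Rle_trans (Cmod_cprod_sub_Re_le k (gain_bounds t) (Cmod_charf_factor_le t)) _.
  have exp_half := exp_pos (1 / 2).
  apply: Rmult_le_compat.
  - by apply: Rmult_le_pos; [lra | apply: rsum_nat_ge0 => i _; exact: Rabs_pos].
  - by left; exact: exp_pos.
  - by apply: Rmult_le_compat_l; [lra | exact: im_le].
  - by apply: exp_le; lra.
have im_near k : (K <= k)%N -> - err <= snd (\cprod_(0 <= n < k) charf_factor a t n) <= err.
  move=> /near near_k; have := Rle_trans _ _ _ (Rabs_snd_Cmod _) near_k.
  by rewrite [snd _]/= Ropp_0 Rplus_0_r => /Rabs_le_between.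
split.
  apply: Rabs_le; split.
    by apply: is_lim_seq_lb (Clim_snd (charf_euler_product t)); exists K => k /im_near [].
  by apply: is_lim_seq_ub (Clim_snd (charf_euler_product t)); exists K => k /im_near [].
apply: is_lim_seq_lb (Clim_fst (charf_euler_product t)); exists K => k /near near_k.
have := Rle_trans _ _ _ (Rabs_fst_Cmod _) near_k; rewrite [fst _]/=.
by move/Rabs_le_between; have := re_ge k; lra.
Qed.

End SaddleLaw.

(** * Sieving by pairwise coprime moduli *)

Definition avoids (D : seq nat) (l : nat) : bool := all (fun d => ~~ (d %| l)%N) D.

Definition sifted_count (D : seq nat) (M : nat) : R :=
  \rsum_(1 <= l < M.+1) (if avoids D l then 1 else 0).

Lemma sifted_count_nil M : sifted_count [::] M = INR M.
Proof. by rewrite /sifted_count /= rsum_const size_iota subn1 /= Rmult_1_r. Qed.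

Lemma sifted_count_cons d D M : (1 < d)%N -> all (coprime d) D ->
  sifted_count (d :: D) M = sifted_count D M - sifted_count D (M %/ d).
Proof.
move=> d_gt1 coprime_d; rewrite /sifted_count.
have -> : \rsum_(1 <= l < (M %/ d).+1) (if avoids D l then 1 else 0) =
  \rsum_(1 <= l < M.+1) (if (d %| l)%N then (if avoids D l then 1 else 0) else 0).
  rewrite rsum_multiples_upto; last by lia.
  apply: eq_bigr => l _; have -> // : avoids D (d * l) = avoids D l.
  apply: eq_in_all => e e_D; rewrite Gauss_dvdr // coprime_sym.
  by move/allP: coprime_d => /(_ e e_D).
rewrite rsumB; apply: eq_bigr => l _ /=.
by case: (d %| l)%N; case: (avoids D l) => /=; lra.
Qed.

Lemma sifted_count_bounds D M : 0 <= sifted_count D M <= INR M.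
Proof.
split; first by apply: rsum_nat_ge0 => l _; case: ifP; lra.
by rewrite -sifted_count_nil; apply: rsum_nat_le => l _ /=; case: ifP; lra.
Qed.

Definition pow34 (Z : R) := sqrt Z * sqrt (sqrt Z).

Lemma pow34_ge0 Z : 0 <= pow34 Z.
Proof. by apply: Rmult_le_pos; exact: sqrt_pos. Qed.

Lemma pow34_div Z d : 0 <= Z -> 0 < d -> pow34 (Z / d) = pow34 Z / pow34 d.
Proof.
move=> Z_ge0 d_gt0; have sqrtd_gt0 := sqrt_lt_R0 _ d_gt0.
have sqrt4d_gt0 := sqrt_lt_R0 _ sqrtd_gt0.
by rewrite /pow34 sqrt_div_alt // sqrt_div_alt //; field; lra.
Qed.

Lemma pow34_ge1 d : 1 <= d -> 1 <= pow34 d.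
Proof.
move=> d_ge1; have sqrtd_ge1 : 1 <= sqrt d by rewrite -sqrt_1; apply: sqrt_le_1_alt.
have sqrt4d_ge1 : 1 <= sqrt (sqrt d) by rewrite -{1}sqrt_1; apply: sqrt_le_1_alt.
rewrite /pow34; nra.
Qed.

Lemma pow34_ge_id Z : 0 <= Z <= 1 -> Z <= pow34 Z.
Proof.
move=> [Z_ge0 Z_le1]; have sqrtZ_ge0 := sqrt_pos Z; have sqrtZ_sq := sqrt_sqrt Z Z_ge0.
have sqrt4Z_ge0 := sqrt_pos (sqrt Z); have sqrt4Z_sq := sqrt_sqrt (sqrt Z) sqrtZ_ge0.
have sqrtZ_le1 : sqrt Z <= 1 by nra.
by rewrite /pow34 -{1}sqrtZ_sq; apply: Rmult_le_compat_l => //; nra.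
Qed.

Lemma pow34E Z : 0 < Z -> pow34 Z = exp (3 / 4 * ln Z).
Proof.
have sqrt_exp u : 0 < u -> sqrt u = exp (ln u / 2).
  by move=> u_gt0; rewrite -Rpower_sqrt // /Rpower; congr exp; lra.
move=> Z_gt0; rewrite /pow34 (sqrt_exp Z) // (sqrt_exp (exp _)); last exact: exp_pos.
by rewrite ln_exp -exp_plus; congr exp; field.
Qed.

Lemma floorn_err_le Z : 0 <= Z -> Rabs (INR (floorn Z) - Z) <= pow34 Z.
Proof.
move=> Z_ge0; have [floor_le lt_floor] := floorn_bounds Z_ge0.
have floor_ge0 := pos_INR (floorn Z); rewrite Rabs_left1; last lra.
by case: (Rle_lt_dec 1 Z) => Z_cases; [have := pow34_ge1 Z_cases | have := @pow34_ge_id Z]; lra.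
Qed.

Lemma sieve_error_le D Z : all (ltn 1%N) D -> pairwise coprime D -> 0 <= Z ->
  Rabs (sifted_count D (floorn Z) - Z * \rprod_(d <- D) (1 - / INR d)) <=
  pow34 Z * \rprod_(d <- D) (1 + / pow34 (INR d)).
Proof.
elim: D Z => [|d D IH] Z.
  by move=> _ _ Z_ge0; rewrite !big_nil !Rmult_1_r sifted_count_nil; exact: floorn_err_le.
move=> /= /andP [d_gt1 D_gt1] /andP [coprime_d coprime_D] Z_ge0.
rewrite sifted_count_cons // !big_cons.
have d_ge2 : 2 <= INR d by apply: INR_ge2.
have Zd_ge0 : 0 <= Z / INR d by apply: Rdiv_le_0_compat; lra.
rewrite -floorn_div //; last by lia.
have errZ := IH Z D_gt1 coprime_D Z_ge0; have errZd := IH _ D_gt1 coprime_D Zd_ge0.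
rewrite pow34_div // in errZd; last lra.
set A := \rprod_(j <- D) _ in errZ errZd *; set B := \rprod_(j <- D) _ in errZ errZd *.
have pow34d_ge1 := @pow34_ge1 (INR d) ltac:(lra).
have -> : sifted_count D (floorn Z) - sifted_count D (floorn (Z / INR d)) - Z * ((1 - / INR d) * A) =
  (sifted_count D (floorn Z) - Z * A) + - (sifted_count D (floorn (Z / INR d)) - Z / INR d * A).
  by field; lra.
apply: Rle_trans (Rabs_triang _ _) _; rewrite Rabs_Ropp.
have -> : pow34 Z * ((1 + / pow34 (INR d)) * B) = pow34 Z * B + pow34 Z / pow34 (INR d) * B.
  by field; lra.
lra.
Qed.

(** * The value of the sum of inverse squares *)

Lemma inv_sq_sin_bounds x : 0 < x < PI / 2 ->
  / (sin x) ^ 2 - 1 <= / x ^ 2 <= / (sin x) ^ 2.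
Proof.
move=> [x_gt0 x_lt].
have sin_pos : 0 < sin x by apply: sin_gt_0; have := PI_RGT_0; lra.
have cos_pos : 0 < cos x by apply: cos_gt_0; lra.
have sin_x_le := sin_le (Rlt_le _ _ x_gt0).
have x_cos_le := @x_cos_le_sin x ltac:(lra).
have x2_gt0 : 0 < x ^ 2 by apply: pow_lt.
have sin2_gt0 : 0 < (sin x) ^ 2 by apply: pow_lt.
have sin2_cos2_x := sin2_cos2 x; rewrite /Rsqr in sin2_cos2_x.
split; last by apply: Rinv_le_contravar => //; apply: pow_incr; lra.
have -> : / sin x ^ 2 - 1 = (cos x) ^ 2 / sin x ^ 2.
  have -> : cos x ^ 2 = 1 - sin x ^ 2 by rewrite -sin2_cos2_x; ring.
  by field; lra.
apply: Rdiv_le_intro => //.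
have -> : / x ^ 2 * sin x ^ 2 = sin x ^ 2 / x ^ 2 by rewrite /Rdiv Rmult_comm.
apply: Rle_div_intro => //.
by rewrite -Rpow_mult_distr Rmult_comm; apply: pow_incr; nra.
Qed.

(* Hofbauer's proof: the sum of [1 / sin ^ 2] over the angles below is explicit. *)
Definition hofbauer_angle (n k : nat) := INR (2 * k + 1) * PI / 2 ^ (n + 2).

Lemma hofbauer_angle_bounds n k : (k < 2 ^ n)%N -> 0 < hofbauer_angle n k < PI / 2.
Proof.
move=> k_lt; have PI_gt0 := PI_RGT_0; rewrite /hofbauer_angle.
have pow2_gt0 : 0 < 2 ^ (n + 2) by apply: pow_lt; lra.
have odd_gt0 : 0 < INR (2 * k + 1) by apply: INR_gt0; lia.
split; first by apply: Rdiv_lt_0_compat => //; apply: Rmult_lt_0_compat.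
apply/Rlt_div_l => //.
have -> : PI / 2 * 2 ^ (n + 2) = 2 ^ (n + 1) * PI by rewrite !pow_add /pow; field.
apply: Rmult_lt_compat_r => //.
have -> : 2 ^ (n + 1) = INR (2 ^ (n + 1)) by rewrite INR_expn INR_2.
by apply: ltn_INR; rewrite expnD expn1; lia.
Qed.

Lemma hofbauer_angle_half n k : hofbauer_angle n k / 2 = hofbauer_angle n.+1 k.
Proof.
rewrite /hofbauer_angle; have -> : 2 ^ (n.+1 + 2) = 2 * 2 ^ (n + 2) by [].
by field; apply: pow_nonzero; lra.
Qed.

Lemma hofbauer_angle_reflect n k : (k < 2 ^ n)%N ->
  hofbauer_angle n.+1 (2 ^ n - k.+1 + 2 ^ n) = (PI - hofbauer_angle n k) / 2.
Proof.
move=> k_lt; rewrite /hofbauer_angle.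
have -> : INR (2 * (2 ^ n - k.+1 + 2 ^ n) + 1) = 2 ^ (n + 2) - INR (2 * k + 1).
  have -> : 2 ^ (n + 2) = INR (2 ^ (n + 2)) by rewrite INR_expn INR_2.
  rewrite -minus_INR; last by rewrite expnD; lia.
  by congr INR; rewrite expnD; lia.
have -> : 2 ^ (n.+1 + 2) = 2 * 2 ^ (n + 2) by [].
by field; apply: pow_nonzero; lra.
Qed.

Lemma inv_sq_sin_double x : 0 < x < PI / 2 ->
  / (sin x) ^ 2 = / 4 * (/ (sin (x / 2)) ^ 2 + / (sin ((PI - x) / 2)) ^ 2).
Proof.
move=> [x_gt0 x_lt].
have -> : sin ((PI - x) / 2) = cos (x / 2) by rewrite -cos_shift; congr cos; field.
have -> : sin x = 2 * sin (x / 2) * cos (x / 2) by rewrite -sin_2a; congr sin; field.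
have sin_pos : 0 < sin (x / 2) by apply: sin_gt_0; lra.
have cos_pos : 0 < cos (x / 2) by apply: cos_gt_0; lra.
have sin2_cos2_half := sin2_cos2 (x / 2); rewrite /Rsqr in sin2_cos2_half.
have -> : / 4 * (/ sin (x / 2) ^ 2 + / cos (x / 2) ^ 2) =
    (sin (x / 2) * sin (x / 2) + cos (x / 2) * cos (x / 2))
    / (4 * (sin (x / 2) ^ 2 * cos (x / 2) ^ 2)) by field; lra.
by rewrite sin2_cos2_half; field; lra.
Qed.

Lemma rsum_inv_sq_sin n :
  \rsum_(0 <= k < (2 ^ n)%N) / (sin (hofbauer_angle n k)) ^ 2 = 2 * 4 ^ n.
Proof.
elim: n => [|n IH].
  rewrite big_nat1 /hofbauer_angle -[INR _]/(INR 1) INR_1.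
  have -> : 1 * PI / 2 ^ (0 + 2) = PI / 4 by rewrite /pow /=; field.
  have sqrt2_gt0 : 0 < sqrt 2 by apply: sqrt_lt_R0; lra.
  rewrite sin_PI4 -[4 ^ 0]/1.
  have -> : (1 / sqrt 2) ^ 2 = / (sqrt 2 * sqrt 2) by field; lra.
  by rewrite sqrt_sqrt; lra.
have -> : (2 ^ n.+1 = 2 ^ n + 2 ^ n)%N by rewrite expnS; lia.
rewrite (@big_cat_nat _ _ _ (2 ^ n)%N) //=; last by lia.
have -> : \rsum_(2 ^ n <= k < 2 ^ n + 2 ^ n) / (sin (hofbauer_angle n.+1 k)) ^ 2 =
  \rsum_(0 <= k < (2 ^ n)%N) / (sin ((PI - hofbauer_angle n k) / 2)) ^ 2.
  rewrite -{1}[(2 ^ n)%N]add0n big_addn addnK big_nat_rev /= add0n.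
  apply: eq_big_seq => k; rewrite mem_index_iota => /andP [_ k_lt].
  by rewrite hofbauer_angle_reflect.
rewrite -big_split /= -[4 ^ n.+1]/(4 * 4 ^ n).
have -> : 2 * (4 * 4 ^ n) = 4 * (2 * 4 ^ n) by ring.
rewrite -IH big_distrr /=; apply: eq_big_seq => k; rewrite mem_index_iota => /andP [_ k_lt].
by rewrite (inv_sq_sin_double (hofbauer_angle_bounds k_lt)) hofbauer_angle_half; lra.
Qed.

Lemma rsum_inv_odd_sq_bounds n :
  PI ^ 2 / 16 * (2 - / 2 ^ n) <= \rsum_(0 <= k < (2 ^ n)%N) / (INR (2 * k + 1)) ^ 2 <= PI ^ 2 / 8.
Proof.
have PI_gt0 := PI_RGT_0; have PI2_gt0 : 0 < PI ^ 2 by apply: pow_lt.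
have pow2_gt0 : 0 < 2 ^ n by apply: pow_lt; lra.
have pow4_gt0 : 0 < 4 ^ n by apply: pow_lt; lra.
have pow4E : 4 ^ n = 2 ^ n * 2 ^ n by rewrite -Rpow_mult_distr; congr (_ ^ _); ring.
set S := \rsum_(0 <= k < (2 ^ n)%N) / (INR (2 * k + 1)) ^ 2.
have angle_sum : \rsum_(0 <= k < (2 ^ n)%N) / (hofbauer_angle n k) ^ 2 = 16 * 4 ^ n / PI ^ 2 * S.
  rewrite /S big_distrr; apply: eq_bigr => k _ /=; rewrite /hofbauer_angle.
  have odd_gt0 : 0 < INR (2 * k + 1) by apply: INR_gt0; lia.
  by rewrite pow_add pow4E; field; lra.
have sum_le : \rsum_(0 <= k < (2 ^ n)%N) / (hofbauer_angle n k) ^ 2 <= 2 * 4 ^ n.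
  rewrite -rsum_inv_sq_sin; apply: rsum_nat_le => k /andP [_ k_lt].
  by have := inv_sq_sin_bounds (hofbauer_angle_bounds k_lt); lra.
have sum_ge : 2 * 4 ^ n - 2 ^ n <= \rsum_(0 <= k < (2 ^ n)%N) / (hofbauer_angle n k) ^ 2.
  have -> : 2 ^ n = \rsum_(0 <= k < (2 ^ n)%N) 1.
    by rewrite rsum_const size_iota subn0 INR_expn INR_2; ring.
  rewrite -rsum_inv_sq_sin rsumB; apply: rsum_nat_le => k /andP [_ k_lt].
  by have := inv_sq_sin_bounds (hofbauer_angle_bounds k_lt); lra.
rewrite angle_sum in sum_le sum_ge.
have factor_gt0 : 0 < 16 * 4 ^ n / PI ^ 2 by apply: Rdiv_lt_0_compat; lra.
split; apply: (Rmult_le_reg_l (16 * 4 ^ n / PI ^ 2)) => //.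
  by apply: Rle_trans sum_ge; rewrite pow4E; right; field; lra.
by apply: Rle_trans sum_le _; right; field; lra.
Qed.

Lemma inv_sq_ge0 m : 0 <= / INR m ^ 2.
Proof. by rewrite -pow_inv; apply: pow2_ge_0. Qed.

Lemma inv_sq0 : / INR 0 ^ 2 = 0.
Proof. by rewrite INR_0 pow_i ?Rinv_0 //; lia. Qed.

Lemma ex_series_inv_sq : ex_series (fun m => / INR m ^ 2).
Proof.
apply: (proj1 (@ex_series_nneg_bounded _ 2 inv_sq_ge0 _)) => N.
apply: (@Rle_trans _ (\rsum_(0 <= m < N + 2) / INR m ^ 2)).
  by apply: rsum_widen_le; [exact: inv_sq_ge0 | lia | lia].
rewrite big_ltn; last by lia.
rewrite big_ltn; last by lia.
have -> : \rsum_(2 <= i < N + 2) / INR i ^ 2 = \rsum_(2 <= i < N + 2) (/ INR i * / INR i).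
  by apply: eq_bigr => i _; rewrite -Rinv_mult /pow Rmult_1_r.
have := @rsum_inv_sq_le 2 (N + 2) isT; rewrite inv_sq0 INR_1 pow1 Rinv_1; lra.
Qed.

Lemma is_lim_rsum_inv_odd_sq :
  is_lim_seq (fun n => \rsum_(0 <= k < (2 ^ n)%N) / (INR (2 * k + 1)) ^ 2) (PI ^ 2 / 8).
Proof.
apply: (@is_lim_seq_le_le (fun n => PI ^ 2 / 16 * (2 - / 2 ^ n)) _ (fun _ => PI ^ 2 / 8)).
- exact: rsum_inv_odd_sq_bounds.
- have inv_pow2_lim : is_lim_seq (fun n => / 2 ^ n) 0.
    apply: (is_lim_seq_ext (fun n => (/ 2) ^ n)); first by move=> n; rewrite pow_inv.
    by apply: is_lim_seq_geom; rewrite Rabs_pos_eq; lra.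
  have -> : PI ^ 2 / 8 = PI ^ 2 / 16 * (2 - 0) by field.
  apply: is_lim_seq_mult'; first exact: is_lim_seq_const.
  by apply: is_lim_seq_minus' => //; exact: is_lim_seq_const.
- exact: is_lim_seq_const.
Qed.

Definition inv_odd_sq m := if (2 %| m)%N then 0 else / INR m ^ 2.

Lemma ex_series_inv_odd_sq : ex_series inv_odd_sq.
Proof.
apply: (proj1 (series_dominated _ ex_series_inv_sq)) => m; have inv_ge0 := inv_sq_ge0 m.
by rewrite /inv_odd_sq; case: ifP => _; rewrite ?Rabs_R0 // Rabs_pos_eq; lra.
Qed.

Lemma rsum_inv_odd_sq N :
  \rsum_(0 <= m < 2 * N) inv_odd_sq m = \rsum_(0 <= k < N) / (INR (2 * k + 1)) ^ 2.
Proof.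
elim: N => [|N IH]; first by rewrite muln0 !big_geq.
have -> : (2 * N.+1 = (2 * N).+2)%N by lia.
rewrite big_nat_recr //= big_nat_recr //= IH big_nat_recr //=.
rewrite /inv_odd_sq dvdn_mulr //.
have -> : (2 %| (2 * N).+1)%N = false by rewrite dvdn2 /= oddM.
by rewrite addn1; lra.
Qed.

Lemma Series_inv_odd_sq : Series inv_odd_sq = PI ^ 2 / 8.
Proof.
have lim_Series : is_lim_seq (fun n => \rsum_(0 <= m < 2 * 2 ^ n) inv_odd_sq m) (Series inv_odd_sq).
  apply: (is_lim_seq_subseq (fun N => \rsum_(0 <= m < N) inv_odd_sq m) _ (fun n => (2 * 2 ^ n)%N)).
    by apply: eventually_subseq => n; apply/ltP; rewrite expnS; have := expn_gt0 2 n; lia.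
  exact: is_lim_seq_rsum ex_series_inv_odd_sq.
have := is_lim_seq_unique _ _ lim_Series.
have -> : Lim_seq (fun n => \rsum_(0 <= m < 2 * 2 ^ n) inv_odd_sq m) = PI ^ 2 / 8.
  apply: is_lim_seq_unique; apply: is_lim_seq_ext is_lim_rsum_inv_odd_sq => n.
  by rewrite rsum_inv_odd_sq.
by case.
Qed.

Lemma Series_inv_sq : Series (fun m => / INR m ^ 2) = PI ^ 2 / 6.
Proof.
have summable := ex_series_inv_sq.
have abs_summable : ex_series (fun m => Rabs (/ INR m ^ 2)).
  by apply: ex_series_ext summable => m; rewrite Rabs_pos_eq //; exact: inv_sq_ge0.
have [even_summable evenE] := @Series_multiples 2 _ isT abs_summable.
have quarter : Series (fun m => / INR (2 * m) ^ 2) = / 4 * Series (fun m => / INR m ^ 2).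
  rewrite -Series_scal_l; apply: Series_ext => m.
  by rewrite INR_muln INR_2 Rpow_mult_distr Rinv_mult; congr (_ * _); rewrite /pow; lra.
have splitE : Series (fun m => / INR m ^ 2) =
    Series (fun m => if (2 %| m)%N then / INR m ^ 2 else 0) + Series inv_odd_sq.
  rewrite -Series_plus //; last exact: ex_series_inv_odd_sq.
  by apply: Series_ext => m; rewrite /inv_odd_sq; case: ifP => _; lra.
by rewrite Series_inv_odd_sq evenE quarter in splitE; lra.
Qed.

Lemma inv_prime_sq_bounds p : prime p -> 0 < / INR p ^ 2 < 1.
Proof.
move=> /INR_prime_ge2 p_ge2; split; first by apply: Rinv_0_lt_compat; apply: pow_lt; lra.
by rewrite -Rinv_1; apply: Rinv_lt_contravar; rewrite /pow; nra.
Qed.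

Lemma is_lim_prod_one_sub_inv_prime_sq : is_lim_seq
  (fun k => \rprod_(0 <= n < k) (if prime n then 1 - / (INR n) ^ 2 else 1)) (6 / PI ^ 2).
Proof.
have PI_gt0 := PI_RGT_0; have PI2_gt0 : 0 < PI ^ 2 by apply: pow_lt.
have termE m :
    (if (0 < m)%N then prime_weight (fun=> 1) m * / INR m ^ 2 else 0) = / INR m ^ 2.
  by case: m => [|m] /=; [rewrite inv_sq0 | rewrite /prime_weight big1 // Rmult_1_l].
have euler_lim : is_lim_seq
    (fun k => \rprod_(0 <= n < k) euler_factor (fun=> 1) (fun m => / INR m ^ 2) n) (PI ^ 2 / 6).
  rewrite -Series_inv_sq -(Series_ext _ _ termE); apply: euler_product.
  - exact: inv_sq_ge0.
  - by rewrite INR_1 pow1 Rinv_1.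
  - by move=> p m _ _; rewrite INR_muln Rpow_mult_distr Rinv_mult.
  - by move=> p p_prime; have := inv_prime_sq_bounds p_prime; lra.
  apply: ex_series_ext ex_series_inv_sq => m.
  by rewrite termE Rabs_pos_eq //; exact: inv_sq_ge0.
have -> : 6 / PI ^ 2 = / (PI ^ 2 / 6) by field; lra.
have inv_lim := @is_lim_seq_inv _ _ euler_lim ltac:(case; lra).
apply: is_lim_seq_ext inv_lim => k /=.
rewrite -rprod_inv => [|n].
  apply: eq_bigr => n _; rewrite /euler_factor; case: ifP => n_prime; last by rewrite Rinv_1.
  by have := inv_prime_sq_bounds n_prime; move: (/ INR n ^ 2) => u u_bounds; field; lra.
rewrite /euler_factor; case: ifP => n_prime; last lra.
have := inv_prime_sq_bounds n_prime; move: (/ INR n ^ 2) => u u_bounds.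
by have : 0 < u / (1 - u); [apply: Rdiv_lt_0_compat | ]; lra.
Qed.

(** * Integers with a given cofactor of the square-free kernel *)

Lemma prod_primes_gt0 s : all prime s -> (0 < \prod_(q <- s) q)%N.
Proof.
elim: s => [|q s IH] /=; first by rewrite big_nil.
by move=> /andP [q_prime s_prime]; rewrite big_cons muln_gt0 prime_gt0 // IH.
Qed.

Lemma rad_gt0 n : (0 < rad n)%N.
Proof. by apply: prod_primes_gt0; apply/allP => q; rewrite mem_primes => /andP []. Qed.

Lemma psi_gt0 n : 0 < INR (psi n).
Proof. by rewrite /psi INR_prod; apply: rprod_gt0 => p _; exact: INR_gt0. Qed.

Lemma rad_le_psi n : INR (rad n) <= INR (psi n).
Proof.
by rewrite /rad /psi !INR_prod; apply: rprod_le => p _; have := pos_INR p; rewrite S_INR; lra.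
Qed.

Lemma logn_prod_primes p s : all prime s -> logn p (\prod_(q <- s) q)%N = count_mem p s.
Proof.
elim: s => [|q s IH] /=; first by rewrite big_nil logn1.
move=> /andP [q_prime s_prime]; rewrite big_cons lognM ?prod_primes_gt0 //; last exact: prime_gt0.
by rewrite IH // logn_prime // eq_sym.
Qed.

Lemma logn_rad p n : logn p (rad n) = (p \in primes n).
Proof.
rewrite /rad logn_prod_primes; first by rewrite count_uniq_mem // primes_uniq.
by apply/allP => q; rewrite mem_primes => /andP [].
Qed.

Lemma mem_primes_rad p n : (p \in primes (rad n)) = (p \in primes n).
Proof. by rewrite -[LHS]logn_gt0 logn_rad lt0b. Qed.

Lemma dvdn_from_logn m n : (0 < m)%N -> (0 < n)%N ->
  (forall p, (logn p m <= logn p n)%N) -> (m %| n)%N.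
Proof.
move=> m_gt0 n_gt0 logn_le; apply/dvdn_partP => // p.
by rewrite -[p \in _]/(p \in primes m) mem_primes => /andP [pp _]; rewrite p_part pfactor_dvdn.
Qed.

Lemma rad_dvdM k j : (0 < k)%N -> (0 < j)%N -> (rad j %| rad (k * j))%N.
Proof.
move=> k_gt0 j_gt0; apply: dvdn_from_logn; rewrite ?rad_gt0 // => p.
by rewrite !logn_rad primesM //; case: (p \in primes j); rewrite ?orbT.
Qed.

Lemma rad_dvd n : (0 < n)%N -> (rad n %| n)%N.
Proof.
move=> n_gt0; apply: dvdn_from_logn; rewrite ?rad_gt0 // => p.
by rewrite logn_rad -logn_gt0; case: (logn p n).
Qed.

Definition kernel_modulus (j p : nat) : nat := (p ^ (if (p %| j)%N then 1 else 2))%N.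

Definition kernel_moduli (j N : nat) : seq nat :=
  [seq kernel_modulus j p | p <- [seq p <- index_iota 0 N.+1 | prime p]].

Lemma rad_eq_avoids j l N : (0 < j)%N -> (0 < l)%N -> (j <= N)%N -> (l <= N)%N ->
  (rad j * l == rad (rad j * l * j))%N = avoids (kernel_moduli j N) l.
Proof.
move=> j_gt0 l_gt0 j_le l_le; have rad_pos := rad_gt0 j.
have radl_gt0 : (0 < rad j * l)%N by rewrite muln_gt0 rad_pos.
apply/eqP/allP => [kernelE d /mapP [p]|no_modulus].
  rewrite mem_filter => /andP [p_prime _] ->; rewrite /kernel_modulus pfactor_dvdn // -ltnNge.
  have := congr1 (logn p) kernelE; rewrite lognM // !logn_rad !mem_primes p_prime j_gt0 /=.
  by case: (p %| j)%N => /=; case: (_ && _); lia.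
apply: eqn_from_log; rewrite ?rad_gt0 // => p.
rewrite lognM // !logn_rad !primesM // mem_primes_rad.
have logn_lt : prime p -> (p <= N)%N -> ((if (p %| j)%N then 1 else 2) > logn p l)%N.
  move=> p_prime p_le; rewrite ltnNge -pfactor_dvdn //; apply: (no_modulus (kernel_modulus j p)).
  by apply: map_f; rewrite mem_filter p_prime mem_index_iota.
case p_j: (p \in primes j) => /=.
  move: p_j; rewrite mem_primes => /and3P [p_prime _ p_dvd].
  by have := logn_lt p_prime (leq_trans (dvdn_leq j_gt0 p_dvd) j_le); rewrite p_dvd; lia.
rewrite orbF add0n -[p \in primes l]logn_gt0.
case: posnP => // p_l.
move: p_l p_j; rewrite logn_gt0 !mem_primes => /and3P [p_prime _ p_dvd].
rewrite p_prime j_gt0 /= => p_ndvd.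
have := logn_lt p_prime (leq_trans (dvdn_leq l_gt0 p_dvd) l_le).
have : (0 < logn p l)%N by rewrite logn_gt0 mem_primes p_prime l_gt0 p_dvd.
by rewrite p_ndvd; lia.
Qed.

(* [k = rad (k * j)] holds exactly when [k * j] has kernel [k] and cofactor [j]; then
   [k = rad j * l] with [l] square-free and coprime to [j]. *)
Definition kernel_count (j M : nat) : R :=
  \rsum_(1 <= k < M.+1) (if (k == rad (k * j))%N then 1 else 0).

Lemma kernel_count_sifted j M N : (0 < j)%N -> (j <= N)%N -> (M <= N)%N ->
  kernel_count j M = sifted_count (kernel_moduli j N) (M %/ rad j).
Proof.
move=> j_gt0 j_le M_le; have rad_pos := rad_gt0 j.
rewrite /sifted_count.
have -> : \rsum_(1 <= l < (M %/ rad j).+1) (if avoids (kernel_moduli j N) l then 1 else 0) =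
  \rsum_(1 <= l < (M %/ rad j).+1) (if (rad j * l == rad (rad j * l * j))%N then 1 else 0).
  apply: eq_big_seq => l; rewrite mem_index_iota => /andP [l_gt0 l_lt].
  by rewrite (@rad_eq_avoids j l N) //; have := leq_div M (rad j); lia.
rewrite -(rsum_multiples_upto M (fun k => if (k == rad (k * j))%N then 1 else 0) rad_pos).
apply: eq_big_seq => k; rewrite mem_index_iota => /andP [k_gt0 _].
by case: ifP => // /eqP kE; case: ifP => //; rewrite kE rad_dvdM.
Qed.

Lemma kernel_moduli_gt1 j N : all (ltn 1%N) (kernel_moduli j N).
Proof.
apply/allP => d /mapP [p]; rewrite mem_filter => /andP [p_prime _] ->.
by rewrite /kernel_modulus /=; case: ifP => _; have := prime_gt1 p_prime; rewrite ?expn1 //; nia.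
Qed.

Lemma pairwise_coprime_kernel_moduli j N : pairwise coprime (kernel_moduli j N).
Proof.
rewrite /kernel_moduli.
have : uniq [seq p <- index_iota 0 N.+1 | prime p] by rewrite filter_uniq // iota_uniq.
have : all prime [seq p <- index_iota 0 N.+1 | prime p] by apply: filter_all.
elim: [seq _ <- _ | _] => [//|p s IH] /= /andP [p_prime s_prime] /andP [p_s s_uniq].
rewrite IH // andbT; apply/allP => d /mapP [q q_s ->]; apply: coprimeXl; apply: coprimeXr.
have q_prime : prime q by move/allP: s_prime; apply.
rewrite prime_coprime // dvdn_prime2 //; apply/eqP => pq.
by move: p_s; rewrite pq q_s.
Qed.

Lemma rprod_kernel_moduli j N (f : nat -> R) :
  \rprod_(d <- kernel_moduli j N) f d =
  \rprod_(0 <= p < N.+1) (if prime p then f (kernel_modulus j p) else 1).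
Proof. by rewrite /kernel_moduli big_map big_filter big_mkcond. Qed.

Lemma rprod_primes (j N : nat) (f : nat -> R) : (0 < j)%N -> (j <= N)%N ->
  \rprod_(p <- primes j) f p = \rprod_(0 <= p < N.+1) (if prime p && (p %| j)%N then f p else 1).
Proof.
move=> j_gt0 j_le; rewrite -(big_mkcond (fun p => prime p && (p %| j)%N)) -[RHS]big_filter.
apply: perm_big; apply: uniq_perm; rewrite ?primes_uniq ?filter_uniq ?iota_uniq // => p.
rewrite mem_filter mem_primes j_gt0 /= mem_index_iota /=.
case: (prime p) => //=; case p_dvd: (p %| j)%N => //=.
by have := dvdn_leq j_gt0 p_dvd; lia.
Qed.

Lemma rprod_kernel_moduli_main j N : (0 < j)%N -> (j <= N)%N ->
  \rprod_(d <- kernel_moduli j N) (1 - / INR d) =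
  (\rprod_(0 <= n < N.+1) (if prime n then 1 - / INR n ^ 2 else 1)) * (INR (rad j) / INR (psi j)).
Proof.
move=> j_gt0 j_le; rewrite rprod_kernel_moduli /rad /psi !INR_prod /Rdiv -rprod_inv; last first.
  by move=> p; exact: INR_gt0.
rewrite -big_split /= (rprod_primes (fun p => INR p * / INR p.+1) j_gt0 j_le) -big_split /=.
apply: eq_bigr => p _; case p_prime: (prime p) => /=; last by lra.
have p_ge2 := INR_prime_ge2 p_prime.
rewrite /kernel_modulus; case: (p %| j)%N; rewrite INR_expn /pow; last by lra.
by rewrite S_INR; field; lra.
Qed.

Definition inv_prime_pow32 n := if prime n then / (INR n * sqrt (INR n)) else 0.

Lemma rsum_inv_prime_pow32_le N : \rsum_(0 <= n < N.+1) inv_prime_pow32 n <= 2.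
Proof.
case: N => [|N]; first by rewrite big_nat1 /inv_prime_pow32 /=; lra.
rewrite big_ltn // big_ltn // {1 2}/inv_prime_pow32 /= !Rplus_0_l.
apply: Rle_trans (rsum_inv_pow32_le N.+2); apply: rsum_nat_le => n /andP [n_ge2 _].
rewrite /inv_prime_pow32; case: ifP => _; first lra.
have INR_n_ge2 := INR_ge2 n_ge2; have sqrt_gt0 : 0 < sqrt (INR n) by apply: sqrt_lt_R0; lra.
by left; apply: Rinv_0_lt_compat; nra.
Qed.

Lemma kernel_modulus_err_le j p : prime p ->
  1 + / pow34 (INR (kernel_modulus j p)) <= exp (inv_prime_pow32 p) * (if (p %| j)%N then 2 else 1).
Proof.
move=> p_prime; rewrite /inv_prime_pow32 p_prime; have p_ge2 := INR_prime_ge2 p_prime.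
have sqrtp_gt0 : 0 < sqrt (INR p) by apply: sqrt_lt_R0; lra.
have inv_gt0 : 0 < / (INR p * sqrt (INR p)) by apply: Rinv_0_lt_compat; nra.
have exp_ge := exp_ineq1_le (/ (INR p * sqrt (INR p))).
rewrite /kernel_modulus; case: (p %| j)%N; rewrite ?expn1.
  have pow34_ge := @pow34_ge1 (INR p) ltac:(lra).
  have : / pow34 (INR p) <= 1 by rewrite -Rinv_1; apply: Rinv_le_contravar; lra.
  lra.
have -> : INR (p ^ 2) = INR p * INR p by rewrite INR_expn; ring.
by rewrite /pow34 sqrt_square; lra.
Qed.

Lemma rprod_kernel_moduli_err j N : (0 < j)%N -> (j <= N)%N ->
  \rprod_(d <- kernel_moduli j N) (1 + / pow34 (INR d)) <= 9 * \rprod_(p <- primes j) 2.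
Proof.
move=> j_gt0 j_le; rewrite rprod_kernel_moduli (rprod_primes (fun=> 2) j_gt0 j_le).
apply: (@Rle_trans _ (\rprod_(0 <= p < N.+1)
    (exp (inv_prime_pow32 p) * (if prime p && (p %| j)%N then 2 else 1)))).
  apply: rprod_le => p _; case p_prime: (prime p) => /=; last first.
    by rewrite /inv_prime_pow32 p_prime exp_0; lra.
  split; last exact: kernel_modulus_err_le.
  have /allP moduli_gt1 := kernel_moduli_gt1 j p.
  have modulus_gt1 : (1 < kernel_modulus j p)%N.
    by apply/moduli_gt1/map_f; rewrite mem_filter p_prime mem_index_iota /=.
  have := @pow34_ge1 (INR (kernel_modulus j p)) ltac:(have := INR_ge2 modulus_gt1; lra).
  by move=> pow34_ge; have := Rinv_0_lt_compat (pow34 (INR (kernel_modulus j p))); lra.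
rewrite big_split rprod_exp; apply: Rmult_le_compat_r.
  by apply: rprod_ge0 => p _; case: ifP; lra.
apply: (@Rle_trans _ (exp 2)); last first.
  have -> : 2 = 1 + 1 by lra.
  rewrite exp_plus; have := exp_le_3; have := exp_pos 1; nra.
by apply: exp_le; exact: rsum_inv_prime_pow32_le.
Qed.

Lemma kernel_count_sieve j Y : (0 < j)%N -> 0 <= Y ->
  Rabs (kernel_count j (floorn Y) - 6 / PI ^ 2 * (Y / INR (psi j))) <=
  9 * (\rprod_(p <- primes j) 2) * pow34 (Y / INR (rad j)).
Proof.
move=> j_gt0 Y_ge0; have rad_pos := INR_gt0 (rad_gt0 j); have psi_pos := psi_gt0 j.
set Z := Y / INR (rad j).
have Z_ge0 : 0 <= Z by apply: Rdiv_le_0_compat.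
pose main N := Z * ((\rprod_(0 <= n < N.+1) (if prime n then 1 - / INR n ^ 2 else 1))
    * (INR (rad j) / INR (psi j))).
have near_main N : (maxn j (floorn Y) <= N)%N ->
    Rabs (kernel_count j (floorn Y) - main N) <= 9 * (\rprod_(p <- primes j) 2) * pow34 Z.
  rewrite geq_max => /andP [j_le Y_le].
  rewrite (kernel_count_sifted j_gt0 j_le Y_le) -floorn_div //; last exact: rad_gt0.
  rewrite /main -rprod_kernel_moduli_main //.
  apply: Rle_trans (sieve_error_le (kernel_moduli_gt1 j N) (pairwise_coprime_kernel_moduli j N) Z_ge0) _.
  by rewrite Rmult_comm; apply: Rmult_le_compat_r; [exact: pow34_ge0 | exact: rprod_kernel_moduli_err].
have main_lim : is_lim_seq (fun N => kernel_count j (floorn Y) - main N)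
    (kernel_count j (floorn Y) - Z * (6 / PI ^ 2 * (INR (rad j) / INR (psi j)))).
  have prod_lim := proj1 (is_lim_seq_incr_1 _ _) is_lim_prod_one_sub_inv_prime_sq.
  apply: is_lim_seq_minus'; first exact: is_lim_seq_const.
  apply: is_lim_seq_mult'; first exact: is_lim_seq_const.
  by apply: is_lim_seq_mult' => //; exact: is_lim_seq_const.
have -> : 6 / PI ^ 2 * (Y / INR (psi j)) = Z * (6 / PI ^ 2 * (INR (rad j) / INR (psi j))).
  by rewrite /Z; have := PI_RGT_0 => PI_gt0; field; lra.
apply: is_lim_seq_ub (is_lim_seq_abs _ _ main_lim).
by exists (maxn j (floorn Y)) => N /near_main.
Qed.

Lemma kernel_count_bounds j Y : (0 < j)%N -> 0 <= Y ->
  0 <= kernel_count j (floorn Y) <= Y / INR (rad j).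
Proof.
move=> j_gt0 Y_ge0; have rad_pos := INR_gt0 (rad_gt0 j).
have Z_ge0 : 0 <= Y / INR (rad j) by apply: Rdiv_le_0_compat.
rewrite (@kernel_count_sifted j _ (maxn j (floorn Y))) ?leq_maxl ?leq_maxr //.
rewrite -floorn_div ?rad_gt0 //; have [floor_le _] := floorn_bounds Z_ge0.
by have := sifted_count_bounds (kernel_moduli j (maxn j (floorn Y))) (floorn (Y / INR (rad j))); lra.
Qed.

Lemma kernel_count_trivial j Y : (0 < j)%N -> 0 <= Y ->
  Rabs (kernel_count j (floorn Y) - 6 / PI ^ 2 * (Y / INR (psi j))) <= Y / INR (rad j).
Proof.
move=> j_gt0 Y_ge0; have rad_pos := INR_gt0 (rad_gt0 j); have rad_psi := rad_le_psi j.
have [count_ge0 count_le] := kernel_count_bounds j_gt0 Y_ge0.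
have psi_part : 0 <= Y / INR (psi j) <= Y / INR (rad j).
  split; first by apply: Rdiv_le_0_compat; lra.
  by apply: Rmult_le_compat_l => //; apply: Rinv_le_contravar.
by have := six_PI2_bounds => c_bounds; apply: Rabs_le; nra.
Qed.

(* Interpolation between the trivial bound [Z] and the sieve bound [9 2 ^ w Z ^ (3 / 4)],
   with weights [1 - 4 eps] and [4 eps]. *)
Lemma kernel_count_interp j Y eps : (0 < j)%N -> 0 < Y -> 0 < eps <= 1 / 4 ->
  Rabs (kernel_count j (floorn Y) - 6 / PI ^ 2 * (Y / INR (psi j))) <=
  9 * (Rpower (Y / INR (rad j)) (1 - eps) * \rprod_(p <- primes j) Rpower 16 eps).
Proof.
move=> j_gt0 Y_gt0 eps_bounds; have rad_pos := INR_gt0 (rad_gt0 j).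
have Z_gt0 : 0 < Y / INR (rad j) by apply: Rdiv_lt_0_compat.
have := kernel_count_trivial j_gt0 (Rlt_le _ _ Y_gt0).
have := kernel_count_sieve j_gt0 (Rlt_le _ _ Y_gt0).
move: (Rabs _) (Y / INR (rad j)) Z_gt0 => q Z Z_gt0; rewrite !rprod_const.
set w := size (primes j) => sieve trivial.
case: (Rle_lt_dec q 0) => q_sign.
  apply: Rle_trans q_sign _; apply: Rmult_le_pos; first lra.
  by left; apply: Rmult_lt_0_compat; [|apply: pow_lt]; exact: exp_pos.
have lnq_le_lnZ : ln q <= ln Z by apply: ln_le.
have pow2_gt0 : 0 < 2 ^ w by apply: pow_lt; lra.
have ln9_ge0 : 0 <= ln 9 by apply: ln_ge0; lra.
have lnq_le : ln q <= ln 9 + INR w * ln 2 + 3 / 4 * ln Z.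
  apply: Rle_trans (ln_le _ _ q_sign sieve) _.
  rewrite pow34E // ln_mult; [|lra|exact: exp_pos].
  by rewrite ln_mult ?ln_exp ?ln_pow; lra.
have pow16E : Rpower 16 eps ^ w = exp (4 * eps * (INR w * ln 2)).
  rewrite /Rpower exp_pow; congr exp.
  have -> : 16 = 2 ^ 4 by rewrite /pow; lra.
  by rewrite ln_pow; [rewrite [INR 4]INR_IZR_INZ /=; ring | lra].
rewrite pow16E -{1}(exp_ln q) // -[9](exp_ln 9); last lra.
by rewrite /Rpower -!exp_plus; apply: exp_le; nra.
Qed.

Lemma rsum_if_leq (A B : nat) (f : nat -> R) :
  \rsum_(1 <= k < A.+1) (if (k <= B)%N then f k else 0) = \rsum_(1 <= k < (minn A B).+1) f k.
Proof.
rewrite -big_mkcond /= [RHS](@big_nat_widen _ _ _ _ _ A.+1); last by rewrite ltnS geq_minl.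
rewrite big_nat_cond [RHS]big_nat_cond; apply: eq_bigl => k.
case: (leqP 1 k) => //=; case: (ltnP k A.+1) => //= k_le.
by rewrite ltnS leq_min; have -> : (k <= A)%N by lia.
Qed.

Lemma rsum_by_cofactor (f : nat -> R) X :
  \rsum_(1 <= n < X.+1) f n =
  \rsum_(1 <= j < X.+1) \rsum_(1 <= k < (X %/ j).+1) (if (k == rad (k * j))%N then f (k * j)%N else 0).
Proof.
have -> : \rsum_(1 <= n < X.+1) f n =
  \rsum_(1 <= n < X.+1) \rsum_(1 <= j < X.+1) (if (n == rad n * j)%N then f n else 0).
  apply: eq_big_seq => n; rewrite mem_index_iota => /andP [n_gt0 n_lt].
  have rad_n := rad_dvd n_gt0.
  have factorE : (n = rad n * (n %/ rad n))%N by rewrite mulnC divnK.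
  rewrite (bigD1_seq (n %/ rad n)%N) ?iota_uniq //=; last first.
    by rewrite mem_index_iota divn_gt0 ?rad_gt0 // dvdn_leq //= ltnS; have := leq_div n (rad n); lia.
  rewrite -factorE eqxx big1_seq ?Rplus_0_r // => j /andP [/eqP j_neq _].
  case: eqP => // nE; case: j_neq; apply/eqP.
  by rewrite -(eqn_pmul2l (rad_gt0 n)) -factorE -nE.
rewrite exchange_big /=; apply: eq_big_seq => j; rewrite mem_index_iota => /andP [j_gt0 _].
have -> : \rsum_(1 <= n < X.+1) (if (n == rad n * j)%N then f n else 0) =
  \rsum_(1 <= n < X.+1) (if (j %| n)%N then (if (n == rad n * j)%N then f n else 0) else 0).
  apply: eq_bigr => n _; case: eqP => [nE|_]; last by case: ifP.
  by rewrite {2}nE dvdn_mull.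
rewrite (rsum_multiples_upto X (fun n => if (n == rad n * j)%N then f n else 0) j_gt0).
by apply: eq_bigr => k _; rewrite mulnC eqn_pmul2r.
Qed.

Lemma le_Rpower_muln theta k j : theta < 1 -> (0 < k)%N -> (0 < j)%N ->
  INR k <= Rpower (INR (k * j)) theta <-> INR k <= Rpower (INR j) (theta / (1 - theta)).
Proof.
move=> theta_lt1 k_gt0 j_gt0; have k_pos := INR_gt0 k_gt0.
have le_exp c : INR k <= exp c <-> ln (INR k) <= c.
  rewrite -{1}(exp_ln (INR k)) //; split=> [|/exp_le //].
  by move=> le_c; apply: Rnot_lt_le => /exp_increasing; lra.
rewrite Rpower_INR_muln // /Rpower -exp_plus; set L := ln (INR j).
have gap : (1 - theta) * (theta / (1 - theta) * L) = theta * L by field; lra.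
by split=> /le_exp H_le; apply/le_exp; nra.
Qed.

Definition kernel_bound (beta x : R) (j : nat) : R := Rmin (x / INR j) (Rpower (INR j) beta).

Lemma S_theta_kernel_count theta x : theta < 1 -> 1 <= x ->
  S_theta theta x =
  \rsum_(1 <= j < (floorn x).+1) kernel_count j (floorn (kernel_bound (theta / (1 - theta)) x j)).
Proof.
move=> theta_lt1 x_ge1.
rewrite /S_theta /S_count (big_morph INR INR_addn INR_0) -/(floorn x) rsum_by_cofactor.
apply: eq_big_seq => j; rewrite mem_index_iota => /andP [j_gt0 _].
have j_pos := INR_gt0 j_gt0; set B := Rpower (INR j) (theta / (1 - theta)).
have B_ge0 : 0 <= B by left; exact: exp_pos.
have -> : floorn (kernel_bound (theta / (1 - theta)) x j) = minn (floorn x %/ j) (floorn B).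
  rewrite /kernel_bound floorn_min //; last by apply: Rdiv_le_0_compat; lra.
  by rewrite floorn_div //; lra.
rewrite /kernel_count -rsum_if_leq.
apply: eq_big_seq => k; rewrite mem_index_iota => /andP [k_gt0 _].
case: eqP => [kE|_]; last by case: ifP.
have le_iff := le_Rpower_muln theta_lt1 k_gt0 j_gt0; rewrite -kE.
case: Rle_dec => [/le_iff k_le | k_nle] /=.
  by rewrite leq_floorn // INR_1.
case: ifP => // /leq_INR k_le; case: k_nle; apply/le_iff.
by apply: Rle_trans k_le _; case: (floorn_bounds B_ge0).
Qed.

Definition moment (a : R) (k n : nat) :=
  if prime n then div_prob a n * (ln (INR n) + / a) ^ k else 0.

Section Moments.
Variable a : R.
Hypothesis a_gt0 : 0 < a.
Let L := - ln a.
Hypothesis L_ge1000 : 1000 <= L.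

Lemma moment_ge0 k n : 0 <= moment a k n.
Proof.
rewrite /moment; case: ifP => n_prime; last lra.
have [q_gt0 _] := div_prob_bounds a_gt0 n_prime.
have := ln_prime_gt0 n_prime; have := Rinv_0_lt_compat _ a_gt0 => inva_gt0 lnp_gt0.
by apply: Rmult_le_pos; [lra | apply: pow_le; lra].
Qed.

Lemma moment_le_succ k n : moment a k n <= a * moment a k.+1 n.
Proof.
rewrite /moment; case: ifP => n_prime; last lra.
have := moment_ge0 k n; rewrite /moment n_prime => moment_pos.
have lnp_gt0 := ln_prime_gt0 n_prime.
have -> : a * (div_prob a n * (ln (INR n) + / a) ^ k.+1) =
    div_prob a n * (ln (INR n) + / a) ^ k * (1 + a * ln (INR n)).
  by rewrite -tech_pow_Rmult; field; lra.
have : 0 <= a * ln (INR n) by nra.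
nra.
Qed.

Lemma moment_scaled k n : prime n ->
  moment a k n = div_prob a n * (1 + a * ln (INR n)) ^ k / a ^ k.
Proof.
move=> n_prime; rewrite /moment n_prime.
have -> : ln (INR n) + / a = (1 + a * ln (INR n)) * / a by field; lra.
by rewrite Rpow_mult_distr pow_inv /Rdiv Rmult_assoc.
Qed.

Lemma inv_saddle_ge : L <= / a /\ 2 <= / a.
Proof. by rewrite (inv_saddle_eq_exp a_gt0) -/L; have := exp_ineq1_le L; lra. Qed.

Lemma saddle_L_le : a * L <= 1 / 100.
Proof.
have := @saddle_L3_le1 a a_gt0 ltac:(rewrite -/L; lra); rewrite -/L => aL3_le1.
have : 100 * (a * L) <= a * L ^ 3.
  have -> : a * L ^ 3 = L * L * (a * L) by ring.
  by apply: Rmult_le_compat_r; nra.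
lra.
Qed.

Let y := floorn (/ a).

Lemma inv_saddle_floor_bounds : L - 1 <= ln (INR y) <= L /\ INR y <= / a < INR y + 1 /\ (1 < y)%N.
Proof.
have [_ inva_ge2] := inv_saddle_ge; have [lny_bounds y_gt1] := ln_floorn_bounds inva_ge2.
by rewrite ln_Rinv // in lny_bounds; split=> //; split=> //; apply: floorn_bounds; lra.
Qed.

Lemma third_moment_le_head n : prime n -> ln (INR n) <= L -> moment a 3 n <= 8 / a ^ 3.
Proof.
move=> n_prime lnp_le; have [L_le_inva _] := inv_saddle_ge.
have [q_gt0 q_lt1] := div_prob_bounds a_gt0 n_prime; have lnp_gt0 := ln_prime_gt0 n_prime.
rewrite /moment n_prime; have -> : 8 / a ^ 3 = (2 * / a) ^ 3 by field; lra.
have cube_le : (ln (INR n) + / a) ^ 3 <= (2 * / a) ^ 3 by apply: pow_incr; lra.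
have cube_ge0 : 0 <= (ln (INR n) + / a) ^ 3 by apply: pow_le; lra.
nra.
Qed.

Lemma third_moment_le_inv_plogp n : moment a 3 n <= 216 / a ^ 4 * inv_plogp n.
Proof.
rewrite /inv_plogp; case: ifP => n_prime; last by rewrite /moment n_prime; lra.
have lnp_gt0 := ln_prime_gt0 n_prime; have p_ge2 := INR_prime_ge2 n_prime.
rewrite moment_scaled //; have x_gt0 := a_ln_prime_gt0 a_gt0 n_prime.
have := div_prob_le_exp a_gt0 n_prime; set x := a * ln (INR n) in x_gt0 *.
set u := / (a * (INR n * ln (INR n))) => q_le.
have u_gt0 : 0 < u by apply: Rinv_0_lt_compat; apply: Rmult_lt_0_compat => //; nra.
have := @pow_mul_exp_le 3 (1 / 2) x isT ltac:(lra) ltac:(lra).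
have -> : (INR 3 / (1 / 2)) ^ 3 = 216 by rewrite INR_IZR_INZ /=; field.
have -> : 1 / 2 * x = x / 2 by field.
move=> cube_le.
have cube_ge0 : 0 <= (1 + x) ^ 3 by apply: pow_le; lra.
have -> : 216 / a ^ 4 * / (INR n * ln (INR n)) = u * 216 / a ^ 3 by rewrite /u; field; lra.
apply: Rmult_le_compat_r; first by left; apply: Rinv_0_lt_compat; exact: pow_lt.
apply: (@Rle_trans _ (u * exp (- (x / 2)) * (1 + x) ^ 3)); first exact: Rmult_le_compat_r.
nra.
Qed.

Lemma rsum_third_moment_head_le : \rsum_(0 <= n < y.+1) moment a 3 n <= 4800 / (a ^ 4 * L).
Proof.
have [lny_bounds [y_le y_gt1]] := inv_saddle_floor_bounds.
have count_le := prime_count_le y_gt1.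
have count_le_saddle : 300 * (INR y / ln (INR y)) <= 600 / (a * L).
  have -> : 600 / (a * L) = 300 * (/ a * / (L / 2)) by field; lra.
  apply: Rmult_le_compat_l; first lra.
  apply: Rmult_le_compat; [exact: pos_INR | by left; apply: Rinv_0_lt_compat; lra | lra |].
  by apply: Rinv_le_contravar; lra.
apply: (@Rle_trans _ (8 / a ^ 3 * \rsum_(0 <= n < y.+1 | prime n) 1)).
  rewrite big_distrr /= [X in X <= _](eq_bigr (fun n => if prime n then moment a 3 n else 0)).
    rewrite -big_mkcond; apply: rsum_le => p; rewrite mem_index_iota => /andP [_ p_lt] p_prime.
    rewrite Rmult_1_r; apply: third_moment_le_head => //.
    have := ln_le _ _ (INR_gt0 (prime_gt0 p_prime)) (leq_INR (p_lt : (p <= y)%N)); lra.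
  by move=> n _; rewrite /moment; case: ifP.
have -> : 4800 / (a ^ 4 * L) = 8 / a ^ 3 * (600 / (a * L)) by field; lra.
apply: Rmult_le_compat_l; last lra.
by apply: Rdiv_le_0_compat; [lra | exact: pow_lt].
Qed.

Lemma rsum_third_moment_tail_le N : \rsum_(y.+1 <= n < N) moment a 3 n <= 17712 / (a ^ 4 * L).
Proof.
have [lny_bounds [_ y_gt1]] := inv_saddle_floor_bounds.
apply: (@Rle_trans _ (216 / a ^ 4 * \rsum_(y.+1 <= n < N) inv_plogp n)).
  by rewrite big_distrr; apply: rsum_nat_le => n _; exact: third_moment_le_inv_plogp.
have tail_le := @rsum_inv_plogp_tail_le y N y_gt1.
have tail_le_L : 41 / ln (INR y) <= 82 / L.
  have -> : 82 / L = 41 * / (L / 2) by field; lra.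
  by apply: Rmult_le_compat_l; [lra | apply: Rinv_le_contravar; lra].
have -> : 17712 / (a ^ 4 * L) = 216 / a ^ 4 * (82 / L) by field; lra.
apply: Rmult_le_compat_l; last lra.
by apply: Rdiv_le_0_compat; [lra | exact: pow_lt].
Qed.

Lemma rsum_third_moment_le k : \rsum_(0 <= n < k) moment a 3 n <= 23000 / (a ^ 4 * L).
Proof.
have constants_le : 4800 / (a ^ 4 * L) + 17712 / (a ^ 4 * L) <= 23000 / (a ^ 4 * L).
  have : 0 < / (a ^ 4 * L).
    by apply: Rinv_0_lt_compat; apply: Rmult_lt_0_compat; [exact: pow_lt | lra].
  rewrite /Rdiv; lra.
apply: (@Rle_trans _ (\rsum_(0 <= n < y.+1 + k) moment a 3 n)).
  by apply: rsum_widen_le => //; [exact: moment_ge0 | lia].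
rewrite (@big_cat_nat _ _ _ y.+1 0 (y.+1 + k)) //=; last by lia.
apply: Rle_trans constants_le; apply: Rplus_le_compat; first exact: rsum_third_moment_head_le.
exact: rsum_third_moment_tail_le.
Qed.

Lemma second_moment_le n : moment a 2 n <= 16 / a ^ 2.
Proof.
case: (boolP (prime n)) => n_prime; last first.
  by rewrite /moment (negbTE n_prime); apply: Rdiv_le_0_compat; [lra | exact: pow_lt].
have [q_gt0 q_lt1] := div_prob_bounds a_gt0 n_prime.
have p_ge2 := INR_prime_ge2 n_prime.
rewrite moment_scaled //; have x_gt0 := a_ln_prime_gt0 a_gt0 n_prime.
have := div_prob_le_exp a_gt0 n_prime.
have -> : a * (INR n * ln (INR n)) = INR n * (a * ln (INR n)) by ring.
set x := a * ln (INR n) in x_gt0 * => q_le.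
apply: Rmult_le_compat_r; first by left; apply: Rinv_0_lt_compat; exact: pow_lt.
case: (Rle_lt_dec x 1) => x_cases.
  by have : (1 + x) ^ 2 <= 2 ^ 2 by [apply: pow_incr; lra]; rewrite -[2 ^ 2]/(2 * (2 * 1)); nra.
have := @pow_mul_exp_le 2 (1 / 2) x isT ltac:(lra) ltac:(lra).
have -> : (INR 2 / (1 / 2)) ^ 2 = 16 by rewrite INR_2; field.
have -> : 1 / 2 * x = x / 2 by field.
have exp_gt0 := exp_pos (- (x / 2)).
have : / (INR n * x) <= 1 by rewrite -Rinv_1; apply: Rinv_le_contravar; nra.
nra.
Qed.

Lemma rsum_Im_charf_factor_le t k : 0 <= t ->
  \rsum_(0 <= n < k) Rabs (snd (charf_factor a t n)) <= 69000 * t ^ 3 / (a ^ 4 * L).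
Proof.
move=> t_ge0; have t3_ge0 := pow_le t 3 t_ge0.
apply: (@Rle_trans _ (3 * t ^ 3 * \rsum_(0 <= n < k) moment a 3 n)).
  rewrite big_distrr; apply: rsum_nat_le => n _ /=; rewrite /charf_factor /moment.
  case: ifP => n_prime; last by rewrite /= Rabs_R0; lra.
  have q_bounds := div_prob_bounds a_gt0 n_prime; have lnp_gt0 := ln_prime_gt0 n_prime.
  have x_ge0 : 0 <= t * ln (INR n) by nra.
  apply: Rle_trans (Im_centered_mix_le q_bounds (geom_ratio_bounds a_gt0 n_prime) x_ge0) _.
  rewrite -/(geom_mean a n).
  have mean_ln_le := geom_mean_ln_le a_gt0 n_prime; have l_ge1 := geom_mean_ge1 a_gt0 n_prime.
  have -> : 3 * div_prob a n * (geom_mean a n * (t * ln (INR n))) ^ 3 =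
    3 * t ^ 3 * (div_prob a n * (geom_mean a n * ln (INR n)) ^ 3) by ring.
  apply: Rmult_le_compat_l; first lra.
  by apply: Rmult_le_compat_l; [lra | apply: pow_incr; nra].
have -> : 69000 * t ^ 3 / (a ^ 4 * L) = 3 * t ^ 3 * (23000 / (a ^ 4 * L)) by field; lra.
by apply: Rmult_le_compat_l; [lra | exact: rsum_third_moment_le].
Qed.

Lemma Re_charf_factor_ge t n : 0 <= t -> 1 - 3 * t ^ 2 * moment a 2 n <= fst (charf_factor a t n).
Proof.
move=> t_ge0; rewrite /charf_factor /moment; case: ifP => n_prime /=; last lra.
have q_bounds := div_prob_bounds a_gt0 n_prime; have lnp_gt0 := ln_prime_gt0 n_prime.
have x_ge0 : 0 <= t * ln (INR n) by nra.
apply: Rle_trans (Re_centered_mix_ge q_bounds (geom_ratio_bounds a_gt0 n_prime) x_ge0).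
rewrite -/(geom_mean a n).
have mean_ln_le := geom_mean_ln_le a_gt0 n_prime; have l_ge1 := geom_mean_ge1 a_gt0 n_prime.
have -> : 3 * div_prob a n * (geom_mean a n * (t * ln (INR n)) * (geom_mean a n * (t * ln (INR n)))) =
  3 * t ^ 2 * (div_prob a n * (geom_mean a n * ln (INR n)) ^ 2) by ring.
have t2_ge0 := pow_le t 2 t_ge0.
have : 3 * t ^ 2 * (div_prob a n * (geom_mean a n * ln (INR n)) ^ 2) <=
    3 * t ^ 2 * (div_prob a n * (ln (INR n) + / a) ^ 2).
  apply: Rmult_le_compat_l; first lra.
  by apply: Rmult_le_compat_l; [lra | apply: pow_incr; nra].
lra.
Qed.

Lemma rprod_Re_charf_factor_ge t k : 0 <= t <= a / 10 ->
  0 <= \rprod_(0 <= n < k) fst (charf_factor a t n) /\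
  1 - 69000 * t ^ 2 / (a ^ 3 * L) <= \rprod_(0 <= n < k) fst (charf_factor a t n).
Proof.
move=> [t_ge0 t_le]; have t2_ge0 := pow_le t 2 t_ge0.
pose loss n := 3 * t ^ 2 * moment a 2 n.
have loss_bounds n : 0 <= loss n <= 1.
  split; first by apply: Rmult_le_pos; [lra | exact: moment_ge0].
  apply: (@Rle_trans _ (3 * (a / 10) ^ 2 * (16 / a ^ 2))); last first.
    by have -> : 3 * (a / 10) ^ 2 * (16 / a ^ 2) = 48 / 100 by [field; lra]; lra.
  apply: Rmult_le_compat; [lra | exact: moment_ge0 | | exact: second_moment_le].
  by apply: Rmult_le_compat_l; [lra | apply: pow_incr; lra].
have prod_ge : \rprod_(0 <= n < k) (1 - loss n) <= \rprod_(0 <= n < k) fst (charf_factor a t n).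
  apply: rprod_le => n _; split; first by have := loss_bounds n; lra.
  exact: Re_charf_factor_ge.
have prod_ge0 : 0 <= \rprod_(0 <= n < k) (1 - loss n).
  by apply: rprod_ge0 => n _; have := loss_bounds n; lra.
have [sum_le _] := @rprod_one_sub_bounds _ (index_iota 0 k) loss (fun n _ => loss_bounds n).
split; first exact: Rle_trans prod_ge0 prod_ge.
apply: Rle_trans prod_ge; apply: Rle_trans sum_le; apply: Rplus_le_compat_l; apply: Ropp_le_contravar.
apply: (@Rle_trans _ (3 * t ^ 2 * a * \rsum_(0 <= n < k) moment a 3 n)).
  rewrite big_distrr; apply: rsum_nat_le => n _ /=; rewrite /loss.
  by have := Rmult_le_compat_l _ _ _ t2_ge0 (moment_le_succ 2 n); lra.
have -> : 69000 * t ^ 2 / (a ^ 3 * L) = 3 * t ^ 2 * a * (23000 / (a ^ 4 * L)) by field; lra.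
by apply: Rmult_le_compat_l; [nra | exact: rsum_third_moment_le].
Qed.

Lemma div_prob_ge n : prime n -> / a <= INR n -> L <= ln (INR n) -> a * ln (INR n) <= 1 / 2 ->
  / (4 * (a * (INR n * ln (INR n)))) <= div_prob a n.
Proof.
move=> n_prime inva_le L_le x_le; have p_ge2 := INR_prime_ge2 n_prime.
have na_ge1 : 1 <= INR n * a.
  by have : / a * a <= INR n * a by [apply: Rmult_le_compat_r; lra]; rewrite Rinv_l; lra.
have expm1_le := @expm1_le_double (a * ln (INR n)) ltac:(split; nra).
rewrite -/(Rpower (INR n) a) in expm1_le.
have expm1_gt0 := Rpower_prime_sub1_gt0 a_gt0 n_prime.
apply: Rinv_le_contravar; first by nra.
have : (INR n + 1) * (Rpower (INR n) a - 1) <= (INR n + 1) * (2 * (a * ln (INR n))).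
  by apply: Rmult_le_compat_l; lra.
have : 1 <= a * (INR n * ln (INR n)) by nra.
nra.
Qed.

Lemma geom_den_le t n : prime n ->
  geom_den (geom_ratio a n) (t * ln (INR n)) <= (a ^ 2 + t ^ 2) * ln (INR n) ^ 2.
Proof.
move=> n_prime; have [r_gt0 r_lt1] := geom_ratio_bounds a_gt0 n_prime.
have r_ge := geom_ratio_ge a n.
have [cos_ge cos_le] := one_sub_cos_bounds (t * ln (INR n)).
rewrite /geom_den.
have : (1 - geom_ratio a n) * (1 - geom_ratio a n) <= (a * ln (INR n)) * (a * ln (INR n)).
  by apply: Rmult_le_compat; lra.
have : 2 * geom_ratio a n * (1 - cos (t * ln (INR n))) <=
    2 * 1 * (t * ln (INR n) * (t * ln (INR n)) / 2) by apply: Rmult_le_compat; lra.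
rewrite /pow; lra.
Qed.

Section Gain.
Variable t : R.
Hypothesis t_ge0 : 0 <= t.
Hypothesis tL_le : 2 * t * L <= 1.

Lemma gain_ge n : prime n -> / a <= INR n -> L <= ln (INR n) <= 2 * L ->
  t ^ 2 / (16 * a * (a ^ 2 + t ^ 2)) * / (INR n * ln (INR n)) <= gain a t n.
Proof.
move=> n_prime inva_le [L_le le_2L]; rewrite /gain n_prime /mix_gain.
have p_ge2 := INR_prime_ge2 n_prime.
have aL_le := saddle_L_le; have x_le : a * ln (INR n) <= 1 / 2 by nra.
have at_gt0 : 0 < a ^ 2 + t ^ 2 by have := pow_lt a 2 a_gt0; have := pow_le t 2 t_ge0; lra.
have r_bounds := geom_ratio_bounds a_gt0 n_prime; have r_ge := geom_ratio_ge a n.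
have q_ge := div_prob_ge n_prime inva_le L_le x_le.
have den_gt0 := geom_den_gt0 (t * ln (INR n)) r_bounds; have den_le := geom_den_le t n_prime.
have cos_ge := @one_sub_cos_ge (t * ln (INR n)) ltac:(split; nra).
have inv_gt0 : 0 < / (4 * (a * (INR n * ln (INR n)))) by apply: Rinv_0_lt_compat; nra.
have phase_ge0 := Rle_0_sqr (t * ln (INR n)); rewrite /Rsqr in phase_ge0.
apply: Rle_div_intro => //.
apply: (@Rle_trans _ (t ^ 2 / (16 * a * (a ^ 2 + t ^ 2)) * / (INR n * ln (INR n))
    * ((a ^ 2 + t ^ 2) * ln (INR n) ^ 2))).
  apply: Rmult_le_compat_l => //; apply: Rmult_le_pos.
    by apply: Rdiv_le_0_compat; [exact: pow_le | apply: Rmult_lt_0_compat; lra].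
  by left; apply: Rinv_0_lt_compat; nra.
have -> : t ^ 2 / (16 * a * (a ^ 2 + t ^ 2)) * / (INR n * ln (INR n))
    * ((a ^ 2 + t ^ 2) * ln (INR n) ^ 2) =
  2 * / (4 * (a * (INR n * ln (INR n)))) * (t * ln (INR n) * (t * ln (INR n)) / 4) * (1 / 2).
  by field; lra.
apply: Rmult_le_compat; [by apply: Rmult_le_pos; lra | lra | | lra].
by apply: Rmult_le_compat; lra.
Qed.

Let w := floorn (/ a * / a).

Lemma inv_saddle_sq_floor_bounds : 2 * L - 1 <= ln (INR w) <= 2 * L /\ (y <= w)%N.
Proof.
have [L_le_inva inva_ge2] := inv_saddle_ge; have [lny_bounds [_ y_gt1]] := inv_saddle_floor_bounds.
have inva2_ge2 : 2 <= / a * / a by nra.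
have [lnw_bounds w_gt1] := ln_floorn_bounds inva2_ge2.
rewrite -/w ln_mult ?ln_Rinv -/L in lnw_bounds w_gt1; [|lra|lra|lra].
split; first lra.
by apply: leq_of_INR; apply: Rlt_le; apply: ln_lt_inv; [apply: INR_gt0; lia | apply: INR_gt0; lia|lra].
Qed.

Lemma inv_plogp_gain_window_ge : / L / 4 <= \rsum_(y.+1 <= n < w.+1) inv_plogp n.
Proof.
have [lny_bounds [_ y_gt1]] := inv_saddle_floor_bounds.
have [lnw_bounds yw] := inv_saddle_sq_floor_bounds.
have /Rabs_le_between [sum_ge _] := rsum_inv_plogp_approx y_gt1 yw.
have invL_gt0 : 0 < / L by apply: Rinv_0_lt_compat; lra.
have inv_lny_ge : / L <= / ln (INR y) by apply: Rinv_le_contravar; lra.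
have inv_lnw_le : / ln (INR w) <= 6 / 10 * / L.
  have -> : 6 / 10 * / L = / (10 / 6 * L) by field; lra.
  by apply: Rinv_le_contravar; lra.
have err_le : 20 / ln (INR y) ^ 2 <= 1 / 10 * / L.
  have -> : 1 / 10 * / L = 20 * / (200 * L) by field; lra.
  apply: Rmult_le_compat_l; first lra.
  by apply: Rinv_le_contravar; rewrite /pow; nra.
lra.
Qed.

Lemma rsum_gain_ge : exists K, forall k, (K <= k)%N ->
  t ^ 2 / (64 * a * (a ^ 2 + t ^ 2) * L) <= \rsum_(0 <= n < k) gain a t n.
Proof.
have [lny_bounds [y_lt y_gt1]] := inv_saddle_floor_bounds.
have [lnw_bounds _] := inv_saddle_sq_floor_bounds.
have at_gt0 : 0 < a ^ 2 + t ^ 2 by have := pow_lt a 2 a_gt0; have := pow_le t 2 t_ge0; lra.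
set c := t ^ 2 / (16 * a * (a ^ 2 + t ^ 2)).
have c_ge0 : 0 <= c by apply: Rdiv_le_0_compat; [exact: pow_le | apply: Rmult_lt_0_compat; lra].
exists w.+1 => k w_lt_k.
apply: (@Rle_trans _ (\rsum_(y.+1 <= n < w.+1) gain a t n)); last first.
  by apply: rsum_widen_le => // i; have := gain_bounds a_gt0 t i; lra.
have -> : t ^ 2 / (64 * a * (a ^ 2 + t ^ 2) * L) = c * (/ L / 4) by rewrite /c; field; lra.
apply: Rle_trans (Rmult_le_compat_l _ _ _ c_ge0 inv_plogp_gain_window_ge) _.
rewrite big_distrr; apply: rsum_nat_le => n /andP [y_lt_n n_le_w] /=.
rewrite /inv_plogp; case: ifP => n_prime; last by have := gain_bounds a_gt0 t n; lra.
have INR_y_lt_n := leq_INR y_lt_n; rewrite S_INR in INR_y_lt_n.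
have [_ inva_ge2] := inv_saddle_ge.
apply: gain_ge => //; first lra.
have := ln_le (/ a) (INR n) ltac:(lra) ltac:(lra); rewrite ln_Rinv // -/L.
have := ln_le (INR n) (INR w) ltac:(lra) (leq_INR (n_le_w : (n <= w)%N)); lra.
Qed.

End Gain.

End Moments.

(** * Minor arcs *)

(* Half of [|1 - exp (i t ln n)|]: a seminorm in [ln n]. *)
Definition half_chord (t : R) (n : nat) := Rabs (sin (t * ln (INR n) / 2)).

Lemma half_chord_bounds t n : 0 <= half_chord t n <= 1.
Proof. by split; [exact: Rabs_pos | apply: Rabs_le; exact: SIN_bound]. Qed.

Lemma half_chordM t m n : (0 < m)%N -> (0 < n)%N ->
  half_chord t (m * n) <= half_chord t m + half_chord t n.
Proof.
move=> m_gt0 n_gt0; rewrite /half_chord INR_muln ln_mult; [|exact: INR_gt0|exact: INR_gt0].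
have -> : t * (ln (INR m) + ln (INR n)) / 2 = t * ln (INR m) / 2 + t * ln (INR n) / 2 by field.
exact: Rabs_sin_add.
Qed.

Lemma half_chord_le_logn t m N : (0 < m)%N -> (m < N)%N ->
  half_chord t m <= \rsum_(0 <= p < N | prime p) (INR (logn p m) * half_chord t p).
Proof.
apply: (@subadditive_le_logn (half_chord t)) => [|p k p_prime k_gt0].
  by rewrite /half_chord INR_1 ln_1 Rmult_0_r /Rdiv Rmult_0_l sin_0 Rabs_R0; lra.
exact: half_chordM (prime_gt0 p_prime) k_gt0.
Qed.

Lemma one_sub_cos_half_chord t n : 1 - cos (t * ln (INR n)) = 2 * (half_chord t n * half_chord t n).
Proof. by rewrite one_sub_cosE /half_chord -Rabs_mult Rabs_pos_eq //; exact: Rle_0_sqr. Qed.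

Lemma rsum_logn_fact p M : prime p -> \rsum_(1 <= m < M.+1) INR (logn p m) = INR (logn p M`!).
Proof.
move=> p_prime; elim: M => [|M IH]; first by rewrite big_geq // logn1.
by rewrite big_nat_recr //= IH factS lognM ?fact_gt0 // INR_addn Rplus_comm.
Qed.

Lemma rsum_half_chord_le t (B : seq nat) M : all prime B ->
  \rsum_(1 <= m < M.+1) (if avoids B m then half_chord t m else 0) <=
  INR M * \rsum_(0 <= p < M.+1)
    (if prime p && (p \notin B) then half_chord t p / (INR p - 1) else 0).
Proof.
move=> B_prime.
apply: (@Rle_trans _ (\rsum_(1 <= m < M.+1) \rsum_(0 <= p < M.+1)
    (if prime p && (p \notin B) then INR (logn p m) * half_chord t p else 0))).
  apply: rsum_nat_le => m /andP [m_gt0 m_le].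
  have chord_ge0 p : 0 <= INR (logn p m) * half_chord t p.
    by apply: Rmult_le_pos; [exact: pos_INR | have := half_chord_bounds t p; lra].
  case: ifP => m_avoids; last by apply: rsum_nat_ge0 => p _; case: ifP => _ //; lra.
  apply: Rle_trans (half_chord_le_logn t m_gt0 m_le) _.
  rewrite big_mkcond; apply: rsum_nat_le => p _.
  case: (boolP (prime p)) => p_prime /=; last lra.
  case: (boolP (p \in B)) => p_B /=; last lra.
  by move/allP: m_avoids => /(_ p p_B) p_ndvd; rewrite lognE (negbTE p_ndvd) !andbF INR_0; lra.
rewrite exchange_big /= big_distrr; apply: rsum_nat_le => p _ /=.
case: (boolP (prime p)) => p_prime /=; last by rewrite big1 //; lra.
case: (boolP (p \in B)) => p_B /=; first by rewrite big1 //; lra.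
have -> : \rsum_(1 <= i < M.+1) (INR (logn p i) * half_chord t p) =
    half_chord t p * INR (logn p M`!).
  by rewrite -(rsum_logn_fact M p_prime) big_distrr; apply: eq_bigr => i _ /=; ring.
have [chord_ge0 _] := half_chord_bounds t p.
have := Rmult_le_compat_l _ _ _ chord_ge0 (logn_fact_le M p_prime).
by rewrite /Rdiv; lra.
Qed.

Lemma rsum_indicator_le (x : R) N : 0 <= x ->
  \rsum_(1 <= n < N.+1) (if Rle_dec (INR n) x then 1 else 0) <= x.
Proof.
move=> x_ge0.
suff : \rsum_(1 <= n < N.+1) (if Rle_dec (INR n) x then 1 else 0) <= INR N /\
  \rsum_(1 <= n < N.+1) (if Rle_dec (INR n) x then 1 else 0) <= x by case.
elim: N => [|N [le_N le_x]]; first by rewrite big_geq // INR_0; lra.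
by rewrite big_nat_recr //=; case: (Rle_dec (INR N.+1) x) => /= N_cases; rewrite ?S_INR in N_cases *; lra.
Qed.

Lemma ln_one_add_bounds s : 0 <= s <= 1 -> s / 2 <= ln (1 + s) <= s.
Proof.
move=> s_bounds; split; last by have := @ln_le_sub1 (1 + s) ltac:(lra); lra.
apply: Rle_trans (@ln_ge_one_sub_inv (1 + s) ltac:(lra)).
have -> : 1 - / (1 + s) = s / (1 + s) by field; lra.
by apply: Rmult_le_compat_l; [lra | apply: Rinv_le_contravar; lra].
Qed.

Lemma Rmax1_mul_Rmin1 t : Rmax 1 t * Rmin 1 t = t.
Proof.
by case: (Rle_lt_dec 1 t) => t_cases; [rewrite Rmax_right ?Rmin_left | rewrite Rmax_left ?Rmin_right]; lra.
Qed.

(* Passing from [n] to [n + g] turns the phase [t ln n] by about [t g / n]. *)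
Lemma half_chord_shift_ge t n g : 0 < t -> (0 < n)%N -> INR g * Rmax 1 t <= INR n ->
  INR g / INR n * t / 8 <= half_chord t n + half_chord t (n + g).
Proof.
move=> t_gt0 n_gt0 g_le; have n_pos := INR_gt0 n_gt0; have g_ge0 := pos_INR g.
have max_ge1 := Rmax_l 1 t; have max_ge_t := Rmax_r 1 t.
set s := INR g / INR n.
have s_ge0 : 0 <= s by apply: Rdiv_le_0_compat.
have sM_le1 : s * Rmax 1 t <= 1.
  have -> : s * Rmax 1 t = INR g * Rmax 1 t / INR n by rewrite /s; field; lra.
  by apply: Rdiv_le_intro; lra.
have [ln_ge ln_le_s] := @ln_one_add_bounds s ltac:(nra).
pose turn := t * ln (1 + s).
have turnE : turn / 2 = t * ln (INR (n + g)) / 2 + - (t * ln (INR n) / 2).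
  have -> : INR (n + g) = (1 + s) * INR n by rewrite /s INR_addn; field; lra.
  by rewrite ln_mult ?/turn; [field | lra | lra].
have turn_bounds : t * s / 2 <= turn <= 1 by rewrite /turn; split; nra.
have sin_ge : turn / 4 <= sin (turn / 2).
  have turn_ge0 : 0 <= turn / 2 by nra.
  have := sin_ge_cubic turn_ge0; set w := turn / 2 in turn_ge0 *.
  have w_le : w <= 1 / 2 by rewrite /w; lra.
  have -> : turn / 4 = w / 2 by rewrite /w; field.
  by move=> cubic; apply: Rle_trans cubic; rewrite /pow; nra.
have triangle : Rabs (sin (turn / 2)) <= half_chord t (n + g) + half_chord t n.
  rewrite turnE; apply: Rle_trans (Rabs_sin_add _ _) _.
  by rewrite sin_neg Rabs_Ropp /half_chord; lra.
have := Rle_abs (sin (turn / 2)); lra.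
Qed.

Lemma rsum_half_chord_ge (B : seq nat) (t delta : R) (N g : nat) :
  0 < t -> 0 < delta -> (g <= N)%N -> (0 < N)%N -> (forall b, b \in B -> (b %| g)%N) ->
  INR g * Rmax 1 t <= delta * INR N <= 2 * (INR g * Rmax 1 t) ->
  (sifted_count B N - delta * INR N) * (delta / 16 * Rmin 1 t) <=
  2 * \rsum_(1 <= m < (2 * N).+1) (if avoids B m then half_chord t m else 0).
Proof.
move=> t_gt0 delta_gt0 g_le N_gt0 B_dvd [g_le_delta delta_le_g].
have min_gt0 : 0 < Rmin 1 t by apply: Rmin_glb_lt; lra.
have maxminE := Rmax1_mul_Rmin1 t.
pose chord n := if avoids B n then half_chord t n else 0.
pose large n := if avoids B n then (if Rle_dec (INR n) (delta * INR N) then 0 else 1) else 0.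
have chord_ge0 n : 0 <= chord n by rewrite /chord; case: ifP; have := half_chord_bounds t n; lra.
have avoids_shift n : avoids B (n + g) = avoids B n.
  by apply: eq_in_all => b /B_dvd b_dvd; rewrite dvdn_addl.
have pair_ge n : (1 <= n < N.+1)%N ->
    delta / 16 * Rmin 1 t * large n <= chord n + chord (n + g)%N.
  move=> /andP [n_gt0 n_le]; have chord_n := chord_ge0 n; have chord_ng := chord_ge0 (n + g)%N.
  rewrite /large; case: ifP => n_avoids; last by rewrite Rmult_0_r; lra.
  case: Rle_dec => n_cases; first by rewrite Rmult_0_r; lra.
  rewrite /chord avoids_shift n_avoids Rmult_1_r.
  have INR_n_le : INR n <= INR N by apply: leq_INR; lia.
  apply: Rle_trans (@half_chord_shift_ge t n g t_gt0 n_gt0 ltac:(lra)).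
  have -> : INR g / INR n * t / 8 = INR g * Rmax 1 t / INR n * Rmin 1 t / 8.
    by rewrite -{1}maxminE; field; lra.
  suff : delta / 2 <= INR g * Rmax 1 t / INR n by nra.
  by apply: Rle_div_intro => //; nra.
have sum_ge : delta / 16 * Rmin 1 t * \rsum_(1 <= n < N.+1) large n <=
    2 * \rsum_(1 <= m < (2 * N).+1) chord m.
  rewrite big_distrr; apply: Rle_trans (rsum_nat_le pair_ge) _.
  rewrite big_split /= Rmult_plus_distr_r !Rmult_1_l; apply: Rplus_le_compat.
    by apply: rsum_widen_le => //; lia.
  have -> : \rsum_(1 <= n < N.+1) chord (n + g)%N = \rsum_(1 + g <= n < N.+1 + g) chord n.
    by rewrite big_addn addnK.
  by apply: rsum_widen_le => //; lia.
apply: Rle_trans sum_ge; rewrite Rmult_comm; apply: Rmult_le_compat_l.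
  by apply: Rmult_le_pos; lra.
have := @rsum_indicator_le (delta * INR N) N ltac:(nra).
set T := \rsum_(1 <= n < N.+1) _ => T_le.
suff : sifted_count B N - T <= \rsum_(1 <= n < N.+1) large n by lra.
rewrite /sifted_count /T rsumB; apply: rsum_nat_le => n _; rewrite /large.
by case: (avoids B n); case: (Rle_dec _ _) => _ /=; lra.
Qed.

Lemma pairwise_coprime_primes s : uniq s -> all prime s -> pairwise coprime s.
Proof.
elim: s => [//|p s IH] /= /andP [p_s s_uniq] /andP [p_prime s_prime].
rewrite IH // andbT; apply/allP => q q_s; have q_prime : prime q by move/allP: s_prime; apply.
rewrite prime_coprime // dvdn_prime2 //; apply/eqP => pq.
by move: p_s; rewrite pq q_s.
Qed.

Lemma pow34_mul_pow2_le k x : 2 ^ (8 * k + 4) <= x -> pow34 x * 2 ^ k <= x * / 2 ^ k.+1.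
Proof.
move=> x_ge; have pow2_ge1 n : 1 <= 2 ^ n by apply: pow_R1_Rle; lra.
have x_ge1 := pow2_ge1 (8 * k + 4)%N; set w := 2 ^ (2 * k + 1).
have w_ge1 : 1 <= w by exact: pow2_ge1.
have w4E : w * w * (w * w) = 2 ^ (8 * k + 4) by rewrite /w -!pow_add; congr (_ ^ _); lia.
have sqrt_ge : w * w <= sqrt x by apply: sqrt_ge_of_sq_le; nra.
have k1_ge1 := pow2_ge1 k.+1.
apply: (Rmult_le_reg_r (2 ^ k.+1)); first lra.
have -> : x * / 2 ^ k.+1 * 2 ^ k.+1 = sqrt x * sqrt x by rewrite sqrt_sqrt; [field | ]; lra.
have -> : pow34 x * 2 ^ k * 2 ^ k.+1 = sqrt x * (sqrt (sqrt x) * w).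
  rewrite /pow34 /w; have -> : (2 * k + 1 = k + k.+1)%N by lia.
  by rewrite pow_add; ring.
apply: Rmult_le_compat_l; first exact: sqrt_pos.
have := sqrt_sqrt (sqrt x) (sqrt_pos x); nra.
Qed.

Lemma sifted_count_primes_ge (B : seq nat) (k N : nat) : uniq B -> all prime B ->
  (size B <= k)%N -> 2 ^ (8 * k + 4) <= INR N -> INR N * / 2 ^ k.+1 <= sifted_count B N.
Proof.
move=> B_uniq B_prime B_size N_ge; have N_ge0 := pos_INR N.
have B_gt1 : all (ltn 1%N) B by apply: sub_all B_prime => p; exact: prime_gt1.
have prime_B p : p \in B -> 2 <= INR p by move/allP: B_prime => B_primes /B_primes /INR_prime_ge2.
have pow2_size : 2 ^ size B <= 2 ^ k by apply: Rle_pow; [lra | lia].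
have pow2_gt0 n : 0 < 2 ^ n by apply: pow_lt; lra.
have := @sieve_error_le B (INR N) B_gt1 (pairwise_coprime_primes B_uniq B_prime) N_ge0.
rewrite floorn_INR => /Rabs_le_between [sifted_ge _].
have main_ge : / 2 ^ k <= \rprod_(d <- B) (1 - / INR d).
  apply: (@Rle_trans _ ((/ 2) ^ size B)); first by rewrite pow_inv; apply: Rinv_le_contravar.
  rewrite -rprod_const; apply: rprod_le => p /prime_B p_ge2; split; first lra.
  by have : / INR p <= / 2 by [apply: Rinv_le_contravar; lra]; lra.
have err_le : \rprod_(d <- B) (1 + / pow34 (INR d)) <= 2 ^ k.
  apply: Rle_trans pow2_size; rewrite -rprod_const; apply: rprod_le => p /prime_B p_ge2.
  have pow34_ge := @pow34_ge1 (INR p) ltac:(lra).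
  have : 0 < / pow34 (INR p) by apply: Rinv_0_lt_compat; lra.
  have : / pow34 (INR p) <= 1 by rewrite -Rinv_1; apply: Rinv_le_contravar; lra.
  lra.
have main_part := Rmult_le_compat_l _ _ _ N_ge0 main_ge.
have err_part := Rmult_le_compat_l _ _ _ (pow34_ge0 (INR N)) err_le.
have pow34_le := pow34_mul_pow2_le N_ge.
have halfE : / 2 ^ k = 2 * / 2 ^ k.+1 by rewrite -(tech_pow_Rmult 2 k); field; have := pow2_gt0 k; lra.
by rewrite halfE in main_part; lra.
Qed.

Lemma exists_multiple_near (Q : nat) (M Y : R) : 0 < INR Q * M -> INR Q * M <= Y ->
  exists h, INR (Q * h) * M <= Y <= 2 * (INR (Q * h) * M).
Proof.
move=> QM_gt0 QM_le; set y := Y / (INR Q * M).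
have y_ge1 : 1 <= y by apply: Rle_div_intro; lra.
have [h_le y_lt] := @floorn_bounds y ltac:(lra).
have h_ge1 : 1 <= INR (floorn y).
  by rewrite -INR_1; apply: leq_INR; apply: leq_floorn; rewrite ?INR_1; lra.
exists (floorn y); rewrite INR_muln.
have -> : INR Q * INR (floorn y) * M = INR (floorn y) * (INR Q * M) by ring.
have -> : Y = y * (INR Q * M) by rewrite /y /Rdiv Rmult_assoc Rinv_l; lra.
have scaled_h_le := Rmult_le_compat_r _ _ _ (Rlt_le _ _ QM_gt0) h_le.
have y_le : y <= 2 * INR (floorn y) by lra.
have := Rmult_le_compat_r _ _ _ (Rlt_le _ _ QM_gt0) y_le; lra.
Qed.

Lemma mix_gain_ge_half q r x : 0 <= q -> 0 < r < 1 ->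
  (1 - r) * (1 - r) <= 2 * r * (1 - cos x) -> q / 2 <= mix_gain q r x.
Proof.
move=> q_ge0 r_bounds cos_ge; apply: Rle_div_intro; first exact: geom_den_gt0.
rewrite /geom_den; have := Rmult_le_compat_l (q / 2) _ _ ltac:(lra) cos_ge; lra.
Qed.

Lemma one_sub_div_prob_le a n : 0 < a -> prime n -> a * ln (INR n) <= 1 / 2 ->
  1 - div_prob a n <= (INR n + 1) * (2 * (a * ln (INR n))).
Proof.
move=> a_gt0 n_prime x_le; have p_ge2 := INR_prime_ge2 n_prime.
have [q_gt0 q_lt1] := div_prob_bounds a_gt0 n_prime.
have expm1_gt0 := Rpower_prime_sub1_gt0 a_gt0 n_prime.
have expm1_le := @expm1_le_double (a * ln (INR n)) ltac:(have := a_ln_prime_gt0 a_gt0 n_prime; lra).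
rewrite -/(Rpower (INR n) a) in expm1_le.
have -> : 1 - div_prob a n = (INR n + 1) * (Rpower (INR n) a - 1) * div_prob a n.
  by rewrite /div_prob; field; nra.
apply: (@Rle_trans _ ((INR n + 1) * (Rpower (INR n) a - 1))); last by apply: Rmult_le_compat_l; lra.
by rewrite -[X in _ <= X]Rmult_1_r; apply: Rmult_le_compat_l; [nra | lra].
Qed.

Lemma Cmod_charf_factor_le_half_chord a t n delta : 0 < a -> prime n -> a * ln (INR n) <= 1 / 2 ->
  0 < delta -> delta <= half_chord t n ->
  Cmod (charf_factor a t n) <= (INR n + 1) * (2 * (a * ln (INR n))) + a * ln (INR n) / delta.
Proof.
move=> a_gt0 n_prime x_le delta_gt0 delta_le; rewrite /charf_factor n_prime Cmod_centered_mix.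
have r_bounds := geom_ratio_bounds a_gt0 n_prime; have r_ge := geom_ratio_ge a n.
have cosE := one_sub_cos_half_chord t n; have := one_sub_div_prob_le a_gt0 n_prime x_le.
case: (Cmod_geom_mix_small (t * ln (INR n)) (div_prob_bounds a_gt0 n_prime) r_bounds) => [mix_le|cos1].
  move=> q_ge; apply: Rle_trans mix_le _; apply: Rplus_le_compat => //.
  have sqrt_ge : delta <= sqrt (2 * geom_ratio a n * (1 - cos (t * ln (INR n)))).
    apply: sqrt_ge_of_sq_le; first lra.
    have : delta * delta <= half_chord t n * half_chord t n by nra.
    rewrite cosE; nra.
  apply: Rmult_le_compat; [lra | | lra | by apply: Rinv_le_contravar].
  by left; apply: Rinv_0_lt_compat; lra.
by rewrite cos1 in cosE; nra.
Qed.

Section MinorArc.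
Variables (a t : R).
Hypothesis a_gt0 : 0 < a.
Let L := - ln a.
Hypothesis L_ge1000 : 1000 <= L.
Hypothesis L4_le_exp : 200 * L ^ 4 <= exp (L / 4).
Hypothesis t_ge : / (2 * L) <= t.
Hypothesis t_le : t <= exp (10 * L).

Let E := exp (L / 4).

Lemma exp_half_L : exp (L / 2) = E * E.
Proof. by rewrite -exp_plus; congr exp; field. Qed.

Lemma saddle_mul_exp4 : a * (E * E * (E * E)) = 1.
Proof.
rewrite -exp_half_L -exp_plus; have -> : L / 2 + L / 2 = L by field.
exact: saddle_mul_exp.
Qed.

Lemma minor_L3_ge : 1000 <= L ^ 3.
Proof. by have -> : L ^ 3 = L * (L * L) by [ring]; nra. Qed.

Lemma minor_exp_ge : 200 * L ^ 4 <= E /\ 200 * L <= E /\ 1 <= E.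
Proof.
have L3_ge := minor_L3_ge; have L4_le : 200 * L ^ 4 <= E by exact: L4_le_exp.
by have L4E : L ^ 4 = L * L ^ 3 by [ring]; split=> //; split; nra.
Qed.

Lemma saddle_L4_le : a * L ^ 4 <= / 200.
Proof.
have [L4_le [_ E_ge1]] := minor_exp_ge; have aE4 := saddle_mul_exp4.
have E4_ge : E * 1 <= E * (E * (E * E)) by apply: Rmult_le_compat_l; nra.
have := Rmult_le_compat_l a _ _ (Rlt_le _ _ a_gt0) L4_le.
by have := Rmult_le_compat_l a _ _ (Rlt_le _ _ a_gt0) E4_ge; lra.
Qed.

Lemma minor_L3_inv_gt0 : 0 < / L ^ 3.
Proof. by apply: Rinv_0_lt_compat; have := minor_L3_ge; lra. Qed.

Lemma Cmod_charf_factor_small_prime n : prime n -> INR n <= exp (L / 2) ->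
  / L ^ 3 <= half_chord t n -> Cmod (charf_factor a t n) <= exp (- (L / 2) / 2).
Proof.
move=> n_prime n_le chord_ge.
have [L4_le [L_le E_ge1]] := minor_exp_ge; have aE4 := saddle_mul_exp4; have aL4_le := saddle_L4_le.
have p_ge2 := INR_prime_ge2 n_prime; have L3_ge := minor_L3_ge.
have lnp_le : ln (INR n) <= L / 2 by rewrite -(ln_exp (L / 2)); apply: ln_le; lra.
have x_le : a * ln (INR n) <= a * (L / 2) by apply: Rmult_le_compat_l; lra.
have aL_le : a * (L / 2) <= 1 / 2 by have L4E : a * L ^ 4 = a * L * L ^ 3 by [ring]; nra.
apply: Rle_trans (Cmod_charf_factor_le_half_chord a_gt0 n_prime _ minor_L3_inv_gt0 chord_ge) _.
  lra.
have -> : exp (- (L / 2) / 2) = / E by rewrite -exp_Ropp; congr exp; field.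
rewrite exp_half_L in n_le.
have inv_part : a * ln (INR n) / / L ^ 3 <= a * L ^ 4 / 2.
  have -> : a * ln (INR n) / / L ^ 3 = a * ln (INR n) * L ^ 3 by field; lra.
  have -> : a * L ^ 4 / 2 = a * (L / 2) * L ^ 3 by field.
  by apply: Rmult_le_compat_r; lra.
have weight_part : (INR n + 1) * (2 * (a * ln (INR n))) <= 2 * (E * E) * (a * L).
  apply: Rmult_le_compat; [lra | | nra | lra].
  by have := a_ln_prime_gt0 a_gt0 n_prime; lra.
apply: (Rmult_le_reg_r E); first lra.
rewrite Rinv_l; last lra.
have weight_small : 2 * (E * E) * (a * L) * E <= 1 / 100.
  have : a * (E * E) * E * (200 * L) <= a * (E * E) * E * E.
    by apply: Rmult_le_compat_l => //; apply: Rmult_le_pos; [apply: Rmult_le_pos|]; nra.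
  lra.
have inv_small : a * L ^ 4 / 2 * E <= 1 / 400.
  have : a * E * (200 * L ^ 4) <= a * E * E by apply: Rmult_le_compat_l => //; nra.
  have : a * (E * E) * 1 <= a * (E * E) * (E * E) by apply: Rmult_le_compat_l; nra.
  lra.
nra.
Qed.

Lemma div_prob_ge_large_prime n : prime n -> exp (L / 2) < INR n -> ln (INR n) <= 41 * L ->
  exp (L / 2) / 4 * / (INR n - 1) <= div_prob a n.
Proof.
move=> n_prime n_gt lnp_le; have [_ [L_le E_ge1]] := minor_exp_ge; have aE4 := saddle_mul_exp4.
have x_le : a * ln (INR n) <= 41 * (a * L) by nra.
have aL_le : a * L * (E * E) <= / 200.
  have -> : a * L * (E * E) = (a * (E * E * (E * E))) * (L / (E * E)) by field; lra.
  by rewrite aE4 Rmult_1_l; apply: Rdiv_le_intro; nra.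
have x_le_half : a * ln (INR n) <= 1 / 2.
  by have : a * L * 1 <= a * L * (E * E) by [apply: Rmult_le_compat_l; nra]; lra.
have expm1_gt0 := Rpower_prime_sub1_gt0 a_gt0 n_prime.
have expm1_le := @expm1_le_double (a * ln (INR n)) ltac:(have := a_ln_prime_gt0 a_gt0 n_prime; lra).
rewrite -/(Rpower (INR n) a) in expm1_le; rewrite exp_half_L in n_gt *.
have p_ge2 := INR_prime_ge2 n_prime.
apply: (@Rle_trans _ (/ (1 + (INR n + 1) * (82 * (a * L))))); last first.
  apply: Rinv_le_contravar; first by nra.
  by apply: Rplus_le_compat_l; apply: Rmult_le_compat_l; lra.
have den_gt0 : 0 < 1 + (INR n + 1) * (82 * (a * L)) by nra.
apply: (Rmult_le_reg_r (1 + (INR n + 1) * (82 * (a * L)))) => //.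
rewrite Rinv_l; last lra.
have -> : E * E / 4 * / (INR n - 1) * (1 + (INR n + 1) * (82 * (a * L))) =
  (E * E + (INR n + 1) * 82 * (a * L * (E * E))) / 4 / (INR n - 1) by field; lra.
apply: Rdiv_le_intro; first lra.
nra.
Qed.

Lemma gain_large_prime n : prime n -> exp (L / 2) < INR n -> ln (INR n) <= 41 * L ->
  / L ^ 3 <= half_chord t n -> exp (L / 2) / 8 * / (INR n - 1) <= gain a t n.
Proof.
move=> n_prime n_gt lnp_le chord_ge; have q_ge := div_prob_ge_large_prime n_prime n_gt lnp_le.
apply: (@Rle_trans _ (div_prob a n / 2)); first lra.
have r_bounds := geom_ratio_bounds a_gt0 n_prime; have r_ge := geom_ratio_ge a n.
have [q_gt0 q_lt1] := div_prob_bounds a_gt0 n_prime.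
rewrite /gain n_prime; apply: mix_gain_ge_half => //; first lra.
rewrite one_sub_cos_half_chord; have L3_ge := minor_L3_ge; have aL4_le := saddle_L4_le.
have x_le : a * ln (INR n) <= / 4 * / L ^ 3.
  apply: (Rmult_le_reg_r (L ^ 3)); first lra.
  rewrite [X in _ <= X]Rmult_assoc Rinv_l; last lra.
  have : a * ln (INR n) * L ^ 3 <= a * (41 * L) * L ^ 3.
    by apply: Rmult_le_compat_r; [lra | apply: Rmult_le_compat_l; lra].
  have -> : a * (41 * L) * L ^ 3 = 41 * (a * L ^ 4) by ring.
  lra.
have inv_le1 : / L ^ 3 <= 1 by rewrite -Rinv_1; apply: Rinv_le_contravar; lra.
have : (1 - geom_ratio a n) * (1 - geom_ratio a n) <= half_chord t n * half_chord t n by nra.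
have : 0 <= half_chord t n * half_chord t n by exact: Rle_0_sqr.
nra.
Qed.

Definition off_phase_primes (z : nat) : seq nat :=
  [seq p <- iota 0 z.+1 | prime p && is_left (Rle_dec (/ L ^ 3) (half_chord t p))].

Lemma mem_off_phase_primes z p : p \in off_phase_primes z ->
  [/\ prime p, (p <= z)%N & / L ^ 3 <= half_chord t p].
Proof.
rewrite mem_filter mem_iota => /andP [/andP [p_prime off_phase] p_le]; split=> //.
by move: off_phase; case: Rle_dec.
Qed.

(* Fifty-six off-phase primes below [1 / sqrt a] contribute a factor [exp (- L / 4)] each. *)
Lemma Cmod_charf_many_off_phase z : INR z <= exp (L / 2) -> (56 <= size (off_phase_primes z))%N ->
  Cmod (charf a t) <= exp (- (14 * L)).
Proof.
move=> z_le many.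
pose g n := if n \in off_phase_primes z then L / 2 else 0.
have factor_le n : Cmod (charf_factor a t n) <= exp (- g n / 2).
  rewrite /g; case: ifP => [/mem_off_phase_primes [n_prime n_le chord_ge]|_].
    by apply: Cmod_charf_factor_small_prime => //; apply: Rle_trans z_le; apply: leq_INR.
  apply: Rle_trans (Cmod_charf_factor_le a_gt0 t n) _; apply: exp_le.
  by have := gain_bounds a_gt0 t n; lra.
apply: Clim_Cmod_le (charf_euler_product a_gt0 t) _; exists z.+1 => k z_lt_k.
apply: Rle_trans (Cmod_cprod_le_exp k factor_le) _; apply: exp_le.
suff : 28 * L <= \rsum_(0 <= n < k) g n by lra.
apply: (@Rle_trans _ (\rsum_(0 <= n < z.+1) g n)); last first.
  by apply: rsum_widen_le => // i; rewrite /g; case: ifP => _; lra.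
apply: (@Rle_trans _ (\rsum_(n <- off_phase_primes z) (L / 2))).
  have := Rmult_le_compat_r (L / 2) _ _ ltac:(lra) (leq_INR many).
  by rewrite rsum_const [INR 56]INR_IZR_INZ /=; lra.
right; rewrite /off_phase_primes big_filter big_mkcond /index_iota subn0.
by apply: eq_big_seq => n n_in; rewrite /g /off_phase_primes mem_filter n_in andbT.
Qed.

Section FewOffPhase.
Variable z : nat.
Hypothesis z_bounds : INR z <= exp (L / 2) < INR z + 1.
Let B := off_phase_primes z.
Hypothesis few : (size B <= 55)%N.
Hypothesis L_ge : 336 * 2 ^ 122 <= L.
Hypothesis L2_le_exp : 448 * 2 ^ 122 * L ^ 2 <= exp (L / 2).

Let N := floorn (exp (40 * L)).
Let delta := / 2 ^ 58.
Let c := / 2 ^ 122.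

Lemma off_phase_primes_prime : all prime B.
Proof. by apply/allP => p /mem_off_phase_primes []. Qed.

Lemma prod_off_phase_primes_le : INR (\prod_(p <- B) p) <= exp (28 * L).
Proof.
rewrite INR_prod; apply: (@Rle_trans _ (exp (L / 2) ^ size B)).
  rewrite -rprod_const; apply: rprod_le => p /mem_off_phase_primes [_ p_le _].
  by split; [exact: pos_INR | have := leq_INR p_le; lra].
rewrite exp_pow; apply: exp_le.
have := Rmult_le_compat_r (L / 2) _ _ ltac:(lra) (leq_INR few).
by rewrite [INR 55]INR_IZR_INZ /=; lra.
Qed.

Lemma cutoff_bounds : exp (40 * L) / 2 <= INR N <= exp (40 * L) /\ 2 ^ 444 <= INR N /\ (0 < N)%N.
Proof.
have exp_ge : 2 ^ 445 <= exp (40 * L) by apply: exp2_le_exp; rewrite INR_IZR_INZ /=; lra.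
rewrite -(tech_pow_Rmult 2 444) in exp_ge.
have [N_le N_gt] := @floorn_bounds (exp (40 * L)) ltac:(lra); rewrite -/N in N_le N_gt.
split; first lra.
by split; [lra | apply: ltn_of_INR; rewrite INR_0; lra].
Qed.

Lemma exists_off_phase_shift : exists g, (g <= N)%N /\ (forall b, b \in B -> (b %| g)%N) /\
  INR g * Rmax 1 t <= delta * INR N <= 2 * (INR g * Rmax 1 t).
Proof.
set Q := (\prod_(p <- B) p)%N; set M := Rmax 1 t.
have Q_gt0 := INR_gt0 (prod_primes_gt0 off_phase_primes_prime).
have Q_le := prod_off_phase_primes_le; rewrite -/Q in Q_gt0 Q_le.
have M_ge1 : 1 <= M by apply: Rmax_l.
have M_le : M <= exp (10 * L) by apply: Rmax_lub => //; have := exp_ineq1_le (10 * L); lra.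
have [[N_ge _] [_ N_gt0]] := cutoff_bounds.
have delta_gt0 : 0 < delta by apply: Rinv_0_lt_compat; lra.
have deltaE : delta * 2 ^ 58 = 1 by rewrite /delta Rinv_l; lra.
have QM_le : INR Q * M <= delta * INR N.
  apply: (@Rle_trans _ (exp (28 * L) * exp (10 * L))); first by apply: Rmult_le_compat; lra.
  apply: (@Rle_trans _ (delta * (exp (40 * L) / 2))); last by apply: Rmult_le_compat_l; lra.
  have -> : exp (40 * L) = exp (28 * L) * exp (10 * L) * exp (2 * L).
    by rewrite -!exp_plus; congr exp; ring.
  have : 2 ^ 59 <= exp (2 * L) by apply: exp2_le_exp; rewrite INR_IZR_INZ /=; lra.
  rewrite -(tech_pow_Rmult 2 58) => exp_ge.
  have : 0 < exp (28 * L) * exp (10 * L) by apply: Rmult_lt_0_compat; exact: exp_pos.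
  nra.
have [h [g_le g_ge]] := @exists_multiple_near Q M _ ltac:(nra) QM_le.
exists (Q * h)%N; split; last first.
  by split=> // b b_B; apply: dvdn_mulr; rewrite /Q (big_rem b) //=; exact: dvdn_mulr.
apply: leq_of_INR; have := pos_INR (Q * h).
have : delta <= 1 by nra.
nra.
Qed.

Lemma off_phase_sifted_count_ge : INR N * / 2 ^ 57 <= sifted_count B N - delta * INR N.
Proof.
have [_ [N_ge N_gt0]] := cutoff_bounds.
have := @sifted_count_primes_ge B 55 N (filter_uniq _ (iota_uniq _ _)) off_phase_primes_prime few N_ge.
have -> : delta = / 2 ^ 56 * / 4.
  by rewrite /delta -Rinv_mult (pow_add 2 56 2); congr (/ (_ * _)); ring.
have -> : / 2 ^ 57 = / 2 ^ 56 * / 2.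
  by rewrite -Rinv_mult (pow_add 2 56 1); congr (/ (_ * _)); ring.
by have := pos_INR N; nra.
Qed.

Lemma rsum_off_phase_half_chord_ge :
  INR N * (2 * c / L) <= \rsum_(1 <= m < (2 * N).+1) (if avoids B m then half_chord t m else 0).
Proof.
have [_ [_ N_gt0]] := cutoff_bounds; have N_pos := INR_gt0 N_gt0.
have [g [g_le [B_dvd g_near]]] := exists_off_phase_shift.
have invL_gt0 : 0 < / (2 * L) by apply: Rinv_0_lt_compat; lra.
have pow2_gt0 n : 0 < 2 ^ n by apply: pow_lt; lra.
have delta_gt0 : 0 < delta by apply: Rinv_0_lt_compat.
have t_gt0 : 0 < t by lra.
have := rsum_half_chord_ge t_gt0 delta_gt0 g_le N_gt0 B_dvd g_near.
set S := \rsum_(1 <= m < (2 * N).+1) _ => chord_sum_ge.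
have min_ge : / (2 * L) <= Rmin 1 t.
  by apply: Rmin_glb => //; rewrite -Rinv_1; apply: Rinv_le_contravar; lra.
have lower : INR N * / 2 ^ 57 * (delta / 16 * / (2 * L)) <=
    (sifted_count B N - delta * INR N) * (delta / 16 * Rmin 1 t).
  apply: Rmult_le_compat; [| | exact: off_phase_sifted_count_ge | ].
  - by apply: Rmult_le_pos; [lra | left; apply: Rinv_0_lt_compat].
  - by apply: Rmult_le_pos; lra.
  - by apply: Rmult_le_compat_l; lra.
have cE : c = / 2 ^ 57 * (delta * / 2 ^ 7).
  by rewrite /c /delta -!Rinv_mult -!pow_add.
have : INR N * / 2 ^ 57 * (delta / 16 * / (2 * L)) = 2 * (INR N * (2 * c / L)).
  by rewrite cE; field; lra.
lra.
Qed.

Let off_phase_large p :=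
  prime p && (z < p)%N && is_left (Rle_dec (/ L ^ 3) (half_chord t p)).

Lemma half_chord_ratio_le p : prime p -> p \notin B ->
  half_chord t p / (INR p - 1) <=
  (if off_phase_large p then / (INR p - 1) else 0) + 4 * / L ^ 3 * (ln (INR p) / INR p).
Proof.
move=> p_prime p_B; rewrite /off_phase_large p_prime.
have p_ge2 := INR_prime_ge2 p_prime; have lnp_gt := ln_ge_half p_ge2.
have inv_gt0 := minor_L3_inv_gt0; have [chord_ge0 chord_le1] := half_chord_bounds t p.
have invp_gt0 : 0 < / (INR p - 1) by apply: Rinv_0_lt_compat; lra.
have mertens_ge0 : 0 <= 4 * / L ^ 3 * (ln (INR p) / INR p).
  by apply: Rmult_le_pos; [lra | apply: Rdiv_le_0_compat; lra].
case: (Rle_dec (/ L ^ 3) (half_chord t p)) => chord_cases /=.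
  have -> : (z < p)%N.
    rewrite ltnNge; apply/negP => p_le; move/negP: p_B; apply.
    by rewrite mem_filter mem_iota p_prime /= add0n ltnS p_le andbT; case: Rle_dec.
  by rewrite /Rdiv /=; nra.
rewrite andbF Rplus_0_l.
apply: Rdiv_le_intro; first lra.
have -> : 4 * / L ^ 3 * (ln (INR p) / INR p) * (INR p - 1) =
    / L ^ 3 * (4 * ln (INR p) * ((INR p - 1) / INR p)) by field; have := minor_L3_ge; lra.
have : 1 / 2 <= (INR p - 1) / INR p by apply: Rle_div_intro; lra.
move=> ratio_ge; have : 1 <= 4 * ln (INR p) * ((INR p - 1) / INR p) by nra.
nra.
Qed.

Lemma rsum_off_phase_large_ge : c / (2 * L) <=
  \rsum_(0 <= p < (2 * N).+1) (if off_phase_large p then / (INR p - 1) else 0).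
Proof.
have [[_ N_le] [_ N_gt0]] := cutoff_bounds; have N_pos := INR_gt0 N_gt0.
have chord_sum_ge := rsum_off_phase_half_chord_ge.
have chord_sum_le := rsum_half_chord_le t (2 * N) off_phase_primes_prime.
set SP := \rsum_(0 <= p < (2 * N).+1) _ in chord_sum_le; set S1 := \rsum_(0 <= p < _) _.
have SP_ge : c / L <= SP.
  rewrite INR_muln INR_2 in chord_sum_le; apply: (Rmult_le_reg_l (2 * INR N)); first lra.
  have -> : 2 * INR N * (c / L) = INR N * (2 * c / L) by field; lra.
  lra.
have SP_le : SP <= S1 + 4 * / L ^ 3 * mertens_sum (2 * N).
  rewrite /SP /S1 /mertens_sum big_distrr /= [X in _ <= _ + X]big_mkcond -big_split /=.
  apply: rsum_nat_le => p _; case: (boolP (prime p)) => p_prime /=; last first.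
    by rewrite /off_phase_large (negbTE p_prime) /=; lra.
  case: (boolP (p \in B)) => p_B /=; last exact: half_chord_ratio_le.
  have p_ge2 := INR_prime_ge2 p_prime; have lnp_gt := ln_ge_half p_ge2.
  apply: Rplus_le_le_0_compat; first by case: ifP => _; [left; apply: Rinv_0_lt_compat |]; lra.
  by apply: Rmult_le_pos; [have := minor_L3_inv_gt0 | apply: Rdiv_le_0_compat]; lra.
have ln2N_le : ln (INR (2 * N)) <= 41 * L.
  rewrite INR_muln INR_2 ln_mult; [|lra|lra].
  by have := ln_le _ _ N_pos N_le; rewrite ln_exp; have := ln2_bounds; lra.
have mertens_le := @mertens_upper (2 * N) ltac:(lia).
have mertens_part : 4 * / L ^ 3 * mertens_sum (2 * N) <= 4 * / L ^ 3 * (42 * L).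
  by apply: Rmult_le_compat_l; [have := minor_L3_inv_gt0 |]; lra.
have pow122_gt0 : 0 < 2 ^ 122 by apply: pow_lt; lra.
have halfE : c / (2 * L) = c / L / 2 by field; lra.
have mertens_small : 4 * / L ^ 3 * (42 * L) <= c / (2 * L).
  have -> : 4 * / L ^ 3 * (42 * L) = 168 / L / L by field; lra.
  have -> : c / (2 * L) = c / 2 / L by field; lra.
  apply: Rmult_le_compat_r; first by left; apply: Rinv_0_lt_compat; lra.
  apply: Rdiv_le_intro; first lra.
  have c_gt0 : 0 < c by apply: Rinv_0_lt_compat.
  have := Rmult_le_compat_l c _ _ (Rlt_le _ _ c_gt0) L_ge.
  have -> : c * (336 * 2 ^ 122) = 336 by rewrite /c; field; lra.
  lra.
lra.
Qed.

Lemma Cmod_charf_few_off_phase : Cmod (charf a t) <= exp (- (14 * L)).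
Proof.
have [[_ N_le] [_ N_gt0]] := cutoff_bounds; have N_pos := INR_gt0 N_gt0.
have ge0 i : 0 <= gain a t i by have := gain_bounds a_gt0 t i; lra.
have pow122_gt0 : 0 < 2 ^ 122 by apply: pow_lt; lra.
have c_gt0 : 0 < c by apply: Rinv_0_lt_compat.
have -> : - (14 * L) = - (28 * L) / 2 by field.
apply: (Cmod_charf_le a_gt0); exists (2 * N).+1 => k k_gt.
apply: (@Rle_trans _ (\rsum_(0 <= n < (2 * N).+1) gain a t n)); last exact: rsum_widen_le.
apply: (@Rle_trans _ (exp (L / 2) / 8 * (c / (2 * L)))).
  have -> : exp (L / 2) / 8 * (c / (2 * L)) = c * exp (L / 2) / (16 * L) by field; lra.
  apply: Rle_div_intro; first lra.
  have := Rmult_le_compat_l c _ _ (Rlt_le _ _ c_gt0) L2_le_exp.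
  have -> : c * (448 * 2 ^ 122 * L ^ 2) = 448 * L * L by rewrite /c; field; lra.
  lra.
have exp_gt0 := exp_pos (L / 2).
apply: Rle_trans (Rmult_le_compat_l (exp (L / 2) / 8) _ _ ltac:(lra) rsum_off_phase_large_ge) _.
rewrite big_distrr; apply: rsum_nat_le => n /andP [_ n_le] /=; rewrite /off_phase_large.
case: (boolP (prime n)) => n_prime /=; last by rewrite Rmult_0_r.
case: (boolP (z < n)%N) => z_lt /=; last by rewrite Rmult_0_r.
case: Rle_dec => chord_ge /=; last by rewrite Rmult_0_r.
apply: gain_large_prime => //; first by have := leq_INR z_lt; rewrite S_INR; lra.
have INR_n_le : INR n <= 2 * INR N by rewrite -INR_2 -INR_muln; apply: leq_INR; lia.
have lnn_le := ln_le _ _ (INR_gt0 (prime_gt0 n_prime)) INR_n_le.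
rewrite ln_mult in lnn_le; [|lra|lra].
by have := ln_le _ _ N_pos N_le; rewrite ln_exp; have := ln2_bounds; lra.
Qed.

End FewOffPhase.

End MinorArc.

Lemma Cmod_charf_minor_arc : exists L0, 1000 <= L0 /\ forall a t, 0 < a -> L0 <= - ln a ->
  / (2 * - ln a) <= t -> t <= exp (10 * - ln a) ->
  Cmod (charf a t) <= exp (- (14 * - ln a)).
Proof.
have [L1 [_ L4_le]] := @exp_dominates 200 (1 / 4) 4 ltac:(lra).
have [L2 [_ L2_le]] := @exp_dominates (448 * 2 ^ 122) (1 / 2) 2 ltac:(lra).
exists (Rmax 1000 (Rmax (336 * 2 ^ 122) (Rmax L1 L2))); split; first exact: Rmax_l.
move=> a t a_gt0; set L := - ln a.
move=> /Rmax_le_inv [L_ge1000 /Rmax_le_inv [L_ge /Rmax_le_inv [L_ge1 L_ge2]]] t_ge t_le.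
have L4_le_exp := L4_le L L_ge1; have L2_le_exp := L2_le L L_ge2.
have quarterE : 1 / 4 * L = L / 4 by field.
have halfE : 1 / 2 * L = L / 2 by field.
rewrite quarterE in L4_le_exp; rewrite halfE in L2_le_exp.
have floor_z := @floorn_bounds (exp (L / 2)) ltac:(have := exp_pos (L / 2); lra).
case: (leqP 56 (size (off_phase_primes a t (floorn (exp (L / 2)))))) => [many|few].
  by apply: Cmod_charf_many_off_phase many => //; case: floor_z.
exact: Cmod_charf_few_off_phase few _ _.
Qed.

(** * Bounds for the characteristic function *)

Section CharfBounds.
Variable a : R.
Hypothesis a_gt0 : 0 < a.
Let L := - ln a.
Hypothesis L_ge1000 : 1000 <= L.
Let variance := / (a ^ 3 * L).

Lemma variance_gt0 : 0 < variance.
Proof. by apply: Rinv_0_lt_compat; apply: Rmult_lt_0_compat; [exact: pow_lt | lra]. Qed.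

Lemma central_gain_ge t : 0 <= t <= a / 10 -> exists K, forall k, (K <= k)%N ->
  variance * t ^ 2 / 128 <= \rsum_(0 <= n < k) gain a t n.
Proof.
move=> [t_ge0 t_le]; have aL_le := saddle_L_le a_gt0 L_ge1000; rewrite -/L in aL_le.
have a2_gt0 := pow_lt a 2 a_gt0; have t2_ge0 := pow_le t 2 t_ge0.
have [K sum_ge] := rsum_gain_ge a_gt0 L_ge1000 t_ge0 ltac:(rewrite -/L; nra).
exists K => k /sum_ge; apply: Rle_trans; rewrite -/L.
have -> : variance * t ^ 2 / 128 = t ^ 2 / (128 * a ^ 3 * L) by rewrite /variance; field; lra.
apply: Rmult_le_compat_l => //; apply: Rinv_le_contravar.
  by apply: Rmult_lt_0_compat; [apply: Rmult_lt_0_compat|]; lra.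
have t2_le : t ^ 2 <= a ^ 2 by apply: pow_incr; lra.
have -> : 128 * a ^ 3 * L = 64 * a * (a ^ 2 + a ^ 2) * L by ring.
by apply: Rmult_le_compat_r; [lra | apply: Rmult_le_compat_l; lra].
Qed.

Lemma charf_central_bounds t : 0 <= t <= a / 10 ->
  Cmod (charf a t) <= exp (- (variance * t ^ 2 / 256)) /\
  Rabs (snd (charf a t)) <=
    138000 * (variance / a * t ^ 3) * exp (- (variance * t ^ 2 / 256)) /\
  - (138000 * (variance / a * t ^ 3) * exp (- (variance * t ^ 2 / 256))) <= fst (charf a t) /\
  1 - 69000 * (variance * t ^ 2)
    - 138000 * (variance / a * t ^ 3) * exp (- (variance * t ^ 2 / 256)) <= fst (charf a t).
Proof.
move=> t_bounds; have [t_ge0 _] := t_bounds; have t3_ge0 := pow_le t 3 t_ge0.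
have var_gt0 := variance_gt0; have gain_ge := central_gain_ge t_bounds.
have exponentE : - (variance * t ^ 2 / 256) = - (variance * t ^ 2 / 128) / 2 by field.
have im_le k : \rsum_(0 <= n < k) Rabs (snd (charf_factor a t n)) <= 69000 * (variance / a * t ^ 3).
  have := rsum_Im_charf_factor_le a_gt0 L_ge1000 k t_ge0; rewrite -/L.
  by have -> : 69000 * t ^ 3 / (a ^ 4 * L) = 69000 * (variance / a * t ^ 3)
    by rewrite /variance; field; lra.
have re_ge k : 1 - 69000 * (variance * t ^ 2) <= \rprod_(0 <= n < k) fst (charf_factor a t n).
  have := proj2 (rprod_Re_charf_factor_ge a_gt0 L_ge1000 k t_bounds); rewrite -/L.
  by have -> : 69000 * t ^ 2 / (a ^ 3 * L) = 69000 * (variance * t ^ 2) by rewrite /variance; field; lra.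
have re_ge0 k := proj1 (rprod_Re_charf_factor_ge a_gt0 L_ge1000 k t_bounds).
have err_le : exp (1 / 2) * (69000 * (variance / a * t ^ 3)) * exp (- (variance * t ^ 2 / 128) / 2) <=
   138000 * (variance / a * t ^ 3) * exp (- (variance * t ^ 2 / 256)).
  rewrite exponentE; apply: Rmult_le_compat_r; first by left; exact: exp_pos.
  have moment_ge0 : 0 <= variance / a * t ^ 3.
    by apply: Rmult_le_pos => //; apply: Rdiv_le_0_compat; lra.
  have : exp (1 / 2) <= 2 by have := @expm1_le_double (1 / 2) ltac:(lra); lra.
  nra.
have [im_part re_part0] := charf_re_im_bounds a_gt0 gain_ge im_le re_ge0.
have [_ re_part] := charf_re_im_bounds a_gt0 gain_ge im_le re_ge.
split; first by rewrite exponentE; apply: (Cmod_charf_le a_gt0).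
split; first lra.
by split; lra.
Qed.

End CharfBounds.

Lemma Cmod_charf_off_center : exists L0, 1000 <= L0 /\ forall a t, 0 < a -> L0 <= - ln a ->
  a / 10 <= t <= exp (10 * - ln a) -> Cmod (charf a t) <= exp (- (14 * - ln a)).
Proof.
have [L1 [L1_ge minor_arc]] := Cmod_charf_minor_arc.
have [L2 [_ L2_le]] := @exp_dominates (14 * 12928) 1 2 ltac:(lra).
exists (Rmax L1 L2); split; first by have := Rmax_l L1 L2; lra.
move=> a t a_gt0 /Rmax_le_inv [L_ge1 L_ge2] [t_ge t_le].
case: (Rle_lt_dec (/ (2 * - ln a)) t) => t_cases; first by apply: minor_arc.
set L := - ln a in L_ge1 L_ge2 t_le t_cases *.
have L_ge1000 : 1000 <= L by lra.
have t_gt0 : 0 < t by lra.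
have tL_le : 2 * t * L <= 1.
  have : t * (2 * L) <= / (2 * L) * (2 * L) by apply: Rmult_le_compat_r; lra.
  rewrite Rinv_l; lra.
have [K gain_ge] := rsum_gain_ge a_gt0 L_ge1000 (Rlt_le _ _ t_gt0) tL_le; rewrite -/L in gain_ge.
have -> : - (14 * L) = - (28 * L) / 2 by field.
apply: (Cmod_charf_le a_gt0); exists K => k /gain_ge sum_ge; apply: Rle_trans sum_ge.
have a2_gt0 := pow_lt a 2 a_gt0.
have a2_le : a ^ 2 <= 100 * t ^ 2.
  by have -> : 100 * t ^ 2 = (10 * t) ^ 2 by [ring]; apply: pow_incr; lra.
apply: Rle_div_intro; first by apply: Rmult_lt_0_compat; [apply: Rmult_lt_0_compat|]; lra.
have := L2_le L L_ge2; rewrite Rmult_1_l => L2_le_exp.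
have aL2_le : a * (14 * 12928 * L ^ 2) <= 1.
  have := Rmult_le_compat_l a _ _ (Rlt_le _ _ a_gt0) L2_le_exp.
  by have := saddle_mul_exp a_gt0; rewrite -/L; lra.
apply: (@Rle_trans _ ((28 * 64 * (a * L ^ 2)) * (101 * t ^ 2))); last by nra.
have -> : 28 * L * (64 * a * (a ^ 2 + t ^ 2) * L) = (28 * 64 * (a * L ^ 2)) * (a ^ 2 + t ^ 2) by ring.
by apply: Rmult_le_compat_l; [nra | lra].
Qed.

(** * Fejer smoothing *)

Definition tent (T t : R) := Rmax 0 (1 - Rabs t / T).

Definition fejer (T y : R) := 2 * RInt (fun t => tent T t * cos (t * y)) 0 T.

Definition cauchy_kernel (k y : R) := k / (1 + (k * y) ^ 2).

Definition fejer_mass (T U x : R) := RInt (fun u => fejer T (x - u)) (- U) U.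

Lemma cauchy_kernel_gt0 k y : 0 < k -> 0 < cauchy_kernel k y.
Proof. by move=> k_gt0; apply: Rdiv_lt_0_compat => //; have := pow2_ge_0 (k * y); lra. Qed.

Lemma is_RInt_cauchy_kernel k x b c : 0 < k ->
  is_RInt (fun u => cauchy_kernel k (x - u)) b c (atan (k * (c - x)) - atan (k * (b - x))).
Proof.
move=> k_gt0; apply: (is_RInt_derive (fun u => atan (k * (u - x)))) => u _.
  auto_derive => //; rewrite /cauchy_kernel /Rsqr; field.
  by have := Rle_0_sqr (k * (x - u)); rewrite /Rsqr; nra.
apply: (@ex_derive_continuous _ _ (fun u => cauchy_kernel k (x - u))); rewrite /cauchy_kernel.
auto_derive; have := pow2_ge_0 (k * (x - u)); rewrite /Rminus /pow; nra.
Qed.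

Lemma ex_RInt_cauchy_kernel k x b c : 0 < k -> ex_RInt (fun u => cauchy_kernel k (x - u)) b c.
Proof. by move=> k_gt0; eexists; exact: is_RInt_cauchy_kernel. Qed.

Lemma RInt_cauchy_kernel_le k x b c : 0 < k -> RInt (fun u => cauchy_kernel k (x - u)) b c <= 4.
Proof.
move=> k_gt0; rewrite (is_RInt_unique _ _ _ _ (@is_RInt_cauchy_kernel k x b c k_gt0)).
have := atan_bound (k * (c - x)); have := atan_bound (k * (b - x)); have := PI_4; lra.
Qed.

Lemma cauchy_kernel_le_far k r y : 0 < k -> 0 < r <= Rabs y -> cauchy_kernel k y <= / (k * (r * r)).
Proof.
move=> k_gt0 [r_gt0 r_le]; have kr2_gt0 : 0 < k * (r * r) by apply: Rmult_lt_0_compat; nra.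
have y2_ge : r * r <= y ^ 2 by rewrite -pow2_abs; nra.
have yE : (k * y) ^ 2 = k * (k * y ^ 2) by ring.
apply: Rdiv_le_intro; first by have := pow2_ge_0 (k * y); lra.
rewrite yE; have -> : / (k * (r * r)) * (1 + k * (k * y ^ 2)) = (1 + k * (k * y ^ 2)) / (k * (r * r)).
  by rewrite /Rdiv Rmult_comm.
by apply: Rle_div_intro => //; have := Rmult_le_compat_l _ _ _ (Rlt_le _ _ k_gt0) y2_ge; nra.
Qed.

Lemma cauchy_kernel_le_sqrt k y : 0 < k -> / sqrt k < Rabs y ->
  cauchy_kernel k y <= 2 / sqrt k * cauchy_kernel (sqrt k) y.
Proof.
move=> k_gt0 y_far; have sqrt_gt0 := sqrt_lt_R0 _ k_gt0; have sqrt_sq := sqrt_sqrt k (Rlt_le _ _ k_gt0).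
have ky2_ge1 : 1 <= k * y ^ 2.
  have : / sqrt k * sqrt k <= Rabs y * sqrt k by apply: Rmult_le_compat_r; lra.
  rewrite Rinv_l; last lra.
  by move=> product_ge1; rewrite -pow2_abs -{1}sqrt_sq; have := Rabs_pos y; nra.
have sqrtE : (sqrt k * y) ^ 2 = k * y ^ 2 by rewrite -{2}sqrt_sq; ring.
rewrite /cauchy_kernel sqrtE.
have -> : 2 / sqrt k * (sqrt k / (1 + k * y ^ 2)) = 2 / (1 + k * y ^ 2) by field; lra.
have -> : (k * y) ^ 2 = k * (k * y ^ 2) by ring.
apply: Rdiv_le_intro; first by nra.
have -> : 2 / (1 + k * y ^ 2) * (1 + k * (k * y ^ 2)) =
    2 * (1 + k * (k * y ^ 2)) / (1 + k * y ^ 2) by field; lra.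
by apply: Rle_div_intro; nra.
Qed.

Section FejerKernel.
Variable T : R.
Hypothesis T_gt0 : 0 < T.

Lemma tent_bounds t : 0 <= tent T t <= 1.
Proof.
have : 0 <= Rabs t / T by apply: Rdiv_le_0_compat; [exact: Rabs_pos | lra].
by move=> ratio_ge0; split; [exact: Rmax_l | apply: Rmax_lub; lra].
Qed.

Lemma tentE t : 0 <= t <= T -> tent T t = 1 - t / T.
Proof.
move=> t_bounds; rewrite /tent Rabs_pos_eq; last lra.
by rewrite Rmax_right //; have : t / T <= 1; [apply: Rdiv_le_intro; lra | lra].
Qed.

Lemma is_RInt_tent_mul (h : R -> R) l :
  is_RInt (fun t => (1 - t / T) * h t) 0 T l -> is_RInt (fun t => tent T t * h t) 0 T l.
Proof.
apply: is_RInt_ext => t; rewrite Rmin_left ?Rmax_right; [|lra|lra] => t_bounds.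
by rewrite tentE //; lra.
Qed.

Lemma ex_RInt_tent_cos y : ex_RInt (fun t => tent T t * cos (t * y)) 0 T.
Proof.
have [l int_l] : ex_RInt (fun t => (1 - t / T) * cos (t * y)) 0 T.
  apply: ex_RInt_cont => x; apply: (@ex_derive_continuous _ _ (fun t => (1 - t / T) * cos (t * y))).
  by auto_derive; lra.
by exists l; exact: is_RInt_tent_mul.
Qed.

Lemma fejerE y : y <> 0 -> fejer T y = 2 * ((1 - cos (T * y)) / (T * (y * y))).
Proof.
move=> y_neq0; congr (2 * _); apply: is_RInt_unique; apply: is_RInt_tent_mul.
pose F t := (1 - t / T) * sin (t * y) / y - cos (t * y) / (T * (y * y)).
have -> : (1 - cos (T * y)) / (T * (y * y)) = minus (F T) (F 0).
  by rewrite /F /minus /plus /opp /= Rmult_0_l sin_0 cos_0; field; lra.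
apply: is_RInt_derive => t _.
  by rewrite /F; auto_derive; [lra | field; lra].
apply: (@ex_derive_continuous _ _ (fun t => (1 - t / T) * cos (t * y))).
by auto_derive; lra.
Qed.

Lemma fejer_0 : fejer T 0 = T.
Proof.
rewrite /fejer (is_RInt_unique _ _ _ (T / 2)); first by field.
apply: is_RInt_tent_mul.
pose F t := t - t * t / (2 * T).
have -> : T / 2 = minus (F T) (F 0) by rewrite /F /minus /plus /opp /=; field; lra.
apply: is_RInt_derive => t _.
  by rewrite Rmult_0_r cos_0 /F; auto_derive => //; field; lra.
apply: (@ex_derive_continuous _ _ (fun t => (1 - t / T) * cos (t * 0))).
by auto_derive; lra.
Qed.

Lemma fejer_bounds y : 0 <= fejer T y <= 5 * cauchy_kernel T y.
Proof.
rewrite /cauchy_kernel; case: (Req_dec y 0) => y_neq0.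
  rewrite y_neq0 fejer_0 Rmult_0_r; have -> : 1 + 0 ^ 2 = 1 by ring.
  by rewrite /Rdiv Rinv_1; lra.
rewrite fejerE //; set z := T * y.
have z_neq0 : z <> 0 by apply: Rmult_integral_contrapositive_currified; lra.
have z2_gt0 : 0 < z ^ 2 by rewrite -Rsqr_pow2; exact: Rsqr_pos_lt.
have [cos_ge cos_le] := one_sub_cos_bounds z; have cos_bound := COS_bound z.
have -> : 2 * ((1 - cos z) / (T * (y * y))) = T * (2 * (1 - cos z) / z ^ 2) by rewrite /z; field; lra.
have -> : 5 * (T / (1 + z ^ 2)) = T * (5 / (1 + z ^ 2)) by field; lra.
split; first by apply: Rmult_le_pos; [lra | apply: Rdiv_le_0_compat; lra].
apply: Rmult_le_compat_l; first lra.
apply: Rdiv_le_intro => //.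
have -> : 5 / (1 + z ^ 2) * z ^ 2 = 5 * z ^ 2 / (1 + z ^ 2) by field; lra.
apply: Rle_div_intro; first lra.
have z2E : z * z = z ^ 2 by ring.
by rewrite z2E in cos_le; case: (Rle_lt_dec (z ^ 2) 4) => z_cases; nra.
Qed.

Lemma Rabs_fejer_le y : Rabs (fejer T y) <= 5 * T.
Proof.
have [W_ge0 W_le] := fejer_bounds y; rewrite Rabs_pos_eq //.
apply: Rle_trans W_le _; apply: Rmult_le_compat_l; first lra.
have y2_ge0 := pow2_ge_0 (T * y); apply: Rdiv_le_intro; first lra.
nra.
Qed.

Lemma fejer_lipschitz x y : Rabs (fejer T x - fejer T y) <= 2 * T ^ 2 * Rabs (x - y).
Proof.
rewrite /fejer -Rmult_minus_distr_l.
have -> : RInt (fun t => tent T t * cos (t * x)) 0 T - RInt (fun t => tent T t * cos (t * y)) 0 T =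
  RInt (fun t => minus (tent T t * cos (t * x)) (tent T t * cos (t * y))) 0 T.
  by rewrite RInt_minus //; exact: ex_RInt_tent_cos.
rewrite Rabs_mult (Rabs_pos_eq 2); last lra.
have -> : 2 * T ^ 2 * Rabs (x - y) = 2 * ((T - 0) * (T * Rabs (x - y))) by ring.
apply: Rmult_le_compat_l; first lra.
apply: abs_RInt_le_const; first lra.
  by apply: ex_RInt_minus; exact: ex_RInt_tent_cos.
move=> t t_bounds; rewrite /minus /plus /opp /= -/(Rminus _ _) -Rmult_minus_distr_l Rabs_mult.
have [tent_ge0 tent_le1] := tent_bounds t; rewrite (Rabs_pos_eq (tent T t)) //.
have := Rabs_cos_sub (t * x) (t * y).
have -> : t * x - t * y = t * (x - y) by ring.
rewrite Rabs_mult (Rabs_pos_eq t); last lra.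
have := Rabs_pos (cos (t * x) - cos (t * y)); have := Rabs_pos (x - y); nra.
Qed.

Lemma fejer_continuous y : continuous (fejer T) y.
Proof. by apply: (@lipschitz_continuous _ (2 * T ^ 2)); exact: fejer_lipschitz. Qed.

Lemma fejer_shift_continuous x u : continuous (fun v => fejer T (x - v)) u.
Proof.
apply: (continuous_comp (fun v => x - v) (fejer T)); last exact: fejer_continuous.
by apply: (@ex_derive_continuous _ _ (fun v => x - v)); auto_derive.
Qed.

Lemma ex_RInt_fejer_shift x b c : ex_RInt (fun u => fejer T (x - u)) b c.
Proof. by apply: ex_RInt_cont => u; exact: fejer_shift_continuous. Qed.

Variable U : R.
Hypothesis U_gt0 : 0 < U.

Lemma fejer_mass_bounds x : 0 <= fejer_mass T U x <= 20.
Proof.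
split.
  apply: RInt_ge_0 => [|| u _]; [lra | exact: ex_RInt_fejer_shift | ].
  by have := fejer_bounds (x - u); lra.
apply: (@Rle_trans _ (RInt (fun u => scal 5 (cauchy_kernel T (x - u))) (- U) U)).
  apply: RInt_le; [lra | exact: ex_RInt_fejer_shift | | ].
    by apply: ex_RInt_scal; exact: ex_RInt_cauchy_kernel.
  by move=> u _; have := fejer_bounds (x - u); rewrite /scal /= /mult /=; lra.
rewrite RInt_scal; last exact: ex_RInt_cauchy_kernel.
have := @RInt_cauchy_kernel_le T x (- U) U T_gt0; set I := RInt _ _ _.
by rewrite /scal /= /mult /=; lra.
Qed.

Lemma RInt_fejer_far b c : Rabs (c - b) <= U / 2 ->
  (forall y, Rmin b c <= y <= Rmax b c -> U / 2 <= Rabs y) ->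
  Rabs (RInt (fun u => fejer T (0 - u)) b c) <= 10 / (T * U).
Proof.
move=> len_le far; have TU_gt0 : 0 < T * (U * U) by apply: Rmult_lt_0_compat; nra.
have fejer_far y : U / 2 <= Rabs y -> Rabs (fejer T (0 - y)) <= 20 / (T * (U * U)).
  move=> y_far; have [W_ge0 W_le] := fejer_bounds (0 - y).
  have y_far_from0 : U / 2 <= Rabs (0 - y) by rewrite Rminus_0_l Rabs_Ropp.
  have := @cauchy_kernel_le_far T (U / 2) (0 - y) T_gt0 ltac:(lra).
  have -> : / (T * (U / 2 * (U / 2))) = 4 / (T * (U * U)) by field; lra.
  by rewrite Rabs_pos_eq //; rewrite /Rdiv; lra.
have := @norm_RInt_le_const_abs _ (fun u => fejer T (0 - u)) b c _ (20 / (T * (U * U)))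
  (fun y y_in => fejer_far y (far y y_in))
  (RInt_correct _ _ _ (ex_RInt_fejer_shift 0 b c)).
rewrite /norm /= /abs /= => int_le; apply: Rle_trans int_le _.
have -> : 10 / (T * U) = U / 2 * (20 / (T * (U * U))) by field; lra.
by apply: Rmult_le_compat_r => //; apply: Rdiv_le_0_compat; lra.
Qed.

Lemma fejer_mass_near x : Rabs x <= U / 2 ->
  Rabs (fejer_mass T U x - fejer_mass T U 0) <= 20 / (T * U).
Proof.
move=> /Rabs_le_between [x_ge x_le]; pose W y := fejer T (0 - y).
have W_int b c : ex_RInt W b c by exact: ex_RInt_fejer_shift.
have shiftE : fejer_mass T U x = RInt W (- U + - x) (U + - x).
  have := @RInt_comp_lin _ W 1 (- x) (- U) U (W_int _ _).
  rewrite !Rmult_1_l => <-; apply: RInt_ext => u _.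
  by rewrite /scal /= /mult /= Rmult_1_l /W; congr (fejer T _); ring.
have chaslesE : fejer_mass T U x - fejer_mass T U 0 =
    RInt W (- U + - x) (- U) - RInt W (U + - x) U.
  have left_part : RInt W (- U + - x) (- U) + RInt W (- U) U = RInt W (- U + - x) U.
    exact: RInt_Chasles.
  have right_part : RInt W (- U + - x) (U + - x) + RInt W (U + - x) U = RInt W (- U + - x) U.
    exact: RInt_Chasles.
  by rewrite shiftE -[fejer_mass T U 0]/(RInt W (- U) U); lra.
have left_end : Rabs (RInt W (- U + - x) (- U)) <= 10 / (T * U).
  apply: RInt_fejer_far => [|y [_ y_le]]; first by apply: Rabs_le; lra.
  have : Rmax (- U + - x) (- U) <= - (U / 2) by apply: Rmax_lub; lra.
  by move=> max_le; rewrite Rabs_left; lra.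
have right_end : Rabs (RInt W (U + - x) U) <= 10 / (T * U).
  apply: RInt_fejer_far => [|y [y_ge _]]; first by apply: Rabs_le; lra.
  have : U / 2 <= Rmin (U + - x) U by apply: Rmin_glb; lra.
  by move=> min_ge; rewrite Rabs_pos_eq; lra.
rewrite chaslesE; apply: Rle_trans (Rabs_triang _ _) _; rewrite Rabs_Ropp.
have -> : 20 / (T * U) = 10 / (T * U) + 10 / (T * U) by field; lra.
lra.
Qed.

End FejerKernel.

Section FejerConvolution.
Variables (f : R -> R) (Lip rate T U : R).
Hypothesis f_bounds : forall u, 0 <= f u <= 1.
Hypothesis f_lipschitz : forall x y, Rabs (f x - f y) <= Lip * Rabs (x - y).
Hypothesis rate_gt0 : 0 < rate.
Hypothesis f_decay : forall u, f u <= exp (- (rate * Rabs u)).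
Hypothesis T_gt0 : 0 < T.
Hypothesis U_gt0 : 0 < U.

Lemma Lip_ge0 : 0 <= Lip.
Proof.
have := f_lipschitz 1 0; rewrite Rminus_0_r Rabs_R1 Rmult_1_r.
by have := Rabs_pos (f 1 - f 0); lra.
Qed.

Definition fejer_conv x := RInt (fun u => f u * fejer T (x - u)) (- U) U.

Lemma ex_RInt_mul_fejer_shift x b c : ex_RInt (fun u => f u * fejer T (x - u)) b c.
Proof.
apply: ex_RInt_cont => u; apply: (continuous_mult f (fun u => fejer T (x - u))).
  exact: lipschitz_continuous f_lipschitz u.
exact: fejer_shift_continuous.
Qed.

(* Near [x] the Lipschitz bound is used, and at distance more than [1 / sqrt T] the decay of the kernel. *)
Lemma fejer_conv_integrand_le x u : Rabs ((f u - f x) * fejer T (x - u)) <=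
  5 * Lip / sqrt T * cauchy_kernel T (x - u) + 10 / sqrt T * cauchy_kernel (sqrt T) (x - u).
Proof.
have sqrtT_gt0 := sqrt_lt_R0 _ T_gt0; have Lip_ge0 := Lip_ge0.
have [W_ge0 W_le] := fejer_bounds T_gt0 (x - u); rewrite Rabs_mult (Rabs_pos_eq (fejer T _)) //.
have lip_le : Rabs (f u - f x) <= Lip * Rabs (x - u) by rewrite (Rabs_minus_sym x u).
have osc_le : Rabs (f u - f x) <= 1 by apply: Rabs_le; have := f_bounds u; have := f_bounds x; lra.
have far := @cauchy_kernel_le_sqrt T (x - u) T_gt0.
have kers_gt0 := cauchy_kernel_gt0 (x - u) sqrtT_gt0.
have near_ge0 : 0 <= 5 * Lip / sqrt T * cauchy_kernel T (x - u).
  by apply: Rmult_le_pos; [apply: Rdiv_le_0_compat |]; lra.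
have far_ge0 : 0 <= 10 / sqrt T * cauchy_kernel (sqrt T) (x - u).
  by apply: Rmult_le_pos; [apply: Rdiv_le_0_compat |]; lra.
case: (Rle_lt_dec (Rabs (x - u)) (/ sqrt T)) => [x_near | /far ker_le].
  have : Rabs (f u - f x) * fejer T (x - u) <= Lip * / sqrt T * (5 * cauchy_kernel T (x - u)).
    apply: Rmult_le_compat => //; first exact: Rabs_pos.
    by apply: Rle_trans lip_le _; exact: Rmult_le_compat_l.
  rewrite /Rdiv in near_ge0 far_ge0 *; lra.
have : Rabs (f u - f x) * fejer T (x - u) <= 1 * (5 * cauchy_kernel T (x - u)).
  by apply: Rmult_le_compat => //; exact: Rabs_pos.
rewrite /Rdiv in near_ge0 far_ge0 ker_le *; lra.
Qed.

Lemma fejer_conv_local x :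
  Rabs (fejer_conv x - f x * fejer_mass T U x) <= (20 * Lip + 40) / sqrt T.
Proof.
have sqrtT_gt0 := sqrt_lt_R0 _ T_gt0; have Lip_ge0 := Lip_ge0.
have shift_int : ex_RInt (fun u => fejer T (x - u)) (- U) U by exact: ex_RInt_fejer_shift.
have ker_int k c : 0 < k -> ex_RInt (fun u => scal c (cauchy_kernel k (x - u))) (- U) U.
  by move=> k_gt0; apply: ex_RInt_scal; exact: ex_RInt_cauchy_kernel.
pose diff u := minus (f u * fejer T (x - u)) (scal (f x) (fejer T (x - u))).
pose major u := plus (scal (5 * Lip / sqrt T) (cauchy_kernel T (x - u)))
   (scal (10 / sqrt T) (cauchy_kernel (sqrt T) (x - u))).
have -> : fejer_conv x - f x * fejer_mass T U x = RInt diff (- U) U.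
  rewrite RInt_minus; [|exact: ex_RInt_mul_fejer_shift | exact: ex_RInt_scal].
  by rewrite (RInt_scal (fun u => fejer T (x - u)) (- U) U (f x)).
apply: (@Rle_trans _ (RInt major (- U) U)).
  apply: (norm_RInt_le diff major (- U) U); first lra.
  - move=> u _; rewrite /norm /= /abs /diff /major /minus /plus /opp /scal /= /mult /= -/(Rminus _ _).
    have -> : f u * fejer T (x - u) - f x * fejer T (x - u) = (f u - f x) * fejer T (x - u) by ring.
    exact: fejer_conv_integrand_le.
  - apply: RInt_correct; apply: ex_RInt_minus; first exact: ex_RInt_mul_fejer_shift.
    exact: ex_RInt_scal.
  - by apply: RInt_correct; apply: ex_RInt_plus; apply: ker_int.
rewrite /major RInt_plus; [|exact: ker_int|exact: ker_int].
rewrite (RInt_scal (fun u => cauchy_kernel T (x - u))); last exact: ex_RInt_cauchy_kernel.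
rewrite (RInt_scal (fun u => cauchy_kernel (sqrt T) (x - u))); last exact: ex_RInt_cauchy_kernel.
have := @RInt_cauchy_kernel_le T x (- U) U T_gt0.
have := @RInt_cauchy_kernel_le (sqrt T) x (- U) U sqrtT_gt0.
set I1 := RInt _ _ _; set I2 := RInt _ _ _ => I1_le I2_le.
rewrite /plus /scal /= /mult /=.
have -> : (20 * Lip + 40) / sqrt T = 5 * Lip / sqrt T * 4 + 10 / sqrt T * 4 by field; lra.
by apply: Rplus_le_compat; apply: Rmult_le_compat_l => //; apply: Rdiv_le_0_compat; lra.
Qed.

Lemma fejer_mass_shift_le x :
  f x * Rabs (fejer_mass T U x - fejer_mass T U 0) <=
  20 / (T * U) + 20 * exp (- (rate * U / 2)).
Proof.
have mass_x := fejer_mass_bounds T_gt0 U_gt0 x; have mass_0 := fejer_mass_bounds T_gt0 U_gt0 0.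
have err_gt0 : 0 < 20 / (T * U) by apply: Rdiv_lt_0_compat; nra.
have exp_gt0 := exp_pos (- (rate * U / 2)); have fx_bounds := f_bounds x.
have diff_ge0 := Rabs_pos (fejer_mass T U x - fejer_mass T U 0).
case: (Rle_lt_dec (Rabs x) (U / 2)) => x_cases.
  by have := fejer_mass_near T_gt0 U_gt0 x_cases; nra.
have fx_le : f x <= exp (- (rate * U / 2)).
  by apply: Rle_trans (f_decay x) _; apply: exp_le; nra.
have diff_le : Rabs (fejer_mass T U x - fejer_mass T U 0) <= 20 by apply: Rabs_le; lra.
apply: (@Rle_trans _ (exp (- (rate * U / 2)) * 20)); last lra.
by apply: Rmult_le_compat; lra.
Qed.

Definition fejer_err := (20 * Lip + 40) / sqrt T + (20 / (T * U) + 20 * exp (- (rate * U / 2))).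

Lemma fejer_conv_approx x : Rabs (fejer_conv x - fejer_mass T U 0 * f x) <= fejer_err.
Proof.
have local := fejer_conv_local x; have shift := fejer_mass_shift_le x.
have -> : fejer_conv x - fejer_mass T U 0 * f x =
    (fejer_conv x - f x * fejer_mass T U x) + f x * (fejer_mass T U x - fejer_mass T U 0) by ring.
apply: Rle_trans (Rabs_triang _ _) _.
by rewrite [in X in _ + X]Rabs_mult (Rabs_pos_eq (f x)) /fejer_err; [lra | case: (f_bounds x)].
Qed.

End FejerConvolution.

Definition smoothed_density (a T u : R) :=
  Series (fun m => saddle_law a m * fejer T (centered_ln a m - u)).

Lemma RInt_smoothed_density_expectation (f : R -> R) (Lip rate a T U : R) :
  (forall u, 0 <= f u <= 1) -> (forall x y, Rabs (f x - f y) <= Lip * Rabs (x - y)) ->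
  0 < rate -> (forall u, f u <= exp (- (rate * Rabs u))) -> 0 < a -> 0 < T -> 0 < U ->
  ex_RInt (fun u => f u * smoothed_density a T u) (- U) U /\
  Rabs (RInt (fun u => f u * smoothed_density a T u) (- U) U - fejer_mass T U 0 * expectation a f)
    <= fejer_err Lip rate T U.
Proof.
move=> f_bounds f_lip rate_gt0 f_decay a_gt0 T_gt0 U_gt0; pose conv := fejer_conv f T U.
have swap : is_RInt (fun u => f u * smoothed_density a T u) (- U) U
    (Series (fun m => saddle_law a m * conv (centered_ln a m))).
  pose g m u := scal (saddle_law a m) (f u * fejer T (centered_ln a m - u)).
  have conv_int m := ex_RInt_mul_fejer_shift f_lip T_gt0 (centered_ln a m) (- U) U.
  have -> : Series (fun m => saddle_law a m * conv (centered_ln a m)) =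
      Series (fun m => RInt (g m) (- U) U).
    by apply: Series_ext => m; rewrite /g RInt_scal.
  apply: is_RInt_ext (@is_RInt_Series g (fun m => 5 * T * saddle_law a m) (- U) U _ _ _).
  - move=> u _; rewrite /smoothed_density -Series_scal_l.
    by apply: Series_ext => m; rewrite /g /scal /= /mult /=; ring.
  - by move=> m; apply: ex_RInt_scal.
  - move=> m u; rewrite /g /scal /= /mult /= Rabs_mult (Rabs_mult (f u)).
    have law_ge0 := saddle_law_ge0 a_gt0 m; have fu_bounds := f_bounds u.
    rewrite (Rabs_pos_eq (saddle_law a m)) // (Rabs_pos_eq (f u)); last lra.
    have := Rabs_fejer_le T_gt0 (centered_ln a m - u) => W_le.
    have := Rabs_pos (fejer T (centered_ln a m - u)) => W_ge0.
    by rewrite Rmult_comm; apply: Rmult_le_compat_r => //; nra.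
  - exact: ex_series_scal_l (ex_series_saddle_law a_gt0).
split; first by eexists; exact: swap.
rewrite (is_RInt_unique _ _ _ _ swap).
have approx m := fejer_conv_approx f_bounds f_lip rate_gt0 f_decay T_gt0 U_gt0 (centered_ln a m).
have [diff_summable diff_le] := ex_series_saddle_law_bounded a_gt0 approx.
have [main_summable _] := @ex_series_saddle_law_bounded a a_gt0
  (fun m => fejer_mass T U 0 * f (centered_ln a m)) 20
  ltac:(move=> m; have := fejer_mass_bounds T_gt0 U_gt0 0; have := f_bounds (centered_ln a m);
    move=> f01 mass_bounds; rewrite Rabs_pos_eq; nra).
apply: Rle_trans diff_le; right; congr Rabs.
rewrite /expectation -Series_scal_l -Series_minus.
- by apply: Series_ext => m; rewrite /conv; ring.
- apply: ex_series_ext (ex_series_plus _ _ diff_summable main_summable) => m.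
  by rewrite /plus /= /conv; ring.
- by apply: ex_series_ext main_summable => m /=; ring.
Qed.

Lemma smoothed_density_fourier a T u : 0 < a -> 0 < T ->
  is_RInt (fun t => tent T t * (fst (charf a t) * cos (t * u) + snd (charf a t) * sin (t * u)))
    0 T (smoothed_density a T u / 2).
Proof.
move=> a_gt0 T_gt0.
pose g m t := scal (saddle_law a m) (tent T t * cos (t * (centered_ln a m - u))).
have -> : smoothed_density a T u / 2 = Series (fun m => RInt (g m) 0 T).
  rewrite /smoothed_density /Rdiv -Series_scal_r; apply: Series_ext => m.
  rewrite /g RInt_scal /fejer /scal /= /mult /=; first by field.
  exact: ex_RInt_tent_cos.
apply: is_RInt_ext (@is_RInt_Series g (saddle_law a) 0 T _ _ (ex_series_saddle_law a_gt0)).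
- move=> t _; have [cos_summable _] := @ex_series_saddle_law_bounded a a_gt0
    (fun m => cos (t * centered_ln a m)) 1 ltac:(move=> m; apply: Rabs_le; exact: COS_bound).
  have [sin_summable _] := @ex_series_saddle_law_bounded a a_gt0
    (fun m => sin (t * centered_ln a m)) 1 ltac:(move=> m; apply: Rabs_le; exact: SIN_bound).
  have -> : fst (charf a t) = Series (fun m => saddle_law a m * cos (t * centered_ln a m)).
    by rewrite /charf /CSeries /=; apply: Series_ext => m /=; ring.
  have -> : snd (charf a t) = Series (fun m => saddle_law a m * sin (t * centered_ln a m)).
    by rewrite /charf /CSeries /=; apply: Series_ext => m /=; ring.
  rewrite -!Series_scal_r -Series_plus; [|exact: ex_series_scal_r|exact: ex_series_scal_r].
  rewrite -Series_scal_l; apply: Series_ext => m.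
  by rewrite /g /scal /= /mult /= Rmult_minus_distr_l cos_minus; ring.
- by move=> m; apply: ex_RInt_scal; exact: ex_RInt_tent_cos.
- move=> m t; rewrite /g /scal /= /mult /= Rabs_mult (Rabs_pos_eq _ (saddle_law_ge0 a_gt0 m)).
  have [tent_ge0 tent_le1] := tent_bounds T_gt0 t; have law_ge0 := saddle_law_ge0 a_gt0 m.
  rewrite Rabs_mult (Rabs_pos_eq (tent T t)) //.
  have : Rabs (cos (t * (centered_ln a m - u))) <= 1 by apply: Rabs_le; exact: COS_bound.
  have := Rabs_pos (cos (t * (centered_ln a m - u))) => cos_ge0 cos_le1.
  rewrite -[X in _ <= X]Rmult_1_r; apply: Rmult_le_compat_l => //.
  nra.
Qed.

(** * The smoothed density near the mean *)

Definition gauss_const (n : nat) := (256 * INR n) ^ n.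

Lemma gauss_const_gt0 n : (0 < n)%N -> 0 < gauss_const n.
Proof. by move=> /INR_gt0 n_gt0; apply: pow_lt; lra. Qed.

Lemma pow_mul_gauss_le j n s : s ^ j <= (1 + s ^ 2) ^ n ->
  s ^ j * exp (- (s ^ 2 / 256)) <= gauss_const n.+1 / (1 + s ^ 2).
Proof.
move=> pow_le_s; have s2_ge0 := pow2_ge_0 s; have exp_gt0 := exp_pos (- (s ^ 2 / 256)).
have := @pow_mul_exp_le n.+1 (1 / 256) (s ^ 2) isT ltac:(lra) s2_ge0.
have -> : INR n.+1 / (1 / 256) = 256 * INR n.+1 by field.
have -> : 1 / 256 * s ^ 2 = s ^ 2 / 256 by field.
rewrite -/(gauss_const n.+1) -tech_pow_Rmult => exp_le_const.
apply: Rle_div_intro; first lra.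
apply: Rle_trans exp_le_const.
have := Rmult_le_compat_r (exp (- (s ^ 2 / 256)) * (1 + s ^ 2)) _ _ ltac:(nra) pow_le_s; lra.
Qed.

Section Density.
Variable a : R.
Hypothesis a_gt0 : 0 < a.
Let L := - ln a.
Hypothesis L_ge1000 : 1000 <= L.
Let T := exp (10 * L).
Hypothesis off_center : forall t, a / 10 <= t <= T -> Cmod (charf a t) <= exp (- (14 * L)).
Let variance := / (a ^ 3 * L).
Let tau := sqrt (a ^ 3 * L).

Lemma tau_gt0 : 0 < tau.
Proof. by apply: sqrt_lt_R0; apply: Rmult_lt_0_compat; [exact: pow_lt | lra]. Qed.

Lemma tau_sq : tau * tau = a ^ 3 * L.
Proof. by apply: sqrt_sqrt; apply: Rmult_le_pos; [apply: pow_le | ]; lra. Qed.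

Lemma variance_tau : variance * (tau * tau) = 1.
Proof. by rewrite tau_sq /variance Rinv_l //; have := tau_gt0; have := tau_sq; nra. Qed.

Lemma variance_mul_sq t : variance * t ^ 2 = (t / tau) ^ 2.
Proof.
have tau_pos := tau_gt0.
have -> : variance * t ^ 2 = variance * (tau * tau) * (t / tau) ^ 2 by field; lra.
by rewrite variance_tau Rmult_1_l.
Qed.

Lemma tauE : tau = a * sqrt (a * L).
Proof.
rewrite /tau; have -> : a ^ 3 * L = a * a * (a * L) by ring.
by rewrite sqrt_mult ?sqrt_square //; nra.
Qed.

Lemma sq_saddle_le_tau : a ^ 2 <= tau.
Proof.
rewrite tauE; have -> : a ^ 2 = a * a by ring.
apply: Rmult_le_compat_l; first lra.
by apply: sqrt_ge_of_sq_le; have := saddle_L_le a_gt0 L_ge1000; rewrite -/L; nra.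
Qed.

Lemma cutoff_ge1 : 1 <= T.
Proof. by have := exp_ineq1_le (10 * L); rewrite -/T; lra. Qed.

Lemma cutoff_gt0 : 0 < T.
Proof. exact: exp_pos. Qed.

Lemma exp14_mul_cutoff : exp (- (14 * L)) * T = a ^ 4.
Proof.
rewrite /T -exp_plus (saddle_pow_eq_exp 4 a_gt0) -/L; congr exp.
by rewrite [INR 4]INR_IZR_INZ /=; ring.
Qed.

Lemma cauchy_kernel_tau Q t :
  Q * tau * cauchy_kernel (/ tau) (0 - t) = Q / (1 + variance * t ^ 2).
Proof.
have tau_pos := tau_gt0; rewrite variance_mul_sq /cauchy_kernel.
have -> : / tau * (0 - t) = - (t / tau) by field; lra.
have -> : (- (t / tau)) ^ 2 = (t / tau) ^ 2 by ring.
by move: (pow2_ge_0 (t / tau)); move: ((t / tau) ^ 2) => w w_ge0; field; lra.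
Qed.

Lemma RInt_le_tau (h : R -> R) Q e b : 0 <= Q -> 0 <= e -> 0 <= b <= T -> ex_RInt h b T ->
  (forall t, b < t < T -> h t <= Q / (1 + variance * t ^ 2) + e * exp (- (14 * L))) ->
  RInt h b T <= 4 * (Q * tau) + e * a ^ 4.
Proof.
move=> Q_ge0 e_ge0 b_bounds h_int h_le; have tau_pos := tau_gt0.
have invtau_gt0 := Rinv_0_lt_compat _ tau_pos; have exp_gt0 := exp_pos (- (14 * L)).
have ker_int : ex_RInt (fun t => cauchy_kernel (/ tau) (0 - t)) b T by exact: ex_RInt_cauchy_kernel.
pose major t := plus (scal (Q * tau) (cauchy_kernel (/ tau) (0 - t))) (e * exp (- (14 * L))).
apply: (@Rle_trans _ (RInt major b T)).
  apply: RInt_le => //; first lra.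
    by apply: ex_RInt_plus; [exact: ex_RInt_scal | exact: ex_RInt_const].
  by move=> t t_in; rewrite /major /plus /scal /= /mult /= cauchy_kernel_tau; exact: h_le.
rewrite RInt_plus; [|exact: ex_RInt_scal | exact: ex_RInt_const].
rewrite (RInt_scal (fun t => cauchy_kernel (/ tau) (0 - t))) // RInt_const.
have := @RInt_cauchy_kernel_le (/ tau) 0 b T invtau_gt0; set I := RInt _ _ _ => I_le.
rewrite /plus /scal /= /mult /=; apply: Rplus_le_compat.
  have := Rmult_le_compat_l (Q * tau) _ _ ltac:(nra) I_le; lra.
rewrite -exp14_mul_cutoff.
have := Rmult_le_compat_l (e * exp (- (14 * L))) (T - b) T ltac:(nra) ltac:(lra); lra.
Qed.

Definition central_amplitude u :=
  a ^ 3 * L * (u ^ 2 / 2 * gauss_const 2 + 138000 / a * Rabs u * gauss_const 3).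

Lemma central_amplitude_ge0 u : 0 <= central_amplitude u.
Proof.
have K2_gt0 := @gauss_const_gt0 2 isT; have K3_gt0 := @gauss_const_gt0 3 isT.
have u_ge0 := Rabs_pos u; have u2_ge0 := pow2_ge_0 u.
apply: Rmult_le_pos; first by apply: Rmult_le_pos; [apply: pow_le |]; lra.
apply: Rplus_le_le_0_compat; apply: Rmult_le_pos; try lra.
by apply: Rmult_le_pos => //; apply: Rdiv_le_0_compat; lra.
Qed.

Lemma Rabs_phase_diff_le t u : Rabs (fst (charf a t) * (cos (t * u) - 1) + snd (charf a t) * sin (t * u)) <=
  Rabs (fst (charf a t)) * Rabs (cos (t * u) - 1) + Rabs (snd (charf a t)) * Rabs (sin (t * u)).
Proof. by apply: Rle_trans (Rabs_triang _ _) _; rewrite !Rabs_mult; apply: Rle_refl. Qed.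

Lemma phase_diff_central t u : 0 <= t <= a / 10 ->
  Rabs (fst (charf a t) * (cos (t * u) - 1) + snd (charf a t) * sin (t * u)) <=
  central_amplitude u / (1 + variance * t ^ 2).
Proof.
move=> t_bounds; have [t_ge0 _] := t_bounds; have tau_pos := tau_gt0; have tau2E := tau_sq.
have [cmod_le [im_le _]] := charf_central_bounds a_gt0 L_ge1000 t_bounds.
rewrite -/L -/variance variance_mul_sq in cmod_le im_le *.
set s := t / tau in cmod_le im_le *.
have tE : t = s * tau by rewrite /s; field; lra.
have varE : variance * t ^ 3 = s ^ 3 * tau.
  have -> : variance * t ^ 3 = variance * (tau * tau) * (s ^ 3 * tau) by rewrite tE; ring.
  by rewrite variance_tau Rmult_1_l.
set E := exp _ in cmod_le im_le; have u_ge0 := Rabs_pos u.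
have cos_le : Rabs (cos (t * u) - 1) <= t ^ 2 * (u ^ 2 / 2).
  have [cos_ge cos_le] := one_sub_cos_bounds (t * u); rewrite Rabs_left1; last lra.
  by have -> : t ^ 2 * (u ^ 2 / 2) = t * u * (t * u) / 2 by [field]; lra.
have sin_le : Rabs (sin (t * u)) <= t * Rabs u.
  by apply: Rle_trans (Rabs_sin_le _) _; rewrite Rabs_mult (Rabs_pos_eq t); lra.
have gauss2 : s ^ 2 * E <= gauss_const 2 / (1 + s ^ 2).
  by apply: pow_mul_gauss_le; rewrite pow_1; lra.
have gauss4 : s ^ 4 * E <= gauss_const 3 / (1 + s ^ 2).
  apply: pow_mul_gauss_le; have -> : s ^ 4 = (s ^ 2) ^ 2 by ring.
  by have := pow2_ge_0 s => s2_ge0; apply: pow_incr; lra.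
apply: Rle_trans (Rabs_phase_diff_le t u) _.
have -> : central_amplitude u / (1 + s ^ 2) =
    u ^ 2 / 2 * (tau * tau) * (gauss_const 2 / (1 + s ^ 2))
    + 138000 / a * Rabs u * (tau * tau) * (gauss_const 3 / (1 + s ^ 2)).
  by rewrite /central_amplitude tau2E; have := pow2_ge_0 s => s2_ge0; field; lra.
apply: Rplus_le_compat.
  apply: (@Rle_trans _ (E * (t ^ 2 * (u ^ 2 / 2)))).
    by apply: Rmult_le_compat => //; [exact: Rabs_pos.. | exact: Rle_trans (Rabs_fst_Cmod _) cmod_le].
  have -> : E * (t ^ 2 * (u ^ 2 / 2)) = u ^ 2 / 2 * (tau * tau) * (s ^ 2 * E) by rewrite tE; ring.
  by apply: Rmult_le_compat_l gauss2; have := pow2_ge_0 u; nra.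
apply: (@Rle_trans _ (138000 * (variance / a * t ^ 3) * E * (t * Rabs u))).
  by apply: Rmult_le_compat => //; exact: Rabs_pos.
have -> : 138000 * (variance / a * t ^ 3) * E * (t * Rabs u) =
    138000 / a * Rabs u * (variance * t ^ 3 * t * E) by field; lra.
have -> : 138000 / a * Rabs u * (variance * t ^ 3 * t * E) =
    138000 / a * Rabs u * (tau * tau) * (s ^ 4 * E) by rewrite varE tE; ring.
apply: Rmult_le_compat_l gauss4; apply: Rmult_le_pos; last by nra.
by apply: Rmult_le_pos => //; apply: Rdiv_le_0_compat; lra.
Qed.

Lemma phase_diff_le t u : 0 <= t <= T ->
  Rabs (fst (charf a t) * (cos (t * u) - 1) + snd (charf a t) * sin (t * u)) <=
  central_amplitude u / (1 + variance * t ^ 2) + 3 * exp (- (14 * L)).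
Proof.
move=> [t_ge0 t_le]; have exp_gt0 := exp_pos (- (14 * L)).
case: (Rle_lt_dec t (a / 10)) => t_cases;
  first by have := @phase_diff_central t u (conj t_ge0 t_cases); lra.
have cmod_le := off_center (conj (Rlt_le _ _ t_cases) t_le).
have main_ge0 : 0 <= central_amplitude u / (1 + variance * t ^ 2).
  apply: Rdiv_le_0_compat; first exact: central_amplitude_ge0.
  by rewrite variance_mul_sq; have := pow2_ge_0 (t / tau); lra.
have re_part : Rabs (fst (charf a t)) * Rabs (cos (t * u) - 1) <= exp (- (14 * L)) * 2.
  apply: Rmult_le_compat; [exact: Rabs_pos.. | exact: Rle_trans (Rabs_fst_Cmod _) cmod_le | ].
  by apply: Rabs_le; have := COS_bound (t * u); lra.
have im_part : Rabs (snd (charf a t)) * Rabs (sin (t * u)) <= exp (- (14 * L)) * 1.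
  apply: Rmult_le_compat; [exact: Rabs_pos.. | exact: Rle_trans (Rabs_snd_Cmod _) cmod_le | ].
  by apply: Rabs_le; exact: SIN_bound.
by have := Rabs_phase_diff_le t u; lra.
Qed.

Lemma smoothed_density_sub_le u :
  Rabs (smoothed_density a T u / 2 - smoothed_density a T 0 / 2) <=
  4 * (central_amplitude u * tau) + 3 * a ^ 4.
Proof.
have T_gt0 := cutoff_gt0; have ampl_ge0 := central_amplitude_ge0 u.
pose diff t := tent T t * (fst (charf a t) * (cos (t * u) - 1) + snd (charf a t) * sin (t * u)).
have diff_int : is_RInt diff 0 T (smoothed_density a T u / 2 - smoothed_density a T 0 / 2).
  have diff_int := is_RInt_minus _ _ _ _ _ _
    (@smoothed_density_fourier a T u a_gt0 T_gt0) (@smoothed_density_fourier a T 0 a_gt0 T_gt0).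
  apply: is_RInt_ext diff_int => t _.
  by rewrite /diff /minus /plus /opp /= Rmult_0_r cos_0 sin_0; ring.
have diff_ex : ex_RInt diff 0 T by eexists; exact: diff_int.
have diff_le t : 0 < t < T ->
    Rabs (diff t) <= central_amplitude u / (1 + variance * t ^ 2) + 3 * exp (- (14 * L)).
  move=> t_in; have := @phase_diff_le t u ltac:(lra).
  have [tent_ge0 tent_le1] := tent_bounds T_gt0 t; rewrite /diff Rabs_mult (Rabs_pos_eq (tent T t)) //.
  by set V := Rabs _; have : 0 <= V := Rabs_pos _; nra.
have upper := @RInt_le_tau diff _ 3 0 ampl_ge0 ltac:(lra) ltac:(lra) diff_ex
  (fun t t_in => Rle_trans _ _ _ (Rle_abs _) (diff_le t t_in)).
have lower := @RInt_le_tau (fun t => opp (diff t)) _ 3 0 ampl_ge0 ltac:(lra) ltac:(lra)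
  (ex_RInt_opp _ _ _ diff_ex)
  (fun t t_in => Rle_trans _ _ _ (Rle_trans _ _ _ (Rle_abs _) (Req_le _ _ (Rabs_Ropp _))) (diff_le t t_in)).
rewrite RInt_opp // (is_RInt_unique _ _ _ _ diff_int) /opp /= in lower.
by rewrite (is_RInt_unique _ _ _ _ diff_int) in upper; apply: Rabs_le; lra.
Qed.

Definition flat_const := 8 * (gauss_const 2 + 138000 * gauss_const 3) + 1.

Lemma smoothed_density_flat u : Rabs (smoothed_density a T u - smoothed_density a T 0) <=
  flat_const * (tau * (a * L)) * (1 + (a * u) ^ 2).
Proof.
have tau_pos := tau_gt0; have aL_le := saddle_L_le a_gt0 L_ge1000; rewrite -/L in aL_le.
have K2_gt0 := @gauss_const_gt0 2 isT; have K3_gt0 := @gauss_const_gt0 3 isT.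
have := smoothed_density_sub_le u.
have -> : smoothed_density a T u / 2 - smoothed_density a T 0 / 2 =
    (smoothed_density a T u - smoothed_density a T 0) / 2 by field.
rewrite /Rdiv Rabs_mult (Rabs_pos_eq (/ 2)); last lra.
set z := a * Rabs u => sub_le.
have z2E : (a * u) ^ 2 = z ^ 2 by rewrite /z !Rpow_mult_distr pow2_abs.
have z2_ge0 := pow2_ge_0 z.
have amplE : central_amplitude u =
    a * L * (gauss_const 2 / 2 * z ^ 2 + 138000 * gauss_const 3 * z).
  by rewrite -z2E /central_amplitude /z; field; lra.
have ampl_le : central_amplitude u <= a * L * ((gauss_const 2 + 138000 * gauss_const 3) * (1 + z ^ 2)).
  rewrite amplE; apply: Rmult_le_compat_l; first by nra.
  have : z <= 1 + z ^ 2 by rewrite /pow; nra.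
  nra.
have ampl_tau := Rmult_le_compat_r _ _ _ (Rlt_le _ _ tau_pos) ampl_le.
have a4_le : 6 * a ^ 4 <= tau * (a * L).
  have -> : 6 * a ^ 4 = a ^ 2 * (a * (6 * a)) by ring.
  apply: Rmult_le_compat; [exact: pow2_ge_0 | nra | exact: sq_saddle_le_tau | ].
  by apply: Rmult_le_compat_l; nra.
have tau_aL_ge0 : 0 <= tau * (a * L) by apply: Rmult_le_pos; nra.
have := Rmult_le_pos _ _ tau_aL_ge0 z2_ge0.
by rewrite z2E /flat_const; lra.
Qed.

Hypothesis small_aL : 552000 * gauss_const 3 * sqrt (a * L) <= / 20000.

Lemma sqrt_saddle_L_le : sqrt (a * L) <= 1 / 10.
Proof.
have := saddle_L_le a_gt0 L_ge1000; rewrite -/L => aL_le.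
have -> : 1 / 10 = sqrt (1 / 100).
  by have -> : 1 / 100 = 1 / 10 * (1 / 10); [field | rewrite sqrt_square; lra].
exact: sqrt_le_1_alt.
Qed.

Lemma Re_charf_ge_half t : 0 <= t <= tau / 600 -> 1 / 2 <= fst (charf a t).
Proof.
move=> [t_ge0 t_le]; have tau_pos := tau_gt0; have sqrt_le := sqrt_saddle_L_le.
have tau_le : tau <= a / 10 by rewrite tauE; nra.
have [_ [_ [_]]] := @charf_central_bounds a a_gt0 L_ge1000 t ltac:(lra).
rewrite -/L -/variance; apply: Rle_trans.
have sq_le : variance * t ^ 2 <= / 360000.
  rewrite variance_mul_sq; have -> : / 360000 = (/ 600) ^ 2 by field.
  apply: pow_incr; split; first exact: Rdiv_le_0_compat.
  by apply: Rdiv_le_intro => //; lra.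
have sq_ge0 : 0 <= variance * t ^ 2 by rewrite variance_mul_sq; exact: pow2_ge_0.
have -> : variance / a * t ^ 3 = variance * t ^ 2 * (t / a) by field; lra.
have ratio_bounds : 0 <= t / a <= 1 / 6000.
  by split; [exact: Rdiv_le_0_compat | apply: Rdiv_le_intro; lra].
have exp_half_le1 : exp (- (variance * t ^ 2 / 256)) <= 1 by apply: exp_le1; lra.
have exp_gt0 := exp_pos (- (variance * t ^ 2 / 256)).
set y := variance * t ^ 2 in sq_le sq_ge0 exp_half_le1 exp_gt0 *.
have cube_bounds : 0 <= y * (t / a) <= / 360000 * (1 / 6000) by split; nra.
have : 138000 * (y * (t / a)) * exp (- (y / 256)) <= 138000 * (y * (t / a)) * 1.
  by apply: Rmult_le_compat_l; lra.
lra.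
Qed.

Let B := 138000 / a * (gauss_const 3 * tau).

Lemma Re_charf_ge t : 0 <= t <= T ->
  - (B / (1 + variance * t ^ 2)) - exp (- (14 * L)) <= fst (charf a t).
Proof.
move=> [t_ge0 t_le]; have tau_pos := tau_gt0; have K3_gt0 := @gauss_const_gt0 3 isT.
have exp_gt0 := exp_pos (- (14 * L)); rewrite variance_mul_sq.
set s := t / tau.
have s2_ge0 := pow2_ge_0 s; have a138_ge0 : 0 <= 138000 / a by apply: Rdiv_le_0_compat; lra.
case: (Rle_lt_dec t (a / 10)) => t_cases; last first.
  have := Rle_trans _ _ _ (Rabs_fst_Cmod _) (off_center (conj (Rlt_le _ _ t_cases) t_le)).
  have : 0 <= B / (1 + s ^ 2).
    by apply: Rdiv_le_0_compat; [apply: Rmult_le_pos; nra | lra].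
  by move=> ? /Rabs_le_between; lra.
have [_ [_ [re_ge _]]] := charf_central_bounds a_gt0 L_ge1000 (conj t_ge0 t_cases).
rewrite -/L -/variance variance_mul_sq -/s in re_ge.
have gauss3 : s ^ 3 * exp (- (s ^ 2 / 256)) <= gauss_const 3 / (1 + s ^ 2).
  apply: pow_mul_gauss_le; have -> : s ^ 3 = s * s ^ 2 by ring.
  have : s <= 1 + s ^ 2 by rewrite /pow; nra.
  have -> : (1 + s ^ 2) ^ 2 = (1 + s ^ 2) * (1 + s ^ 2) by ring.
  nra.
have main_le : 138000 * (variance / a * t ^ 3) * exp (- (s ^ 2 / 256)) <= B / (1 + s ^ 2).
  have -> : 138000 * (variance / a * t ^ 3) * exp (- (s ^ 2 / 256)) =
      138000 / a * tau * (variance * (tau * tau)) * (s ^ 3 * exp (- (s ^ 2 / 256))).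
    by rewrite /s; field; lra.
  have -> : B / (1 + s ^ 2) = 138000 / a * tau * (gauss_const 3 / (1 + s ^ 2)) by rewrite /B; field; lra.
  by rewrite variance_tau Rmult_1_r; apply: Rmult_le_compat_l => //; nra.
lra.
Qed.

Lemma is_RInt_smoothed_density_0 :
  is_RInt (fun t => tent T t * fst (charf a t)) 0 T (smoothed_density a T 0 / 2).
Proof.
apply: is_RInt_ext (@smoothed_density_fourier a T 0 a_gt0 cutoff_gt0) => t _.
by rewrite Rmult_0_r cos_0 sin_0 /=; ring.
Qed.

Let damped_Re_charf t := tent T t * fst (charf a t).

Lemma tau_le_tenth : tau <= a / 10.
Proof. by rewrite tauE; have := sqrt_saddle_L_le; nra. Qed.

Lemma ex_RInt_damped_Re_charf x y : 0 <= x <= y -> y <= T -> ex_RInt damped_Re_charf x y.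
Proof.
move=> xy_bounds y_le; have D_int : ex_RInt damped_Re_charf 0 T.
  by eexists; exact: is_RInt_smoothed_density_0.
apply: (ex_RInt_Chasles_2 _ 0); first lra.
by apply: (ex_RInt_Chasles_1 _ _ _ T) => //; lra.
Qed.

Lemma RInt_damped_Re_charf_near_ge : tau / 600 / 4 <= RInt damped_Re_charf 0 (tau / 600).
Proof.
have tau_pos := tau_gt0; have T_ge1 := cutoff_ge1; have T_gt0 := cutoff_gt0.
have aL_le := saddle_L_le a_gt0 L_ge1000; rewrite -/L in aL_le.
have a_le : a <= 1 / 100000 by nra.
have tau_le := tau_le_tenth.
have -> : tau / 600 / 4 = RInt (fun _ => 1 / 4) 0 (tau / 600).
  by rewrite RInt_const /scal /= /mult /=; field.
apply: RInt_le => [|||t t_in].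
- lra.
- exact: ex_RInt_const.
- by apply: ex_RInt_damped_Re_charf; lra.
rewrite /damped_Re_charf tentE //; last lra.
have := @Re_charf_ge_half t ltac:(lra).
have : t / T <= 1 / 2 by apply: Rdiv_le_intro => //; nra.
nra.
Qed.

Lemma RInt_damped_Re_charf_far_ge :
  - (4 * (B * tau) + a ^ 4) <= RInt damped_Re_charf (tau / 600) T.
Proof.
have tau_pos := tau_gt0; have T_ge1 := cutoff_ge1; have T_gt0 := cutoff_gt0.
have K3_gt0 := @gauss_const_gt0 3 isT; have tau_le := tau_le_tenth.
have aL_le := saddle_L_le a_gt0 L_ge1000; rewrite -/L in aL_le.
have a_le : a <= 1 / 100000 by nra.
have B_ge0 : 0 <= B by apply: Rmult_le_pos; [apply: Rdiv_le_0_compat | nra]; lra.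
have D_int : ex_RInt damped_Re_charf (tau / 600) T by apply: ex_RInt_damped_Re_charf; lra.
have : RInt (fun t => opp (damped_Re_charf t)) (tau / 600) T <= 4 * (B * tau) + 1 * a ^ 4.
  apply: RInt_le_tau => //; [lra | lra | exact: ex_RInt_opp | ].
  move=> t t_in; rewrite /opp /= /damped_Re_charf.
  have [tent_ge0 tent_le1] := tent_bounds T_gt0 t; have := @Re_charf_ge t ltac:(lra).
  have : 0 <= B / (1 + variance * t ^ 2).
    by apply: Rdiv_le_0_compat => //; rewrite variance_mul_sq; have := pow2_ge_0 (t / tau); lra.
  have exp_gt0 := exp_pos (- (14 * L)).
  by case: (Rle_lt_dec 0 (fst (charf a t))) => ? ? ?; nra.
by rewrite RInt_opp // /opp /=; lra.
Qed.

Lemma smoothed_density_ge : tau / 2000 <= smoothed_density a T 0.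
Proof.
have tau_pos := tau_gt0; have T_ge1 := cutoff_ge1; have tau_le := tau_le_tenth.
have aL_le := saddle_L_le a_gt0 L_ge1000; rewrite -/L in aL_le.
have a_le : a <= 1 / 100000 by nra.
have splitE : RInt damped_Re_charf 0 (tau / 600) + RInt damped_Re_charf (tau / 600) T =
    smoothed_density a T 0 / 2.
  rewrite -(is_RInt_unique _ _ _ _ is_RInt_smoothed_density_0).
  by apply: RInt_Chasles; apply: ex_RInt_damped_Re_charf; lra.
have near_ge := RInt_damped_Re_charf_near_ge; have far_ge := RInt_damped_Re_charf_far_ge.
have B_tau_le : 4 * (B * tau) <= tau / 20000.
  have -> : 4 * (B * tau) = 552000 * gauss_const 3 * (tau / a) * tau by rewrite /B; field; lra.
  have -> : tau / a = sqrt (a * L) by rewrite tauE; field; lra.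
  by have := Rmult_le_compat_r tau _ _ (Rlt_le _ _ tau_pos) small_aL; lra.
have a4_le : a ^ 4 <= tau / 20000.
  have -> : a ^ 4 = a ^ 2 * a ^ 2 by ring.
  have := sq_saddle_le_tau; have := pow2_ge_0 a; nra.
lra.
Qed.

End Density.

(** * Expectations of two-sided exponentials *)

Definition biexp (A b u : R) := exp (- (A * Rmax (- u) 0 + b * Rmax u 0)).

Lemma biexp_exponent_ge0 A b u : 0 < A -> 0 < b -> 0 <= A * Rmax (- u) 0 + b * Rmax u 0.
Proof. by move=> A_gt0 b_gt0; have := Rmax_r (- u) 0; have := Rmax_r u 0; nra. Qed.

Lemma biexp_bounds A b u : 0 < A -> 0 < b -> 0 <= biexp A b u <= 1.
Proof.
move=> A_gt0 b_gt0; split; first by left; exact: exp_pos.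
by apply: exp_le1; have := biexp_exponent_ge0 u A_gt0 b_gt0; lra.
Qed.

Lemma Rmax0_lipschitz x y : Rabs (Rmax x 0 - Rmax y 0) <= Rabs (x - y).
Proof.
apply: Rabs_le; have := Rle_abs (x - y); have := Rle_abs (- (x - y)); rewrite Rabs_Ropp.
by rewrite /Rmax; case: Rle_dec; case: Rle_dec; lra.
Qed.

Lemma biexp_lipschitz A b x y : 0 < A -> 0 < b ->
  Rabs (biexp A b x - biexp A b y) <= (A + b) * Rabs (x - y).
Proof.
move=> A_gt0 b_gt0.
apply: Rle_trans (exp_opp_lipschitz (biexp_exponent_ge0 x A_gt0 b_gt0) (biexp_exponent_ge0 y A_gt0 b_gt0)) _.
have -> : A * Rmax (- x) 0 + b * Rmax x 0 - (A * Rmax (- y) 0 + b * Rmax y 0) =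
  A * (Rmax (- x) 0 - Rmax (- y) 0) + b * (Rmax x 0 - Rmax y 0) by ring.
apply: Rle_trans (Rabs_triang _ _) _; rewrite !Rabs_mult (Rabs_pos_eq A) ?(Rabs_pos_eq b); [|lra|lra].
have neg_part := Rmax0_lipschitz (- x) (- y); have pos_part := Rmax0_lipschitz x y.
have oppE : Rabs (- x - - y) = Rabs (x - y) by rewrite -Rabs_Ropp; congr Rabs; ring.
by rewrite oppE in neg_part; nra.
Qed.

Lemma Rmax0_add_opp u : Rmax (- u) 0 + Rmax u 0 = Rabs u.
Proof. by rewrite /Rmax /Rabs; case: Rle_dec; case: Rle_dec; case: Rcase_abs; lra. Qed.

Lemma biexp_le_exp a A b u : a <= A -> a <= b -> biexp A b u <= exp (- (a * Rabs u)).
Proof.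
move=> a_le_A a_le_b; apply: exp_le; rewrite -Rmax0_add_opp.
by have := Rmax_r (- u) 0; have := Rmax_r u 0; nra.
Qed.

Lemma biexp_weight_le a A b u : 0 < a -> a <= A -> a <= b ->
  biexp A b u * (1 + (a * u) ^ 2) <= 16 * biexp (A / 2) (b / 2) u.
Proof.
move=> a_gt0 a_le_A a_le_b; set g := biexp (A / 2) (b / 2) u.
have -> : biexp A b u = g * g by rewrite /g /biexp -exp_plus; congr exp; field.
have g_gt0 : 0 < g by exact: exp_pos.
have g_le := @biexp_le_exp (a / 2) (A / 2) (b / 2) u ltac:(lra) ltac:(lra); rewrite -/g in g_le.
set y := a * Rabs u; have y_ge0 : 0 <= y by apply: Rmult_le_pos; [lra | exact: Rabs_pos].
have -> : (a * u) ^ 2 = y ^ 2 by rewrite /y !Rpow_mult_distr pow2_abs.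
have exponentE : a / 2 * Rabs u = 1 / 2 * y by rewrite /y; field.
rewrite exponentE in g_le.
have := @pow_mul_exp_le 2 (1 / 2) y isT ltac:(lra) y_ge0.
have -> : (INR 2 / (1 / 2)) ^ 2 = 16 by rewrite INR_2; field.
have : 1 + y ^ 2 <= (1 + y) ^ 2 by rewrite /pow; nra.
have := pow2_ge_0 y; have := exp_pos (- (1 / 2 * y)) => exp_gt0 y2_ge0 sq_le exp_sq_le.
have : g * (1 + y ^ 2) <= (1 + y) ^ 2 * exp (- (1 / 2 * y)).
  by rewrite Rmult_comm; apply: Rmult_le_compat; lra.
nra.
Qed.

Lemma biexp_continuous A b u : 0 < A -> 0 < b -> continuous (biexp A b) u.
Proof.
by move=> A_gt0 b_gt0; apply: (@lipschitz_continuous _ (A + b)) => x y; exact: biexp_lipschitz.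
Qed.

Lemma ex_RInt_biexp A b c d : 0 < A -> 0 < b -> ex_RInt (biexp A b) c d.
Proof. by move=> A_gt0 b_gt0; apply: ex_RInt_cont => u; exact: biexp_continuous. Qed.

Lemma RInt_biexp A b U : 0 < A -> 0 < b -> 0 < U ->
  RInt (biexp A b) (- U) U = (1 - exp (- (A * U))) / A + (1 - exp (- (b * U))) / b.
Proof.
move=> A_gt0 b_gt0 U_gt0.
have <- : RInt (biexp A b) (- U) 0 + RInt (biexp A b) 0 U = RInt (biexp A b) (- U) U.
  by apply: RInt_Chasles; exact: ex_RInt_biexp.
congr (_ + _); apply: is_RInt_unique.
  apply: (is_RInt_ext (fun u => exp (A * u))).
    move=> u; rewrite Rmin_left ?Rmax_right; [|lra|lra] => u_in.
    by rewrite /biexp Rmax_left ?Rmax_right; [congr exp; ring|lra|lra].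
  have -> : (1 - exp (- (A * U))) / A = minus (exp (A * 0) / A) (exp (A * - U) / A).
    rewrite /minus /plus /opp /= Rmult_0_r exp_0; have -> : A * - U = - (A * U) by ring.
    by field; lra.
  apply: (is_RInt_derive (fun u => exp (A * u) / A)) => u _.
    by auto_derive => //; field; lra.
  by apply: (@ex_derive_continuous _ _ (fun u => exp (A * u))); auto_derive.
apply: (is_RInt_ext (fun u => exp (- (b * u)))).
  move=> u; rewrite Rmin_left ?Rmax_right; [|lra|lra] => u_in.
  by rewrite /biexp Rmax_right ?Rmax_left; [congr exp; ring|lra|lra].
have -> : (1 - exp (- (b * U))) / b = minus (- exp (- (b * U)) / b) (- exp (- (b * 0)) / b).
  by rewrite /minus /plus /opp /= Rmult_0_r Ropp_0 exp_0; field; lra.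
apply: (is_RInt_derive (fun u => - exp (- (b * u)) / b)) => u _.
  by auto_derive => //; field; lra.
by apply: (@ex_derive_continuous _ _ (fun u => exp (- (b * u)))); auto_derive.
Qed.

Definition biexp_const (Lip : R) := 2000 * (20 * Lip + 80) + 64000 * flat_const + 1.

Lemma flat_const_gt0 : 0 < flat_const.
Proof. by rewrite /flat_const; have := @gauss_const_gt0 2 isT; have := @gauss_const_gt0 3 isT; lra. Qed.

Section ExpectationBiexp.
Variable a : R.
Hypothesis a_gt0 : 0 < a.
Let L := - ln a.
Hypothesis L_ge1000 : 1000 <= L.
Let T := exp (10 * L).
Let U := exp (2 * L).
Hypothesis off_center : forall t, a / 10 <= t <= T -> Cmod (charf a t) <= exp (- (14 * L)).
Hypothesis small_aL : 552000 * gauss_const 3 * sqrt (a * L) <= / 20000.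
Let M0 := smoothed_density a T 0.
Let tau := sqrt (a ^ 3 * L).

Lemma smoothed_density_lower : tau / 2000 <= M0 /\ a ^ 2 / 2000 <= M0 /\ 0 < M0.
Proof.
have M0_ge := smoothed_density_ge a_gt0 L_ge1000 off_center small_aL.
have tau_ge := sq_saddle_le_tau a_gt0 L_ge1000; have tau_pos := tau_gt0 a_gt0 L_ge1000.
by rewrite -/L -/T -/M0 -/tau in M0_ge tau_ge tau_pos; split=> //; split; lra.
Qed.

Lemma saddle_window : a * U = exp L.
Proof.
rewrite /U; have -> : 2 * L = L + L by ring.
by rewrite exp_plus -Rmult_assoc (saddle_mul_exp a_gt0) Rmult_1_l.
Qed.

Lemma exp5_saddle : exp (- (5 * L)) = a ^ 5 /\ a ^ 5 <= a ^ 2 * (a * L).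
Proof.
split; first by rewrite (saddle_pow_eq_exp 5 a_gt0) -/L [INR 5]INR_IZR_INZ.
have aL_le := saddle_L_le a_gt0 L_ge1000; rewrite -/L in aL_le.
have -> : a ^ 5 = a ^ 2 * (a * (a * a)) by ring.
by apply: Rmult_le_compat_l; [exact: pow2_ge_0 | apply: Rmult_le_compat_l; nra].
Qed.

Lemma fejer_err_cutoff_le Lip : 0 <= Lip -> fejer_err Lip a T U <= (20 * Lip + 80) * a ^ 5.
Proof.
move=> Lip_ge0; have [exp5E _] := exp5_saddle.
have sqrtT : sqrt T = exp (5 * L).
  have -> : T = exp (5 * L) * exp (5 * L) by rewrite /T -exp_plus; congr exp; ring.
  by rewrite sqrt_square //; left; exact: exp_pos.
have expL_ge : 10 * L <= exp L.
  by have := @exp_ge_pow 2 L isT ltac:(lra); rewrite INR_2 /pow; nra.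
rewrite /fejer_err sqrtT saddle_window -exp5E.
have lip_part : (20 * Lip + 40) / exp (5 * L) = (20 * Lip + 40) * exp (- (5 * L)).
  by rewrite /Rdiv -exp_Ropp.
have far_part : 20 / (T * U) <= 20 * exp (- (5 * L)).
  rewrite /T /U -exp_plus /Rdiv -exp_Ropp; apply: Rmult_le_compat_l; first lra.
  by apply: exp_le; lra.
have decay_part : exp (- (exp L / 2)) <= exp (- (5 * L)) by apply: exp_le; lra.
by rewrite lip_part; lra.
Qed.

Section TwoRates.
Variables A b : R.
Hypothesis a_le_A : a <= A.
Hypothesis b_bounds : 1 / 2 <= b <= 1.
Let I := / A + / b.

Lemma rates_bounds : 0 < A /\ a <= b /\ 0 < / A /\ 1 <= / b.
Proof.
have aL_le := saddle_L_le a_gt0 L_ge1000; rewrite -/L in aL_le.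
have invb_ge : 1 <= / b by rewrite -{1}Rinv_1; apply: Rinv_le_contravar; lra.
by split; [lra | split; [nra | split=> //; apply: Rinv_0_lt_compat; lra]].
Qed.

Lemma RInt_biexp_window : Rabs (RInt (biexp A b) (- U) U - I) <= a * L * I.
Proof.
have [A_gt0 [a_le_b [invA_gt0 invb_ge]]] := rates_bounds.
have tail_le c : a <= c -> exp (- (c * U)) <= a * L.
  move=> a_le_c; have U_gt0 : 0 < U := exp_pos _.
  apply: (@Rle_trans _ (exp (- L))).
    by apply: exp_le; have := exp_ineq1_le L; rewrite -saddle_window; nra.
  by rewrite -(saddle_eq_exp a_gt0); nra.
rewrite RInt_biexp; [|lra|lra|exact: exp_pos].
have -> : (1 - exp (- (A * U))) / A + (1 - exp (- (b * U))) / b - I =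
  - (exp (- (A * U)) * / A + exp (- (b * U)) * / b) by rewrite /I; field; lra.
have expA_gt0 := exp_pos (- (A * U)); have expb_gt0 := exp_pos (- (b * U)).
rewrite Rabs_Ropp Rabs_pos_eq; last by apply: Rplus_le_le_0_compat; apply: Rmult_le_pos; lra.
have := Rmult_le_compat_r (/ A) _ _ ltac:(lra) (tail_le A a_le_A).
by have := Rmult_le_compat_r (/ b) _ _ ltac:(lra) (tail_le b a_le_b); rewrite /I; lra.
Qed.

Lemma RInt_biexp_density_flat :
  ex_RInt (fun u => biexp A b u * smoothed_density a T u) (- U) U ->
  Rabs (RInt (fun u => biexp A b u * smoothed_density a T u) (- U) U - M0 * RInt (biexp A b) (- U) U)
    <= 32 * flat_const * (tau * (a * L)) * I.
Proof.
move=> density_int; have [A_gt0 [a_le_b [invA_gt0 invb_ge]]] := rates_bounds.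
have U_gt0 : 0 < U := exp_pos _; have tau_pos := tau_gt0 a_gt0 L_ge1000; rewrite -/L -/tau in tau_pos.
set c := flat_const * (tau * (a * L)).
have c_ge0 : 0 <= c by have := flat_const_gt0 => ?; apply: Rmult_le_pos; [lra | apply: Rmult_le_pos; nra].
have f_int c1 c2 : ex_RInt (biexp A b) c1 c2 by apply: ex_RInt_biexp; lra.
have half_int : ex_RInt (biexp (A / 2) (b / 2)) (- U) U by apply: ex_RInt_biexp; lra.
pose diff u := minus (biexp A b u * smoothed_density a T u) (scal M0 (biexp A b u)).
pose major u := scal (c * 16) (biexp (A / 2) (b / 2) u).
have -> : RInt (fun u => biexp A b u * smoothed_density a T u) (- U) U - M0 * RInt (biexp A b) (- U) U =
    RInt diff (- U) U.
  by rewrite RInt_minus //; [rewrite (RInt_scal (biexp A b)) | exact: ex_RInt_scal].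
apply: (@Rle_trans _ (RInt major (- U) U)).
  apply: (norm_RInt_le diff major (- U) U); first lra.
  - move=> u _; rewrite /norm /= /abs /diff /major /minus /plus /opp /scal /= /mult /=.
    have -> : biexp A b u * smoothed_density a T u + - (M0 * biexp A b u) =
      biexp A b u * (smoothed_density a T u - M0) by ring.
    have [f_ge0 _] := @biexp_bounds A b u A_gt0 ltac:(lra); rewrite Rabs_mult (Rabs_pos_eq (biexp A b u)) //.
    have flat := smoothed_density_flat a_gt0 L_ge1000 off_center u; rewrite -/L -/T -/M0 -/tau -/c in flat.
    apply: Rle_trans (Rmult_le_compat_l _ _ _ f_ge0 flat) _.
    by have := Rmult_le_compat_l _ _ _ c_ge0 (biexp_weight_le u a_gt0 a_le_A a_le_b); lra.
  - by apply: RInt_correct; apply: ex_RInt_minus => //; exact: ex_RInt_scal.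
  - by apply: RInt_correct; exact: ex_RInt_scal.
rewrite /major (RInt_scal (biexp (A / 2) (b / 2))) // /scal /= /mult /= RInt_biexp; [|lra|lra|lra].
have -> : 32 * flat_const * (tau * (a * L)) * I = c * 16 * (1 / (A / 2) + 1 / (b / 2)).
  by rewrite /c /I; field; lra.
have expA_gt0 := exp_pos (- (A / 2 * U)); have expb_gt0 := exp_pos (- (b / 2 * U)).
apply: Rmult_le_compat_l; first lra.
by apply: Rplus_le_compat; apply: Rmult_le_compat_r; try lra; left; apply: Rinv_0_lt_compat; lra.
Qed.

Lemma expectation_biexp Lip : A + b <= Lip ->
  Rabs (fejer_mass T U 0 * expectation a (biexp A b) - M0 * I) <= biexp_const Lip * (a * L) * (M0 * I).
Proof.
move=> rates_le; have [A_gt0 [a_le_b [invA_gt0 invb_ge]]] := rates_bounds.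
have b_gt0 : 0 < b by lra.
have [tau_le [a2_le M0_gt0]] := smoothed_density_lower; have [_ a5_le] := exp5_saddle.
have aL_gt0 : 0 < a * L by nra.
have I_ge1 : 1 <= I by rewrite /I; lra.
have [density_int fejer_le] := @RInt_smoothed_density_expectation (biexp A b) (A + b) a a T U
  (fun u => biexp_bounds u A_gt0 b_gt0) (fun x y => biexp_lipschitz x y A_gt0 b_gt0)
  a_gt0 (fun u => biexp_le_exp u a_le_A a_le_b) a_gt0 (exp_pos _) (exp_pos _).
have flat_le := RInt_biexp_density_flat density_int; have window_le := RInt_biexp_window.
have err_le := @fejer_err_cutoff_le (A + b) ltac:(lra).
set S := RInt (fun u => biexp A b u * _) (- U) U in fejer_le flat_le.
set J := RInt (biexp A b) (- U) U in flat_le window_le.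
have mass_part : Rabs (M0 * (J - I)) <= a * L * (M0 * I).
  rewrite Rabs_mult (Rabs_pos_eq M0); last lra.
  by have := Rmult_le_compat_l M0 _ _ ltac:(lra) window_le; lra.
have err_part : fejer_err (A + b) a T U <= 2000 * (20 * Lip + 80) * (a * L) * (M0 * I).
  apply: Rle_trans err_le _.
  have pow5_le : a ^ 5 <= 2000 * M0 * (a * L) * I.
    have : a ^ 2 * (a * L) <= 2000 * M0 * (a * L) by apply: Rmult_le_compat_r; lra.
    have : 0 <= 2000 * M0 * (a * L) by apply: Rmult_le_pos; lra.
    nra.
  have := @Rmult_le_compat (20 * (A + b) + 80) (20 * Lip + 80) _ _ ltac:(lra)
    (pow_le a 5 ltac:(lra)) ltac:(lra) pow5_le; lra.
have flat_part : 32 * flat_const * (tau * (a * L)) * I <= 64000 * flat_const * (a * L) * (M0 * I).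
  have := @Rmult_le_compat_l (32 * flat_const * (a * L) * I) tau (2000 * M0).
  have : 0 <= 32 * flat_const * (a * L) * I.
    by have := flat_const_gt0 => ?; apply: Rmult_le_pos; [apply: Rmult_le_pos|]; lra.
  by move=> ge0 /(_ ge0 ltac:(lra)); lra.
have -> : fejer_mass T U 0 * expectation a (biexp A b) - M0 * I =
  - (S - fejer_mass T U 0 * expectation a (biexp A b)) + ((S - M0 * J) + M0 * (J - I)) by ring.
apply: Rle_trans (Rabs_triang _ _) _; rewrite Rabs_Ropp.
by have := Rabs_triang (S - M0 * J) (M0 * (J - I)); rewrite /biexp_const; lra.
Qed.

End TwoRates.

End ExpectationBiexp.

Lemma ratio_of_proportional Z N r eps x y : 0 < Z -> 0 < N -> 0 <= r -> 0 <= eps <= 1 / 2 ->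
  Rabs (Z * x - N) <= eps * N -> Rabs (Z * y - r * N) <= eps * (r * N) ->
  Rabs (y - r * x) <= 4 * eps * r * x.
Proof.
move=> Z_gt0 N_gt0 r_ge0 eps_bounds x_near y_near.
have N_le : N <= 2 * (Z * x) by move/Rabs_le_between: x_near => [x_ge _]; nra.
apply: (Rmult_le_reg_l Z) => //; rewrite -{1}(Rabs_pos_eq Z) -?Rabs_mult; last lra.
have -> : Z * (y - r * x) = (Z * y - r * N) + - (r * (Z * x - N)) by ring.
apply: Rle_trans (Rabs_triang _ _) _; rewrite Rabs_Ropp Rabs_mult (Rabs_pos_eq r) //.
have := Rmult_le_compat_l r _ _ r_ge0 x_near.
have := @Rmult_le_compat_l (2 * eps * r) _ _ ltac:(nra) N_le; lra.
Qed.

Lemma saddle_L_le_inv_sq a : 0 < a -> 100 <= - ln a -> a * - ln a <= / - ln a * / - ln a.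
Proof.
move=> a_gt0 L_ge; have := saddle_L3_le1 a_gt0 L_ge; set L := - ln a in L_ge * => aL3_le.
have invL_gt0 : 0 < / L by apply: Rinv_0_lt_compat; lra.
have -> : a * L = (a * L ^ 3) * (/ L * / L) by field; lra.
by have : 0 < / L * / L by [nra]; nra.
Qed.

Section ExpectationRatio.
Variables beta a : R.
Hypothesis beta_gt0 : 0 < beta.
Hypothesis a_gt0 : 0 < a.
Let L := - ln a.
Hypothesis L_ge1000 : 1000 <= L.
Let T := exp (10 * L).
Let U := exp (2 * L).
Hypothesis off_center : forall t, a / 10 <= t <= T -> Cmod (charf a t) <= exp (- (14 * L)).
Hypothesis small_aL : 552000 * gauss_const 3 * sqrt (a * L) <= / 20000.
Let eps := biexp_const (1 + beta) * (a * L).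
Hypothesis eps_bounds : 0 <= eps <= 1 / 2.
Let M0 := smoothed_density a T 0.
Let Z := fejer_mass T U 0.
Let E1 := expectation a (biexp a (1 - a)).
Let E2 := expectation a (biexp (beta + a) (1 - a)).
Let N := M0 * (/ a + / (1 - a)).

Lemma saddle_le_half : a <= 1 / 2.
Proof. by have := saddle_L_le a_gt0 L_ge1000; rewrite -/L; nra. Qed.

Lemma expectation_biexp_ge0 : 0 <= E1.
Proof.
have a_le := saddle_le_half.
have biexp01 m : 0 <= biexp a (1 - a) (centered_ln a m) <= 1 by apply: biexp_bounds; lra.
apply: Series_ge0 => [m|].
  by apply: Rmult_le_pos; [exact: saddle_law_ge0 | have := biexp01 m; lra].
apply: (proj1 (@ex_series_saddle_law_bounded a a_gt0 _ 1 _)) => m.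
by have := biexp01 m => ?; rewrite Rabs_pos_eq; lra.
Qed.

Lemma expectation_biexp_near : Rabs (Z * E1 - N) <= eps * N /\ a / 2000 <= N.
Proof.
have a_le := saddle_le_half.
have [_ [M0_ge M0_gt0]] := smoothed_density_lower a_gt0 L_ge1000 off_center small_aL.
have inva_gt0 : 0 < / a by apply: Rinv_0_lt_compat.
have inv1a_gt0 : 0 < / (1 - a) by apply: Rinv_0_lt_compat; lra.
split.
  exact: (@expectation_biexp a a_gt0 L_ge1000 off_center small_aL a (1 - a)
    (Rle_refl a) ltac:(lra) (1 + beta) ltac:(lra)).
have -> : a / 2000 = a ^ 2 / 2000 * / a by field; lra.
have a2_ge0 := pow2_ge_0 a; rewrite -/L -/T -/M0 in M0_ge M0_gt0.
by rewrite /N; apply: Rmult_le_compat; lra.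
Qed.

Lemma expectation_biexp_lower : 0 < Z /\ a / 80000 <= E1.
Proof.
have E1_ge0 := expectation_biexp_ge0; have [near N_ge] := expectation_biexp_near.
have mass_bounds : 0 <= Z <= 20 by apply: fejer_mass_bounds; exact: exp_pos.
have N_le : N <= 2 * (Z * E1) by move/Rabs_le_between: near => [? _]; nra.
split; last by nra.
by apply: Rnot_le_lt => Z_le0; nra.
Qed.

Lemma expectation_ratio_le :
  Rabs (E2 - E1 * (a * ((1 + beta) / beta))) <=
  (4 * biexp_const (1 + beta) + / beta) * (a * L) * (E1 * (a * ((1 + beta) / beta))).
Proof.
have a_le := saddle_le_half; have E1_ge0 := expectation_biexp_ge0.
have [near N_ge] := expectation_biexp_near; have [Z_gt0 _] := expectation_biexp_lower.
set R := a * ((1 + beta) / beta); set r := a * (1 + beta) / (beta + a).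
have R_gt0 : 0 < R by apply: Rmult_lt_0_compat => //; apply: Rdiv_lt_0_compat; lra.
have r_gt0 : 0 < r by apply: Rdiv_lt_0_compat; nra.
have near2 : Rabs (Z * E2 - r * N) <= eps * (r * N).
  have -> : r * N = M0 * (/ (beta + a) + / (1 - a)) by rewrite /r /N; field; lra.
  exact: (@expectation_biexp a a_gt0 L_ge1000 off_center small_aL (beta + a) (1 - a)
    ltac:(lra) ltac:(lra) (1 + beta) ltac:(lra)).
have ratio_le :=
  @ratio_of_proportional Z N r eps E1 E2 Z_gt0 ltac:(lra) (Rlt_le _ _ r_gt0) eps_bounds near near2.
have gap_bounds : 0 <= R - r <= R * (a * / beta).
  have -> : R - r = R * (a * / (beta + a)) by rewrite /R /r; field; lra.
  have inv_gt0 : 0 < / (beta + a) by apply: Rinv_0_lt_compat; lra.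
  have inv_le : / (beta + a) <= / beta by apply: Rinv_le_contravar; lra.
  by split; [apply: Rmult_le_pos; nra | apply: Rmult_le_compat_l; nra].
have -> : E2 - E1 * R = (E2 - r * E1) + - ((R - r) * E1) by ring.
apply: Rle_trans (Rabs_triang _ _) _.
rewrite Rabs_Ropp (Rabs_pos_eq ((R - r) * E1)); last by apply: Rmult_le_pos; lra.
have gap_part : (R - r) * E1 <= / beta * (a * L) * (E1 * R).
  apply: (@Rle_trans _ (R * (a * / beta) * E1)); first by apply: Rmult_le_compat_r; lra.
  have -> : R * (a * / beta) * E1 = (/ beta * a * (E1 * R)) * 1 by ring.
  have -> : / beta * (a * L) * (E1 * R) = (/ beta * a * (E1 * R)) * L by ring.
  apply: Rmult_le_compat_l; last lra.
  by apply: Rmult_le_pos; [nra | apply: Rmult_le_pos; lra].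
have ratio_part : 4 * eps * r * E1 <= 4 * eps * R * E1.
  by apply: Rmult_le_compat_r => //; apply: Rmult_le_compat_l; lra.
have -> : (4 * biexp_const (1 + beta) + / beta) * (a * L) * (E1 * R) =
  4 * eps * R * E1 + / beta * (a * L) * (E1 * R) by rewrite /eps; ring.
lra.
Qed.

End ExpectationRatio.

Lemma expectation_ratio (beta : R) : 0 < beta -> exists C L0, 0 < C /\ 1000 <= L0 /\
  forall a, 0 < a -> L0 <= - ln a ->
  a / 80000 <= expectation a (biexp a (1 - a)) /\
  Rabs (expectation a (biexp (beta + a) (1 - a))
      - expectation a (biexp a (1 - a)) * (a * ((1 + beta) / beta)))
    <= C * (a * - ln a) * (expectation a (biexp a (1 - a)) * (a * ((1 + beta) / beta))).
Proof.
move=> beta_gt0; have [L1 [L1_ge off_center]] := Cmod_charf_off_center.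
have K3_gt0 := @gauss_const_gt0 3 isT; set c := biexp_const (1 + beta).
have c_gt0 : 0 < c by rewrite /c /biexp_const; have := flat_const_gt0; lra.
have invbeta_gt0 : 0 < / beta by apply: Rinv_0_lt_compat.
exists (4 * c + / beta), (L1 + 20000 * (552000 * gauss_const 3) + 2 * c).
split; first lra.
split; first lra.
move=> a a_gt0; set L := - ln a => L_ge.
have L_ge1000 : 1000 <= L by lra.
have invL_gt0 : 0 < / L by apply: Rinv_0_lt_compat; lra.
have LinvL : L * / L = 1 by rewrite Rinv_r; lra.
have aL_gt0 : 0 < a * L by nra.
have := @saddle_L_le_inv_sq a a_gt0 ltac:(rewrite -/L; lra); rewrite -/L => aL_le.
have off_center_a t : a / 10 <= t <= exp (10 * L) -> Cmod (charf a t) <= exp (- (14 * L)).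
  by apply: off_center; rewrite -/L; lra.
have small_aL : 552000 * gauss_const 3 * sqrt (a * L) <= / 20000.
  have sqrt_le : sqrt (a * L) <= / L.
    by rewrite -(sqrt_square (/ L)); [apply: sqrt_le_1_alt | lra].
  have := Rmult_le_compat_l (552000 * gauss_const 3) _ _ ltac:(lra) sqrt_le.
  have := Rmult_le_compat_r (/ L) (20000 * (552000 * gauss_const 3)) L ltac:(lra) ltac:(lra); lra.
have eps_bounds : 0 <= c * (a * L) <= 1 / 2.
  split; first by nra.
  have := Rmult_le_compat_r (/ L) (2 * c) L ltac:(lra) ltac:(lra).
  by have := @Rmult_le_compat_l c (a * L) (/ L) ltac:(lra) ltac:(nra); lra.
split.
  exact: (proj2 (expectation_biexp_lower beta_gt0 a_gt0 L_ge1000 off_center_a small_aL eps_bounds)).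
exact: expectation_ratio_le beta_gt0 a_gt0 L_ge1000 off_center_a small_aL eps_bounds.
Qed.

(** * Rankin's bound for the sieve error *)

Definition rankin_weight (a : R) (n : nat) : R := Rpower (16 * INR n) (a / 8) / INR n.

Definition rankin_excess (a : R) (n : nat) : R :=
  if prime n then div_prob a n * ((INR n + 1) * rankin_weight a n - 1) else 0.

Lemma rankin_weight_ge0 a n : 0 <= rankin_weight a n.
Proof.
case: n => [|n]; first by rewrite /rankin_weight INR_0 /Rdiv Rinv_0; lra.
by apply: Rdiv_le_0_compat; [left; exact: exp_pos | exact: INR_gt0].
Qed.

Lemma rankin_factor_le a n : 0 < a -> prime n ->
  0 <= euler_factor (rankin_weight a) (geom_ratio a) n <= psi_factor a n * exp (rankin_excess a n).
Proof.
move=> a_gt0 n_prime; have [q_gt0 q_lt1] := div_prob_bounds a_gt0 n_prime.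
have p_ge2 := INR_prime_ge2 n_prime; have [r_gt0 r_lt1] := geom_ratio_bounds a_gt0 n_prime.
have weight_ge0 := rankin_weight_ge0 a n; have := psi_factor_div_prob a_gt0 n_prime.
rewrite /euler_factor /psi_factor /rankin_excess n_prime.
set odds := geom_ratio a n / (1 - geom_ratio a n) => factorE.
have odds_gt0 : 0 < odds by apply: Rdiv_lt_0_compat; lra.
split; first by have := Rmult_le_pos _ _ weight_ge0 (Rlt_le _ _ odds_gt0); lra.
have oddsE : odds = (INR n + 1) * (div_prob a n / (1 - div_prob a n)).
  have -> : odds = (INR n + 1) * (1 + psi_weight n * odds - 1) by rewrite /psi_weight; field; lra.
  by rewrite factorE; field; lra.
have -> : 1 + rankin_weight a n * odds =
    / (1 - div_prob a n) * (1 + div_prob a n * ((INR n + 1) * rankin_weight a n - 1)).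
  by rewrite oddsE; field; lra.
apply: Rmult_le_compat_l; first by left; apply: Rinv_0_lt_compat; lra.
exact: exp_ineq1_le.
Qed.

Lemma Rpower_rprod (s : seq nat) (f : nat -> R) c : (forall i, i \in s -> 0 < f i) ->
  Rpower (\rprod_(i <- s) f i) c = \rprod_(i <- s) Rpower (f i) c.
Proof.
elim: s => [|i s IH] f_gt0; first by rewrite !big_nil Rpower_1_l.
have s_gt0 j : j \in s -> 0 < f j by move=> j_s; apply: f_gt0; rewrite inE j_s orbT.
rewrite !big_cons -IH // Rpower_mult_distr //; first by apply: f_gt0; exact: mem_head.
exact: rprod_gt0.
Qed.

Lemma prime_weight_rankin a j :
  prime_weight (rankin_weight a) j =
  Rpower (/ INR (rad j)) (1 - a / 8) * \rprod_(p <- primes j) Rpower 16 (a / 8).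
Proof.
have prime_pos p : p \in primes j -> 0 < INR p.
  by rewrite mem_primes => /andP [/prime_gt0 p_gt0 _]; exact: INR_gt0.
rewrite /rad INR_prod {1}/Rpower ln_Rinv; last exact: rprod_gt0.
have -> : exp ((1 - a / 8) * - ln (\rprod_(p <- primes j) INR p)) =
    Rpower (\rprod_(p <- primes j) INR p) (- (1 - a / 8)) by rewrite /Rpower; congr exp; ring.
rewrite Rpower_rprod // -big_split /prime_weight /=; apply: eq_big_seq => p /prime_pos p_gt0.
rewrite /rankin_weight /Rpower ln_mult; [|lra|lra].
rewrite -{2}(exp_ln (INR p)) //.
by rewrite /Rdiv -exp_Ropp -!exp_plus; congr exp; field.
Qed.

Section RankinBound.
Variable a : R.
Hypothesis a_gt0 : 0 < a.
Let L := - ln a.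
Hypothesis L_ge100 : 100 <= L.

Lemma saddle_L2_le : a * L ^ 2 <= / 100 /\ a <= / 100.
Proof.
have aL3_le := saddle_L3_le1 a_gt0 L_ge100; rewrite -/L in aL3_le.
have L2_ge1 : 1 <= L ^ 2 by rewrite /pow; nra.
have aL2_ge : a * 1 <= a * L ^ 2 by apply: Rmult_le_compat_l; lra.
have aL2_le : a * L ^ 2 <= / 100 by nra.
by split; lra.
Qed.

Section PerPrimeExcess.
Variable n : nat.
Hypothesis n_prime : prime n.
Let z := a / 8 * ln (16 * INR n).

Lemma rankin_exponent_bounds : 0 <= z <= 5 * a / 8 * ln (INR n) /\ z <= a * ln (INR n) / 2 + 1 / 2.
Proof.
have p_ge2 := INR_prime_ge2 n_prime; have [_ a_le] := saddle_L2_le.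
have ln2_le := ln_le 2 (INR n) ltac:(lra) p_ge2; have ln2_in := ln2_bounds.
have ln16E : ln (16 * INR n) = 4 * ln 2 + ln (INR n).
  rewrite ln_mult; [|lra|lra].
  have -> : 16 = 2 ^ 4 by rewrite /pow; lra.
  by rewrite ln_pow; [rewrite [INR 4]INR_IZR_INZ /=; lra | lra].
by rewrite /z ln16E; split; [split|]; nra.
Qed.

Lemma rankin_excessE :
  rankin_excess a n = div_prob a n * (exp z - 1) + div_prob a n * exp z * / INR n.
Proof.
by rewrite /rankin_excess n_prime /rankin_weight /Rpower -/z; have := INR_prime_ge2 n_prime => ?; field; lra.
Qed.

Lemma rankin_excess_le_inv : ln (INR n) <= L ^ 2 -> rankin_excess a n <= 4 / INR n.
Proof.
move=> lnp_le; have p_ge2 := INR_prime_ge2 n_prime; have lnp_gt0 := ln_prime_gt0 n_prime.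
have [q_gt0 q_lt1] := div_prob_bounds a_gt0 n_prime; have [aL2_le _] := saddle_L2_le.
have [[z_ge0 z_le] _] := rankin_exponent_bounds; have invp_gt0 := Rinv_0_lt_compat (INR n) ltac:(lra).
have z_le_half : z <= 1 / 2.
  by have := Rmult_le_compat_l _ _ _ (Rlt_le _ _ a_gt0) lnp_le; lra.
have expm1_le := expm1_le_double (conj z_ge0 z_le_half).
have exp_ge := exp_ineq1_le z.
have first_part : div_prob a n * (exp z - 1) <= 5 / 4 * / INR n.
  apply: (@Rle_trans _ (/ (a * (INR n * ln (INR n))) * (5 * a / 4 * ln (INR n)))).
    by apply: Rmult_le_compat; [lra | lra | exact: div_prob_le | lra].
  by right; field; repeat split; lra.
have second_part : div_prob a n * exp z * / INR n <= 2 * / INR n.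
  by apply: Rmult_le_compat_r; [lra | nra].
by rewrite rankin_excessE /Rdiv; lra.
Qed.

Lemma rankin_excess_le_inv_plogp : rankin_excess a n <= 4 / a * inv_plogp n.
Proof.
have p_ge2 := INR_prime_ge2 n_prime; have lnp_gt0 := ln_prime_gt0 n_prime.
have [q_gt0 q_lt1] := div_prob_bounds a_gt0 n_prime.
have [_ z_le] := rankin_exponent_bounds; have exp_gt0 := exp_pos z.
have den_gt0 : 0 < a * (INR n * ln (INR n)) by apply: Rmult_lt_0_compat => //; nra.
have invden_gt0 := Rinv_0_lt_compat _ den_gt0.
have invp_le1 : / INR n <= 1 by rewrite -Rinv_1; apply: Rinv_le_contravar; lra.
have tilt_le : exp (- (a * ln (INR n) / 2)) * exp z <= 2.
  rewrite -exp_plus; apply: (@Rle_trans _ (exp (1 / 2))); first by apply: exp_le; lra.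
  by have := @expm1_le_double (1 / 2) ltac:(lra); lra.
have q_exp_le : div_prob a n * exp z <= 2 * / (a * (INR n * ln (INR n))).
  have := Rmult_le_compat_r (exp z) _ _ ltac:(lra) (div_prob_le_exp a_gt0 n_prime).
  by have := Rmult_le_compat_l _ _ _ (Rlt_le _ _ invden_gt0) tilt_le; lra.
have q_exp_inv_le : div_prob a n * exp z * / INR n <= div_prob a n * exp z * 1.
  by apply: Rmult_le_compat_l; nra.
rewrite rankin_excessE /inv_plogp n_prime.
have -> : 4 / a * / (INR n * ln (INR n)) = 2 * (2 * / (a * (INR n * ln (INR n)))).
  by field; repeat split; lra.
lra.
Qed.

End PerPrimeExcess.

Lemma rsum_rankin_excess_le N :
  \rsum_(0 <= n < N) rankin_excess a n <= 4 * (1 + L ^ 2) + 200 / (a * L ^ 2).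
Proof.
have L2_ge : 10000 <= L ^ 2 by rewrite /pow; nra.
have cut_ge2 : 2 <= exp (L ^ 2) by have := exp_ineq1_le (L ^ 2); lra.
have [[lnw_ge lnw_le] w_gt1] := ln_floorn_bounds cut_ge2; rewrite ln_exp in lnw_ge lnw_le.
set w := floorn (exp (L ^ 2)) in lnw_ge lnw_le w_gt1.
have inva_gt0 : 0 < 4 / a by apply: Rdiv_lt_0_compat; lra.
pose major n := if (n <= w)%N then 4 * / INR n else 4 / a * inv_plogp n.
have inv_ge0 n : 0 <= / INR n.
  by case: n => [|n]; [rewrite INR_0 Rinv_0; lra | left; apply: Rinv_0_lt_compat; exact: INR_gt0].
have major_ge0 n : 0 <= major n.
  by rewrite /major; case: ifP => _; [have := inv_ge0 n | have := inv_plogp_ge0 n]; nra.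
apply: (@Rle_trans _ (\rsum_(0 <= n < N) major n)).
  apply: rsum_nat_le => n _; case n_prime: (prime n); last by rewrite /rankin_excess n_prime.
  rewrite /major; case: leqP => n_le; last exact: rankin_excess_le_inv_plogp.
  apply: rankin_excess_le_inv => //.
  by have := ln_le _ _ (INR_gt0 (prime_gt0 n_prime)) (leq_INR n_le); lra.
apply: (@Rle_trans _ (\rsum_(0 <= n < maxn N w.+1) major n)).
  by apply: rsum_widen_le => //; rewrite leq_maxl.
rewrite (@big_cat_nat _ _ _ w.+1) //=; last by rewrite leq_maxr.
apply: Rplus_le_compat.
  rewrite big_ltn // {1}/major leq0n INR_0 Rinv_0 Rmult_0_r Rplus_0_l.
  apply: (@Rle_trans _ (4 * \rsum_(1 <= n < w.+1) / INR n)); last by have := harmonic_le w; lra.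
  by rewrite big_distrr; apply: rsum_nat_le => n /andP [_ n_lt]; rewrite /major -ltnS n_lt /=; lra.
apply: (@Rle_trans _ (4 / a * \rsum_(w.+1 <= n < maxn N w.+1) inv_plogp n)).
  by rewrite big_distrr; apply: rsum_nat_le => n /andP [n_gt _]; rewrite /major leqNgt n_gt /=; lra.
apply: Rle_trans (Rmult_le_compat_l _ _ _ (Rlt_le _ _ inva_gt0) (rsum_inv_plogp_tail_le _ w_gt1)) _.
apply: (@Rle_trans _ (4 / a * (41 / (82 / 100 * L ^ 2)))).
  apply: Rmult_le_compat_l; first lra.
  by apply: Rmult_le_compat_l; [lra | apply: Rinv_le_contravar; lra].
by right; field; lra.
Qed.

Lemma rsum_rankin_le N :
  \rsum_(1 <= j < N) (prime_weight (rankin_weight a) j * geom_ratio a j) <=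
  psi_series a * exp (4 * (1 + L ^ 2) + 200 / (a * L ^ 2)).
Proof.
apply: Rle_trans (rsum_le_euler_prod (rankin_weight_ge0 a) _ (geom_ratio1 a) _ _ N) _.
- by move=> m; left; exact: exp_pos.
- by move=> p m; exact: geom_ratioM.
- by move=> p p_prime; have := geom_ratio_bounds a_gt0 p_prime; lra.
apply: (@Rle_trans _ (\rprod_(0 <= n < N) (psi_factor a n * exp (rankin_excess a n)))).
  apply: rprod_le => n _; case n_prime: (prime n); first exact: rankin_factor_le.
  by rewrite /euler_factor /psi_factor /rankin_excess n_prime exp_0; lra.
rewrite big_split rprod_exp; apply: Rmult_le_compat.
- by apply: rprod_ge0 => n _; have := psi_factor_ge1 a_gt0 n; lra.
- by left; exact: exp_pos.
- exact: rprod_psi_factor_le.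
- by apply: exp_le; exact: rsum_rankin_excess_le.
Qed.

Lemma kernel_bound_saddle (beta : R) (j : nat) : (0 < j)%N ->
  kernel_bound beta (exp ((1 + beta) * G a)) j =
  Rmin (exp (beta * G a - centered_ln a j)) (exp (beta * G a + beta * centered_ln a j)).
Proof.
move=> /INR_gt0 j_pos; rewrite /kernel_bound; congr Rmin.
  by rewrite -{1}(exp_ln (INR j)) // /Rdiv -exp_Ropp -exp_plus /centered_ln; congr exp; ring.
by rewrite /Rpower /centered_ln; congr exp; ring.
Qed.

Lemma tilted_exponent_le (beta v y u : R) : 0 < beta -> y <= v - u -> y <= v + beta * u ->
  (1 - a / 8) * y <= v * (1 - a / 8) - a * u.
Proof.
move=> beta_gt0 y_le_left y_le_right; have [_ a_le] := saddle_L2_le.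
case: (Rle_lt_dec 0 u) => u_sign.
  have := @Rmult_le_compat_l (1 - a / 8) _ _ ltac:(lra) y_le_left.
  have : a * u <= (1 - a / 8) * u by apply: Rmult_le_compat_r; lra.
  lra.
have := @Rmult_le_compat_l (1 - a / 8) _ _ ltac:(lra) y_le_right.
have : (1 - a / 8) * (beta * u) <= 0 by have : beta * u <= 0; nra.
have : a * u <= 0 by nra.
lra.
Qed.

Lemma rankin_term_le (beta : R) (j : nat) : 0 < beta -> (0 < j)%N ->
  Rpower (kernel_bound beta (exp ((1 + beta) * G a)) j / INR (rad j)) (1 - a / 8) *
    \rprod_(p <- primes j) Rpower 16 (a / 8) <=
  exp (beta * G a * (1 - a / 8)) * exp (a * G a) * (prime_weight (rankin_weight a) j * geom_ratio a j).
Proof.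
move=> beta_gt0 j_gt0; have rad_pos := INR_gt0 (rad_gt0 j).
have weight_ge0 : 0 <= prime_weight (rankin_weight a) j.
  by apply: prime_weight_ge0 => p; exact: rankin_weight_ge0.
rewrite kernel_bound_saddle //; set u := centered_ln a j.
set Y := Rmin (exp (beta * G a - u)) (exp (beta * G a + beta * u)).
have Y_gt0 : 0 < Y by apply: Rmin_glb_lt; exact: exp_pos.
have left_le := ln_le _ _ Y_gt0 (Rmin_l (exp (beta * G a - u)) (exp (beta * G a + beta * u))).
have right_le := ln_le _ _ Y_gt0 (Rmin_r (exp (beta * G a - u)) (exp (beta * G a + beta * u))).
rewrite !ln_exp in left_le right_le.
have -> : Rpower (Y / INR (rad j)) (1 - a / 8) =
    Rpower Y (1 - a / 8) * Rpower (/ INR (rad j)) (1 - a / 8).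
  by rewrite -Rpower_mult_distr //; exact: Rinv_0_lt_compat.
rewrite Rmult_assoc -prime_weight_rankin.
have -> : exp (beta * G a * (1 - a / 8)) * exp (a * G a) * (prime_weight (rankin_weight a) j * geom_ratio a j) =
  exp (beta * G a * (1 - a / 8) - a * u) * prime_weight (rankin_weight a) j.
  have -> : exp (beta * G a * (1 - a / 8) - a * u) =
      exp (beta * G a * (1 - a / 8)) * exp (a * G a) * geom_ratio a j.
    by rewrite /geom_ratio /Rpower -!exp_plus /u /centered_ln; congr exp; ring.
  ring.
by apply: Rmult_le_compat_r => //; apply: exp_le; apply: tilted_exponent_le beta_gt0 left_le right_le.
Qed.

End RankinBound.

Lemma rankin_exponent_le (beta : R) : 0 < beta -> exists L0, 1000 <= L0 /\
  forall a, 0 < a -> L0 <= - ln a ->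
  4 * (1 + (- ln a) ^ 2) + 200 / (a * (- ln a) ^ 2) - beta * a * G a / 8 <= - (5 * - ln a).
Proof.
move=> beta_gt0.
have [L1 [_ L2_le]] := @exp_dominates (32 / beta * 13) 1 3 ltac:(lra).
exists (Rmax (Rmax 3000 L1) (12800 / beta)); split.
  by have := Rmax_l (Rmax 3000 L1) (12800 / beta); have := Rmax_l 3000 L1; lra.
move=> a a_gt0 /Rmax_le_inv [/Rmax_le_inv [L_ge3000 L_ge1] L_ge2]; set L := - ln a in L_ge3000 L_ge1 L_ge2 *.
have aL_gt0 : 0 < a * L by nra.
have invaL_gt0 : 0 < / (a * L) by apply: Rinv_0_lt_compat.
have G_ge : / (2 * (a * a * L)) <= G a.
  apply: Rle_trans (@G_lower a a_gt0 ltac:(rewrite -/L; lra)); rewrite -/L.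
  have sqrt_ge : 54 <= sqrt L by apply: sqrt_ge_of_sq_le; lra.
  have err_le : 27 / sqrt L <= 1 / 2 by apply: Rdiv_le_intro; lra.
  rewrite Rinv_mult /Rdiv; apply: Rmult_le_compat_r; last lra.
  by left; apply: Rinv_0_lt_compat; nra.
have gain : beta / 16 * / (a * L) <= beta * a * G a / 8.
  have -> : beta / 16 * / (a * L) = beta * a / 8 * / (2 * (a * a * L)) by field; lra.
  have -> : beta * a * G a / 8 = beta * a / 8 * G a by field.
  by apply: Rmult_le_compat_l => //; nra.
have inv_loss : 200 / (a * L ^ 2) <= beta / 64 * / (a * L).
  have -> : 200 / (a * L ^ 2) = 200 / L * / (a * L) by field; lra.
  apply: Rmult_le_compat_r; first lra.
  apply: Rdiv_le_intro; first lra.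
  have -> : 200 = beta / 64 * (12800 / beta) by field; lra.
  by apply: Rmult_le_compat_l => //; lra.
have sq_loss : 13 * L ^ 2 <= beta / 32 * / (a * L).
  have := L2_le L L_ge1; rewrite Rmult_1_l -(inv_saddle_eq_exp a_gt0) => inva_ge.
  have -> : beta / 32 * / (a * L) = / a * (beta / 32 * / L) by field; lra.
  have -> : 13 * L ^ 2 = 32 / beta * 13 * L ^ 3 * (beta / 32 * / L) by field; lra.
  apply: Rmult_le_compat_r => //.
  by apply: Rmult_le_pos; [lra | left; apply: Rinv_0_lt_compat; lra].
have L2_geL : L <= L ^ 2 by rewrite /pow; nra.
lra.
Qed.

Lemma rankin_bound (beta : R) : 0 < beta -> exists L0, 1000 <= L0 /\
  forall a, 0 < a -> L0 <= - ln a -> forall N,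
  \rsum_(1 <= j < N) (9 * (Rpower (kernel_bound beta (exp ((1 + beta) * G a)) j / INR (rad j)) (1 - a / 8) *
    \rprod_(p <- primes j) Rpower 16 (a / 8))) <=
  9 * (exp (beta * G a) * exp (a * G a) * psi_series a * a ^ 5).
Proof.
move=> beta_gt0; have [L0 [L0_ge exponent_le]] := rankin_exponent_le beta_gt0.
exists L0; split=> // a a_gt0 L_ge N; have := exponent_le a a_gt0 L_ge.
set L := - ln a in L_ge * => exponent_le_a.
have L_ge100 : 100 <= - ln a by rewrite -/L; lra.
have H_ge1 := psi_series_ge1 a_gt0.
rewrite -big_distrr /=; apply: Rmult_le_compat_l; first lra.
pose c := exp (beta * G a * (1 - a / 8)) * exp (a * G a).
have c_ge0 : 0 <= c by left; apply: Rmult_lt_0_compat; exact: exp_pos.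
apply: (@Rle_trans _ (c * (psi_series a * exp (4 * (1 + L ^ 2) + 200 / (a * L ^ 2))))).
  apply: Rle_trans (Rmult_le_compat_l _ _ _ c_ge0 (rsum_rankin_le a_gt0 L_ge100 N)).
  rewrite big_distrr; apply: rsum_nat_le => j /andP [j_gt0 _].
  exact: rankin_term_le.
have -> : c * (psi_series a * exp (4 * (1 + L ^ 2) + 200 / (a * L ^ 2))) =
  exp (beta * G a) * exp (a * G a) * psi_series a
    * exp (4 * (1 + L ^ 2) + 200 / (a * L ^ 2) - beta * a * G a / 8).
  rewrite /c /Rminus (exp_plus (4 * (1 + L ^ 2) + 200 / (a * L ^ 2))).
  have -> : beta * G a * (1 + - (a / 8)) = beta * G a + - (beta * a * G a / 8) by field.
  by rewrite exp_plus; ring.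
apply: Rmult_le_compat_l.
  by apply: Rmult_le_pos; [left; apply: Rmult_lt_0_compat; exact: exp_pos | lra].
rewrite (saddle_pow_eq_exp 5 a_gt0) -/L [INR 5]INR_IZR_INZ /=; exact: exp_le.
Qed.

(** * The asymptotic formula *)

Lemma biexp_tilt a b u : 0 <= b ->
  biexp (b + a) (1 - a) u * exp (- (a * u)) = Rmin (exp (b * u)) (exp (- u)).
Proof.
move=> b_ge0; rewrite /biexp -exp_plus; case: (Rle_lt_dec 0 u) => u_sign.
  rewrite Rmax_right; last lra.
  rewrite Rmax_left // Rmin_right; last by apply: exp_le; nra.
  by congr exp; ring.
rewrite Rmax_left; last lra.
rewrite Rmax_right; last lra.
by rewrite Rmin_left; [congr exp; ring | apply: exp_le; nra].
Qed.

Lemma is_series_expectation a b : 0 < a -> a < 1 -> 0 <= b ->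
  is_series (fun n => / INR (psi n.+1) * Rmin (exp (b * centered_ln a n.+1)) (exp (- centered_ln a n.+1)))
    (exp (a * G a) * psi_series a * expectation a (biexp (b + a) (1 - a))).
Proof.
move=> a_gt0 a_lt1 b_ge0; have H_ge1 := psi_series_ge1 a_gt0.
pose term m := saddle_law a m * biexp (b + a) (1 - a) (centered_ln a m).
have biexp_le1 m : Rabs (biexp (b + a) (1 - a) (centered_ln a m)) <= 1.
  by have := @biexp_bounds (b + a) (1 - a) (centered_ln a m) ltac:(lra) ltac:(lra) => ?;
    rewrite Rabs_pos_eq; lra.
have [summable _] := ex_series_saddle_law_bounded a_gt0 biexp_le1.
have sum_from1 : is_series (fun n => term n.+1) (expectation a (biexp (b + a) (1 - a))).
  apply: (@is_series_incr_1 _ _ term).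
  have -> : plus (expectation a (biexp (b + a) (1 - a))) (term 0%N) = expectation a (biexp (b + a) (1 - a)).
    by rewrite /plus /= /term /saddle_law /psi_term /= /Rdiv; ring.
  exact: Series_correct summable.
apply: is_series_ext (@is_series_scal _ _ (exp (a * G a) * psi_series a) _ _ sum_from1) => n.
rewrite -(biexp_tilt a _ b_ge0) /scal /= /mult /= -prime_weight_psi /term /saddle_law /psi_term /=.
have -> : exp (- (a * centered_ln a n.+1)) = exp (a * G a) * geom_ratio a n.+1.
  by rewrite /geom_ratio /Rpower -exp_plus /centered_ln; congr exp; ring.
by field; lra.
Qed.

Lemma F_expectation a : 0 < a -> a < 1 ->
  F (G a) = 6 / PI ^ 2 * (exp (a * G a) * psi_series a * expectation a (biexp a (1 - a))).
Proof.
move=> a_gt0 a_lt1; have := @is_series_expectation a 0 a_gt0 a_lt1 (Rle_refl _).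
rewrite Rplus_0_l => sum_E; rewrite /F -(is_series_unique _ _ sum_E).
congr (_ * _); apply: Series_ext => n; rewrite Rmult_0_l exp_0; congr (_ * Rmin _ _).
have n_pos : 0 < INR n.+1 by exact: INR_gt0.
by rewrite -{1}(exp_ln (INR n.+1)) // /Rdiv -exp_Ropp -exp_plus /centered_ln; congr exp; ring.
Qed.

Lemma F_ge v : 0 <= v -> 6 / PI ^ 2 <= F v.
Proof.
move=> v_ge0; have c_bounds := six_PI2_bounds.
have term_ge0 n : 0 <= / INR (psi n.+1) * Rmin 1 (exp v / INR n.+1).
  apply: Rmult_le_pos; first by left; apply: Rinv_0_lt_compat; exact: psi_gt0.
  apply: Rmin_glb; first lra.
  by apply: Rdiv_le_0_compat; [left; exact: exp_pos | exact: INR_gt0].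
have summable : ex_series (fun n => / INR (psi n.+1) * Rmin 1 (exp v / INR n.+1)).
  apply: (@ex_series_nneg_bounded _ (exp v * exp (/ 1 * 83)) term_ge0 _).1 => N.
  have := @rsum_psi_term_le 1 ltac:(lra) N.+1; rewrite big_ltn // {1}/psi_term /= Rplus_0_l big_add1 /=.
  move=> sum_le; apply: Rle_trans (Rmult_le_compat_l _ _ _ (Rlt_le _ _ (exp_pos v)) sum_le).
  rewrite big_distrr; apply: rsum_nat_le => n _; rewrite /psi_term /= prime_weight_psi.
  have -> : exp v * (/ INR (psi n.+1) * geom_ratio 1 n.+1) = / INR (psi n.+1) * (exp v / INR n.+1).
    by rewrite /geom_ratio Rpower_Ropp Rpower_1; [rewrite /Rdiv; ring | exact: INR_gt0].
  apply: Rmult_le_compat_l; last exact: Rmin_r.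
  by left; apply: Rinv_0_lt_compat; exact: psi_gt0.
suff : 1 <= Series (fun n => / INR (psi n.+1) * Rmin 1 (exp v / INR n.+1)) by rewrite /F; nra.
have := rsum_le_Series 1 term_ge0 summable; rewrite big_nat1.
have -> : psi 1 = 1%N by rewrite /psi big_nil.
rewrite INR_1 Rinv_1 Rmult_1_l /Rdiv Rinv_1 Rmult_1_r Rmin_left //.
by have := exp_ineq1_le v; lra.
Qed.

Lemma kernel_count_lt1 j Y : 0 <= Y < 1 -> kernel_count j (floorn Y) = 0.
Proof.
move=> [Y_ge0 Y_lt1]; have [floor_le _] := floorn_bounds Y_ge0.
have -> : floorn Y = 0%N.
  have : INR (floorn Y) < INR 1 by rewrite INR_1; lra.
  by move/ltn_of_INR; lia.
by rewrite /kernel_count big_geq.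
Qed.

Lemma saddle_pow5_le a L c E theta : 0 < a < 1 -> 1 <= L -> 1 / 3 <= c -> a / 80000 <= E ->
  0 < theta < 1 -> 9 * a ^ 5 <= 3000000 * (a * L) * (c * (E * (a / theta))).
Proof.
move=> a_bounds L_ge1 c_ge E_ge theta_bounds.
have ratio_ge : a <= a / theta by apply: Rle_div_intro; nra.
have a2_bounds : 0 < a * a <= 1 by nra.
have a5_le : a ^ 5 <= a * (a * a).
  have cube_gt0 : 0 < a * (a * a) by apply: Rmult_lt_0_compat; lra.
  have -> : a ^ 5 = a * (a * a) * (a * a) by ring.
  nra.
have c_E_ge : 1 / 3 * (a / 80000 * a) <= c * (E * (a / theta)) by apply: Rmult_le_compat; nra.
have cube_ge0 : 0 <= a * (a * a) by apply: Rmult_le_pos; lra.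
apply: (@Rle_trans _ (3000000 * a * (1 / 3 * (a / 80000 * a)))).
  have -> : 3000000 * a * (1 / 3 * (a / 80000 * a)) = 25 / 2 * (a * (a * a)) by field.
  lra.
by apply: Rmult_le_compat; nra.
Qed.

Lemma alpha_spec theta x : theta < 1 -> 1 < x ->
  0 < alpha theta x /\ G (alpha theta x) = (1 - theta) * ln x.
Proof.
move=> theta_lt1 x_gt1.
apply: (epsilon_spec (inhabits 0) (fun a => 0 < a /\ G a = (1 - theta) * ln x)).
by apply: G_surjective; have := ln_gt0 x_gt1; nra.
Qed.

Lemma lnln_ge1 x : 27 <= x -> 3 <= ln x /\ 1 <= ln (ln x).
Proof.
have ln3_ge1 : 1 <= ln 3 by rewrite -{1}(ln_exp 1); apply: ln_le; [exact: exp_pos | exact: exp_le_3].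
move=> x_ge27; have lnx_ge3 : 3 <= ln x.
  have : ln (3 * (3 * 3)) <= ln x by apply: ln_le; lra.
  by rewrite ln_mult ?ln_mult; lra.
by split=> //; apply: Rle_trans ln3_ge1 _; apply: ln_le; lra.
Qed.

Lemma Rabs_mul_sub1_le x y : Rabs (x * y - 1) <= Rabs (x - 1) + Rabs (y - 1) + Rabs (x - 1) * Rabs (y - 1).
Proof.
have -> : x * y - 1 = (x - 1) + (y - 1) + (x - 1) * (y - 1) by ring.
apply: Rle_trans (Rabs_triang _ _) _; rewrite Rabs_mult.
by have := Rabs_triang (x - 1) (y - 1); lra.
Qed.

Lemma Rabs_sub1_le_sq r : 0 <= r -> Rabs (r - 1) <= Rabs (r * r - 1).
Proof.
move=> r_ge0; have -> : r * r - 1 = (r - 1) * (r + 1) by ring.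
rewrite Rabs_mult (Rabs_pos_eq (r + 1)); last lra.
by have := Rabs_pos (r - 1); nra.
Qed.

Section MainTerm.
Variable theta : R.
Hypothesis theta_gt0 : 0 < theta.
Hypothesis theta_lt1 : theta < 1.
Let beta := theta / (1 - theta).

Lemma beta_gt0 : 0 < beta.
Proof. by apply: Rdiv_lt_0_compat; lra. Qed.

Lemma S_theta_kernel_count_upto x N : 1 <= x -> (floorn x < N)%N ->
  S_theta theta x = \rsum_(1 <= j < N) kernel_count j (floorn (kernel_bound beta x j)).
Proof.
move=> x_ge1 N_gt; rewrite (S_theta_kernel_count theta_lt1 x_ge1) -/beta.
rewrite [RHS](@big_cat_nat _ _ _ (floorn x).+1) //= [X in _ = _ + X]big1_seq ?Rplus_0_r //.
move=> j; rewrite mem_index_iota => /andP [_ /andP [j_gt _]].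
have j_pos : 0 < INR j by apply: INR_gt0; lia.
apply: kernel_count_lt1; split.
  by left; apply: Rmin_glb_lt; [apply: Rdiv_lt_0_compat; lra | exact: exp_pos].
apply: Rle_lt_trans (Rmin_l _ _) _; apply/Rlt_div_l => //.
have [_ x_lt] := @floorn_bounds x ltac:(lra).
by have := leq_INR j_gt; rewrite S_INR; lra.
Qed.

Lemma S_theta_approx a B : 0 < a -> a < 1 -> 0 < G a ->
  (forall N, \rsum_(1 <= j < N)
    (9 * (Rpower (kernel_bound beta (exp ((1 + beta) * G a)) j / INR (rad j)) (1 - a / 8) *
    \rprod_(p <- primes j) Rpower 16 (a / 8))) <= B) ->
  Rabs (S_theta theta (exp ((1 + beta) * G a)) - 6 / PI ^ 2 *
    (exp (beta * G a) * (exp (a * G a) * psi_series a * expectation a (biexp (beta + a) (1 - a))))) <= B.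
Proof.
move=> a_gt0 a_lt1 G_gt0 err_le; have beta_pos := beta_gt0.
set x := exp ((1 + beta) * G a).
have x_ge1 : 1 <= x by have := exp_ineq1_le ((1 + beta) * G a); rewrite -/x; nra.
pose W n := / INR (psi n.+1) * Rmin (exp (beta * centered_ln a n.+1)) (exp (- centered_ln a n.+1)).
have boundE j : (0 < j)%N -> kernel_bound beta x j =
    exp (beta * G a) * Rmin (exp (beta * centered_ln a j)) (exp (- centered_ln a j)).
  move=> j_gt0; rewrite /x kernel_bound_saddle // Rmin_comm /Rminus !exp_plus.
  have := exp_pos (beta * G a); move: (exp (beta * G a)) (exp _) (exp _) => c u w c_gt0.
  by rewrite /Rmin; case: Rle_dec => cu_le; case: Rle_dec => u_le //; exfalso; nra.
have partial_le N : (floorn x < N)%N ->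
    Rabs (S_theta theta x - 6 / PI ^ 2 * (exp (beta * G a) * \rsum_(0 <= n < N) W n)) <= B.
  move=> N_gt; rewrite (S_theta_kernel_count_upto x_ge1 (ltnW N_gt : (floorn x < N.+1)%N)).
  have -> : 6 / PI ^ 2 * (exp (beta * G a) * \rsum_(0 <= n < N) W n) =
      \rsum_(1 <= j < N.+1) (6 / PI ^ 2 * (kernel_bound beta x j / INR (psi j))).
    rewrite big_add1 /= !big_distrr; apply: eq_bigr => n _ /=.
    by rewrite boundE // /W /Rdiv; ring.
  rewrite rsumB; apply: Rle_trans (Rabs_rsum_le _ _ _) _; apply: Rle_trans (err_le N.+1).
  apply: rsum_nat_le => j /andP [j_gt0 _]; apply: kernel_count_interp => //; last lra.
  by apply: Rmin_glb_lt; [apply: Rdiv_lt_0_compat; [lra | exact: INR_gt0] | exact: exp_pos].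
have sum_lim := proj1 (is_series_rsum _ _) (is_series_expectation a_gt0 a_lt1 (Rlt_le _ _ beta_pos)).
have lim := is_lim_seq_minus' _ _ _ _ (is_lim_seq_const (S_theta theta x)) (is_lim_seq_mult' _ _ _ _
  (is_lim_seq_const (6 / PI ^ 2)) (is_lim_seq_mult' _ _ _ _ (is_lim_seq_const (exp (beta * G a))) sum_lim)).
apply: is_lim_seq_ub (is_lim_seq_abs _ _ lim).
by exists (floorn x).+1 => N /partial_le.
Qed.

Lemma S_theta_saddle : exists C L0, 0 < C /\ 1000 <= L0 /\ forall a, 0 < a -> L0 <= - ln a -> 0 < G a ->
  Rabs (S_theta theta (exp (G a / (1 - theta))) - exp (beta * G a) * F (G a) * (a / theta)) <=
  C * (a * - ln a) * (exp (beta * G a) * F (G a) * (a / theta)).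
Proof.
have [C [L1 [C_gt0 [L1_ge ratio_le]]]] := expectation_ratio beta_gt0.
have [L2 [L2_ge err_le]] := rankin_bound beta_gt0.
exists (C + 3000000), (Rmax L1 L2); split; first lra.
split; first by have := Rmax_l L1 L2; lra.
move=> a a_gt0 /Rmax_le_inv [L_ge1 L_ge2] G_gt0.
have a_lt1 : a < 1 by rewrite (saddle_eq_exp a_gt0) -exp_0; apply: exp_increasing; lra.
have [E1_ge ratio_le_a] := ratio_le a a_gt0 L_ge1.
have approx := S_theta_approx a_gt0 a_lt1 G_gt0 (err_le a a_gt0 L_ge2).
have H_ge1 := psi_series_ge1 a_gt0; have [c_ge _] := six_PI2_bounds.
have small := @saddle_pow5_le a (- ln a) (6 / PI ^ 2) _ theta ltac:(lra) ltac:(lra) c_ge E1_ge ltac:(lra).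
have -> : G a / (1 - theta) = (1 + beta) * G a by rewrite /beta; field; lra.
have ratioE : (1 + beta) / beta = / theta by rewrite /beta; field; lra.
rewrite ratioE -/(Rdiv a theta) in ratio_le_a; rewrite (F_expectation a_gt0 a_lt1).
move: approx small ratio_le_a {E1_ge}.
set S := S_theta _ _; set E1 := expectation a (biexp a _); set E2 := expectation a (biexp (_ + _) _).
set c := 6 / PI ^ 2 in c_ge *; set K := exp (a * G a) * psi_series a; set x_theta := exp (beta * G a).
set L := - ln a; move=> approx small ratio_le_a.
have KB_gt0 : 0 < x_theta * K by do 2?[apply: Rmult_lt_0_compat; first exact: exp_pos]; lra.
have -> : S - x_theta * (c * (K * E1)) * (a / theta) =
  (S - c * (x_theta * (K * E2))) + c * (x_theta * K) * (E2 - E1 * (a / theta)) by ring.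
apply: Rle_trans (Rabs_triang _ _) _; rewrite Rabs_mult (Rabs_pos_eq (c * (x_theta * K))); last by nra.
have main_part := Rmult_le_compat_l (c * (x_theta * K)) _ _ ltac:(nra) ratio_le_a.
have err_part := Rmult_le_compat_l (x_theta * K) _ _ (Rlt_le _ _ KB_gt0) small.
have errE : 9 * (x_theta * exp (a * G a) * psi_series a * a ^ 5) = x_theta * K * (9 * a ^ 5).
  by rewrite /K; ring.
by rewrite errE in approx; lra.
Qed.

Definition main_term (x : R) : R := Rpower x theta * F ((1 - theta) * ln x) * (alpha theta x / theta).

Lemma main_term_gt0 x : 1 < x -> 0 < main_term x.
Proof.
move=> x_gt1; have [al_gt0 _] := alpha_spec theta_lt1 x_gt1; have lnx_gt0 := ln_gt0 x_gt1.
have := @F_ge ((1 - theta) * ln x) ltac:(nra); have := six_PI2_bounds => c_bounds F_ge_c.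
apply: Rmult_lt_0_compat; last exact: Rdiv_lt_0_compat.
by apply: Rmult_lt_0_compat; [exact: exp_pos | lra].
Qed.

Lemma S_theta_main_term_saddle : exists C L0, 0 < C /\ 3000 <= L0 /\
  forall x, 27 <= x -> L0 <= - ln (alpha theta x) ->
  Rabs (S_theta theta x - main_term x) <= C * (alpha theta x * - ln (alpha theta x)) * main_term x.
Proof.
have [C [L0 [C_gt0 [L0_ge estimate]]]] := S_theta_saddle.
exists C, (Rmax L0 3000); split=> //; split; first exact: Rmax_r.
move=> x x_ge27 /Rmax_le_inv [L_ge _]; have [al_gt0 G_al] := @alpha_spec theta x theta_lt1 ltac:(lra).
have [lnx_ge3 _] := lnln_ge1 x_ge27.
have := estimate _ al_gt0 L_ge ltac:(rewrite G_al; nra); rewrite G_al.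
have -> : (1 - theta) * ln x / (1 - theta) = ln x by field; lra.
rewrite exp_ln; last lra.
by have -> : beta * ((1 - theta) * ln x) = theta * ln x by rewrite /beta; field; lra.
Qed.

Lemma alpha_ln_alpha_le x : 27 <= x -> 3000 <= - ln (alpha theta x) ->
  alpha theta x * - ln (alpha theta x) <= sqrt (14 / (1 - theta)) * sqrt (ln (ln x) / ln x).
Proof.
move=> x_ge27 L_ge; have [al_gt0 G_al] := @alpha_spec theta x theta_lt1 ltac:(lra).
have [lnx_ge3 lnlnx_ge1] := lnln_ge1 x_ge27.
have [saddle_near [L_le_lnG _]] := G_saddle_asymp al_gt0 L_ge; rewrite G_al in saddle_near L_le_lnG.
move: (alpha theta x) al_gt0 L_ge saddle_near L_le_lnG {G_al} => a a_gt0.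
set L := - ln a => L_ge saddle_near L_le_lnG.
have sqrtL_ge : 54 <= sqrt L by apply: sqrt_ge_of_sq_le; lra.
have err_le : 690 / sqrt L <= 13 by apply: Rdiv_le_intro; lra.
have saddle_le : a * a * ((1 - theta) * ln x) * L <= 14 by move/Rabs_le_between: saddle_near; lra.
have L_le : L <= ln (ln x) by apply: Rle_trans L_le_lnG _; apply: ln_le; nra.
have aL_ge0 : 0 <= a * L by nra.
rewrite -sqrt_mult; [|by apply: Rdiv_le_0_compat; lra|by apply: Rdiv_le_0_compat; lra].
apply: sqrt_ge_of_sq_le => //.
have -> : 14 / (1 - theta) * (ln (ln x) / ln x) = (14 * ln (ln x)) / ((1 - theta) * ln x) by field; lra.
apply: Rle_div_intro; first by nra.
have -> : a * L * (a * L) * ((1 - theta) * ln x) = (a * a * ((1 - theta) * ln x) * L) * L by ring.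
by apply: Rmult_le_compat; try lra; repeat apply: Rmult_le_pos; lra.
Qed.

Lemma S_theta_bounds x : 0 <= x -> 0 <= S_theta theta x <= x.
Proof.
move=> x_ge0; split; first exact: pos_INR.
have [floor_le _] := floorn_bounds x_ge0; apply: Rle_trans floor_le.
apply: leq_INR; rewrite /S_count -/(floorn x).
apply: (@leq_trans (\sum_(1 <= m < (floorn x).+1) 1)%N); last by rewrite sum_nat_const_nat subn1 muln1.
by apply: leq_sum => i _; case: Rle_dec.
Qed.

Lemma alpha_ge_exp x V : 27 <= x -> (1 - theta) * ln x <= V ->
  exp (- Rmax 3000 (ln V)) <= alpha theta x.
Proof.
move=> x_ge27 v_le; have [al_gt0 G_al] := @alpha_spec theta x theta_lt1 ltac:(lra).
have [lnx_ge3 _] := lnln_ge1 x_ge27; have v_gt0 : 0 < (1 - theta) * ln x by nra.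
rewrite {1}(saddle_eq_exp al_gt0); apply: exp_le; apply: Ropp_le_contravar.
case: (Rle_lt_dec (- ln (alpha theta x)) 3000) => L_cases; first by apply: Rle_trans L_cases (Rmax_l _ _).
have [_ [L_le_lnG _]] := G_saddle_asymp al_gt0 (Rlt_le _ _ L_cases); rewrite G_al in L_le_lnG.
by have := ln_le _ _ v_gt0 v_le; have := Rmax_r 3000 (ln V); lra.
Qed.

Lemma main_term_ge x V : 27 <= x -> (1 - theta) * ln x <= V ->
  exp (- Rmax 3000 (ln V)) / 3 <= main_term x.
Proof.
move=> x_ge27 v_le; have [lnx_ge3 _] := lnln_ge1 x_ge27; have al_ge := alpha_ge_exp x_ge27 v_le.
have exp_gt0 := exp_pos (- Rmax 3000 (ln V)); have c_bounds := six_PI2_bounds.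
have power_ge1 : 1 <= Rpower x theta by rewrite /Rpower -exp_0; apply: exp_le; nra.
have F_ge_c := @F_ge ((1 - theta) * ln x) ltac:(nra).
have ratio_ge : exp (- Rmax 3000 (ln V)) <= alpha theta x / theta.
  by apply: (Rle_trans _ _ _ al_ge); apply: Rle_div_intro; nra.
have factor_ge : 1 / 3 <= Rpower x theta * F ((1 - theta) * ln x) by nra.
rewrite /main_term; apply: (@Rle_trans _ (1 / 3 * exp (- Rmax 3000 (ln V)))); first lra.
by apply: Rmult_le_compat; lra.
Qed.

Lemma S_theta_main_term_bounded_range V : 83 <= V -> exists C, 0 < C /\
  forall x, 27 <= x -> (1 - theta) * ln x <= V ->
  Rabs (S_theta theta x - main_term x) <= C * main_term x * sqrt (ln (ln x) / ln x).
Proof.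
move=> V_ge83; set X := exp (V / (1 - theta)); set M := Rmax 3000 (ln V).
set r := sqrt ((1 - theta) / V).
have X_gt0 : 0 < X by exact: exp_pos.
have r_gt0 : 0 < r by apply: sqrt_lt_R0; apply: Rdiv_lt_0_compat; lra.
have expM_gt0 := exp_pos M; have exp_opp := exp_mul_opp M.
exists ((1 + 3 * X * exp M) / r); split; first by apply: Rdiv_lt_0_compat => //; nra.
move=> x x_ge27 v_le; have [lnx_ge3 lnlnx_ge1] := lnln_ge1 x_ge27.
have mt_gt0 := @main_term_gt0 x ltac:(lra); have mt_ge := main_term_ge x_ge27 v_le; rewrite -/M in mt_ge.
have x_le : x <= X.
  rewrite -(exp_ln x); last lra.
  by apply: exp_le; apply: Rle_div_intro; lra.
have [S_ge0 S_le] := @S_theta_bounds x ltac:(lra).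
have r_le : r <= sqrt (ln (ln x) / ln x).
  apply: sqrt_le_1_alt; apply: (@Rle_trans _ (1 / ln x)).
    apply: Rle_div_intro; first lra.
    have -> : (1 - theta) / V * ln x = ((1 - theta) * ln x) / V by field; lra.
    by apply: Rdiv_le_intro; lra.
  by apply: Rmult_le_compat_r => //; left; apply: Rinv_0_lt_compat; lra.
have S_le_mt : S_theta theta x <= 3 * X * exp M * main_term x.
  have := Rmult_le_compat_l (3 * X * exp M) _ _ ltac:(nra) mt_ge.
  have -> : 3 * X * exp M * (exp (- M) / 3) = X * (exp M * exp (- M)) by field.
  by rewrite exp_opp; lra.
have -> : (1 + 3 * X * exp M) / r * main_term x * sqrt (ln (ln x) / ln x) =
  (1 + 3 * X * exp M) * main_term x * (sqrt (ln (ln x) / ln x) / r) by field; lra.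
apply: (@Rle_trans _ ((1 + 3 * X * exp M) * main_term x * 1)); first by apply: Rabs_le; lra.
apply: Rmult_le_compat_l; first by apply: Rmult_le_pos; nra.
by apply: Rle_div_intro; lra.
Qed.

Lemma S_theta_main_term : exists C : R, 0 < C /\ forall x : R, 27 <= x ->
  Rabs (S_theta theta x - main_term x) <= C * main_term x * sqrt (ln (ln x) / ln x).
Proof.
have [C1 [L0 [C1_gt0 [L0_ge large]]]] := S_theta_main_term_saddle.
have exp_ge := exp_ineq1_le (2 * L0).
have [C2 [C2_gt0 bounded]] := @S_theta_main_term_bounded_range (83 * exp (2 * L0)) ltac:(lra).
have sqrt_ge0 := sqrt_pos (14 / (1 - theta)).
exists (C1 * sqrt (14 / (1 - theta)) + C2); split; first by nra.
move=> x x_ge27; have [al_gt0 G_al] := @alpha_spec theta x theta_lt1 ltac:(lra).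
have mt_gt0 := @main_term_gt0 x ltac:(lra); have root_ge0 := sqrt_pos (ln (ln x) / ln x).
have unit_ge0 : 0 <= main_term x * sqrt (ln (ln x) / ln x) by nra.
case: (Rle_lt_dec ((1 - theta) * ln x) (83 * exp (2 * L0))) => v_cases.
  have := bounded x x_ge27 v_cases.
  have := Rmult_le_pos _ _ (Rmult_le_pos _ _ (Rlt_le _ _ C1_gt0) sqrt_ge0) unit_ge0; lra.
have L_ge : L0 <= - ln (alpha theta x) by apply: L_ge_of_G_ge => //; rewrite G_al; lra.
apply: Rle_trans (large x x_ge27 L_ge) _.
have := Rmult_le_compat_l (C1 * main_term x) _ _ ltac:(nra) (@alpha_ln_alpha_le x x_ge27 ltac:(lra)).
have : 0 <= C2 * (main_term x * sqrt (ln (ln x) / ln x)) by nra.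
lra.
Qed.

Lemma lnln_saddle_asymp a x : 0 < a -> 2500 <= - ln a -> 27 <= x ->
  Rabs (a * a * ((1 - theta) * ln x) * - ln a - 1) <= 4 / 10 ->
  Rabs (ln (ln x) / (2 * - ln a) - 1) <= (Rabs (ln (1 - theta)) + 2) / sqrt (- ln a).
Proof.
move=> a_gt0; set L := - ln a; have lnaE : ln a = - L by rewrite /L; lra.
set v := (1 - theta) * ln x; set b := Rabs (ln (1 - theta)) => L_ge x_ge27 near.
have [lnx_ge3 lnlnx_ge1] := lnln_ge1 x_ge27; have v_gt0 : 0 < v by rewrite /v; nra.
have b_bounds : - b <= ln (1 - theta) <= b by apply/Rabs_le_between; rewrite -/b; lra.
have lnL_le := @ln_le_2sqrt L ltac:(lra); have lnL_ge0 := @ln_ge0 L ltac:(lra).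
have sqrt_sq : sqrt L * sqrt L = L by apply: sqrt_sqrt; lra.
have sqrtL_ge : 50 <= sqrt L by apply: sqrt_ge_of_sq_le; lra.
set w := a * a * v * L in near; have [w_ge w_le] := proj1 (Rabs_le_between _ _) near.
have w_gt0 : 0 < w by lra.
have lnw_le : ln w <= 1 by apply: Rle_trans (ln_le_sub1 w_gt0) _; lra.
have lnw_ge : - 1 <= ln w.
  apply: Rle_trans (ln_ge_one_sub_inv w_gt0).
  have : / w <= / (6 / 10) by apply: Rinv_le_contravar; lra.
  have -> : / (6 / 10) = 10 / 6 by field.
  lra.
have lnwE : ln w = - (2 * L) + ln (1 - theta) + ln (ln x) + ln L.
  have aa_gt0 : 0 < a * a by nra.
  have aav_gt0 : 0 < a * a * v by nra.
  by rewrite /w (ln_mult _ L) ?(ln_mult _ v) ?(ln_mult a a) // ?lnaE /v ?ln_mult; lra.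
have -> : ln (ln x) / (2 * L) - 1 = (ln w - ln L - ln (1 - theta)) / (2 * L) by rewrite lnwE; field; lra.
rewrite /Rdiv Rabs_mult (Rabs_pos_eq (/ (2 * L))); last by left; apply: Rinv_0_lt_compat; lra.
have -> : (b + 2) * / sqrt L = (2 * sqrt L * (b + 2)) * / (2 * L) by rewrite -{3}sqrt_sq; field; lra.
apply: Rmult_le_compat_r; first by left; apply: Rinv_0_lt_compat; lra.
by apply: Rabs_le; nra.
Qed.

Lemma alpha_equiv : exists K, 0 < K /\ forall x, 27 <= x -> 3000000 <= - ln (alpha theta x) ->
  Rabs (alpha theta x / (sqrt (2 / (1 - theta)) * / sqrt (ln x * ln (ln x))) - 1) <=
  K / sqrt (- ln (alpha theta x)).
Proof.
set b := Rabs (ln (1 - theta)); have b_ge0 : 0 <= b by exact: Rabs_pos.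
exists (690 + (b + 2) + 690 * (b + 2)); split; first lra.
move=> x x_ge27 L_ge; have [al_gt0 G_al] := @alpha_spec theta x theta_lt1 ltac:(lra).
have [lnx_ge3 lnlnx_ge1] := lnln_ge1 x_ge27.
have [near _] := @G_saddle_asymp _ al_gt0 ltac:(lra); rewrite G_al in near.
move: (alpha theta x) al_gt0 L_ge near {G_al} => a a_gt0; have := @lnln_saddle_asymp a x a_gt0.
set L := - ln a; set v := (1 - theta) * ln x => lnln_near L_ge near.
have sqrtL_ge : 1725 <= sqrt L by apply: sqrt_ge_of_sq_le; lra.
have invs_bounds : 0 < / sqrt L <= 1.
  by split; [apply: Rinv_0_lt_compat | rewrite -Rinv_1; apply: Rinv_le_contravar]; lra.
have err_le : 690 / sqrt L <= 4 / 10 by apply: Rdiv_le_intro; lra.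
have {}lnln_near := lnln_near ltac:(lra) x_ge27 (Rle_trans _ _ _ near err_le); rewrite -/b in lnln_near.
have lx_gt0 : 0 < ln x * ln (ln x) by apply: Rmult_lt_0_compat; lra.
have c_gt0 : 0 < 2 / (1 - theta) by apply: Rdiv_lt_0_compat; lra.
have sqrtlx_gt0 := sqrt_lt_R0 _ lx_gt0; have sqrtc_gt0 := sqrt_lt_R0 _ c_gt0.
set r := a / _.
have r_gt0 : 0 < r.
  by apply: Rdiv_lt_0_compat => //; apply: Rmult_lt_0_compat => //; exact: Rinv_0_lt_compat.
have r2E : r * r = a * a * v * L * (ln (ln x) / (2 * L)).
  have -> : r * r = a * a * (sqrt (ln x * ln (ln x)) * sqrt (ln x * ln (ln x))) /
     (sqrt (2 / (1 - theta)) * sqrt (2 / (1 - theta))) by rewrite /r; field; lra.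
  by rewrite !sqrt_sqrt; [rewrite /v; field | |]; lra.
apply: Rle_trans (Rabs_sub1_le_sq (Rlt_le _ _ r_gt0)) _.
rewrite r2E; apply: Rle_trans (Rabs_mul_sub1_le _ _) _.
have := Rmult_le_compat _ _ _ _ (Rabs_pos _) (Rabs_pos _) near lnln_near.
have : 690 / sqrt L * ((b + 2) / sqrt L) <= 690 * ((b + 2) / sqrt L).
  by rewrite /Rdiv; apply: Rmult_le_compat_r; nra.
have -> : (690 + (b + 2) + 690 * (b + 2)) / sqrt L =
  690 / sqrt L + (b + 2) / sqrt L + 690 * ((b + 2) / sqrt L) by field; lra.
lra.
Qed.

Lemma S_theta_ratio_main_term : exists C L0, 0 < C /\ 3000 <= L0 /\
  forall x, 27 <= x -> L0 <= - ln (alpha theta x) ->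
  Rabs (S_theta theta x / main_term x - 1) <= C / sqrt (- ln (alpha theta x)).
Proof.
have [C [L0 [C_gt0 [L0_ge estimate]]]] := S_theta_main_term_saddle.
exists C, L0; split=> //; split=> // x x_ge27 L_ge.
have [al_gt0 _] := @alpha_spec theta x theta_lt1 ltac:(lra).
have mt_gt0 := @main_term_gt0 x ltac:(lra); have := estimate x x_ge27 L_ge.
have := @saddle_L3_le1 _ al_gt0 ltac:(lra); set L := - ln (alpha theta x) in L_ge * => aL3_le {}estimate.
have sqrtL_ge : 1 <= sqrt L by apply: sqrt_ge_of_sq_le; lra.
have sqrtL_le : sqrt L <= L by have := sqrt_sqrt L ltac:(lra); nra.
have aL_le : alpha theta x * L <= / sqrt L.
  rewrite -[/ sqrt L]Rmult_1_l; apply: Rle_div_intro; first lra.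
  apply: Rle_trans aL3_le; rewrite Rmult_assoc; apply: Rmult_le_compat_l; first lra.
  have -> : L ^ 3 = L * (L * L) by ring.
  by apply: Rmult_le_compat_l; nra.
have -> : S_theta theta x / main_term x - 1 = (S_theta theta x - main_term x) / main_term x by field; lra.
rewrite /Rdiv Rabs_mult (Rabs_pos_eq (/ main_term x)); last by left; exact: Rinv_0_lt_compat.
apply: Rdiv_le_intro => //; apply: Rle_trans estimate _; apply: Rmult_le_compat_r; first lra.
by apply: Rmult_le_compat_l; lra.
Qed.

Lemma neg_ln_alpha_unbounded M : exists X, forall x, X < x -> 27 <= x /\ M <= - ln (alpha theta x).
Proof.
exists (Rmax 27 (exp (83 * exp (2 * M) / (1 - theta)))) => x /Rmax_Rlt [x_gt27 x_gt].
split; first lra.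
have [al_gt0 G_al] := @alpha_spec theta x theta_lt1 ltac:(lra).
apply: L_ge_of_G_ge => //; rewrite G_al.
have := ln_increasing _ _ (exp_pos _) x_gt; rewrite ln_exp => lnx_gt.
have := Rmult_lt_compat_l (1 - theta) _ _ ltac:(lra) lnx_gt.
have -> : (1 - theta) * (83 * exp (2 * M) / (1 - theta)) = 83 * exp (2 * M) by field; lra.
lra.
Qed.

Lemma S_theta_equiv : is_lim (fun x : R =>
  S_theta theta x / (Rpower x theta * F ((1 - theta) * ln x) * / theta
    * sqrt (2 / (1 - theta)) * / sqrt (ln x * ln (ln x)))) p_infty 1.
Proof.
have [C [L0 [C_gt0 [_ S_near]]]] := S_theta_ratio_main_term.
have [K [K_gt0 alpha_near]] := alpha_equiv.
apply/is_lim_spec => eps; have eps_gt0 := cond_pos eps.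
set T := C + K + C * K; have T_gt0 : 0 < T by rewrite /T; nra.
have [X large] := neg_ln_alpha_unbounded (Rmax (Rmax L0 3000000) ((T / eps + 1) * (T / eps + 1))).
exists X => x /large [x_ge27 /Rmax_le_inv [/Rmax_le_inv [L_ge L_ge_alpha] L_ge_eps]].
have [al_gt0 _] := @alpha_spec theta x theta_lt1 ltac:(lra).
have [lnx_ge3 lnlnx_ge1] := lnln_ge1 x_ge27.
have := S_near x x_ge27 L_ge; have := alpha_near x x_ge27 L_ge_alpha.
have power_gt0 : 0 < Rpower x theta by exact: exp_pos.
have F_gt0 : 0 < F ((1 - theta) * ln x).
  by have := @F_ge ((1 - theta) * ln x) ltac:(nra); have := six_PI2_bounds; lra.
have sqrtlx_gt0 : 0 < sqrt (ln x * ln (ln x)) by apply: sqrt_lt_R0; nra.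
have sqrtc_gt0 : 0 < sqrt (2 / (1 - theta)) by apply: sqrt_lt_R0; apply: Rdiv_lt_0_compat; lra.
set den := _ * / sqrt (ln x * ln (ln x)).
have -> : S_theta theta x / (Rpower x theta * F ((1 - theta) * ln x) * / theta
    * sqrt (2 / (1 - theta)) * / sqrt (ln x * ln (ln x))) =
    S_theta theta x / main_term x * (alpha theta x / den).
  by rewrite /den /main_term; field; repeat split; lra.
set L := - ln (alpha theta x) in L_ge_eps *; set q := S_theta theta x / _; set r := _ / den.
move=> r_near q_near; have Teps_gt0 : 0 < T / eps by apply: Rdiv_lt_0_compat.
have sqrtL_ge : T / eps + 1 <= sqrt L by apply: sqrt_ge_of_sq_le; lra.
have invs_bounds : 0 < / sqrt L <= 1.
  by split; [apply: Rinv_0_lt_compat | rewrite -Rinv_1; apply: Rinv_le_contravar]; lra.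
apply: Rle_lt_trans (Rabs_mul_sub1_le q r) _.
have product_le := Rmult_le_compat _ _ _ _ (Rabs_pos _) (Rabs_pos _) q_near r_near.
have product_le_sqrt : C / sqrt L * (K / sqrt L) <= C * K / sqrt L.
  rewrite /Rdiv; have -> : C * / sqrt L * (K * / sqrt L) = C * K * / sqrt L * / sqrt L by ring.
  by rewrite -[X in _ <= X]Rmult_1_r; apply: Rmult_le_compat_l; [apply: Rmult_le_pos; nra | lra].
have total_lt : T / sqrt L < eps.
  apply/Rlt_div_l; first lra.
  have -> : T = T / eps * eps by field; lra.
  by rewrite Rmult_comm; apply: Rmult_lt_compat_l; lra.
by rewrite /T /Rdiv in total_lt product_le_sqrt q_near r_near product_le *; lra.
Qed.

End MainTerm.

Theorem theorem1 (theta : R) (H0 : 0 < theta) (H1 : theta < 1) :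
  (exists C : R, 0 < C /\
     forall x : R, 27 <= x ->
       Rabs (S_theta theta x
             - Rpower x theta * F ((1 - theta) * ln x) * (alpha theta x / theta))
       <= C * (Rpower x theta * F ((1 - theta) * ln x) * (alpha theta x / theta))
            * sqrt (ln (ln x) / ln x))
  /\
  is_lim (fun x : R =>
            S_theta theta x /
            (Rpower x theta * F ((1 - theta) * ln x) * / theta
             * sqrt (2 / (1 - theta)) * / sqrt (ln x * ln (ln x))))
         p_infty 1.
Proof. by split; [exact: S_theta_main_term | exact: S_theta_equiv]. Qed.
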